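(* Let $n\ge 2$, let $S\subset\mathbb{R}^{n+1}$ be a smooth hypersurface, $y\in S$, and suppose that near $y$ the surface $S$ is the graph $\{(x,g(x))\}$ of a function $g$ of the first $n$ variables, with $(z,g(z))=y$. Put $H(x)=g(x+z)-g(z)-\nabla g(z)\cdot x$. Suppose $g$ is either real-analytic (with $N(H)$ nonempty) or a smooth function such that the Newton polyhedron $N(H)$ intersects each coordinate axis. Let $k$ denote the dimension of the face (compact or not) of $N(H)$ that intersects the critical line $\{(t,\dots,t):t\in\mathbb{R}\}$ in its interior, with $k=0$ if the line intersects $N(H)$ at a vertex. For $\lambda\in\mathbb{R}^{n+1}$ let $$T(\lambda)=\int_S e^{-i\lambda\cdot s}\phi(s)\,d\sigma(s).$$ Then there is a neighborhood $U$ of $y$ such that if the smooth cutoff function $\phi$ is supported in $U$ the following hold. (a) If $d(H)<2$ and each zero of each $H_F(x)$ on $(\mathbb{R}-\{0\})^n$ has order at most $2$, then there is a constant $C$ such that $|T(\lambda)|\le C|\lambda|^{-1/2}$ for $|\lambda|>2$. (b) If $d(H)\ge 2$ and each zero of each $H_F(x)$ on $(\mathbb{R}-\{0\})^n$ has order at most $d(H)$, then there is a constant $C$ such that $|T(\lambda)|\le C|\lambda|^{-1/d(H)}(\ln|\lambda|)^{n-k}$ for $|\lambda|>2$. If $d(H)$ is not an integer, the exponent $n-k$ can be improved to $n-k-1$. (c) If the maximum order $m$ of any zero of any $H_F(x)$ on $(\mathbb{R}-\{0\})^n$ satisfies $m>\max(d(H),2)$, then there is a constant $C$ such that $|T(\lambda)|\le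 C|\lambda|^{-1/m}$ for $|\lambda|>2$. Here $F$ ranges over the compact faces of $N(H)$.
   Context: $\sigma$ is the standard surface measure on $S$. The coordinates are assumed to be such that $(0,\dots,0,1)$ is not in the tangent space of $S$ at $y$ (so the graph representation exists); cutoff functions $\phi$ are smooth and compactly supported near $y$, within the region where $S$ is the graph of $g$. Newton polyhedron: let $f$ be smooth near the origin of $\mathbb{R}^n$ with Taylor expansion $\sum_\alpha f_\alpha x^\alpha$ at the origin. For each $\alpha$ with $f_\alpha\neq 0$ let $Q_\alpha=\{x\in\mathbb{R}^n: x_i\ge\alpha_i\text{ for all }i\}$. The Newton polyhedron $N(f)$ is the convex hull of the union of all these $Q_\alpha$. When $N(f)$ is nonempty, the Newton distance is $d(f)=\inf\{t:(t,\dots,t)\in N(f)\}$. For a compact face $F$ of $N(f)$ (a vertex is considered a compact face of dimension $0$), $f_F(x)=\sum_{\alpha\in F}f_\alpha x^\alpha$. The order of a zero of $f_F$ at a point is the smallest $|\alpha|$ such that $\partial^\alpha f_F$ is nonzero at that point. The number $k$ is thus the dimension of the face of $N(H)$ whose relative interior contains the point $(d(H),\dots,d(H))$ at which the critical line meets the boundary of $N(H)$. *)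

(* Defs.v *)
From HB Require Import structures.
From mathcomp Require Export all_boot all_order all_algebra.
From mathcomp Require Export all_classical all_reals all_analysis.
From mathcomp Require Export complex.

Set Implicit Arguments.
Unset Strict Implicit.
Unset Printing Implicit Defensive.

Import Order.TTheory GRing.Theory Num.Theory.
Import numFieldNormedType.Exports.

Local Open Scope classical_set_scope.
Local Open Scope ring_scope.

Notation borelRn R n := (g_sigma_algebraType (@open 'rV[R]_n)).

Section lebesgue_tuple.
Context {R : realType}.

Definition tcons n (p : measurableTypeR R * n.-tuple (measurableTypeR R)) :
    n.+1.-tuple (measurableTypeR R) := [tuple of p.1 :: p.2].

Lemma measurable_tcons n : measurable_fun [set: _] (@tcons n).
Proof.
by apply: measurable_cons; [exact: measurable_fst|exact: measurable_snd].
Qed.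

Section step.
Context n (m : {sigma_finite_measure set (n.-tuple (measurableTypeR R)) -> \bar R}).

Let lm : {sigma_finite_measure set (measurableTypeR R) -> \bar R} :=
  @lebesgue_measure R.

Definition tuple_step :=
  pushforward (product_measure1 lm m) (@tcons n).

HB.instance Definition _ := Measure.copy tuple_step
  (measure_function_pushforward__canonical__measure_function_Measure
    (product_measure1 lm m) (@measurable_tcons n)).

Let tuncons (t : n.+1.-tuple (measurableTypeR R)) :
  measurableTypeR R * n.-tuple (measurableTypeR R) :=
  (thead t, [tuple of behead t]).

Let measurable_tuncons : measurable_fun [set: _] tuncons.
Proof.
apply/measurable_fun_pairP; split.
  exact: measurable_tnth.
exact: measurable_behead.
Qed.

Let tconsK : cancel (@tcons n) tuncons.
Proof.
by move=> [x t]; congr pair => //; apply: val_inj.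
Qed.

Let tuple_step_sigma_finite : sigma_finite setT tuple_step.
Proof.
have /sigma_finiteP[F [TF ndF Foo]] := sigma_finiteT lm.
have /sigma_finiteP[G [TG ndG Goo]] := sigma_finiteT m.
exists (fun k => tuncons @^-1` (F k `*` G k)).
  apply/seteqP; split => // t _.
  have [a _ Fa] : (\bigcup_k F k) (thead t) by rewrite -TF.
  have [b _ Gb] : (\bigcup_k G k) [tuple of behead t] by rewrite -TG.
  exists (maxn a b) => //; split => /=.
    by move: Fa; exact/subsetPset/ndF/leq_maxl.
  by move: Gb; exact/subsetPset/ndG/leq_maxr.
move=> k; have [mF Fk] := Foo k; have [mG Gk] := Goo k; split.
  rewrite -[X in measurable X]setTI; apply: measurable_tuncons => //.
  exact: measurableX.
rewrite /tuple_step /pushforward -comp_preimage.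
rewrite (_ : tuncons \o _ = id); last first.
  by apply/funext => p /=; rewrite tconsK.
by rewrite preimage_id product_measure1E// lte_mul_pinfty// ge0_fin_numE.
Qed.

HB.instance Definition _ := Measure_isSigmaFinite.Build _ _ _ tuple_step
  tuple_step_sigma_finite.

End step.

Fixpoint lebesgue_tuple n :
    {sigma_finite_measure set (n.-tuple (measurableTypeR R)) -> \bar R} :=
  match n with
  | 0 => \d_ ([tuple] : 0.-tuple (measurableTypeR R))
  | k.+1 => tuple_step (lebesgue_tuple k)
  end.

Definition row_of_tuple n (t : n.-tuple (measurableTypeR R)) : borelRn R n :=
  \row_i tnth t i.

Lemma measurable_row_of_tuple n : measurable_fun [set: _] (@row_of_tuple n).
Proof.
apply: (@measurability _ _ _ (borelRn R n) _ _ (@open 'rV[R]_n)) => //.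
move=> _ [A oA <-].
rewrite setTI.
pose box (q : 'rV[rat]_n * nat) := [set t : n.-tuple (measurableTypeR R) |
  forall i, ball (ratr (q.1 0 i) : R) (q.2.+1%:R^-1) (tnth t i)].
pose D := [set q | box q `<=` @row_of_tuple n @^-1` A].
have -> : @row_of_tuple n @^-1` A = \bigcup_(q in D) box q.
  apply/seteqP; split => [t At|t [q Dq bqt]]; last exact: Dq.
  have : nbhs (row_of_tuple t : 'rV[R]_n) A by exact: open_nbhs_nbhs.
  move=> /nbhs_ballP [e /= e0 eA].
  have [k ke] : exists k : nat, k.+1%:R^-1 < e / 2.
    have e2 : 0 < e / 2 by rewrite divr_gt0.
    have [k _ /(_ k (leqnn k))/= ke] := near_infty_natSinv_lt (PosNum e2).
    by exists k.
  have qE i : exists x : rat, ball (tnth t i : R) k.+1%:R^-1 (ratr x).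
    have : tnth t i - k.+1%:R^-1 < tnth t i + k.+1%:R^-1 :> R.
      by rewrite ltrBlDr -addrA ltrDl addr_gt0.
    move=> /rat_in_itvoo[x].
    rewrite in_itv/= => /andP[x1 x2]; exists x.
    by rewrite /ball/= ltr_distlC x1.
  have [q qP] := boolp.choice qE.
  exists (\row_i q i, k) => /=.
    move=> s bs; apply: eA; split => // i j; rewrite !mxE.
    have := bs j; rewrite /= mxE => bsj.
    have := ball_triangle (qP j) bsj; apply: le_ball.
    by rewrite [leRHS](splitr e) lerD// ltW.
  by move=> i /=; rewrite mxE; exact/ball_sym/qP.
rewrite bigcup_mkcond; apply: countable_bigcupT_measurable => [|q].
  exact: countableP.
case: ifPn => // _.
have -> : box q = \bigcap_(i in [set: 'I_n])
    [set t | ball (ratr (q.1 0 i) : R) (q.2.+1%:R^-1) (tnth t i)].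
  by apply/seteqP; split => t /= h i; [move=> _; exact: h|exact: h].
apply: fin_bigcap_measurable => // i _.
rewrite -[X in measurable X]setTI.
apply: (@measurable_tnth _ (measurableTypeR R) n i measurableT
  (ball (ratr (q.1 0 i) : R) (q.2.+1%:R^-1))).
exact: measurable_realfun.measurable_ball.
Qed.

Definition lebesgueRn n : set (borelRn R n) -> \bar R :=
  pushforward (lebesgue_tuple n) (@row_of_tuple n).

HB.instance Definition _ n := Measure.copy (@lebesgueRn n)
  (measure_function_pushforward__canonical__measure_function_Measure
    (lebesgue_tuple n) (@measurable_row_of_tuple n)).

End lebesgue_tuple.

Notation multiindex n := {ffun 'I_n -> nat}.

Definition mdegree n (a : multiindex n) : nat := (\sum_i a i)%N.

Section calculus.
Context {R : realType}.

Definition mfactorial n (a : multiindex n) : R := ((\prod_i (a i)`!)%N)%:R.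

Definition monomial n (a : multiindex n) (x : 'rV[R]_n) : R :=
  \prod_i x 0 i ^+ a i.

Definition partial n (W : normedModType R) (i : 'I_n) (f : 'rV[R]_n -> W) :
  'rV[R]_n -> W := 'D_(delta_mx 0 i) f.

Definition mpartial n (W : normedModType R) (a : multiindex n)
    (f : 'rV[R]_n -> W) : 'rV[R]_n -> W :=
  foldr (fun i h => iter (a i) (partial i) h) f (enum 'I_n).

(* C^oo on V (used with V open): all iterated partial derivatives, in every
   order of differentiation, exist and are continuous on V. *)
Definition smooth_on n (W : normedModType R) (V : set 'rV[R]_n)
    (f : 'rV[R]_n -> W) : Prop :=
  forall (s : seq 'I_n) (x : 'rV[R]_n), V x ->
    {for x, continuous (foldr (@partial n W) f s)} /\
    forall i, derivable (foldr (@partial n W) f s) x (delta_mx 0 i).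

(* Near each point of V, f is the sum of an absolutely convergent power series
   (summed here by increasing total degree). *)
Definition analytic_on n (V : set 'rV[R]_n) (f : 'rV[R]_n -> R) : Prop :=
  forall p, V p -> exists (c : multiindex n -> R) (r : R), 0 < r /\
    forall h : 'rV[R]_n, `|h| < r ->
      summable [set: multiindex n] (fun a => (c a * monomial a h)%:E) /\
      (fun N : nat => \sum_(a \in [set a : multiindex n | (mdegree a < N)%N])
         c a * monomial a h) @ \oo --> f (p + h).

Definition taylor_coef n (f : 'rV[R]_n -> R) (a : multiindex n) : R :=
  mpartial a f 0 / mfactorial a.

(* x is a point where f vanishes to order exactly m (m > 0 if f x = 0). *)
Definition vanishing_order n (f : 'rV[R]_n -> R) (x : 'rV[R]_n) (m : nat) : Prop :=
  (exists a, mdegree a = m /\ mpartial a f x != 0) /\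
  (forall a, (mdegree a < m)%N -> mpartial a f x = 0).

End calculus.

Section convex.
Context {R : realType} {n : nat}.
Implicit Types (A N F : set 'rV[R]_n) (x y : 'rV[R]_n).

Definition dotp x y : R := \sum_i x 0 i * y 0 i.

(* The library norm on row vectors is the sup norm. *)
Definition enorm x : R := Num.sqrt (dotp x x).

Definition convex_hull A : set 'rV[R]_n :=
  smallest (fun C : set 'rV[R]_n => convex_set C) A.

Definition affine_hull A : set 'rV[R]_n :=
  [set x | exists (m : nat) (w : 'I_m -> R) (p : 'I_m -> 'rV[R]_n),
    [/\ forall i, A (p i), \sum_i w i = 1 & x = \sum_i w i *: p i]].

Definition relative_interior A : set 'rV[R]_n :=
  [set x | A x /\ \forall y \near x, affine_hull A y -> A y].

(* The affine hull of A is p plus the row space of M, of dimension k. *)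
Definition affine_dim A (k : nat) : Prop :=
  exists (p : 'rV[R]_n) (M : 'M[R]_n), \rank M = k /\
    affine_hull A = [set x | (x - p <= M)%MS].

(* N itself is the face given by a = 0, c = 0. *)
Definition is_face N F : Prop :=
  F !=set0 /\ exists (a : 'rV[R]_n) (c : R),
    (forall x, N x -> c <= dotp a x) /\ F = [set x | N x /\ dotp a x = c].

End convex.

Section newton.
Context {R : realType} {n : nat}.
Implicit Types (f : 'rV[R]_n -> R) (N F : set 'rV[R]_n).

Definition mvec (a : multiindex n) : 'rV[R]_n := \row_i (a i)%:R.

Definition orthant (a : multiindex n) : set 'rV[R]_n :=
  [set x | forall i, (a i)%:R <= x 0 i].

Definition newton_polyhedron f : set 'rV[R]_n :=
  convex_hull (\bigcup_(a in [set a | taylor_coef f a != 0]) orthant a).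

Definition diag (t : R) : 'rV[R]_n := const_mx t.

Definition newton_distance f : R := inf [set t | newton_polyhedron f (diag t)].

(* For compact F the index set below is finite. *)
Definition face_poly f F (x : 'rV[R]_n) : R :=
  \sum_(a \in [set a | F (mvec a)]) taylor_coef f a * monomial a x.

Definition compact_face N F : Prop := is_face N F /\ compact F.

(* f_F has, for some compact face F, a zero of order m on (R - {0})^n. *)
Definition face_zero_order f (m : nat) : Prop :=
  exists (F : set 'rV[R]_n) (x : 'rV[R]_n),
    [/\ compact_face (newton_polyhedron f) F,
        forall i, x 0 i != 0,
        face_poly f F x = 0 &
        vanishing_order (face_poly f F) x m].

Definition meets_coordinate_axes N : Prop :=
  forall i : 'I_n, exists t : R, N (t *: delta_mx 0 i).

(* k is the dimension of the face whose relative interior contains the point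
   (d, ..., d), d = d(f), where the critical line meets the boundary of N(f). *)
Definition critical_face_dim f (k : nat) : Prop :=
  exists F, [/\ is_face (newton_polyhedron f) F,
    relative_interior F (diag (newton_distance f)) & affine_dim F k].

End newton.

Section hypersurface.
Context {R : realType} {n : nat}.
Implicit Types (S : set 'rV[R]_(n + 1)) (V : set 'rV[R]_n)
  (psi : 'rV[R]_n -> 'rV[R]_(n + 1)).

(* psi : V -> S is a smooth injective immersion, and a homeomorphism onto a
   relatively open subset of S. *)
Definition local_parametrization S V psi : Prop :=
  [/\ open V, smooth_on V psi,
      (forall u, V u -> row_free ('J psi u)),
      {in V &, injective psi} &
      forall O, open O -> O `<=` V ->
        exists2 O', open O' & psi @` O = S `&` O'].

Definition smooth_hypersurface S : Prop :=
  forall p, S p -> exists V psi, local_parametrization S V psi /\ (psi @` V) p.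

(* 'J psi u has the partial derivatives of psi as its rows, so this is the
   square root of the Gram determinant. *)
Definition area_density psi (u : 'rV[R]_n) : R :=
  Num.sqrt (\det ('J psi u *m ('J psi u)^T)).

(* These conditions determine sigma uniquely on Borel sets: S is covered by
   countably many images of local parametrizations. *)
Definition is_surface_measure S
    (sigma : {measure set (borelRn R (n + 1)) -> \bar R}) : Prop :=
  sigma (~` S) = 0%E /\
  forall V psi, local_parametrization S V psi ->
  forall B : set (borelRn R (n + 1)), measurable B -> B `<=` psi @` V ->
    sigma B = (\int[@lebesgueRn R n]_(u in V `&` psi @^-1` B)
                 (area_density psi u)%:E)%E.

Definition graph_map (g : 'rV[R]_n -> R) (x : 'rV[R]_n) : 'rV[R]_(n + 1) :=
  row_mx x (g x)%:M.

Definition taylor_remainder2 (g : 'rV[R]_n -> R) (z x : 'rV[R]_n) : R :=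
  g (x + z) - g z - \sum_i partial i g z * x 0 i.

End hypersurface.

Section oscillatory.
Local Open Scope complex_scope.
Context {R : realType}.

Definition cintegral d (T : measurableType d) (mu : {measure set T -> \bar R})
    (D : set T) (f : T -> R[i]) : R[i] :=
  (\int[mu]_(x in D) complex.Re (f x))%R +i* (\int[mu]_(x in D) complex.Im (f x))%R.

(* e^{i t} *)
Definition expi (t : R) : R[i] := cos t +i* sin t.

Definition surface_FT n (S : set 'rV[R]_n)
    (sigma : {measure set (borelRn R n) -> \bar R})
    (phi : 'rV[R]_n -> R) (lambda : 'rV[R]_n) : R[i] :=
  cintegral sigma S (fun s => expi (- dotp lambda s) * (phi s)%:C).

Definition closed_support n (phi : 'rV[R]_n -> R) : set 'rV[R]_n :=
  closure [set s | phi s != 0].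

Definition decays_like n (T : 'rV[R]_n -> R[i]) (b : R -> R) : Prop :=
  exists C : R, forall lambda : 'rV[R]_n, 2 < enorm lambda ->
    `|T lambda| <= (C * b (enorm lambda))%:C.

End oscillatory.

(* Main.v *)
(* Near y the surface is a graph, and T(lambda) becomes an integral over a cube
   whose phase is, up to a constant, b . x + L H(x) with L = - lambda_(n+1).
   When |L| is small compared with |lambda|, one integration by parts along a
   coordinate axis gives O(1/|lambda|).  Otherwise the cube is cut, for some
   0 < theta < 1, into the boxes where |x_i| is comparable to theta^(m_i), with
   m in N^n; let X be a corner of such a box.  By Dickson's lemma finitely many
   minimal exponents E generate the Newton polyhedron of H, and on the box H and
   its scaled derivatives differ from those of sum_(a in E) H_a x^a by little
   compared with sum_(a in E) X^a.  As X approaches 0 this sum is governed, along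
   subsequences, by a compact face F, and the hypothesis that the zeros of H_F
   have order at most M yields 2 <= p <= M and a direction w, with |w_i| of the
   size of X_i, such that |(d/dw)^p H| is at least a constant times
   sum_(a in E) X^a throughout the box.  Orders 0 and 1 can be avoided: by
   Euler's identity for the weighted homogeneous H_F, a vanishing Hessian forces
   a vanishing gradient and a vanishing value.  As p >= 2, the linear part of the
   phase is harmless, and van der Corput's lemma along w bounds the contribution
   of the box by
     X_1 ... X_n min(1, (|L| sum_(a in E) X^a)^(-1/M)).
   Here X^a = theta^(m . a), and min_(a in E) m . a <= t |m| as soon as
   (t, ..., t) lies in N(H).  If d(H) < M, take d(H) < t < M and the sum over m is
   O(|L|^(-1/M)).  If M <= d(H), one gains exponential decay in the k quantities
   <m, v_j>, for v_j a basis of the directions of the face through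
   (d(H), ..., d(H)), so that only n - k summations are left; they produce the
   logarithms, the last of them being geometric when M < d(H). *)

From HB Require Import structures.
Require Import Defs.
From mathcomp Require Import all_boot all_order all_algebra.
From mathcomp Require Import all_classical all_reals all_analysis.
From mathcomp Require Import measurable_realfun ring lra zify.

Set Implicit Arguments.
Unset Strict Implicit.
Unset Printing Implicit Defensive.

Import Order.TTheory GRing.Theory Num.Theory.
Import numFieldNormedType.Exports.

Local Open Scope classical_set_scope.
Local Open Scope ring_scope.

(** * Van der Corput's lemma *)

(** No smooth partition is used. A box is cut off sharply: Lebesgue measure is invariant under
    translation by t w, so an integral equals its own average over 0 <= t <= 1, and each line meets
    the box in an interval, where van der Corput's lemma applies. The direction can therefore change
    from box to box without any change of variables.

    The obstacle is uniformity: the coordinates of X may tend to 0 at unrelated rates, while the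
    lower bound for a derivative must have one constant. It is proved by contradiction. The dyadic
    exponents of the coordinates, followed along an ultrafilter, produce a positive integral weight,
    hence a compact face and a point with nonzero coordinates at which all tested derivatives of H_F
    vanish. Finitely many directions suffice for the test, because Kronecker's substitution (s, s^D,
    s^(D^2), ...) turns distinct monomials into distinct powers of s.

    The exponent M is 2 in (a), the integral part of d(H) in (b) and m in (c). Orders of zeros are
    integers, so rounding loses nothing in (b), and M < d(H) there exactly when d(H) is not an
    integer. *)

Section van_der_corput.
Context {R : realType}.
Implicit Types (a b : R) (F : nat -> R -> R).

(** Primitives replace integrals until [continuous_antiderivative], so the oscillatory estimates
    rest on the mean value theorem alone. Continuity on the closed interval with differentiability
    inside is what that theorem asks for and what the fundamental theorem of calculus returns. *)
Definition antiderivative a b (G g : R -> R) :=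
  {within `[a, b], continuous G} /\
  forall x, x \in `]a, b[ -> is_derive x 1 G (g x).

Lemma antiderivativeW a b c d G g : a <= c -> d <= b ->
  antiderivative a b G g -> antiderivative c d G g.
Proof.
move=> ac db [cG dG]; split.
  apply: continuous_subspaceW cG => x /=; rewrite !in_itv/= => /andP[cx xd].
  by rewrite (le_trans ac)//= (le_trans xd).
move=> x; rewrite in_itv/= => /andP[cx xd]; apply: dG.
by rewrite in_itv/= (le_lt_trans ac)//= (lt_le_trans xd).
Qed.

Lemma antiderivative_of_derive a b G g :
  (forall x, x \in `[a, b] -> is_derive x 1 G (g x)) -> antiderivative a b G g.
Proof.
move=> dG; split.
  apply: continuous_in_subspaceT => x; rewrite inE/= => /dG[dGx _].
  exact/differentiable_continuous/derivable1_diffP.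
move=> x; rewrite in_itv/= => /andP[ax xb]; apply: dG.
by rewrite in_itv/= !ltW.
Qed.

Lemma antiderivativeN a b G g :
  antiderivative a b G g -> antiderivative a b (\- G) (\- g).
Proof.
move=> [cG dG]; split; first by move=> x; apply: continuousN; exact: cG.
by move=> x /dG dGx; exact: is_deriveN.
Qed.

Lemma antiderivativeD a b G g H h :
  antiderivative a b G g -> antiderivative a b H h ->
  antiderivative a b (G \+ H) (g \+ h).
Proof.
move=> [cG dG] [cH dH]; split.
  by move=> x; apply: continuousD; [exact: cG|exact: cH].
by move=> x xab; apply: is_deriveD; [exact: dG|exact: dH].
Qed.

(** Both [H + G] and [H - G] have a nonnegative derivative, hence are nondecreasing by the mean
    value theorem. *)
Lemma antiderivative_le a b G g H h : a <= b ->
  antiderivative a b G g -> antiderivative a b H h ->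
  (forall x, x \in `]a, b[ -> `|g x| <= h x) ->
  `|G b - G a| <= H b - H a.
Proof.
move=> ab GG HH gh.
have key K k : antiderivative a b K k ->
    (forall x, x \in `]a, b[ -> 0 <= k x) -> K a <= K b.
  move=> [cK dK] k0; move: ab; rewrite le_eqVlt => /predU1P[->//|ab].
  have [c cab cE] := MVT ab dK cK.
  by rewrite -subr_ge0 cE mulr_ge0 ?k0// subr_ge0 ltW.
have := key _ _ (antiderivativeD HH (antiderivativeN GG)).
have := key _ _ (antiderivativeD HH GG).
move=> /= h1 h2; rewrite ler_norml.
have {}h1 : H a + G a <= H b + G b.
  by apply: h1 => x /gh; rewrite ler_norml => /andP[]; lra.
have {}h2 : H a - G a <= H b - G b.
  by apply: h2 => x /gh; rewrite ler_norml => /andP[]; lra.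
by apply/andP; split; lra.
Qed.

Lemma antiderivative_lip a b G g (K : R) : a <= b -> antiderivative a b G g ->
  (forall x, x \in `]a, b[ -> `|g x| <= K) -> `|G b - G a| <= K * (b - a).
Proof.
move=> ab GG gK; rewrite mulrBr.
apply: (@antiderivative_le a b G g (fun x => K * x) (fun=> K)) => //.
apply: antiderivative_of_derive => x _.
have := is_deriveZ K (is_derive_id x (1:R)).
by rewrite /GRing.scale /= mulr1.
Qed.

(** The bound on [q] is inclusive, so [F p] has the derivative [F p.+1]: the case of order 1 uses
    [F 2], and continuity of [F p] settles its sign. *)
Definition derivative_chain a b p F :=
  forall q t, (q <= p)%N -> t \in `[a, b] -> is_derive t 1 (F q) (F q.+1 t).

Lemma derivative_chainW a b c d p q F : a <= c -> d <= b -> (q <= p)%N ->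
  derivative_chain a b p F -> derivative_chain c d q F.
Proof.
move=> ac db qp HF r t rq; rewrite in_itv/= => /andP[ct td]; apply: HF.
  exact: leq_trans qp.
by rewrite in_itv/= (le_trans ac)//= (le_trans td).
Qed.

Lemma derivative_chainN a b p F :
  derivative_chain a b p F -> derivative_chain a b p (fun q => \- (F q)).
Proof. by move=> HF q t qp tab; exact/is_deriveN/HF. Qed.

(** [sin F / F'] is nearly a primitive of [cos F]: its derivative is off by at most [|F''| / F'^2].
    The error is measured by a primitive [h] of a majorant, which covers both monotone [F'] ([h] is
    then [1 / F'] up to sign) and bounded [F''] ([h] linear). *)
Lemma nonstationary_phase a b F (L : R) (Phi h h' : R -> R) : a <= b -> 0 < L ->
  derivative_chain a b 1 F -> antiderivative a b Phi (fun t => cos (F 0%N t)) ->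
  (forall t, t \in `[a, b] -> L <= `|F 1%N t|) ->
  antiderivative a b h h' ->
  (forall t, t \in `]a, b[ -> `|F 2%N t| / F 1%N t ^+ 2 <= h' t) ->
  `|Phi b - Phi a| <= 2 / L + (h b - h a).
Proof.
move=> ab L0 HF HPhi FL Hh hh'.
have F0 t : t \in `[a, b] -> F 1%N t != 0.
  by move=> /FL; apply: contraTneq => ->; rewrite normr0 -ltNge.
pose G t := sin (F 0%N t) / F 1%N t.
have HG : antiderivative a b G
    (fun t => cos (F 0%N t) - sin (F 0%N t) * F 2%N t / F 1%N t ^+ 2).
  apply: antiderivative_of_derive => t tab.
  have d0 := HF 0%N t isT tab; have d1 := HF 1%N t isT tab.
  have dV := is_deriveV (F0 _ tab) d1.
  have dsin : is_derive t 1 (fun t => sin (F 0%N t)) (cos (F 0%N t) * F 1%N t).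
    exact: (@is_derive1_comp _ sin (F 0%N) t).
  have := is_deriveM dsin dV.
  move=> hd; apply: (is_derive_eq hd).
  rewrite /GRing.scale/=; have := F0 _ tab => F1; rewrite -exprVn.
  by field.
have h1 : `|(Phi b - G b) - (Phi a - G a)| <= h b - h a.
  apply: (antiderivative_le ab (antiderivativeD HPhi (antiderivativeN HG)) Hh).
  move=> t tab /=; apply: le_trans (hh' _ tab).
  rewrite opprB addrCA subrr addr0 normrM normrM -mulrA.
  rewrite normfV normrX real_normK ?num_real// ler_piMl//.
    by rewrite divr_ge0// sqr_ge0.
  by rewrite ler_norml sin_geN1 sin_le1.
have hG t : t \in `[a, b] -> `|G t| <= L^-1.
  move=> tab; rewrite normrM normfV -[leRHS]mul1r ler_pM// ?invr_ge0//.
    by rewrite ler_norml sin_geN1 sin_le1.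
  by rewrite lef_pV2 ?posrE ?FL// normr_gt0 F0.
have -> : Phi b - Phi a = (Phi b - G b - (Phi a - G a)) + G b - G a by ring.
apply: le_trans (ler_normB _ _) _.
apply: le_trans (lerD (ler_normD _ _) (lexx _)) _.
have := hG a; have := hG b; rewrite !in_itv/= !lexx ab/= => /(_ isT) Gb /(_ isT) Ga.
rewrite (_ : 2 / L = L^-1 + L^-1); last by ring.
lra.
Qed.

(** When [F''] keeps its sign, [|F''| / F'^2] is the derivative of [1 / F'] up to sign, and [1 / F']
    varies by at most [1 / L]; this is the third [1 / L] in the bound. *)
Lemma van_der_corput1 a b F (L : R) (Phi : R -> R) : a <= b -> 0 < L ->
  derivative_chain a b 1 F -> antiderivative a b Phi (fun t => cos (F 0%N t)) ->
  (forall t, t \in `[a, b] -> L <= F 1%N t) ->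
  (forall t, t \in `[a, b] -> 0 <= F 2%N t) \/
  (forall t, t \in `[a, b] -> F 2%N t <= 0) ->
  `|Phi b - Phi a| <= 3 / L.
Proof.
move=> ab L0 HF HPhi FL Fs.
have F0 t : t \in `[a, b] -> 0 < F 1%N t by move=> /FL; exact: lt_le_trans.
have HV : antiderivative a b (fun t => (F 1%N t)^-1)
    (fun t => - (F 2%N t / F 1%N t ^+ 2)).
  apply: antiderivative_of_derive => t tab.
  have d1 := HF 1%N t isT tab.
  have := is_deriveV (lt0r_neq0 (F0 _ tab)) d1.
  move=> hd; apply: (is_derive_eq hd); rewrite /GRing.scale/= -exprVn.
  by rewrite mulNr [RHS]mulrC mulrN opprK mulrC mulrN opprK || ring.
have FV t : t \in `[a, b] -> 0 <= (F 1%N t)^-1 <= L^-1.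
  move=> tab; rewrite invr_ge0 ltW ?F0//= lef_pV2 ?posrE ?F0//.
  exact: FL.
have := FV a; have := FV b; rewrite !in_itv/= !lexx ab/= => /(_ isT) Vb /(_ isT) Va.
have FL' t : t \in `[a, b] -> L <= `|F 1%N t|.
  by move=> tab; apply: le_trans (FL _ tab) (ler_norm _).
have oc t : t \in `]a, b[ -> t \in `[a, b].
  by rewrite !in_itv/= => /andP[? ?]; rewrite !ltW.
case: Fs => Fs.
- have := nonstationary_phase ab L0 HF HPhi FL' (antiderivativeN HV).
  move=> /(_ _)/le_trans; apply.
    move=> t tab /=.
    by rewrite opprK ger0_norm ?Fs// oc.
  rewrite (_ : 2 / L = L^-1 + L^-1); last by ring.
  rewrite (_ : 3 / L = L^-1 + L^-1 + L^-1); last by ring.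
  by move: Va Vb => /andP[? ?] /andP[? ?] /=; lra.
- have := nonstationary_phase ab L0 HF HPhi FL' HV.
  move=> /(_ _)/le_trans; apply.
    by move=> t tab /=; rewrite ler0_norm ?Fs ?mulNr// oc.
  rewrite (_ : 2 / L = L^-1 + L^-1); last by ring.
  rewrite (_ : 3 / L = L^-1 + L^-1 + L^-1); last by ring.
  by move: Va Vb => /andP[? ?] /andP[? ?] /=; lra.
Qed.

(** [G] grows at rate at least [L], so it stays in [[-d, d]] for a length of at most [2 * d / L]. An
    outer interval may degenerate to an end point at which the lower bound fails, hence the guards
    [a < c1] and [c2 < b]. *)
Lemma increasing_split a b (L d : R) (G g : R -> R) : a <= b -> 0 < L -> 0 < d ->
  (forall t, t \in `[a, b] -> is_derive t 1 G (g t)) ->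
  (forall t, t \in `[a, b] -> L <= g t) ->
  exists c1 c2, [/\ a <= c1, c1 <= c2, c2 <= b, c2 - c1 <= 2 * d / L &
    (forall t, t \in `[a, c1] -> a < c1 -> d <= - G t) /\
    (forall t, t \in `[c2, b] -> c2 < b -> d <= G t)].
Proof.
move=> ab L0 d0 dG gL.
have incr s t : a <= s -> s <= t -> t <= b -> L * (t - s) <= G t - G s.
  move=> as_ st tb.
  have HG : antiderivative s t G g.
    apply: antiderivativeW (antiderivative_of_derive dG) => //.
  have [c cab ->] : exists2 c, c \in `[s, t] & G t - G s = g c * (t - s).
    by case: HG => cG dG'; apply: MVT_segment.
  rewrite ler_wpM2r ?subr_ge0// gL//.
  move: cab; rewrite !in_itv/= => /andP[sc ct].
  by rewrite (le_trans as_ sc) (le_trans ct).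
have mono s t : a <= s -> s <= t -> t <= b -> G s <= G t.
  move=> as_ st tb; rewrite -subr_ge0; apply: le_trans (incr _ _ as_ st tb).
  by rewrite mulr_ge0 ?subr_ge0// ltW.
have cG : {within `[a, b], continuous G}.
  exact: (antiderivative_of_derive (g := g) _).1.
have Gab : G a <= G b by apply: mono.
have hit v : G a <= v <= G b -> exists2 c, a <= c <= b & G c = v.
  move=> Gv; have [|c cab cE] := IVT ab cG (v := v).
    by rewrite min_l// max_r.
  by exists c => //; rewrite in_itv/= in cab.
have [|aNd] := leP (G b) (- d).
  move=> Gbd; exists b, b; split => //.
    by rewrite subrr divr_ge0 ?ltW ?mulr_gt0.
  split; last by move=> t; rewrite ltxx.
  move=> t; rewrite in_itv/= => /andP[at_ tb] _.
  by have := mono _ _ at_ tb (lexx _); lra.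
have [|bd] := leP d (G a).
  move=> Gad; exists a, a; split => //.
    by rewrite subrr divr_ge0 ?ltW ?mulr_gt0.
  split; first by move=> t; rewrite ltxx.
  move=> t; rewrite in_itv/= => /andP[at_ tb] _.
  by have := mono _ _ (lexx _) at_ tb; lra.
have [c1 [ac1 c1b Gc1 lc1]] : exists c1, [/\ a <= c1, c1 <= b,
    - d <= G c1 & (a < c1 -> G c1 = - d)].
  have [aN|Na] := leP (- d) (G a); first by exists a; rewrite ltxx.
  have [|c /andP[ac cb] Gc] := hit (- d); first by rewrite !ltW.
  by exists c; rewrite Gc lexx.
have [c2 [ac2 c2b Gc2 lc2]] : exists c2, [/\ a <= c2, c2 <= b,
    G c2 <= d & (c2 < b -> G c2 = d)].
  have [aN|Na] := leP (G b) d; first by exists b; rewrite ltxx.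
  have [|c /andP[ac cb] Gc] := hit d; first by rewrite !ltW.
  by exists c; rewrite Gc lexx.
have c12 : c1 <= c2.
  rewrite leNgt; apply/negP => c21.
  have := lc1 (le_lt_trans ac2 c21); have := lc2 (lt_le_trans c21 c1b).
  by have := mono _ _ ac2 (ltW c21) c1b; lra.
exists c1, c2; split => //.
  rewrite ler_pdivlMr// mulrC; apply: le_trans (incr _ _ ac1 c12 c2b) _; lra.
split=> t; rewrite in_itv/= => /andP[h1 h2] h3.
  by have := mono _ _ h1 h2 c1b; rewrite lc1//; lra.
by have := mono _ _ ac2 h1 h2; rewrite lc2//; lra.
Qed.

(** Induction on the order: off a short interval the derivative of one order less is large, and on
    that interval the trivial bound is used. For order 1 a lower bound is not enough and [F 2] must
    keep its sign; in the step from 1 to 2 this is automatic, since [F 2 >= L]. *)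
Lemma van_der_corput p : (0 < p)%N ->
  exists2 K : R, 0 < K & forall a b F (L : R) (Phi : R -> R), a <= b -> 0 < L ->
    derivative_chain a b p F ->
    antiderivative a b Phi (fun t => cos (F 0%N t)) ->
    (forall t, t \in `[a, b] -> L <= F p t) ->
    (p = 1%N -> (forall t, t \in `[a, b] -> 0 <= F 2%N t) \/
                (forall t, t \in `[a, b] -> F 2%N t <= 0)) ->
    `|Phi b - Phi a| <= K * L `^ (- p%:R^-1).
Proof.
case: p => // p _; elim: p => [|p [K K0 IH]].
  exists 3 => // a b F L Phi ab L0 HF HPhi FL Fs.
  rewrite invr1 powR_inv1 ?(ltW L0)//.
  exact: van_der_corput1 ab L0 HF HPhi FL (Fs erefl).
exists (2 * K + 2); first by rewrite addr_gt0// mulr_gt0.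
move=> a b F L Phi ab L0 HF HPhi FL _.
(* This choice balances the two contributions: [d / L] and the power of [d] from the induction
   hypothesis are both [L] to the power [-1 / (p + 2)]. *)
pose d := L `^ (1 - p.+2%:R^-1).
have d0 : 0 < d by rewrite powR_gt0.
have dL : d / L = L `^ (- p.+2%:R^-1).
  rewrite /d -(powR_inv1 (ltW L0)) -powRD ?(gt_eqF L0) ?implybT//.
  by rewrite addrAC subrr add0r.
have dp : d `^ (- p.+1%:R^-1) = L `^ (- p.+2%:R^-1).
  rewrite -powRrM; congr (_ `^ _).
  have : (p%:R : R) >= 0 by [].
  by rewrite -(natr1 p.+1) -(natr1 p) => ?; field; lra.
have dFp t : t \in `[a, b] -> is_derive t 1 (F p.+1) (F p.+2 t) by exact: HF.
have [c1 [c2 [ac1 c12 c2b c12d [s1 s2]]]] := increasing_split ab L0 d0 dFp FL.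
have c1b := le_trans c12 c2b; have ac2 := le_trans ac1 c12.
have Fs t : t \in `[a, b] -> 0 <= F p.+2 t.
  by move=> /FL; apply: le_trans; exact: ltW.
have B1 : `|Phi c1 - Phi a| <= K * d `^ (- p.+1%:R^-1).
  move: (ac1); rewrite le_eqVlt => /predU1P[<-|ltac1].
    by rewrite subrr normr0 mulr_ge0 ?ltW// powR_gt0.
  apply: (IH a c1 (fun q => \- (F q))) => //.
  - apply: derivative_chainN; exact: derivative_chainW HF.
  - have [cP dP] := antiderivativeW (lexx a) c1b HPhi.
    by split => // t /dP; rewrite cosN.
  - by move=> t tac; exact: s1.
  - move=> [p0]; right => t; rewrite in_itv/= => /andP[at_ tc].
    rewrite oppr_le0; move: Fs; rewrite p0; apply.
    by rewrite in_itv/= at_ (le_trans tc).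
have B2 : `|Phi b - Phi c2| <= K * d `^ (- p.+1%:R^-1).
  move: (c2b); rewrite le_eqVlt => /predU1P[->|ltc2b].
    by rewrite subrr normr0 mulr_ge0 ?ltW// powR_gt0.
  apply: (IH c2 b F) => //.
  - exact: derivative_chainW HF.
  - exact: antiderivativeW HPhi.
  - by move=> t tac; exact: s2.
  - move=> [p0]; left => t; rewrite in_itv/= => /andP[at_ tc].
    move: Fs; rewrite p0; apply.
    by rewrite in_itv/= tc (le_trans _ at_).
have B3 : `|Phi c2 - Phi c1| <= 2 * (d / L).
  apply: (@le_trans _ _ (1 * (c2 - c1))); last by rewrite mul1r mulrA.
  apply: (antiderivative_lip c12 (antiderivativeW ac1 c2b HPhi)) => x _.
  by rewrite ler_norml cos_geN1 cos_le1.
rewrite dp in B1, B2; rewrite dL in B3.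
have -> : Phi b - Phi a = (Phi b - Phi c2) + (Phi c2 - Phi c1) + (Phi c1 - Phi a).
  by ring.
apply: le_trans (ler_normD _ _) _.
apply: le_trans (lerD (ler_normD _ _) (lexx _)) _.
rewrite mulrDl -mulrA mulrDl mul1r; lra.
Qed.

(* The sign of [F p] is constant by the intermediate value theorem, and the
   cosine is even. *)
Lemma van_der_corput_norm p : (1 < p)%N ->
  exists2 K : R, 0 < K & forall a b F (L : R) (Phi : R -> R), a <= b -> 0 < L ->
    derivative_chain a b p F ->
    antiderivative a b Phi (fun t => cos (F 0%N t)) ->
    (forall t, t \in `[a, b] -> L <= `|F p t|) ->
    `|Phi b - Phi a| <= K * L `^ (- p%:R^-1).
Proof.
move=> p1; have [K K0 HK] := van_der_corput (ltnW p1).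
exists K => // a b F L Phi ab L0 HF HPhi FL.
have p1' (Q : Prop) : p = 1%N -> Q by move=> pE; rewrite pE in p1.
have {}HK a' b' F' L' Phi' ab' L0' HF' HP' HL' :=
  HK a' b' F' L' Phi' ab' L0' HF' HP' HL' (@p1' _).
have cF : {within `[a, b], continuous (F p)}.
  apply: (antiderivative_of_derive (g := F p.+1) _).1 => t tab.
  exact: HF.
have aab : a \in `[a, b] by rewrite in_itv/= lexx.
have sgn t : t \in `[a, b] -> (0 < F p t) = (0 < F p a).
  move=> tab; have := FL _ tab; have := FL _ aab.
  have at_ : a <= t by rewrite (itvP tab).
  have cFt : {within `[a, t], continuous (F p)}.
    apply: continuous_subspaceW cF => x /=; rewrite !in_itv/= => /andP[-> xt].
    by rewrite (le_trans xt)// (itvP tab).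
  move=> La Lt.
  have nz s : s \in `[a, t] -> F p s != 0.
    move=> sat; apply: contraTneq L0 => Fs0.
    have := FL s; rewrite Fs0 normr0 -leNgt; apply.
    move: sat tab; rewrite !in_itv/= => /andP[-> st] /andP[_].
    exact: le_trans.
  have H0 : ~ (Num.min (F p a) (F p t) <= 0 <= Num.max (F p a) (F p t)).
    by move=> /(IVT at_ cFt)[c cat /eqP]; apply/negP; exact: nz.
  apply/idP/idP => h; rewrite ltNge; apply/negP => h'; apply: H0.
    by rewrite ge_min h' /= le_max (ltW h) orbT.
  by rewrite ge_min h' orbT /= le_max (ltW h).
have [Fa|Fa] := ltP 0 (F p a).
  apply: (HK a b F) => //.
  by move=> t tab; have := FL _ tab; rewrite gtr0_norm// sgn.
apply: (HK a b (fun q => \- (F q))) => //.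
- exact: derivative_chainN.
- by case: HPhi => cP dP; split => // t /dP; rewrite cosN.
- by move=> t tab; have := FL _ tab; rewrite ler0_norm// leNgt sgn// -leNgt.
Qed.

(* Integration by parts against the amplitude [A]. *)
Lemma amplitude_bound a b (Phi Psi c A dA : R -> R) (K M M' : R) : a <= b ->
  antiderivative a b Phi c ->
  antiderivative a b Psi (fun t => c t * A t) ->
  (forall t, t \in `[a, b] -> is_derive t 1 A (dA t)) ->
  (forall t, t \in `[a, b] -> `|A t| <= M) ->
  (forall t, t \in `[a, b] -> `|dA t| <= M') ->
  (forall t, t \in `[a, b] -> `|Phi t - Phi a| <= K) ->
  `|Psi b - Psi a| <= K * (M + M' * (b - a)).
Proof.
move=> ab HPhi HPsi HA AM AM' PhiK.
pose P t := (Phi t - Phi a) * A t.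
have HP : antiderivative a b P (fun t => c t * A t + (Phi t - Phi a) * dA t).
  case: HPhi => cPhi dPhi; split.
    move=> x.
    apply: (@continuousM R (subspace `[a, b]) (fun t => Phi t - Phi a) A).
      apply: (@continuousB _ _ (subspace `[a, b]) Phi (cst (Phi a))).
        exact: cPhi.
      exact: cst_continuous.
    exact: (antiderivative_of_derive HA).1.
  move=> x xab; have xab' : x \in `[a, b].
    by move: xab; rewrite !in_itv/= => /andP[? ?]; rewrite !ltW.
  have d1 := dPhi _ xab; have d2 := HA _ xab'.
  have d3 : is_derive x 1 (fun t => Phi t - Phi a) (c x).
    have hd := is_deriveB d1 (is_derive_cst (Phi a) x 1).
    by apply: (is_derive_eq hd); rewrite subr0.
  have := is_deriveM d3 d2; move=> hd; apply: (is_derive_eq hd).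
  by rewrite /GRing.scale/= addrC [A x * _]mulrC.
have aab : a \in `[a, b] by rewrite in_itv/= lexx.
have bab : b \in `[a, b] by rewrite in_itv/= lexx andbT.
have K0 : 0 <= K by apply: le_trans (PhiK _ aab).
have h : `|(Psi b - P b) - (Psi a - P a)| <= (K * M') * (b - a).
  apply: (antiderivative_lip ab (antiderivativeD HPsi (antiderivativeN HP))).
  move=> t tab /=; have tab' : t \in `[a, b].
    by move: tab; rewrite !in_itv/= => /andP[? ?]; rewrite !ltW.
  rewrite opprD addrA subrr sub0r normrN normrM ler_pM//.
    exact: PhiK.
  exact: AM'.
have -> : Psi b - Psi a = (Psi b - P b - (Psi a - P a)) + P b.
  by rewrite /P subrr mul0r; ring.
apply: le_trans (ler_normD _ _) _; rewrite mulrDr addrC lerD// ?mulrA//.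
by rewrite /P normrM ler_pM// ?PhiK// AM.
Qed.

End van_der_corput.

(** * Lebesgue measure on tuples *)

Section lebesgue_tuple_theory.
Context {R : realType}.
Local Notation mu := (@lebesgue_tuple R _).
Local Notation tup n := (n.-tuple (measurableTypeR R)).

Lemma lebesgue_measure_translation (r : R) (A : set (measurableTypeR R)) :
  measurable A -> lebesgue_measure ((fun x => x + r) @^-1` A) = lebesgue_measure A.
Proof.
move=> mA.
have mf : measurable_fun [set: measurableTypeR R]
    (fun x : measurableTypeR R => (x + r : measurableTypeR R)).
  by apply: measurable_funD => //; exact: measurable_cst.
apply/esym.
apply: (@lebesgue_measure_unique _ (measure_function_pushforward__canonical__measure_function_Measure
    lebesgue_measure mf)) => //.
move=> _ [[a b] _ <-] /=; rewrite /pushforward.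
have -> : (fun x => x + r) @^-1` `]a, b] = [set` `](a - r), (b - r)]].
  by apply/seteqP; split=> x /=; rewrite !in_itv/= ltrBlDr lerBrDr.
rewrite !lebesgue_measure_itv/= !lte_fin ltrD2r; case: ifPn => // _.
by rewrite -!EFinB; congr EFin; ring.
Qed.

Definition tshift n (v : 'I_n -> R) (x : tup n) : tup n :=
  [tuple (tnth x i + v i : measurableTypeR R) | i < n].

Lemma tnth_tshift n (v : 'I_n -> R) x i : tnth (tshift v x) i = tnth x i + v i.
Proof. by rewrite tnth_mktuple. Qed.

(** Measurability jointly in the point and in the length of the shift, as Fubini's theorem
    requires. *)
Lemma measurable_tshift2 n (w : 'I_n -> R) :
  measurable_fun [set: measurableTypeR R * tup n]
    (fun p => tshift (fun i => p.1 * w i) p.2).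
Proof.
apply/measurable_fun_tnthP => i.
rewrite (_ : _ \o _ = fun p : measurableTypeR R * tup n =>
    tnth p.2 i + p.1 * w i); last first.
  by apply/funext => p /=; rewrite tnth_tshift.
apply: measurable_funD.
  exact: (measurableT_comp (measurable_tnth i) measurable_snd).
apply: measurable_funM; first exact: measurable_fst.
exact: measurable_cst.
Qed.

Lemma measurable_tshift n (v : 'I_n -> R) :
  measurable_fun [set: tup n] (tshift v).
Proof.
apply/measurable_fun_tnthP => i.
rewrite (_ : _ \o _ = fun p : tup n => tnth p i + v i); last first.
  by apply/funext => p /=; rewrite tnth_tshift.
apply: measurable_funD; first exact: measurable_tnth.
exact: measurable_cst.
Qed.

Lemma lebesgue_tuple_translation n (v : 'I_n -> R) (A : set (tup n)) :
  measurable A -> mu (tshift v @^-1` A) = mu A.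
Proof.
elim: n v A => [|n IH] v A mA.
  congr (mu _); apply/seteqP; split=> x /=; rewrite (tuple0 x).
    by rewrite (tuple0 (tshift _ _)).
  by rewrite (tuple0 (tshift _ _)).
rewrite /= /tuple_step /pushforward /product_measure1.
set B := @tcons R n @^-1` A.
have mB : measurable B.
  by rewrite -[B]setTI; apply: measurable_tcons.
pose v' i := v (lift ord0 i).
pose h x := mu (xsection B x).
have -> : (fun x => mu (xsection (@tcons R n @^-1` (tshift v @^-1` A)) x))
    = h \o (fun x => x + v ord0).
  apply/funext => x /=; rewrite /h -(IH v'); last exact: measurable_xsection.
  congr (mu _); apply/seteqP; split => t /=; rewrite /xsection/= !inE/=.
    rewrite /B/=; congr (A _); apply: eq_from_tnth => i; rewrite tnth_tshift.
    case: (unliftP ord0 i) => [j ->|->]; last by rewrite !tnth0.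
    by rewrite !tnthS tnth_tshift.
  rewrite /B/=; congr (A _); apply: eq_from_tnth => i; rewrite tnth_tshift.
  case: (unliftP ord0 i) => [j ->|->]; last by rewrite !tnth0.
  by rewrite !tnthS tnth_tshift.
have mh : measurable_fun [set: measurableTypeR R] h.
  exact: measurable_fun_xsection.
have mf : measurable_fun [set: measurableTypeR R]
    (fun x : measurableTypeR R => (x + v ord0 : measurableTypeR R)).
  by apply: measurable_funD => //; exact: measurable_cst.
transitivity (\int[measure_function_pushforward__canonical__measure_function_Measure
    lebesgue_measure mf]_x h x)%E.
  by apply/esym; apply: ge0_integral_pushforward.
apply: eq_measure_integral => C mC _.
exact: lebesgue_measure_translation.
Qed.

Lemma measurable_tuple_box n (I : 'I_n -> interval R) :
  measurable [set x : tup n | forall i, tnth x i \in I i].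
Proof.
rewrite (_ : [set _ | _] = \bigcap_(i in [set: 'I_n])
    ((fun x : tup n => tnth x i) @^-1` [set` I i])); last first.
  by apply/seteqP; split=> x /= h i; [move=> _; exact: h|exact: h].
apply: fin_bigcap_measurable => // i _; rewrite -[X in measurable X]setTI.
apply: (@measurable_tnth _ (measurableTypeR R) n i measurableT).
exact: measurable_itv.
Qed.

Lemma lebesgue_tuple_box_le n (I : 'I_n -> interval R) (l : 'I_n -> R) :
  (forall i, lebesgue_measure ([set` I i] : set R) <= (l i)%:E)%E ->
  (mu [set x : tup n | forall i, (tnth x i : R) \in I i] <= (\prod_i l i)%:E)%E.
Proof.
elim: n I l => [|n IH] I l Il.
  rewrite big_ord0 /= diracE; case: (_ \in _) => //=.
have l0 i : 0 <= l i by rewrite -lee_fin; apply: le_trans (Il i).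
rewrite /= /tuple_step /pushforward.
rewrite (_ : _ @^-1` _ = [set` I ord0] `*`
    [set x : tup n | forall i, (tnth x i : R) \in I (lift ord0 i)]); last first.
  apply/seteqP; split => [[a x]/= h|[a x]/= [h1 h2] i].
    split; first by have := h ord0; rewrite tnth0.
    by move=> i; have := h (lift ord0 i); rewrite tnthS.
  by case: (unliftP ord0 i) => [j ->|->]; rewrite ?tnth0// tnthS.
rewrite product_measure1E; first last.
- exact: measurable_tuple_box.
- exact: measurable_itv.
rewrite big_ord_recl EFinM; by apply: lee_pmul; rewrite ?Il//; apply: IH => i; exact: Il.
Qed.

Lemma integrable_indic_lty d (T : measurableType d)
    (m : {measure set T -> \bar R}) (Q : set T) :
  measurable Q -> (m Q < +oo)%E -> m.-integrable setT (fun x => (\1_Q x)%:E).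
Proof.
move=> mQ Qoo; apply/integrableP; split.
  by apply/measurable_EFinP; exact: measurable_indic.
under eq_integral do rewrite abse_EFin ger0_norm//.
by rewrite integral_indic// setIT.
Qed.

(** Every translate of [f] has the same integral, so the integral equals the average of those of the
    translates by [t w], and after Fubini a bound on each segment in direction [w] becomes a bound
    in [n] variables. No coordinates adapted to [w] are introduced. *)
Lemma translation_average n (f : tup n -> R) (w : 'I_n -> R) (Q : set (tup n))
    (del K A : R) :
  measurable_fun [set: tup n] f -> (forall x, `|f x| <= A) ->
  measurable Q -> (mu Q < +oo)%E -> 0 < del ->
  (forall x t, 0 <= t <= del -> f (tshift (fun i => t * w i) x) != 0 -> Q x) ->
  (forall x, Q x -> `|(\int[lebesgue_measure]_(t in `[0%R, del])
      f (tshift (fun i => t * w i) x))%R| <= K) ->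
  `|(\int[mu]_x f x)%R| <= K / del * fine (mu Q).
Proof.
move=> mf fA mQ Qoo del0 fQ fK.
have A0 : 0 <= A by apply: le_trans (fA [tuple of nseq n 0]).
have fin : mu.-integrable setT (EFin \o f).
  apply: (@le_integrable _ _ _ _ _ _ _ (EFin \o (fun x => A * \1_Q x))) => //.
  - exact/measurable_EFinP.
  - move=> x _ /=; rewrite lee_fin.
    have [->|fx] := eqVneq (f x) 0; first by rewrite normr0.
    have Qx : Q x.
      apply: (fQ x 0); first by rewrite lexx ltW.
      rewrite (_ : tshift _ _ = x)//; apply: eq_from_tnth => i.
      by rewrite tnth_tshift mul0r addr0.
    by rewrite indicE mem_set// mulr1 (ger0_norm A0).
  - rewrite (_ : EFin \o _ = fun x => (A%:E * (\1_Q x)%:E)%E); last first.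
      by apply/funext => x /=; rewrite EFinM.
    apply: integrableZl => //.
    exact: integrable_indic_lty.
(* The indicator of [[0, del]] turns the average over [t] into an integral over a product space. *)
pose h (p : measurableTypeR R * tup n) : \bar R :=
  (f (tshift (fun i => p.1 * w i) p.2) * \1_(`[0, del] : set R) p.1)%:E.
have mh : measurable_fun setT h.
  apply/measurable_EFinP; apply: measurable_funM.
    exact: measurableT_comp mf (measurable_tshift2 w).
  apply: (measurableT_comp (measurable_indic _)) => //; exact: measurable_itv.
have hle t x : (`|h (t, x)| <= (A * \1_(`[0, del] : set R) t)%:E * (\1_Q x)%:E)%E.
  rewrite /h/= -EFinM lee_fin normrM [X in _ * X]ger0_norm// !indicE.
  have [/[!inE]/= tin|_] := boolP (t \in _); last by rewrite !mulr0 mul0r.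
  rewrite !mulr1; set y := tshift _ _.
  have [->|fx] := eqVneq (f y) 0; first by rewrite normr0 mulr_ge0.
  rewrite mem_set ?mulr1//; apply: fQ fx; by rewrite in_itv/= in tin.
have iE : (\int[lebesgue_measure]_t (\1_(`[0%R, del] : set R) t)%:E = del%:E)%E.
  have mI : measurable (`[0%R, del] : set (measurableTypeR R)).
    exact: measurable_itv.
  rewrite (integral_indic lebesgue_measure measurableT mI) setIT.
  have := @lebesgue_measure_itv R `[0, del]%R.
  by rewrite /= lte_fin del0 -EFinB subr0 => <-.
have ih : ((@lebesgue_measure R) \x mu)%E.-integrable setT h.
  apply/integrable12ltyP => //.
  apply: (@le_lt_trans _ _ (\int[lebesgue_measure]_t
     ((A * \1_(`[0%R, del] : set R) t)%:E * mu Q)))%E.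
    apply: ge0_le_integral => //.
    - by move=> t _; apply: integral_ge0.
    - apply: (measurable_fun_fubini_tonelli_F (abse \o h)).
        exact: measurableT_comp.
      by move=> p; exact: abse_ge0.
    - apply: emeasurable_funM; last exact: measurable_cst.
      apply/measurable_EFinP; apply: measurable_funM; first exact: measurable_cst.
      by apply: measurable_indic; exact: measurable_itv.
    - move=> t _.
      rewrite (_ : mu Q = \int[mu]_x (\1_Q x)%:E)%E; last first.
        by rewrite integral_indic// setIT.
      rewrite -ge0_integralZl//; [|by apply/measurable_EFinP; exact: measurable_indic
        |by rewrite lee_fin mulr_ge0].
      apply: ge0_le_integral => //.
      + apply: measurableT_comp => //.
        apply: measurableT_comp mh _; exact: measurable_pair1.
      + apply: emeasurable_funM; first exact: measurable_cst.
        by apply/measurable_EFinP; exact: measurable_indic.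
  rewrite -[mu Q]fineK ?ge0_fin_numE//.
  under eq_integral do rewrite -EFinM mulrAC EFinM.
  rewrite ge0_integralZl//.
  - by rewrite iE -EFinM ltry.
  - by apply/measurable_EFinP; apply: measurable_indic; exact: measurable_itv.
  - by rewrite lee_fin mulr_ge0// fine_ge0.
have fub := Fubini ih.
(* With [x] integrated first, translation invariance makes the inner integral the same for all [t]
   in [[0, del]]. *)
have L : (\int[lebesgue_measure]_t \int[mu]_x h (t, x) =
    (del * \int[mu]_x f x)%:E)%E.
  transitivity (\int[lebesgue_measure]_t
     ((\int[mu]_x f x)%R%:E * (\1_(`[0%R, del] : set R) t)%:E))%E.
    apply: eq_integral => t _; rewrite /h/=.
    under eq_integral do rewrite EFinM muleC.
    have mt := measurable_tshift (fun i => t * w i).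
    have ift : mu.-integrable setT
        (fun x => (f (tshift (fun i => t * w i) x))%:E).
      apply/integrableP; split.
        by apply/measurable_EFinP; exact: measurableT_comp.
      move/integrableP : fin => [_]; apply: le_lt_trans.
      rewrite le_eqVlt; apply/orP; left; apply/eqP.
      transitivity (\int[measure_function_pushforward__canonical__measure_function_Measure
          mu mt]_x `|(f x)%:E|)%E.
        apply/esym; apply: (ge0_integral_pushforward mt mu) => //.
        by apply: measurableT_comp => //; exact/measurable_EFinP.
      apply: eq_measure_integral => B mB _.
      exact: lebesgue_tuple_translation.
    have push : (\int[mu]_x (f (tshift (fun i => t * w i) x))%:E =
        \int[mu]_x (f x)%:E)%E.
      transitivity (\int[measure_function_pushforward__canonical__measure_function_Measure
          mu mt]_x (f x)%:E)%E.
        apply/esym; apply: (@integral_pushforward _ _ _ _ _ _ mt mu setT) => //.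
        exact/measurable_EFinP.
      apply: eq_measure_integral => B mB _.
      exact: lebesgue_tuple_translation.
    rewrite integralZl// push muleC; congr (_ * _)%E.
    by rewrite /Rintegral fineK// integrable_fin_num.
  rewrite integralZl//; last exact: integrable_indic_itv.
  by rewrite iE -EFinM mulrC.
have {}fub : (del * \int[mu]_x f x)%:E = (\int[mu]_x \int[lebesgue_measure]_t h (t, x))%E.
  by rewrite -L fub.
(* With [t] integrated first, the inner integral is at most [K] on [Q]; off [Q] it is zero, since
   [f] vanishes along the whole segment. *)
have hx x : (`|\int[lebesgue_measure]_t h (t, x)| <= K%:E * (\1_Q x)%:E)%E.
  have hE : (\int[lebesgue_measure]_t h (t, x) =
      \int[lebesgue_measure]_(t in `[0%R, del])
        (f (tshift (fun i => t * w i) x))%:E)%E.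
    rewrite [RHS]integral_mkcond; apply: eq_integral => t _.
    rewrite /h /= patchE indicE; case: ifPn => _; first by rewrite mulr1.
    by rewrite mulr0.
  have [Qx|Qx] := pselect (Q x); last first.
    rewrite indicE memNset// mule0 hE integral0_eq ?abse0// => t/=.
    rewrite in_itv/= => tin; apply/eqP; rewrite eqe; apply: contrapT => /negP fx.
    exact/Qx/fQ/fx.
  rewrite indicE mem_set// mule1 hE.
  have := fK _ Qx; rewrite /Rintegral -lee_fin -abse_EFin fineK//.
  apply: integrable_fin_num; first exact: measurable_itv.
  apply: measurable_bounded_integrable.
  - exact: measurable_itv.
  - have := @lebesgue_measure_itv R `[0, del]%R.
    by rewrite /= lte_fin del0 -EFinB => ->; rewrite ltry.
  - apply: (@measurable_funS _ _ _ _ setT) => //.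
    apply: measurableT_comp mf _.
    exact: measurableT_comp (measurable_tshift2 w) (measurable_pair2 x).
  - exists A; split; first by rewrite num_real.
    by move=> B AB t _ /=; apply: le_trans (ltW AB).
have mG : measurable_fun setT (fun x => \int[lebesgue_measure]_t h (t, x))%E.
  exact: measurable_fubini_G ih.
have : ((del * `|\int[mu]_x f x|)%:E <= (K * fine (mu Q))%:E)%E.
  rewrite -{1}(gtr0_norm del0) -normrM -abse_EFin fub.
  apply: le_trans (le_abse_integral _ _ _) _ => //.
  apply: (@le_trans _ _ (\int[mu]_x (K%:E * (\1_Q x)%:E)))%E.
    apply: ge0_le_integral => //.
      by apply: measurableT_comp.
    by apply/measurable_EFinP; apply: measurable_funM;
      [exact: measurable_cst|exact: measurable_indic].
  rewrite integralZl//; last exact: integrable_indic_lty.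
  by rewrite integral_indic// setIT EFinM fineK// ge0_fin_numE.
by rewrite lee_fin mulrAC ler_pdivlMr// mulrC.
Qed.

End lebesgue_tuple_theory.

(** * Smooth functions *)

Section row_norm.
Context {R : realType} {n : nat}.
Implicit Types x y : 'rV[R]_n.

Lemma coord_le_norm x i : `|x 0 i| <= `|x|.
Proof.
rewrite [leRHS]/Num.norm/= mx_normrE.
exact: (le_bigmax _ (fun ij => `|x ij.1 ij.2|) (0, i)).
Qed.

Lemma norm_le_coord x (e : R) : 0 <= e -> (forall i, `|x 0 i| <= e) -> `|x| <= e.
Proof.
move=> e0 xe; rewrite [leLHS]/Num.norm/= mx_normrE; apply: bigmax_le => // -[i j] _.
by rewrite /= (ord1 i).
Qed.

Lemma norm_lt_coord x (e : R) : 0 < e -> (forall i, `|x 0 i| < e) -> `|x| < e.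
Proof.
move=> e0 xe; rewrite [ltLHS]/Num.norm/= mx_normrE.
by apply: bigmax_lt => // -[i j] _; rewrite /= (ord1 i).
Qed.

End row_norm.

Lemma is_derive_MVT {R : realType} (a b : R) (g dg : R -> R) : a <= b ->
  (forall s, a <= s <= b -> is_derive s 1 g (dg s)) ->
  exists2 c, a <= c <= b & g b - g a = dg c * (b - a).
Proof.
move=> ab dgs.
have [c cab cE] : exists2 c, c \in `[a, b] & g b - g a = dg c * (b - a).
  apply: MVT_segment => //.
    by move=> x; rewrite in_itv/= => /andP[/ltW ax /ltW xb]; apply: dgs; rewrite ax.
  apply: continuous_in_subspaceT => s; rewrite inE/= in_itv/= => /dgs[+ _].
  by move=> /derivable1_diffP; exact: differentiable_continuous.
by exists c.
Qed.

Section lines.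
Context {R : realType} {V : normedModType R}.
Implicit Types (f : V -> R) (x v : V).

(** The two difference quotients are the same function of [h], so derivability and the derivative
    pass from [f] to its restriction to a line, and back, without the chain rule. *)
Lemma growth_rate_line f x v (s : R) :
  (fun h : R => h^-1 *: (((fun t => f (x + t *: v)) \o shift s) (h *: (1:R)) -
    f (x + s *: v))) =
  (fun h : R => h^-1 *: ((f \o shift (x + s *: v)) (h *: v) - f (x + s *: v))).
Proof.
apply/funext => h /=; congr (_ *: (f _ - _)).
by rewrite -[h%:A]/(h * 1) mulr1 scalerDl addrCA.
Qed.

Lemma derive_line f x v (s : R) :
  'D_v f (x + s *: v) = 'D_1 (fun t : R => f (x + t *: v)) s.
Proof. by rewrite /derive growth_rate_line. Qed.

Lemma derivable_line f x v (s : R) :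
  derivable f (x + s *: v) v = derivable (fun t : R => f (x + t *: v)) s 1.
Proof. by rewrite /derivable growth_rate_line. Qed.

Lemma is_derive_line f x v (s : R) : derivable f (x + s *: v) v ->
  is_derive s 1 (fun t : R => f (x + t *: v)) ('D_v f (x + s *: v)).
Proof. by rewrite derivable_line derive_line => df; exact: DeriveDef. Qed.

Lemma line_MVT f x v (t : R) :
  (forall s, `|s| <= `|t| -> derivable f (x + s *: v) v) ->
  exists2 s, `|s| <= `|t| & f (x + t *: v) - f x = t * 'D_v f (x + s *: v).
Proof.
move=> df.
have dl (s : R) : `|s| <= `|t| ->
    is_derive s 1 (fun t : R => f (x + t *: v)) ('D_v f (x + s *: v)).
  by move=> /df; exact: is_derive_line.
have [t0|t0] := leP 0 t.
  have st s : 0 <= s <= t -> `|s| <= `|t|.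
    by move=> /andP[s0 st]; rewrite !ger0_norm.
  have [s sI sE] := is_derive_MVT t0 (fun s h => dl s (st s h)).
  by exists s; [exact: st|move: sE; rewrite scale0r addr0 subr0 mulrC].
have st s : t <= s <= 0 -> `|s| <= `|t|.
  by move=> /andP[s0 st]; rewrite (ltr0_norm t0) ler0_norm// lerN2.
have [s sI sE] := is_derive_MVT (ltW t0) (fun s h => dl s (st s h)).
exists s; first exact: st.
by move: sE; rewrite scale0r addr0 sub0r mulrN => /(congr1 -%R); rewrite opprB opprK mulrC.
Qed.

End lines.

(** * Differentiability from continuous partial derivatives *)

Section C1.
Context {R : realType} {n : nat}.
Implicit Types (f : 'rV[R]_n -> R) (x : 'rV[R]_n).
Local Notation e i := (delta_mx 0 i : 'rV[R]_n).

Definition lin_form (c : 'I_n -> R) (h : 'rV[R]_n) : R := \sum_i h 0 i * c i.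

Lemma lin_form_is_linear c : linear (lin_form c).
Proof.
move=> a u v; rewrite /lin_form scaler_sumr -big_split; apply: eq_bigr => i _.
by rewrite !mxE mulrDl -mulrA.
Qed.

HB.instance Definition _ c :=
  GRing.isLinear.Build R _ _ _ (lin_form c) (lin_form_is_linear c).

Lemma continuous_lin_form c : continuous (lin_form c).
Proof.
apply: continuous_big; first exact: add_continuous.
move=> i _ x.
apply: (@cvgM _ _ (nbhs x) _ (fun h : 'rV[R]_n => h 0 i) (fun=> c i)).
  exact: coord_continuous.
exact: cvg_cst.
Qed.

(** The increment is split into [n] steps parallel to the axes; the mean value theorem is applied to
    each, and the intermediate partial derivatives are compared with those at [x]. *)
Lemma C1_differentiable f x :
  (\forall y \near x, forall i, derivable f y (e i)) ->
  (forall i, {for x, continuous (partial i f)}) ->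
  differentiable f x /\ forall h, 'd f x h = \sum_i h 0 i * partial i f x.
Proof.
move=> df cf.
pose L := lin_form (fun i => partial i f x).
have cL : continuous L by exact: continuous_lin_form.
have key : f \o shift x = cst (f x) + L +o_ (0 : 'rV[R]_n) id.
  apply/eqaddoP => eps eps0.
  (* Each of the [n] steps may cost [eta] times the norm of [h]; the denominator [n.+1] avoids a
     division by zero. *)
  pose eta := eps / n.+1%:R.
  have eta0 : 0 < eta by rewrite divr_gt0.
  have [r /= r0 Hr] : exists2 r, 0 < r & forall y, `|y - x| < r ->
      (forall i, derivable f y (e i)) /\
      (forall i, `|partial i f y - partial i f x| <= eta).
    have : \forall y \near x, (forall i, derivable f y (e i)) /\
      (forall i, `|partial i f y - partial i f x| <= eta).
      apply: filterI; first exact: df.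
      apply: (@filter_forall _ 'I_n (fun i y => `|partial i f y - partial i f x| <= eta)
        _ (nbhs_filter x)) => i.
      have /cvgrPdist_le/(_ _ eta0) := cf i.
      by apply: filterS => y; rewrite distrC.
    move=> /nbhs_ballP[r /= r0 Hr]; exists r => // y yx; apply: Hr.
    by rewrite -ball_normE/= distrC.
  apply/nbhs_ballP; exists r => //= h; rewrite -ball_normE/= sub0r normrN => hr.
  pose hk (k : nat) : 'rV[R]_n := \row_j (if (j < k)%N then h 0 j else 0).
  have hkn : hk n = h by apply/rowP => j; rewrite mxE ltn_ord.
  have hk0 : hk 0%N = 0 by apply/rowP => j; rewrite !mxE.
  have hkS (k : 'I_n) : hk k.+1 = hk k + h 0 k *: e k.
    apply/rowP => j; rewrite !mxE ltnS eqxx/= leq_eqVlt.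
    have [->|jk] := eqVneq j k; first by rewrite eqxx/= ltnn mulr1 add0r.
    by rewrite (negbTE (jk : val j != val k)) /= mulr0 addr0.
  have step (k : 'I_n) :
      `|f (x + hk k.+1) - f (x + hk k) - h 0 k * partial k f x| <= eta * `|h|.
    have small s : `|s| <= `|h 0 k| -> `|(x + hk k + s *: e k) - x| < r.
      move=> sh; rewrite addrAC -addrA addrC -addrA (addrC x) addrAC -addrA subrr addr0 || idtac.
      apply: le_lt_trans hr; apply: norm_le_coord => // j.
      rewrite !mxE eqxx/=.
      have [->|jk] := eqVneq j k.
        by rewrite ltnn mulr1 (le_trans _ (coord_le_norm h k))// ; apply: le_trans sh; rewrite le_eqVlt; apply/orP; left; apply/eqP; congr (`|_|); ring.
      rewrite mulr0; case: ifPn => _; apply: le_trans (coord_le_norm h j).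
        by rewrite le_eqVlt; apply/orP; left; apply/eqP; congr (`|_|); ring.
      by rewrite (_ : _ - _ = 0) ?normr0//; ring.
    have [s sh sE] := @line_MVT _ _ f (x + hk k) (e k) (h 0 k)
      (fun s sh => (Hr _ (small s sh)).1 k).
    rewrite hkS addrA sE -mulrBr normrM mulrC ler_pM//.
      exact: (Hr _ (small s sh)).2.
    exact: coord_le_norm.
  have tele : f (h + x) - (f x + \sum_i h 0 i * partial i f x) =
      \sum_(k < n) (f (x + hk k.+1) - f (x + hk k) - h 0 k * partial k f x).
    rewrite [in RHS]big_split/= sumrN opprD addrA; congr (_ - _).
    rewrite -(big_mkord xpredT (fun k => f (x + hk k.+1) - f (x + hk k))).
    by rewrite (telescope_sumr (fun k => f (x + hk k)))// hkn hk0 addr0 (addrC h).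
  rewrite [X in `|X| <= _](_ : _ = f (h + x) - (f x + \sum_i h 0 i * partial i f x))//.
  rewrite tele; apply: le_trans (ler_norm_sum _ _ _) _.
  apply: le_trans (ler_sum _ (fun k _ => step k)) _.
  rewrite sumr_const card_ord -mulr_natr mulrAC ler_wpM2r//.
  by rewrite /eta mulrAC ler_pdivrMr// ler_wpM2l ?ler_nat// ltW.
have dE := diff_unique cL key; split.
  by apply/diff_locallyP; split; rewrite dE.
by move=> h; rewrite dE.
Unshelve. all: by end_near. Qed.

End C1.

Lemma dist_le_halves {R : realFieldType} (eps a b c : R) :
  `|a - c| <= eps / 2 -> `|b - c| <= eps / 2 -> `|a - b| <= eps.
Proof.
by rewrite !ler_norml => /andP[? ?] /andP[? ?]; apply/andP; split; lra.
Qed.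

Lemma near_eq_continuous {T U : topologicalType} (f g : T -> U) (x : T) :
  (\forall y \near x, f y = g y) -> {for x, continuous f} ->
  {for x, continuous g}.
Proof.
move=> fg cf A; rewrite -(nbhs_singleton fg) => /cf.
by apply: filterS2 fg => y /= ->.
Qed.

Section smooth.
Context {R : realType} {n : nat}.
Implicit Types (f g : 'rV[R]_n -> R) (x w : 'rV[R]_n) (V : set 'rV[R]_n).
Local Notation e i := (delta_mx 0 i : 'rV[R]_n).
Local Notation D s f := (foldr (@partial R n R) f s).

Lemma smooth_partial V f i : smooth_on V f -> smooth_on V (partial i f).
Proof. by move=> sf s x Vx; rewrite -foldr_rcons; exact: sf. Qed.

Lemma smooth_iterated V f s : smooth_on V f -> smooth_on V (D s f).
Proof. by move=> sf s' x Vx; rewrite -foldr_cat; exact: sf. Qed.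

Lemma smooth_subset V V' f : V' `<=` V -> smooth_on V f -> smooth_on V' f.
Proof. by move=> VV sf s x /VV; exact: sf. Qed.

Lemma eq_on_iterated V f g s x : open V -> (forall y, V y -> f y = g y) ->
  V x -> D s f x = D s g x.
Proof.
move=> oV fg; elim: s x => [|i s IH] x Vx /=; first exact: fg.
rewrite /partial; apply: near_eq_derive.
have : nbhs x V by exact: open_nbhs_nbhs.
by apply: filterS => y Vy; exact: IH.
Qed.

Lemma eq_on_smooth V f g : open V -> (forall y, V y -> f y = g y) ->
  smooth_on V f -> smooth_on V g.
Proof.
move=> oV fg sf s x Vx.
have E : \forall y \near x, D s f y = D s g y.
  have : nbhs x V by exact: open_nbhs_nbhs.
  by apply: filterS => y Vy; exact: eq_on_iterated Vy.
split; first by have [cf _] := sf s x Vx; exact: near_eq_continuous E cf.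
move=> i; have [_ /(_ i)] := sf s x Vx.
exact: near_eq_derivable.
Qed.

Lemma smooth_differentiable V f x : open V -> smooth_on V f -> V x ->
  differentiable f x /\ forall w, 'D_w f x = \sum_i w 0 i * partial i f x.
Proof.
move=> oV sf Vx.
have [||df dE] := @C1_differentiable _ _ f x.
- have : nbhs x V by exact: open_nbhs_nbhs.
  by apply: filterS => y Vy; exact: (sf [::] y Vy).2.
- by move=> i; exact: (sf [:: i] x Vx).1.
by split => // w; rewrite deriveE// dE.
Qed.

Lemma smooth_derivable V f x w : open V -> smooth_on V f -> V x ->
  derivable f x w.
Proof. by move=> oV sf Vx; exact/diff_derivable/(smooth_differentiable oV sf Vx).1. Qed.

Lemma is_derive_lin {W : normedModType R} (I : Type) (r : seq I) (c : I -> R)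
    (F : I -> W -> R) (dF : I -> R) (x v : W) :
  (forall i, is_derive x v (F i) (dF i)) ->
  is_derive x v (fun y => \sum_(i <- r) c i * F i y) (\sum_(i <- r) c i * dF i).
Proof.
move=> H; elim: r => [|i r IH].
  rewrite big_nil; under [X in is_derive _ _ X]eq_fun do rewrite big_nil.
  exact: is_derive_cst.
rewrite big_cons; under [X in is_derive _ _ X]eq_fun do rewrite big_cons.
have Hi := H i; apply: (@is_deriveD _ _ _ (fun y => c i * F i y)).
Qed.

Lemma iterated_lin V (I : Type) (r : seq I) (c : I -> R)
    (F : I -> 'rV[R]_n -> R) s x :
  open V -> (forall i, smooth_on V (F i)) -> V x ->
  D s (fun y => \sum_(i <- r) c i * F i y) x = \sum_(i <- r) c i * D s (F i) x.
Proof.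
move=> oV sF; elim: s x => [//|j s IH] x Vx /=.
transitivity ('D_(e j) (fun y => \sum_(i <- r) c i * D s (F i) y) x).
  apply: near_eq_derive; have : nbhs x V by exact: open_nbhs_nbhs.
  by apply: filterS => y Vy; exact: IH.
have H := @is_derive_lin _ _ r c (fun i => D s (F i)) (fun i => 'D_(e j) (D s (F i)) x) x (e j).
by apply: derive_val; apply: H => i; apply/derivableP; exact: (sF i s x Vx).2.
Qed.

Lemma smooth_lin V (I : Type) (r : seq I) (c : I -> R) (F : I -> 'rV[R]_n -> R) :
  open V -> (forall i, smooth_on V (F i)) ->
  smooth_on V (fun y => \sum_(i <- r) c i * F i y).
Proof.
move=> oV sF s x Vx.
have E : \forall y \near x, \sum_(i <- r) c i * D s (F i) y =
    D s (fun y => \sum_(i <- r) c i * F i y) y.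
  have : nbhs x V by exact: open_nbhs_nbhs.
  by apply: filterS => y Vy; rewrite (iterated_lin r c s oV sF Vy).
split.
  apply: near_eq_continuous E _; rewrite /prop_for /continuous_at.
  apply: cvg_big; [exact: add_continuous|exact: (nbhs_filter x)|].
  move=> i _; apply: (@cvgM _ _ (nbhs x) _ (fun=> c i)); first exact: cvg_cst.
  exact: (sF i s x Vx).1.
move=> i; apply: (near_eq_derivable E).
have H := @is_derive_lin _ _ r c (fun i => D s (F i)) (fun j => 'D_(e i) (D s (F j)) x) x (e i).
by case: H => // j; apply/derivableP; exact: (sF j s x Vx).2.
Qed.

Lemma smooth_deriv V f w : open V -> smooth_on V f -> smooth_on V ('D_w f).
Proof.
move=> oV sf.
apply: (@eq_on_smooth V (fun y => \sum_i w 0 i * partial i f y) ('D_w f) oV).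
  by move=> y Vy; rewrite (smooth_differentiable oV sf Vy).2.
exact: (@smooth_lin V _ _ (fun i => w 0 i) (fun i => partial i f) oV
  (fun i => @smooth_partial V f i sf)).
Qed.

Definition dirD w f : 'rV[R]_n -> R := 'D_w f.

Lemma smooth_deriv_iter V f w q : open V -> smooth_on V f ->
  smooth_on V (iter q (dirD w) f).
Proof. move=> oV sf; elim: q => [|q IH]; first exact: sf.
exact: (@smooth_deriv V _ w oV IH). Qed.

Lemma eq_on_deriv_iter V f g w q x : open V -> (forall y, V y -> f y = g y) ->
  V x -> iter q (dirD w) f x = iter q (dirD w) g x.
Proof.
move=> oV fg; elim: q x => [|q IH] x Vx /=; first exact: fg.
apply: near_eq_derive.
have : nbhs x V by exact: open_nbhs_nbhs.
by apply: filterS => y Vy; exact: IH.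
Qed.

Lemma deriv_iter_lin V (I : Type) (r : seq I) (c : I -> R)
    (F : I -> 'rV[R]_n -> R) w q x :
  open V -> (forall i, smooth_on V (F i)) -> V x ->
  iter q (dirD w) (fun y => \sum_(i <- r) c i * F i y) x =
  \sum_(i <- r) c i * iter q (dirD w) (F i) x.
Proof.
move=> oV sF; elim: q x => [//|q IH] x Vx /=.
transitivity ('D_w (fun y => \sum_(i <- r) c i * iter q (dirD w) (F i) y) x).
  apply: near_eq_derive; have : nbhs x V by exact: open_nbhs_nbhs.
  by apply: filterS => y Vy; exact: IH.
have H := @is_derive_lin _ _ r c (fun i => iter q (dirD w) (F i))
  (fun i => 'D_w (iter q (dirD w) (F i)) x) x w.
apply: derive_val; apply: H => i; apply/derivableP.
exact: (@smooth_derivable V _ x w oV (@smooth_deriv_iter V _ w q oV (sF i)) Vx).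
Qed.

(** The derivative in direction [w] is the sum of the [w_i] times the partial derivatives, so its
    power expands into [n ^ q] words. Each word keeps its own product of the [w_i], to match
    estimates in which derivatives are scaled by the coordinates. *)
Lemma deriv_iter_bound V f w q x (B : R) : open V -> smooth_on V f -> V x ->
  (forall s : seq 'I_n, size s = q -> `|(\prod_(i <- s) w 0 i) * D s f x| <= B) ->
  `|iter q (dirD w) f x| <= n%:R ^+ q * B.
Proof.
move=> oV; elim: q f B => [|q IH] f B sf Vx hB.
  by have := hB [::] erefl; rewrite big_nil mul1r expr0 mul1r.
rewrite iterSr (@eq_on_deriv_iter V _ (fun y => \sum_i w 0 i * partial i f y))//; last first.
  by move=> y Vy; rewrite /dirD (smooth_differentiable oV sf Vy).2.
rewrite (@deriv_iter_lin V _ _ (fun i => w 0 i) (fun i => partial i f) w q x oV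
  (fun i => @smooth_partial V f i sf) Vx).
apply: le_trans (ler_norm_sum _ _ _) _.
apply: (@le_trans _ _ (\sum_(i < n) n%:R ^+ q * B)); last first.
  by rewrite sumr_const card_ord exprS -[leLHS]mulr_natl mulrA.
apply: ler_sum => i _.
have [w0|wi] := eqVneq (w 0 i) 0.
  rewrite w0 mul0r normr0 mulr_ge0//.
  by apply: le_trans (hB (nseq q.+1 i) _); rewrite ?normr_ge0 ?size_nseq.
rewrite normrM -ler_pdivlMl ?normr_gt0// mulrCA.
apply: (IH (partial i f) _ (@smooth_partial V f i sf) Vx) => s sq.
rewrite ler_pdivlMl ?normr_gt0// -normrM mulrA.
have := hB (rcons s i); rewrite size_rcons sq => /(_ erefl).
by rewrite foldr_rcons -cats1 big_cat/= big_seq1 [_ * w 0 i]mulrC.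
Qed.

(** Two uses of the mean value theorem: along [e i] for the increment of [f] in direction [e j],
    then along [e j]. The left-hand side is symmetric in [i] and [j], which is the source of
    [schwarz]. *)
Lemma second_difference V f x i j (r : R) : open V -> smooth_on V f ->
  (forall y, `|y - x| <= r -> V y) -> forall t : R, 0 < t -> t + t <= r ->
  exists2 y, `|y - x| <= t + t &
    f (x + t *: e i + t *: e j) - f (x + t *: e i) - f (x + t *: e j) + f x =
    t ^+ 2 * partial j (partial i f) y.
Proof.
move=> oV sf xV t t0 tr.
have ne k : `|e k| <= 1.
  apply: norm_le_coord => // l; rewrite mxE eqxx/=.
  by case: eqP; rewrite ?normr1// normr0.
have near_x s u : `|s| <= `|t| -> `|u| <= `|t| -> `|x + s *: e i + u *: e j - x| <= t + t.
  move=> st ut; rewrite -(addrA x) [x + _]addrC addrK.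
  apply: le_trans (ler_normD _ _) _; rewrite !normrZ -(gtr0_norm t0) lerD//.
    by rewrite -[leRHS]mulr1 ler_pM.
  by rewrite -[leRHS]mulr1 ler_pM.
have inV s u : `|s| <= `|t| -> `|u| <= `|t| -> V (x + s *: e i + u *: e j).
  by move=> st ut; apply: xV; apply: le_trans tr; exact: near_x.
pose g y := f (y + t *: e j) - f y.
have dg s : `|s| <= `|t| -> is_derive (x + s *: e i) (e i) g
    (partial i f (x + s *: e i + t *: e j) - partial i f (x + s *: e i)).
  move=> st.
  have d2 : is_derive (x + s *: e i) (e i) f (partial i f (x + s *: e i)).
    apply/derivableP; apply: (sf [::] _ _).2.
    by have := inV s 0 st; rewrite scale0r addr0 normr0; apply.
  have d1 : is_derive (x + s *: e i) (e i) (fun y => f (y + t *: e j))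
     (partial i f (x + s *: e i + t *: e j)).
    have E : (fun h : R => h^-1 *: (((fun y => f (y + t *: e j)) \o shift (x + s *: e i)) (h *: e i) -
        f (x + s *: e i + t *: e j))) =
      (fun h : R => h^-1 *: ((f \o shift (x + s *: e i + t *: e j)) (h *: e i) -
        f (x + s *: e i + t *: e j))).
      by apply/funext => h /=; rewrite -!addrA.
    apply: DeriveDef; last by rewrite /partial /derive E.
    by rewrite /derivable E; apply: (sf [::] _ (inV s t st _)).2.
  exact: is_deriveB.
have [s st sE] : exists2 s, `|s| <= `|t| &
    g (x + t *: e i) - g x = t * 'D_(e i) g (x + s *: e i).
  by apply: line_MVT => s /dg[].
have [u ut uE] : exists2 u, `|u| <= `|t| &
   partial i f (x + s *: e i + t *: e j) - partial i f (x + s *: e i) =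
     t * 'D_(e j) (partial i f) (x + s *: e i + u *: e j).
  by apply: line_MVT => u ut; apply: (sf [:: i] _ (inV s u st ut)).2.
exists (x + s *: e i + u *: e j); first exact: near_x.
rewrite /partial in uE *; rewrite expr2 -mulrA -uE.
have [_ <-] := dg s st; rewrite -sE /g; ring.
Qed.

Lemma schwarz V f x i j : open V -> smooth_on V f -> V x ->
  partial i (partial j f) x = partial j (partial i f) x.
Proof.
move=> oV sf Vx.
have [r r0 xV] : exists2 r : R, 0 < r & forall y, `|y - x| <= r -> V y.
  have /nbhs_ballP[r /= r0 rV] : nbhs x V by exact: open_nbhs_nbhs.
  exists (r / 2); first by rewrite divr_gt0.
  move=> y yx; apply: rV; rewrite -ball_normE/= distrC.
  by apply: le_lt_trans yx _; rewrite ltr_pdivrMr// ltr_pMr// ltr1n.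
apply/eqP; rewrite -subr_eq0 -normr_le0; apply/ler_addgt0Pl => eps eps0.
rewrite addr0.
have [cij _] := sf [:: i; j] x Vx; have [cji _] := sf [:: j; i] x Vx.
have eps2 : 0 < eps / 2 by rewrite divr_gt0.
have /cvgrPdist_le/(_ _ eps2) hij := cij; have /cvgrPdist_le/(_ _ eps2) hji := cji.
have [d /= d0 Hd] := (nbhs_ballP x _).1 (filterI hij hji).
pose t := Num.min d r / 4.
have t0 : 0 < t by rewrite divr_gt0// lt_min d0.
have tr : t + t <= r.
  have : Num.min d r <= r by rewrite ge_min lexx orbT.
  rewrite /t; lra.
have td : t + t < d.
  have : Num.min d r <= d by rewrite ge_min lexx.
  rewrite /t; lra.
have [y yx yE] := second_difference i j oV sf xV t0 tr.
have [u ux uE] := second_difference j i oV sf xV t0 tr.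
(* The two second differences are the same number, so the mixed derivatives agree at two points
   close to [x]; their continuity does the rest. *)
have E : partial j (partial i f) y = partial i (partial j f) u.
  apply: (@mulfI _ (t ^+ 2)); first by rewrite expf_neq0 ?gt_eqF.
  apply: etrans (esym yE) (etrans _ uE).
  rewrite (addrAC x (t *: e j)); congr (_ + _); exact: addrAC.
have [|_ hy] := Hd y; first by rewrite -ball_normE/= distrC (le_lt_trans yx).
have [|hu _] := Hd u; first by rewrite -ball_normE/= distrC (le_lt_trans ux).
rewrite /= in hy hu; rewrite E in hy.
exact: dist_le_halves hu hy.
Qed.

Lemma iterated_perm V f s t x : open V -> smooth_on V f -> V x ->
  perm_eq s t -> D s f x = D t f x.
Proof.
move=> oV sf; have front s1 s2 i y : V y -> D (s1 ++ i :: s2) f y = D (i :: s1 ++ s2) f y.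
  elim: s1 y => [//|j s1 IH] y Vy.
  transitivity (D [:: j] (D (i :: s1 ++ s2) f) y).
    exact: (@eq_on_iterated V _ _ [:: j] y oV IH Vy).
  exact: (@schwarz V _ y j i oV (@smooth_iterated V f (s1 ++ s2) sf) Vy).
elim: s t x => [|i s IH] t x Vx st; first by move: st; rewrite perm_sym => /perm_nilP->.
have : i \in t by rewrite -(perm_mem st) mem_head.
move=> /splitPr tE; case: tE st => t1 t2.
rewrite perm_sym -[i :: t2]cat1s perm_catCA /= perm_cons perm_sym => st.
rewrite front//; transitivity (D [:: i] (D s f) x) => //.
by apply: (@eq_on_iterated V _ _ [:: i] x oV _ Vx) => u Vu; exact: IH.
Qed.

Lemma mpartialE (a : multiindex n) f :
  mpartial a f = D (flatten [seq nseq (a i) i | i <- enum 'I_n]) f.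
Proof.
rewrite /mpartial; elim: (enum 'I_n) => //= i s ->.
by rewrite foldr_cat; elim: (a i) => //= k ->.
Qed.

Lemma iterated_mpartial V f s x : open V -> smooth_on V f -> V x ->
  D s f x = mpartial [ffun i => count_mem i s] f x.
Proof.
move=> oV sf Vx; rewrite mpartialE; apply: (iterated_perm oV sf Vx).
apply/allP => j _ /=; apply/eqP.
rewrite count_flatten -map_comp sumnE big_map big_enum/= (bigD1 j)//= big1.
  by rewrite addn0 count_nseq/= eqxx mul1n ffunE.
by move=> i /negbTE ij; rewrite count_nseq/= ij mul0n.
Qed.

(** Induction on [K]: the partial derivatives are flat to one order less, and the mean value theorem
    on the segment from 0 to [x] restores the missing factor. *)
Lemma flat_bound V f K : open V -> smooth_on V f -> V 0 ->
  (forall s, (size s < K)%N -> D s f 0 = 0) ->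
  exists C r, [/\ 0 < C, 0 < r & forall x, `|x| < r -> `|f x| <= C * `|x| ^+ K].
Proof.
move=> oV; elim: K f => [|K IH] f sf V0 f0.
  have [cf _] := sf [::] 0 V0.
  have /cvgrPdist_le/(_ _ ltr01)/nbhs_ballP[r /= r0 Hr] := cf.
  exists (`|f 0| + 1), r; split => //.
  move=> x xr; rewrite expr0 mulr1.
  have := Hr x; rewrite -ball_normE/= sub0r normrN => /(_ xr) fx.
  rewrite -[f x](subrK (f 0)) addrC; apply: le_trans (ler_normD _ _) _.
  by rewrite lerD2l distrC.
have Hi i : exists Cr : R * R, [/\ 0 < Cr.1, 0 < Cr.2 & forall x, `|x| < Cr.2 ->
    `|partial i f x| <= Cr.1 * `|x| ^+ K].
  have [|s sK|C [r H]] := IH (partial i f) _ V0.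
  - exact: smooth_partial.
  - by rewrite -foldr_rcons; apply: f0; rewrite size_rcons.
  - by exists (C, r).
have {Hi} [Cr Hi] := choice Hi.
have [r0 /= r00 Hr0] : exists2 r : R, 0 < r & forall y, `|y| < r -> V y.
  have /nbhs_ballP[r /= r0 rV] : nbhs (0 : 'rV[R]_n) V by exact: open_nbhs_nbhs.
  by exists r => // y yr; apply: rV; rewrite -ball_normE/= sub0r normrN.
pose C := 1 + \sum_i (Cr i).1.
have C0 : 0 < C.
  by rewrite ltr_wpDr// sumr_ge0// => i _; have [/ltW] := Hi i.
have CiC i : (Cr i).1 <= C.
  rewrite /C (bigD1 i)//= addrCA lerDl addr_ge0// sumr_ge0// => j _.
  by have [/ltW] := Hi j.
pose r := \big[Num.min/r0]_i (Cr i).2.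
have r_gt0 : 0 < r.
  by rewrite /r; elim/big_ind: _ => // [a b a0 b0|i _]; [rewrite lt_min a0|have [] := Hi i].
have rr0 : r <= r0 by rewrite /r bigmin_le_id.
have rri i : r <= (Cr i).2 by rewrite /r bigmin_le_cond.
exists (n.+1%:R * C), r; split => //; first by rewrite mulr_gt0.
move=> x xr.
have sx (s : R) : `|s| <= `|1 : R| -> `|s *: x| <= `|x|.
  by rewrite normr1 => s1; rewrite normrZ ler_piMl.
have [s s1 sE] : exists2 s : R, `|s| <= `|1 : R| &
    f (0 + 1 *: x) - f 0 = 1 * 'D_x f (0 + s *: x).
  apply: line_MVT => s s1; rewrite add0r.
  apply: (@smooth_derivable V f _ x oV sf).
  by apply: Hr0; apply: le_lt_trans (sx _ s1) (lt_le_trans xr rr0).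
move: sE; rewrite !add0r scale1r mul1r (f0 [::] isT : f 0 = 0) subr0 => ->.
have Vsx : V (s *: x).
  by apply: Hr0; apply: le_lt_trans (sx _ s1) (lt_le_trans xr rr0).
rewrite (smooth_differentiable oV sf Vsx).2.
apply: le_trans (ler_norm_sum _ _ _) _.
apply: (@le_trans _ _ (\sum_(i < n) C * `|x| ^+ K.+1)).
  apply: ler_sum => i _; rewrite normrM exprS mulrCA ler_pM//; first exact: coord_le_norm.
  have [_ _ /(_ (s *: x)) Hs] := Hi i.
  apply: le_trans (Hs _) _.
    exact: le_lt_trans (sx _ s1) (lt_le_trans xr (rri i)).
  have [/ltW Ci0 _ _] := Hi i; apply: ler_pM; rewrite ?exprn_ge0 ?CiC//.
  by apply: lerXn2r; rewrite ?nnegrE ?normr_ge0 ?sx.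
rewrite sumr_const card_ord -[leLHS]mulr_natl mulrA ler_wpM2r ?exprn_ge0//.
by rewrite ler_wpM2r ?ler_nat// ltW.
Qed.

End smooth.

(** * Monomials, minimal exponents and the Newton part *)

Section monomials.
Context {R : realType} {n : nat}.
Implicit Types (a b : multiindex n) (x y w : 'rV[R]_n) (s : seq 'I_n).
Local Notation e i := (delta_mx 0 i : 'rV[R]_n).
Local Notation D s f := (foldr (@partial R n R) f s).

(** The monomial on the line [y + t w], as a polynomial in [t]: iterated derivatives in direction
    [w] become its coefficients times factorials. *)
Definition line_poly a y w : {poly R} :=
  \prod_i (w 0 i *: 'X + (y 0 i)%:P) ^+ a i.

Lemma monomial_line a y w t : monomial a (y + t *: w) = (line_poly a y w).[t].
Proof.
rewrite /monomial /line_poly horner_prod; apply: eq_bigr => i _.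
by rewrite !mxE horner_exp !hornerE addrC mulrC.
Qed.

Lemma deriv_iter_monomial_line a y w q t :
  iter q (dirD w) (monomial a) (y + t *: w) = ((line_poly a y w)^`(q)).[t].
Proof.
elim: q t => [|q IH] t; first exact: monomial_line.
rewrite iterS /dirD derive_line derivnS.
rewrite (_ : (fun t => _) = horner ((line_poly a y w)^`(q))); last exact/funext.
by rewrite -derive1E -derivE.
Qed.

Lemma deriv_iter_monomial a y w q :
  iter q (dirD w) (monomial a) y = ((line_poly a y w)^`(q)).[0].
Proof. by rewrite -deriv_iter_monomial_line scale0r addr0. Qed.

Lemma deriv_iter_monomial_coef a y w q :
  iter q (dirD w) (monomial a) y = (line_poly a y w)`_q *+ q`!.
Proof. by rewrite deriv_iter_monomial horner_coef0 coef_derivn addn0 ffactnn. Qed.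

Definition mdec a i : multiindex n := [ffun j => (a j - (j == i))%N].

Lemma is_derive_monomial a i x :
  is_derive x (e i) (monomial a) ((a i)%:R * monomial (mdec a i) x).
Proof.
have E (t : R) : monomial a (x + t *: e i) =
    (\prod_(j | j != i) x 0 j ^+ a j) * (x 0 i + t) ^+ a i.
  rewrite /monomial (bigD1 i)//= mulrC; congr (_ * _).
    apply: eq_bigr => j ji; rewrite !mxE eqxx/= (negbTE ji).
    by rewrite mulr0 addr0.
  by rewrite !mxE !eqxx mulr1.
have := derivable_line (monomial a) x (e i) 0; have := derive_line (monomial a) x (e i) 0.
rewrite scale0r addr0; rewrite (_ : (fun t => _) = fun t : R =>
  (\prod_(j | j != i) x 0 j ^+ a j) * (x 0 i + t) ^+ a i); last exact/funext.
have H : is_derive (0 : R) 1 (fun t : R =>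
    (\prod_(j | j != i) x 0 j ^+ a j) * (x 0 i + t) ^+ a i)
  ((a i)%:R * monomial (mdec a i) x).
  have d1 : is_derive (0:R) 1 (fun t : R => x 0 i + t) 1.
    by have := is_deriveD (is_derive_cst (x 0 i) (0:R) 1) (is_derive_id (0:R) 1); rewrite add0r.
  case ai : (a i) => [|k].
    rewrite mul0r; under [X in is_derive _ _ X]eq_fun do rewrite expr0 mulr1.
    exact: is_derive_cst.
  have d2 := @is_deriveX _ _ _ k.+1 _ _ _ d1; rewrite exprfctE in d2.
  have d3 := is_deriveZ (\prod_(j | j != i) x 0 j ^+ a j) d2.
  apply: (is_derive_eq d3).
  rewrite /GRing.scale/= addr0 /monomial [in RHS](bigD1 i)//= ffunE eqxx ai subn1/=.
  rewrite mulr1 mulrCA [_ * x 0 i ^+ k]mulrC; congr (_ * (_ * _)).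
  by apply: eq_bigr => j ji; rewrite ffunE (negbTE ji) subn0.
move=> dE fE; apply: DeriveDef; first by rewrite fE; case: H.
by rewrite dE derive_val.
Qed.

(** The factor produced by differentiating along the word [s]. It vanishes when a letter occurs too
    often, which makes the truncated subtraction in [mdecs] harmless. *)
Definition mfall a s : nat := \prod_j (a j) ^_ (count_mem j s).

Definition mdecs a s : multiindex n := [ffun j => (a j - count_mem j s)%N].

Lemma iterated_monomial a s x :
  D s (monomial a) x = (mfall a s)%:R * monomial (mdecs a s) x.
Proof.
elim: s x => [|i s IH] x.
  rewrite /mfall big1 ?mul1r//=.
  by congr monomial; apply/ffunP => j; rewrite ffunE subn0.
rewrite /= {1}/partial (_ : D s (monomial a) = fun x => (mfall a s)%:R * monomial (mdecs a s) x); last exact/funext.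
have := is_deriveZ ((mfall a s)%:R : R) (is_derive_monomial (mdecs a s) i x).
move=> H; rewrite (@derive_val _ _ _ _ _ _ _ H) /GRing.scale/= mulrA -natrM.
rewrite (_ : (_ * _)%N = mfall a (i :: s)).
  congr (_ * _); congr monomial.
  by apply/ffunP => j; rewrite !ffunE/= (eq_sym i) addnC subnDA.
rewrite /mfall (bigD1 i)//= [in RHS](bigD1 i)//= eqxx ffunE add1n ffactnSr.
rewrite mulnAC; congr (_ * _)%N; apply: eq_bigr => j ji.
by rewrite (eq_sym i) (negbTE ji).
Qed.

Lemma continuous_monomial a : continuous (monomial a : 'rV[R]_n -> R).
Proof.
apply: continuous_big; first exact: mul_continuous.
move=> i _ x; apply: differentiable_continuous.
case: (a i) => [|k]; first exact: differentiable_cst.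
have := @differentiableX _ _ (fun y : 'rV[R]_n => y 0 i) k x (differentiable_coord x 0 i).
by rewrite exprfctE.
Qed.

Lemma smooth_monomial a : smooth_on [set: 'rV[R]_n] (monomial a).
Proof.
move=> s x _.
rewrite (_ : D s (monomial a) = fun x => (mfall a s)%:R * monomial (mdecs a s) x); last first.
  by apply/funext => y; exact: iterated_monomial.
split.
  apply: (@cvgM _ _ (nbhs x) _ (fun=> _)); first exact: cvg_cst.
  exact: continuous_monomial.
by move=> i; have := is_deriveZ ((mfall a s)%:R : R) (is_derive_monomial (mdecs a s) i x); case.
Qed.

Lemma smooth_polynomial (r : seq (multiindex n)) (c : multiindex n -> R) :
  smooth_on [set: 'rV[R]_n] (fun x => \sum_(a <- r) c a * monomial a x).
Proof.
exact: (@smooth_lin _ _ setT _ r c (@monomial R n) openT smooth_monomial).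
Qed.

Lemma iterated_polynomial (r : seq (multiindex n)) (c : multiindex n -> R) s x :
  D s (fun x => \sum_(a <- r) c a * monomial a x) x =
  \sum_(a <- r) c a * ((mfall a s)%:R * monomial (mdecs a s) x).
Proof.
rewrite (@iterated_lin _ _ setT _ r c (@monomial R n) s x openT smooth_monomial I).
by apply: eq_bigr => a _; rewrite iterated_monomial.
Qed.

Definition mseq b : seq 'I_n := flatten [seq nseq (b i) i | i <- enum 'I_n].

Lemma count_mseq b j : count_mem j (mseq b) = b j.
Proof.
rewrite count_flatten -map_comp sumnE big_map big_enum/= (bigD1 j)//= big1.
  by rewrite addn0 count_nseq/= eqxx mul1n.
by move=> i /negbTE ij; rewrite count_nseq/= ij mul0n.
Qed.

Lemma mpartial_polynomial (r : seq (multiindex n)) (c : multiindex n -> R) b x :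
  mpartial b (fun x => \sum_(a <- r) c a * monomial a x) x =
  \sum_(a <- r) c a * ((\prod_j (a j) ^_ (b j))%N%:R *
     \prod_j x 0 j ^+ (a j - b j)).
Proof.
rewrite mpartialE -/(mseq b) iterated_polynomial; apply: eq_bigr => a _.
congr (_ * (_%:R * _)).
  by rewrite /mfall; apply: eq_bigr => j _; rewrite count_mseq.
by rewrite /monomial; apply: eq_bigr => j _; rewrite ffunE count_mseq.
Qed.

(** Derivatives scaled by the coordinates act diagonally on monomials. They can therefore be
    compared with the monomials themselves on boxes whose sides have very different lengths. *)
Lemma scaled_iterated_monomial a s x :
  (\prod_(i <- s) x 0 i) * D s (monomial a) x = (mfall a s)%:R * monomial a x.
Proof.
rewrite iterated_monomial mulrCA.
have [le_sa|] := boolP [forall j, (count_mem j s <= a j)%N].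
  congr (_ * _); rewrite (_ : \prod_(i <- s) _ = \prod_j x 0 j ^+ count_mem j s).
    rewrite -big_split; apply: eq_bigr => j _ /=.
    by rewrite ffunE -exprD subnKC// (forallP le_sa).
  elim: s {le_sa} => [|i s IH]; first by rewrite big_nil big1.
  rewrite big_cons IH [in RHS](bigD1 i)//= eqxx exprD expr1 -mulrA; congr (_ * _).
  rewrite (bigD1 i)//=; congr (_ * _); apply: eq_bigr => j ji.
  by rewrite (eq_sym i) (negbTE ji).
rewrite negb_forall => /existsP[j]; rewrite -ltnNge => aj.
by rewrite /mfall (bigD1 j)//= ffact_small// mul0n !mul0r.
Qed.

End monomials.

(** * Dickson's lemma and enumerations of exponents *)

Section multiindices.
Context {n : nat}.
Implicit Types a b : multiindex n.

Definition mle a b := [forall i, (a i <= b i)%N].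

Lemma mleP a b : reflect (forall i, (a i <= b i)%N) (mle a b).
Proof. exact: forallP. Qed.

Lemma mle_trans a b c : mle a b -> mle b c -> mle a c.
Proof. by move=> /mleP ab /mleP bc; apply/mleP => i; exact: leq_trans (ab i) (bc i). Qed.

Lemma mle_degree a b : mle a b -> (mdegree a <= mdegree b)%N.
Proof. by move=> /mleP ab; apply: leq_sum. Qed.

Lemma mle_degree_eq a b : mle a b -> (mdegree b <= mdegree a)%N -> a = b.
Proof.
move=> /mleP ab ba; apply/ffunP => i; apply/eqP; rewrite eqn_leq ab /=.
rewrite leqNgt; apply/negP => aib; move: ba; apply/negP; rewrite -ltnNge.
rewrite /mdegree (bigD1 i)//= [ltnRHS](bigD1 i)//= -addSn leq_add//.
exact: leq_sum.
Qed.

(** Induction on the number of coordinates that are compared. *)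
Lemma dickson_upto (k : nat) (S : multiindex n -> Prop) : (k <= n)%N ->
  exists E : seq (multiindex n), (forall a, a \in E -> S a) /\
    forall a, S a -> exists2 b, b \in E &
      forall i : 'I_n, (i < k)%N -> (b i <= a i)%N.
Proof.
elim: k S => [|k IH] S kn.
  have [[a Sa]|S0] := pselect (exists a, S a).
    exists [:: a]; split; first by move=> b; rewrite inE => /eqP->.
    by move=> b _; exists a; rewrite ?mem_head.
  by exists [::]; split => // a Sa; exfalso; apply: S0; exists a.
have [E0 [E0S E0P]] := IH S (ltnW kn).
pose ik := Ordinal kn.
(* The basis [E0] for the first [k] coordinates serves every exponent whose next coordinate is at
   least [M]. Below [M] that coordinate takes finitely many values, and each slice has a basis of
   its own. *)
pose M := \max_(b <- E0) b ik.
have [Ev EvP] := choice (fun v : nat => IH (fun a => S a /\ a ik = v) (ltnW kn)).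
exists (E0 ++ flatten [seq Ev v | v <- iota 0 M]); split.
  move=> a; rewrite mem_cat => /orP[/E0S//|/flattenP[s /mapP[v _ ->]]].
  by move=> /(EvP v).1[].
move=> a Sa; have [b bE ba] := E0P a Sa.
have [Ma|aM] := leqP M (a ik).
  exists b; first by rewrite mem_cat bE.
  move=> i; rewrite ltnS leq_eqVlt => /orP[/eqP ik'|]; last exact: ba.
  have -> : i = ik by exact: val_inj.
  by apply: leq_trans Ma; rewrite /M; exact: (@leq_bigmax_seq _ E0 xpredT (fun b : multiindex n => b ik)).
have [b' b'E b'a] := (EvP (a ik)).2 a (conj Sa erefl).
exists b'.
  rewrite mem_cat; apply/orP; right; apply/flattenP; exists (Ev (a ik)) => //.
  by apply: map_f; rewrite mem_iota.
move=> i; rewrite ltnS leq_eqVlt => /orP[/eqP ik'|]; last exact: b'a.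
have -> : i = ik by exact: val_inj.
by have [_ ->] := (EvP (a ik)).1 b' b'E.
Qed.

Definition minimal_basis (S : multiindex n -> Prop) (E : seq (multiindex n)) :=
  [/\ uniq E, forall a, a \in E -> S a,
      forall a, S a -> exists2 b, b \in E & mle b a &
      forall a b, a \in E -> S b -> mle b a -> b = a].

Lemma exists_minimal_basis (S : multiindex n -> Prop) : exists E, minimal_basis S E.
Proof.
have [E [ES EP]] := dickson_upto S (leqnn n).
have {}EP a : S a -> exists2 b, b \in E & mle b a.
  by move=> /EP[b bE ba]; exists b => //; apply/mleP => i; exact: ba.
exists [seq a <- undup E | all (fun b => mle b a ==> (b == a)) E]; split.
- by rewrite filter_uniq// undup_uniq.
- by move=> a; rewrite mem_filter mem_undup => /andP[_ /ES].
- move=> a /EP[b0 b0E b0a].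
  (* Among the elements of [E] below [a], one of least degree is minimal. *)
  have exk : exists k, [exists b : seq_sub E, mle (val b) a && (mdegree (val b) == k)].
    by exists (mdegree b0); apply/existsP; exists (SeqSub b0E); rewrite /= b0a eqxx.
  case: (ex_minnP exk) => k /existsP[[b bE] /= /andP[ba /eqP bk]] kmin.
  exists b => //; rewrite mem_filter mem_undup bE andbT.
  apply/allP => b' b'E; apply/implyP => b'b; apply/eqP.
  apply: mle_degree_eq => //; rewrite bk; apply: kmin.
  by apply/existsP; exists (SeqSub b'E); rewrite /= (mle_trans b'b ba) eqxx.
- move=> a b; rewrite mem_filter mem_undup => /andP[/allP aP aE] /EP[c cE cb] ba.
  have /eqP ca := implyP (aP c cE) (mle_trans cb ba).
  apply: (mle_degree_eq ba); rewrite -ca; exact: mle_degree.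
Qed.

Definition mbox (K : nat) : seq (multiindex n) :=
  [seq [ffun i => val (f i)] | f : {ffun 'I_n -> 'I_K} <- enum {: {ffun 'I_n -> 'I_K}}].

Lemma mbox_uniq K : uniq (mbox K).
Proof.
rewrite map_inj_uniq ?enum_uniq// => f g /ffunP fg; apply/ffunP => i.
by apply: val_inj; have := fg i; rewrite !ffunE.
Qed.

Lemma mem_mbox K a : (a \in mbox K) = [forall i, (a i < K)%N].
Proof.
apply/mapP/forallP => [[f _ -> i]|aK]; first by rewrite ffunE; exact: ltn_ord.
exists [ffun i => Ordinal (aK i)]; rewrite ?mem_enum//.
by apply/ffunP => i; rewrite !ffunE.
Qed.

Lemma leq_mdegree a i : (a i <= mdegree a)%N.
Proof. by rewrite /mdegree (bigD1 i)//= leq_addr. Qed.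

Definition degseq N : seq (multiindex n) := [seq a <- mbox N | (mdegree a < N)%N].

Lemma degseq_uniq N : uniq (degseq N).
Proof. by rewrite filter_uniq// mbox_uniq. Qed.

Lemma mem_degseq N a : (a \in degseq N) = (mdegree a < N)%N.
Proof.
rewrite mem_filter; case: ltnP => //= aN; rewrite mem_mbox.
by apply/forallP => i; apply: leq_ltn_trans aN; exact: leq_mdegree.
Qed.

Lemma fsbig_degseq (R : realType) N (F : multiindex n -> R) :
  \sum_(a \in [set a : multiindex n | (mdegree a < N)%N]) F a =
  \sum_(a <- degseq N) F a.
Proof.
have E : [set a : multiindex n | (mdegree a < N)%N] = [set` degseq N].
  by apply/seteqP; split => a /=; rewrite mem_degseq.
rewrite E; apply/esym/fsbig_seq; exact: degseq_uniq.
Qed.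

End multiindices.

(** * Termwise differentiation of limits *)

Section limits_of_smooth.
Context {R : realType} {n : nat}.
Implicit Types (f : 'rV[R]_n -> R) (x : 'rV[R]_n) (p : nat -> 'rV[R]_n -> R).
Local Notation e i := (delta_mx 0 i : 'rV[R]_n).
Local Notation D s f := (foldr (@partial R n R) f s).

(* The uniform second-order Taylor bound makes the derivatives [d N] converge. *)
Lemma derive_limit (q : nat -> R -> R) (f : R -> R) (d : nat -> R) (tau K : R) :
  0 < tau -> 0 < K ->
  (forall t, `|t| < tau -> q N t @[N --> \oo] --> f t) ->
  (forall N t, `|t| < tau -> `|q N t - q N 0 - t * d N| <= t ^+ 2 * K) ->
  exists2 L : R, d N @[N --> \oo] --> L & is_derive (0:R) (1:R) f L.
Proof.
move=> tau0 K0 qf qd.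
have tau0' : `|0 : R| < tau by rewrite normr0.
have cd : cvg (d N @[N --> \oo]).
  apply/cauchy_cvgP/cauchyP => eps eps0.
  (* For this fixed [t] the quadratic error is at most [t * (eps / 8)], so convergence of [q] at the
     two points 0 and [t] makes the slopes a Cauchy sequence. *)
  pose t := Num.min (tau / 2) (eps / (8 * K)).
  have t0 : 0 < t by rewrite lt_min !divr_gt0// mulr_gt0.
  have tt : `|t| < tau.
    rewrite gtr0_norm//; have : t <= tau / 2 by rewrite ge_min lexx.
    by move=> /le_lt_trans; apply; rewrite ltr_pdivrMr// ltr_pMr// ltr1n.
  have tK : t * K <= eps / 8.
    have : t <= eps / (8 * K) by rewrite ge_min lexx orbT.
    by rewrite invfM mulrA ler_pdivlMr.
  have e8 : 0 < t * (eps / 8) by rewrite mulr_gt0// divr_gt0.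
  have /cvgrPdist_lt/(_ _ e8)[N1 _ H1] := qf t tt.
  have /cvgrPdist_lt/(_ _ e8)[N2 _ H2] := qf 0 tau0'.
  exists (d (maxn N1 N2)); exists (maxn N1 N2) => // N /= NN.
  rewrite -ball_normE/=.
  have := H1 _ (leq_maxl N1 N2); have := H1 _ (leq_trans (leq_maxl N1 N2) NN).
  have := H2 _ (leq_maxr N1 N2); have := H2 _ (leq_trans (leq_maxr N1 N2) NN).
  have := qd N t tt; have := qd (maxn N1 N2) t tt.
  move: (q N t) (q N 0) (q (maxn N1 N2) t) (q (maxn N1 N2) 0) (f t) (f 0)
    (d N) (d (maxn N1 N2)) => a0 a1 a2 a3 a4 a5 dN dM /=.
  rewrite !ltr_norml !ler_norml => h1 h2 h3 h4 h5 h6.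
  have tKe : t ^+ 2 * K <= t * (eps / 8) by rewrite expr2 -mulrA ler_pM2l.
  have : `|t * (dM - dN)| < t * eps.
    rewrite ltr_norml mulrBr; move: h1 h2 h3 h4 h5 h6 => /andP[? ?] /andP[? ?] /andP[? ?] /andP[? ?] /andP[? ?] /andP[? ?].
    by apply/andP; split; lra.
  by rewrite normrM gtr0_norm// ltr_pM2l// ltr_norml.
have [L dL] : exists L : R, d N @[N --> \oo] --> L by exists (lim (d N @[N --> \oo])).
exists L; first exact: dL.
have fL t : `|t| < tau -> `|f t - f 0 - t * L| <= t ^+ 2 * K.
  move=> tt.
  have c1 : `|q N t - q N 0 - t * d N| @[N --> \oo] --> `|f t - f 0 - t * L|.
    apply: cvg_norm; apply: cvgB; first by apply: cvgB; exact: qf.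
    by apply: cvgM => //; exact: cvg_cst.
  rewrite -(cvg_lim (@norm_hausdorff _ _) c1)//; apply: limr_le; first exact: cvgP c1.
  by apply: nearW => N; exact: qd.
have H : (fun h : R => h^-1 *: ((f \o shift 0) (h *: (1:R)) - f 0)) @ 0^' --> L.
  apply/cvgrPdist_le => eps eps0.
  have eK0 : 0 < eps / K by rewrite divr_gt0.
  near=> h.
  have h0 : h != 0 by near: h; exact: nbhs_dnbhs_neq.
  have ht : `|h| < tau by near: h; exact: dnbhs0_lt.
  have he : `|h| <= eps / K by near: h; exact: dnbhs0_le.
  rewrite /= addr0 -[h *: 1]/(h * 1) mulr1 -[h^-1 *: _]/(h^-1 * _).
  rewrite distrC -(@ler_pM2l _ `|h|) ?normr_gt0// -normrM mulrBr mulrA divff// mul1r.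
  apply: le_trans (fL h ht) _.
  rewrite -(real_normK (num_real h)) expr2 -mulrA ler_pM2l ?normr_gt0//.
  by rewrite -ler_pdivlMr.
apply: DeriveDef; first exact: cvgP H.
exact: (cvg_lim (@norm_hausdorff _ _) H).
Unshelve. all: by end_near. Qed.

Definition locally_bounded_derivatives (r : R) p := forall s (rho : R), rho < r ->
  exists2 K, 0 < K & forall N x, `|x| <= rho -> `|D s (p N) x| <= K.

Lemma partial_limit (r : R) p f i x :
  (forall N, smooth_on [set: 'rV[R]_n] (p N)) ->
  locally_bounded_derivatives r p ->
  (forall y, `|y| < r -> p N y @[N --> \oo] --> f y) ->
  `|x| < r -> partial i (p N) x @[N --> \oo] --> partial i f x.
Proof.
move=> sp bp pf xr.
pose rho := (`|x| + r) / 2.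
have xrho : `|x| < rho by rewrite /rho; lra.
have rhor : rho < r by rewrite /rho; lra.
have [K K0 HK] := bp [:: i; i] rho rhor.
have tau0 : 0 < rho - `|x| by rewrite subr_gt0.
have small t : `|t| < rho - `|x| -> `|x + t *: e i| <= rho.
  move=> tt; apply: le_trans (ler_normD _ _) _; rewrite -lerBrDl.
  apply: le_trans (ltW tt); rewrite normrZ ler_piMr//.
  apply: norm_le_coord => // l; rewrite mxE eqxx/=.
  by case: eqP; rewrite ?normr1// normr0.
have [t tt|N t tt|L dL [df fL]] := @derive_limit (fun N t => p N (x + t *: e i))
  (fun t => f (x + t *: e i)) (fun N => partial i (p N) x) _ K tau0 K0.
- by apply: pf; apply: le_lt_trans (small _ tt) rhor.
- rewrite scale0r addr0.
  have [s st ->] := line_MVT (fun s (_ : `|s| <= `|t|) => (sp N [::] (x + s *: e i) I).2 i).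
  have [u us] := line_MVT (fun u (_ : `|u| <= `|s|) => (sp N [:: i] (x + u *: e i) I).2 i).
  rewrite -mulrBr /partial /= => ->.
  rewrite mulrA normrM ler_pM//.
    by rewrite normrM -(real_normK (num_real t)) expr2 ler_wpM2l.
  by apply: HK; apply: small; apply: le_lt_trans tt; exact: le_trans st.
by have := derive_line f x (e i) 0; rewrite scale0r addr0 fL /partial => ->.
Qed.

(** One letter of [s] at a time; bounds on the derivatives along all words are assumed because the
    sequence of partial derivatives must satisfy the same hypothesis again. *)
Lemma iterated_limit (r : R) p f s x :
  (forall N, smooth_on [set: 'rV[R]_n] (p N)) ->
  locally_bounded_derivatives r p ->
  (forall y, `|y| < r -> p N y @[N --> \oo] --> f y) ->
  `|x| < r -> D s (p N) x @[N --> \oo] --> D s f x.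
Proof.
move=> sp bp pf; elim: s x => [|i s IH] x xr /=; first exact: pf.
have bs : locally_bounded_derivatives r (fun N => D s (p N)).
  move=> s' rho rhor; have [K K0 HK] := bp (s' ++ s) rho rhor.
  by exists K => // N y yr; rewrite -foldr_cat; exact: HK.
exact: (@partial_limit r (fun N => D s (p N)) (D s f) i x
  (fun N => @smooth_iterated _ _ setT (p N) s (sp N)) bs IH xr).
Qed.

End limits_of_smooth.

Lemma leq_subn_pred (a b d : nat) :
  (0 < a - b)%N -> (b < d)%N -> (a <= (a - b).-1 + d)%N.
Proof. lia. Qed.

(** * The remainder after the Newton part *)

Section remainder.
Context {R : realType} {n : nat}.
Implicit Types (f H : 'rV[R]_n -> R) (x : 'rV[R]_n) (a b : multiindex n)
  (E : seq (multiindex n)) (s : seq 'I_n).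
Local Notation e i := (delta_mx 0 i : 'rV[R]_n).
Local Notation D s f := (foldr (@partial R n R) f s).

Definition newton_gauge E x : R := \sum_(a <- E) `|monomial a x|.

Definition newton_part H E x : R := \sum_(a <- E) taylor_coef H a * monomial a x.

Lemma norm_coord x : x != 0 -> exists i, `|x| = `|x 0 i|.
Proof.
rewrite -normr_eq0 {1}/Num.norm/= => /mx_norm_neq0[[i j] /= xij]; exists j.
by rewrite [LHS]/Num.norm/= xij (ord1 i).
Qed.

Lemma newton_gauge_ge0 E x : 0 <= newton_gauge E x.
Proof. by apply: sumr_ge0. Qed.

Lemma monomial_le_gauge E a x : uniq E -> a \in E -> `|monomial a x| <= newton_gauge E x.
Proof.
by move=> uE aE; rewrite /newton_gauge (bigD1_seq a)//= lerDl sumr_ge0.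
Qed.

Lemma normr_monomial a x : `|monomial a x| = \prod_i `|x 0 i| ^+ a i.
Proof. by rewrite normr_prod; apply: eq_bigr => i _; rewrite normrX. Qed.

Lemma norm_monomial_le a x (rho : R) : `|x| <= rho -> `|monomial a x| <= rho ^+ mdegree a.
Proof.
move=> xr; rewrite normr_monomial /mdegree -prodrXr; apply: ler_prod => i _.
rewrite exprn_ge0//= lerXn2r ?nnegrE//.
  exact: le_trans xr.
exact: le_trans (coord_le_norm x i) xr.
Qed.

Definition msub a b : multiindex n := [ffun i => (a i - b i)%N].

Lemma mdegree_msub a b : mle b a -> mdegree (msub a b) = (mdegree a - mdegree b)%N.
Proof.
move=> /mleP ba; rewrite /mdegree -sumnB//.
by apply: eq_bigr => i _; rewrite ffunE.
Qed.

Lemma monomial_msub a b x : mle b a -> monomial a x = monomial b x * monomial (msub a b) x.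
Proof.
move=> /mleP ba; rewrite -big_split; apply: eq_bigr => i _ /=.
by rewrite ffunE -exprD subnKC.
Qed.

Lemma norm_monomial_mle a b x (rho : R) : mle b a -> `|x| <= rho ->
  `|monomial a x| <= rho ^+ (mdegree a - mdegree b) * `|monomial b x|.
Proof.
move=> ba xr; rewrite (monomial_msub x ba) normrM mulrC -mdegree_msub//.
by rewrite ler_wpM2r// norm_monomial_le.
Qed.

Lemma iterated_comb V (c1 c2 : R) f g s x : open V -> smooth_on V f ->
  smooth_on V g -> V x ->
  D s (fun y => c1 * f y + c2 * g y) x = c1 * D s f x + c2 * D s g x.
Proof.
move=> oV sf sg Vx.
have := @iterated_lin R n V bool [:: true; false] (fun o : bool => if o then c1 else c2)
  (fun o : bool => if o then f else g) s x oV
  (fun o : bool => match o return smooth_on V (if o then f else g) with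
            true => sf | false => sg end) Vx.
rewrite !big_cons !big_nil !addr0 => <-.
apply: (@eq_on_iterated R n V) => // y _.
by rewrite !big_cons !big_nil addr0.
Qed.

Lemma smooth_comb V (c1 c2 : R) f g : open V -> smooth_on V f -> smooth_on V g ->
  smooth_on V (fun y => c1 * f y + c2 * g y).
Proof.
move=> oV sf sg.
have := @smooth_lin R n V bool [:: true; false] (fun o : bool => if o then c1 else c2)
  (fun o : bool => if o then f else g) oV
  (fun o : bool => match o return smooth_on V (if o then f else g) with
            true => sf | false => sg end).
apply: (@eq_on_smooth R n V) => // y _.
by rewrite !big_cons !big_nil addr0.
Qed.

Lemma iterated_add V f g s x : open V -> smooth_on V f -> smooth_on V g -> V x ->
  D s (fun y => f y + g y) x = D s f x + D s g x.
Proof.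
move=> oV sf sg Vx; have := iterated_comb 1 1 s oV sf sg Vx; rewrite !mul1r => <-.
by apply: (@eq_on_iterated R n V) => // y _; rewrite !mul1r.
Qed.

Lemma iterated_sub V f g s x : open V -> smooth_on V f -> smooth_on V g -> V x ->
  D s (fun y => f y - g y) x = D s f x - D s g x.
Proof.
move=> oV sf sg Vx; have := iterated_comb 1 (-1) s oV sf sg Vx.
rewrite mul1r mulN1r => <-.
by apply: (@eq_on_iterated R n V) => // y _; rewrite mul1r mulN1r.
Qed.

Lemma smooth_sub V f g : open V -> smooth_on V f -> smooth_on V g ->
  smooth_on V (fun y => f y - g y).
Proof.
move=> oV sf sg; have := smooth_comb 1 (-1) oV sf sg.
by apply: (@eq_on_smooth R n V) => // y _; rewrite mul1r mulN1r.
Qed.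

(** Each derivative costs one order of flatness, so flatness to order [K + M] pays for [M] of
    them. *)
Lemma flat_iterated_bound V f K M : open V -> smooth_on V f -> V 0 ->
  (forall s, (size s < K + M)%N -> D s f 0 = 0) ->
  exists C r, [/\ 0 < C, 0 < r & forall x s, `|x| < r -> (size s <= M)%N ->
    `|D s f x| <= C * `|x| ^+ K].
Proof.
move=> oV; elim: M f => [|M IH] f sf V0 f0.
  have [|C [r [C0 r0 Cr]]] := @flat_bound R n V f K oV sf V0.
    by move=> s sK; apply: f0; rewrite addn0.
  by exists C, r; split => // x [|//] xr _; exact: Cr.
have Hi i : exists Cr : R * R, [/\ 0 < Cr.1, 0 < Cr.2 & forall x s, `|x| < Cr.2 ->
    (size s <= M)%N -> `|D s (partial i f) x| <= Cr.1 * `|x| ^+ K].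
  have [|C [r H]] := IH (partial i f) (@smooth_partial R n V f i sf) V0.
    by move=> s sK; rewrite -foldr_rcons; apply: f0; rewrite size_rcons addnS ltnS.
  by exists (C, r).
have [|C' [r' [C'0 r'0 Cr']]] := @flat_bound R n V f K oV sf V0.
  by move=> s sK; apply: f0; rewrite (leq_trans sK)// leq_addr.
have {Hi} [Cr Hi] := choice Hi.
pose C := C' + \sum_i (Cr i).1.
have CiC i : (Cr i).1 <= C.
  rewrite /C (bigD1 i)//= addrCA lerDl addr_ge0 ?(ltW C'0)// sumr_ge0// => j _.
  by have [/ltW] := Hi j.
have C'C : C' <= C by rewrite lerDl sumr_ge0// => j _; have [/ltW] := Hi j.
pose r := \big[Num.min/r']_i (Cr i).2.
have r_gt0 : 0 < r.
  by rewrite /r; elim/big_ind: _ => // [u v u0 v0|i _]; [rewrite lt_min u0|have [] := Hi i].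
have rr' : r <= r' by rewrite /r bigmin_le_id.
have rri i : r <= (Cr i).2 by rewrite /r bigmin_le_cond.
exists C, r; split => //; first exact: lt_le_trans C'C.
move=> x s xr; case/lastP: s => [_|s i].
  by apply: le_trans (Cr' x (lt_le_trans xr rr')) _; rewrite ler_wpM2r// exprn_ge0.
rewrite size_rcons ltnS foldr_rcons => sM; have [_ _ HC] := Hi i.
apply: le_trans (HC _ _ (lt_le_trans xr (rri i)) sM) _.
by rewrite ler_wpM2r// exprn_ge0.
Qed.

Lemma count_sum_size s : (\sum_j count_mem j s)%N = size s.
Proof.
elim: s => [|i s IH]; first by rewrite big1.
rewrite big_split/= IH (bigD1 i)//= eqxx big1 ?addn0//.
by move=> j /negbTE; rewrite eq_sym => ->.
Qed.

(** Up to [q!] and [d ^+ q], the left-hand side is one term of the binomial expansion of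
    [(rho + d) ^+ k]. *)
Lemma ffact_exp_bound (k q : nat) (rho d : R) : 0 <= rho -> 0 < d ->
  (k ^_ q)%:R * rho ^+ (k - q) <= q`!%:R / d ^+ q * (rho + d) ^+ k.
Proof.
move=> rho0 d0; have [qk|kq] := leqP q k; last first.
  by rewrite ffact_small// mul0r mulr_ge0// ?divr_ge0 ?exprn_ge0 ?addr_ge0 ?(ltW d0).
rewrite exprDn (bigD1 (Ordinal (qk : (q < k.+1)%N)))//= mulrDr.
apply: ler_wpDr.
  rewrite mulr_ge0 ?divr_ge0 ?exprn_ge0 ?(ltW d0)// sumr_ge0// => i _.
  by rewrite mulrn_wge0// mulr_ge0// exprn_ge0// ltW.
rewrite -bin_ffact natrM -mulr_natr le_eqVlt; apply/orP; left; apply/eqP.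
have dq : d ^+ q != 0 by rewrite expf_neq0// gt_eqF.
by rewrite -mulr_natr; field.
Qed.

Definition deriv_const (M : nat) (d : R) : R := \prod_(i < n) (M`!%:R / d ^+ M).

Lemma deriv_const_ge0 M (d : R) : 0 <= d -> 0 <= deriv_const M d.
Proof. by move=> d0; apply: prodr_ge0 => i _; rewrite divr_ge0 ?exprn_ge0. Qed.

(** A real-variable Cauchy estimate: derivatives at radius [rho] are paid for by enlarging the
    radius to [rho + d], with a constant that depends on the order and not on [a]. *)
Lemma mfall_exp_bound a s (M : nat) (rho d : R) : 0 <= rho -> 0 < d -> d <= 1 ->
  (size s <= M)%N ->
  (mfall a s)%:R * rho ^+ mdegree (mdecs a s) <= deriv_const M d * (rho + d) ^+ mdegree a.
Proof.
move=> rho0 d0 d1 sM.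
rewrite /deriv_const /mdegree -!prodrXr natr_prod -!big_split/=; apply: ler_prod => i _.
rewrite ffunE mulr_ge0 ?exprn_ge0//=.
apply: le_trans (ffact_exp_bound _ _ rho0 d0) _.
have qM : (count_mem i s <= M)%N by apply: leq_trans sM; exact: count_size.
rewrite ler_wpM2r ?exprn_ge0 ?addr_ge0 ?(ltW d0)// ler_pM ?invr_ge0 ?exprn_ge0 ?(ltW d0)//.
  by rewrite ler_nat leq_fact // .
by rewrite lef_pV2 ?posrE ?exprn_gt0// ler_wiXn2l// ltW.
Qed.

(** The form in which [H] may be replaced by its Newton part. Derivatives are scaled by the
    coordinates because the directions used on a box have [|w_i|] at most a constant times [|x_i|];
    the factor [|x|] is the gain that makes the error negligible near 0. *)
Definition remainder_estimate H E := forall M, exists C r : R,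
  [/\ 0 < C, 0 < r & forall x s, `|x| < r -> (size s <= M)%N ->
    `|(\prod_(i <- s) x 0 i) * D s (fun y => H y - newton_part H E y) x|
      <= C * `|x| * newton_gauge E x].

Lemma norm_prod_coord_le1 s x : `|x| <= 1 -> `|\prod_(i <- s) x 0 i| <= 1.
Proof.
move=> x1; rewrite normr_prod; elim: s => [|i s IH]; first by rewrite big_nil.
rewrite big_cons mulr_ile1// ?prodr_ge0//.
exact: le_trans (coord_le_norm x i) x1.
Qed.

Lemma smooth_newton_part H E : smooth_on [set: 'rV[R]_n] (newton_part H E).
Proof. exact: smooth_polynomial. Qed.

Lemma taylor_box_flat V H K s : open V -> smooth_on V H -> V 0 -> (size s < K)%N ->
  D s (fun y => H y - \sum_(a <- mbox K) taylor_coef H a * monomial a y) 0 = 0.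
Proof.
move=> oV sH V0 sK.
have sP := smooth_subset (@subsetT _ V) (smooth_polynomial (mbox K) (taylor_coef H)).
rewrite (@iterated_mpartial R n V _ s 0 oV (smooth_sub oV sH sP) V0).
set b := [ffun i => count_mem i s].
have bK : mdegree b = size s.
  by rewrite -count_sum_size; apply: eq_bigr => i _; rewrite ffunE.
rewrite mpartialE (iterated_sub _ oV sH sP V0) -!mpartialE mpartial_polynomial.
rewrite (bigD1_seq b)/= ?mbox_uniq//; last first.
  rewrite mem_mbox; apply/forallP => i; apply: leq_ltn_trans (leq_mdegree b i) _.
  by rewrite bK.
rewrite [X in _ - (_ + X)]big1 ?addr0 => [|a ab].
  have -> : \prod_j (0 : 'rV[R]_n) 0 j ^+ (b j - b j) = 1.
    by apply: big1 => j _; rewrite subnn.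
  rewrite /taylor_coef mulr1.
  rewrite /mfactorial (_ : (\prod_j b j ^_ b j)%N = (\prod_i (b i)`!)%N); last first.
    by apply: eq_bigr => i _; rewrite ffactnn.
  rewrite divfK ?subrr// pnatr_eq0 -lt0n prodn_gt0// => i; exact: fact_gt0.
have [le_ba|] := boolP (mle b a); last first.
  rewrite negb_forall => /existsP[j]; rewrite -ltnNge => aj.
  by rewrite (bigD1 j)//= ffact_small// mul0n mul0r mulr0.
have [i bai] : exists i, (b i < a i)%N.
  apply/existsP; rewrite -[X in is_true X]negbK negb_exists; apply/forallP => ba.
  case/eqP: ab; apply/ffunP => i; apply/eqP; rewrite eqn_leq leqNgt ba.
  exact: (mleP _ _ le_ba).
rewrite [X in _ * (_ * X)](bigD1 i)//= mxE expr0n subn_eq0 leqNgt bai/=.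
by rewrite mul0r !mulr0.
Qed.

(** A Taylor polynomial of high degree plus a flat error. In the polynomial, an exponent outside [E]
    is a proper multiple of one in [E], whence a factor [|x|]. The flat error is absorbed by the
    pure power in [E] of the largest coordinate of [x]. *)
Lemma smooth_remainder V H E : open V -> smooth_on V H -> V 0 ->
  minimal_basis (fun a => taylor_coef H a != 0) E ->
  (forall i, exists m, [ffun j => if j == i then m else 0%N] \in E) ->
  remainder_estimate H E.
Proof.
move=> oV sH V0 [uE EH Hcov _] axes M.
have [m mE] := choice axes.
(* One order more than every pure power in [E]: the spare factor is the [|x|] of the estimate. The
   degree [K] then leaves room for [M] derivatives and contains all of [E]. *)
pose K0 := (\max_i m i).+1.
pose K := (maxn (K0 + M) (\max_(a <- E) mdegree a).+1).
have EK a : a \in E -> a \in mbox K.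
  move=> aE; rewrite mem_mbox; apply/forallP => i.
  apply: leq_ltn_trans (leq_mdegree a i) _; rewrite leq_max ltnS.
  by rewrite (@leq_bigmax_seq _ E xpredT (fun a => mdegree a))// orbT.
pose P y := \sum_(a <- mbox K) taylor_coef H a * monomial a y.
pose Q y := \sum_(a <- [seq a <- mbox K | a \notin E]) taylor_coef H a * monomial a y.
have PE y : P y = newton_part H E y + Q y.
  rewrite /P (bigID (mem E))/= /Q big_filter; congr (_ + _).
  rewrite -big_filter; apply: perm_big; apply: uniq_perm => //.
    by rewrite filter_uniq// mbox_uniq.
  move=> a; rewrite mem_filter; case: (boolP (a \in E)) => //= aE; exact: EK.
have sP : smooth_on V P by apply: smooth_subset (smooth_polynomial _ _).
have sQ : smooth_on V Q by apply: smooth_subset (smooth_polynomial _ _).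
have sE : smooth_on V (newton_part H E) by apply: smooth_subset (smooth_polynomial _ _).
have sG := smooth_sub oV sH sP.
have [|C1 [r1 [C10 r10 H1]]] := @flat_iterated_bound V _ K0 M oV sG V0.
  move=> s sK; apply: (taylor_box_flat oV sH V0).
  by apply: leq_trans sK _; exact: leq_maxl.
have [r0 /= r00 Hr0] : exists2 r : R, 0 < r & forall y : 'rV[R]_n, `|y| < r -> V y.
  have /nbhs_ballP[r /= r0 rV] : nbhs (0 : 'rV[R]_n) V by exact: open_nbhs_nbhs.
  by exists r => // y yr; apply: rV; rewrite -ball_normE/= sub0r normrN.
pose C2 := \sum_(a <- mbox K) `|taylor_coef H a| * deriv_const M 1 * 2 ^+ mdegree a.
have C20 : 0 <= C2.
  by apply: sumr_ge0 => a _; rewrite !mulr_ge0 ?exprn_ge0// deriv_const_ge0.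
exists (C1 + C2), (Num.min 1 (Num.min r0 r1)); split.
- by rewrite ltr_wpDr.
- by rewrite !lt_min ltr01 r00 r10.
move=> x s; rewrite !lt_min => /and3P[x1 xr0 xr1] sM.
have Vx : V x by exact: Hr0.
have -> : D s (fun y => H y - newton_part H E y) x =
    D s (fun y => H y - P y) x + D s Q x.
  rewrite (iterated_sub _ oV sH sE Vx) (iterated_sub _ oV sH sP Vx) -addrA; congr (_ + _).
  have -> : D s P x = D s (fun y => newton_part H E y + Q y) x.
    by apply: (@eq_on_iterated R n V) => // y _; rewrite PE.
  by rewrite (iterated_add _ oV sE sQ Vx) opprD subrK.
rewrite mulrDr; apply: le_trans (ler_normD _ _) _; rewrite !mulrDl lerD//.
- rewrite normrM; apply: le_trans (ler_wpM2r _ (norm_prod_coord_le1 s (ltW x1))) _ => //.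
  rewrite mul1r; apply: le_trans (H1 x s xr1 sM) _; rewrite -mulrA ler_pM2l//.
  have [->|xN0] := eqVneq x 0.
    by rewrite normr0 expr0n mul0r.
  have [i xi] := norm_coord xN0.
  rewrite exprS ler_wpM2l//; apply: le_trans _ (monomial_le_gauge x uE (mE i)).
  rewrite normr_monomial [leRHS](bigD1 i)//= ffunE eqxx [X in _ * X]big1 ?mulr1; last first.
    by move=> j ji; rewrite ffunE (negbTE ji) expr0.
  rewrite -xi ler_wiXn2l ?(ltW x1)//.
  exact: (@leq_bigmax_seq _ (index_enum 'I_n) xpredT m).
- rewrite iterated_polynomial mulr_sumr.
  apply: le_trans (ler_norm_sum _ _ _) _.
  rewrite -mulrA mulr_suml big_filter big_mkcond/=; apply: ler_sum => a _.
  case: ifPn => aE; last by rewrite !mulr_ge0 ?newton_gauge_ge0 ?exprn_ge0// deriv_const_ge0.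
  have [->|ta] := eqVneq (taylor_coef H a) 0.
    by rewrite mul0r mulr0 normr0 !mul0r.
  have [b bE ba] := Hcov a ta.
  rewrite mulrCA -iterated_monomial scaled_iterated_monomial normrM [X in _ * X]normrM -!mulrA.
  rewrite ler_wpM2l// normr_nat mulrA.
  have dba : (0 < mdegree a - mdegree b)%N.
    rewrite subn_gt0 ltnNge; apply: contra aE => dab.
    by rewrite -(mle_degree_eq ba dab).
  apply: ler_pM => //.
    have := @mfall_exp_bound a s M 1 1 ler01 ltr01 (lexx _) sM.
    by rewrite expr1n mulr1.
  apply: le_trans (norm_monomial_mle ba (lexx _)) _.
  apply: ler_pM => //; rewrite ?exprn_ge0//; last exact: monomial_le_gauge.
  by rewrite -[leRHS]expr1 ler_wiXn2l// ltW.
Qed.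

(** The first clause is absolute convergence on every smaller polydisc, phrased through bounded
    partial sums. *)
Definition power_series (r : R) (c : multiindex n -> R) f :=
  (forall rho, 0 <= rho -> rho < r -> exists K, forall N,
    \sum_(a <- degseq N) `|c a| * rho ^+ mdegree a <= K) /\
  (forall x, `|x| < r ->
    \sum_(a <- degseq N) c a * monomial a x @[N --> \oo] --> f x).

(** The filter [P] makes room for the series from which the minimal exponents have been removed. *)
Lemma power_series_bounded r c f (P : pred (multiindex n)) : 0 < r ->
  power_series r c f ->
  locally_bounded_derivatives r
    (fun N x => \sum_(a <- [seq a <- degseq N | P a]) c a * monomial a x).
Proof.
move=> r0 [cb _] s rho rhor.
pose rho' := Num.max rho 0.
have rho'0 : 0 <= rho' by rewrite le_max lexx orbT.
have rho'r : rho' < r by rewrite gt_max rhor.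
pose d := Num.min 1 ((r - rho') / 2).
have d0 : 0 < d by rewrite lt_min ltr01 divr_gt0 ?subr_gt0.
have d1 : d <= 1 by rewrite ge_min lexx.
have rd : rho' + d < r.
  have : d <= (r - rho') / 2 by rewrite ge_min lexx orbT.
  by lra.
have [K HK] := cb (rho' + d) (addr_ge0 rho'0 (ltW d0)) rd.
have C0 := @deriv_const_ge0 (size s) d (ltW d0).
have K0 : 0 <= K by apply: le_trans (HK 0%N); rewrite sumr_ge0// => a _; rewrite mulr_ge0// exprn_ge0// addr_ge0// ltW.
exists (deriv_const (size s) d * K + 1); first by rewrite ltr_wpDl ?mulr_ge0.
move=> N x xrho; rewrite iterated_polynomial.
apply: le_trans (ler_norm_sum _ _ _) _.
apply: (@le_trans _ _ (deriv_const (size s) d * K)); last by rewrite lerDl.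
apply: le_trans (ler_wpM2l C0 (HK N)); rewrite mulr_sumr big_filter big_mkcond/=.
apply: ler_sum => a _; case: ifPn => _; last first.
  by rewrite mulr_ge0// mulr_ge0// exprn_ge0// addr_ge0// ltW.
rewrite normrM [leRHS]mulrCA ler_wpM2l// normrM normr_nat.
apply: le_trans (mfall_exp_bound a rho'0 d0 d1 (leqnn (size s))).
rewrite ler_wpM2l// norm_monomial_le//; apply: le_trans xrho _.
by rewrite le_max lexx.
Qed.

Lemma power_series_coef r c f : 0 < r -> power_series r c f -> taylor_coef f = c.
Proof.
move=> r0 psf; apply/funext => b; rewrite /taylor_coef mpartialE.
have [cb cf] := psf.
have H := @iterated_limit R n r (fun N x => \sum_(a <- [seq a <- degseq N | xpredT a]) c a * monomial a x)
  f (mseq b) 0 (fun N => @smooth_polynomial R n _ _) (power_series_bounded _ r0 psf).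
have {H} := H _ _; rewrite normr0 => /(_ _ r0) H.
have {}H : D (mseq b) (fun x => \sum_(a <- [seq a <- degseq N | xpredT a]) c a * monomial a x) 0
    @[N --> \oo] --> D (mseq b) f 0.
  apply: H => y yr; under eq_fun do rewrite filter_predT.
  exact: cf.
have E : \forall N \near \oo, D (mseq b)
   (fun x => \sum_(a <- [seq a <- degseq N | xpredT a]) c a * monomial a x) 0 =
   c b * mfactorial b.
  exists (mdegree b).+1 => // N /= bN.
  rewrite filter_predT iterated_polynomial (bigD1_seq b)/= ?degseq_uniq ?mem_degseq//.
  rewrite big1 ?addr0 => [|a ab].
    rewrite (_ : monomial _ _ = 1) ?mulr1; last first.
      by apply: big1 => j _; rewrite ffunE count_mseq subnn.
    congr (_ * _%:R); apply: eq_bigr => j _.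
    by rewrite count_mseq ffactnn.
  have [le_ba|] := boolP (mle b a); last first.
    rewrite negb_forall => /existsP[j]; rewrite -ltnNge => aj.
    by rewrite /mfall (bigD1 j)//= count_mseq ffact_small// mul0n mul0r mulr0.
  have [i bai] : exists i, (b i < a i)%N.
    apply/existsP; rewrite -[X in is_true X]negbK negb_exists; apply/forallP => ba.
    case/eqP: ab; apply/ffunP => i; apply/eqP; rewrite eqn_leq leqNgt ba.
    exact: (mleP _ _ le_ba).
  rewrite [X in _ * (_ * X)](bigD1 i)//= ffunE count_mseq mxE expr0n subn_eq0 leqNgt bai/=.
  by rewrite mul0r !mulr0.
have {}E : D (mseq b) f 0 = c b * mfactorial b.
  apply: (cvg_unique (@norm_hausdorff _ _) H).
  by apply: cvg_near_cst; exact: E.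
rewrite -/(mseq b) E mulfK// pnatr_eq0 -lt0n prodn_gt0// => i; exact: fact_gt0.
Qed.

(** In place of pure powers that dominate a flat error, the whole tail is estimated term by term:
    every exponent outside [E] is a proper multiple of one in [E], and the resulting bounds are
    summable. *)
Lemma analytic_remainder r H E : 0 < r -> power_series r (taylor_coef H) H ->
  minimal_basis (fun a => taylor_coef H a != 0) E -> remainder_estimate H E.
Proof.
move=> r0 psH [uE EH Hcov _] M.
pose rho := Num.min 1 (r / 4).
have rho0 : 0 < rho by rewrite lt_min ltr01 divr_gt0.
have rho1 : rho <= 1 by rewrite ge_min lexx.
have rhor : rho + rho < r.
  have : rho <= r / 4 by rewrite ge_min lexx orbT.
  by lra.
have [cb cf] := psH.
have [K HK] := cb (rho + rho) (addr_ge0 (ltW rho0) (ltW rho0)) rhor.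
(* [d] exceeds all degrees in [E]. Factoring out the monomial of [b] and one [|x|] leaves a power of
   [rho] at most [rho ^+ mdegree a / rho ^+ d]; the radius [rho + rho] below [r] is the room for the
   Cauchy estimate. *)
pose d := (\max_(a <- E) mdegree a).+1.
have C0 := @deriv_const_ge0 M rho (ltW rho0).
pose C := deriv_const M rho * K / rho ^+ d.
have K0 : 0 <= K.
  apply: le_trans (HK 0%N); rewrite sumr_ge0// => a _.
  by rewrite mulr_ge0// exprn_ge0// addr_ge0// ltW.
have C_ge0 : 0 <= C by rewrite divr_ge0 ?exprn_ge0 ?mulr_ge0// ltW.
exists (C + 1), rho; split => //; first by rewrite ltr_wpDl.
move=> x s xrho sM.
pose q N x := \sum_(a <- [seq a <- degseq N | a \notin E]) taylor_coef H a * monomial a x.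
have qlim y : `|y| < r -> q N y @[N --> \oo] --> H y - newton_part H E y.
  move=> yr; apply: (@cvg_trans _ ((fun N => \sum_(a <- degseq N) taylor_coef H a * monomial a y
      - newton_part H E y) @ \oo)); last first.
    by apply: cvgB; [exact: cf|exact: cvg_cst].
  apply: near_eq_cvg; exists d => // N /= dN.
  rewrite (bigID (mem E))/= /q big_filter addrAC -big_filter.
  rewrite (_ : \sum_(i <- _ | _) _ = newton_part H E y) ?subrr ?add0r//.
  apply: perm_big; apply: uniq_perm => //.
    by rewrite filter_uniq// degseq_uniq.
  move=> a; rewrite mem_filter mem_degseq; case: (boolP (a \in E)) => //= aE.
  apply: leq_trans dN; rewrite ltnS.
  exact: (@leq_bigmax_seq _ E xpredT (fun a => mdegree a)).
have xr : `|x| < r by apply: lt_trans xrho _; apply: le_lt_trans rhor; rewrite lerDl ltW.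
have lim := @iterated_limit R n r q _ s x (fun N => @smooth_polynomial R n _ _)
  (power_series_bounded _ r0 psH) qlim xr.
have qb N : `|(\prod_(i <- s) x 0 i) * D s (q N) x| <= (C + 1) * `|x| * newton_gauge E x.
  apply: (@le_trans _ _ (C * (`|x| * newton_gauge E x))); last first.
    by rewrite -mulrA ler_wpM2r ?lerDl// mulr_ge0// newton_gauge_ge0.
  rewrite iterated_polynomial mulr_sumr.
  apply: le_trans (ler_norm_sum _ _ _) _.
  rewrite /C -!mulrA.
  apply: le_trans (ler_wpM2l C0 (ler_wpM2r _ (HK N))); last first.
    by rewrite mulr_ge0 ?invr_ge0 ?exprn_ge0 ?(ltW rho0)// mulr_ge0// newton_gauge_ge0.
  rewrite mulr_suml mulr_sumr big_filter big_mkcond/=; apply: ler_sum => a _.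
  have gx : 0 <= (rho ^+ d)^-1 * (`|x| * newton_gauge E x).
    by rewrite mulr_ge0 ?invr_ge0 ?exprn_ge0 ?(ltW rho0)// mulr_ge0// newton_gauge_ge0.
  have rr : 0 <= rho + rho by rewrite addr_ge0// ltW.
  case: ifPn => aE; last by rewrite mulr_ge0// mulr_ge0// mulr_ge0// exprn_ge0.
  have [->|ta] := eqVneq (taylor_coef H a) 0.
    by rewrite mul0r mulr0 normr0 !mul0r mulr0.
  have [b bE ba] := Hcov a ta.
  rewrite mulrCA -iterated_monomial scaled_iterated_monomial normrM [X in _ * X]normrM normr_nat.
  rewrite [leRHS]mulrCA -!mulrA ler_wpM2l//.
  have dba : (0 < mdegree a - mdegree b)%N.
    rewrite subn_gt0 ltnNge; apply: contra aE => dab.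
    by rewrite -(mle_degree_eq ba dab).
  have bd : (mdegree b < d)%N.
    by rewrite ltnS; exact: (@leq_bigmax_seq _ E xpredT (fun a => mdegree a)).
  have m1 : `|monomial a x| <= rho ^+ mdegree a * (rho ^+ d)^-1 * (`|x| * newton_gauge E x).
    apply: le_trans (norm_monomial_mle ba (lexx _)) _.
    rewrite mulrA; apply: ler_pM; rewrite ?exprn_ge0//; last exact: monomial_le_gauge.
    rewrite -(prednK dba) exprS mulrC ler_wpM2r//.
    apply: le_trans (_ : rho ^+ (mdegree a - mdegree b).-1 <= _).
      by rewrite lerXn2r ?nnegrE// ltW.
    rewrite ler_pdivlMr ?exprn_gt0// -exprD ler_wiXn2l ?(ltW rho0)//.
    exact: leq_subn_pred.
  apply: le_trans (ler_wpM2l _ m1) _ => //.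
  rewrite !mulrA ler_wpM2r ?newton_gauge_ge0// ler_wpM2r// ler_wpM2r ?invr_ge0 ?exprn_ge0 ?(ltW rho0)//.
  rewrite [leRHS]mulrC; apply: le_trans (mfall_exp_bound a (ltW rho0) rho0 rho1 sM).
  rewrite ler_wpM2l// ler_wiXn2l ?(ltW rho0)//.
  by apply: leq_sum => j _; rewrite ffunE leq_subr.
have cv : `|(\prod_(i <- s) x 0 i) * D s (q N) x| @[N --> \oo] -->
    `|(\prod_(i <- s) x 0 i) * D s (fun y => H y - newton_part H E y) x|.
  by apply: cvg_norm; apply: cvgM => //; exact: cvg_cst.
rewrite -(cvg_lim (@norm_hausdorff _ _) cv); apply: limr_le; first exact: cvgP cv.
exact: nearW.
Qed.

End remainder.

(** * Passage to a face in the limit *)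

Section face_limit.
Context {R : realType} {n : nat}.
Implicit Types (x : 'rV[R]_n) (a b m : multiindex n) (E : seq (multiindex n)).

Definition wdot (j : 'I_n -> nat) (m : multiindex n) : nat := (\sum_i j i * m i)%N.

Lemma dyadic_scale (y : R) (k : nat) : 0 < y -> y < 2^-1 ^+ k ->
  exists j : nat, (k <= j)%N /\ 1 <= y * 2 ^+ j <= 2.
Proof.
move=> y0 yk.
have exj : exists j : nat, 1 <= y * 2 ^+ j.
  have [j _ /(_ j (leqnn j))/= jy] := near_infty_natSinv_lt (PosNum y0).
  have yj : y^-1 < j.+1%:R by rewrite invf_plt ?posrE.
  exists j; rewrite -ler_pdivrMl// mulr1; apply: le_trans (ltW yj) _.
  by rewrite -natrX ler_nat; exact: ltn_expl.
case: (ex_minnP exj) => j j1 jmin; exists j; split.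
  rewrite leqNgt; apply/negP => jk.
  have := j1; rewrite leNgt => /negP; apply.
  rewrite -ltr_pdivlMr ?exprn_gt0// div1r -exprVn; apply: lt_le_trans yk _.
  by rewrite ler_wiXn2l ?invr_ge0// ?invf_le1// ?ler1n// ltnW.
rewrite j1/=; case: j j1 jmin => [|j] j1 jmin.
  rewrite expr0 mulr1; apply: ltW (lt_le_trans yk _); apply: (@le_trans _ _ 1); last by rewrite ler1n.
  by rewrite exprn_ile1 ?invr_ge0// invf_le1// ler1n.
rewrite exprS mulrCA -[leRHS]mulr1 ler_pM2l//; rewrite leNgt; apply/negP => h.
by have := jmin j (ltW h); rewrite ltnn.
Qed.

Lemma exists_argmin (T : eqType) (s : seq T) (f : T -> nat) : s != [::] ->
  exists2 t, t \in s & forall u, u \in s -> (f t <= f u)%N.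
Proof.
elim: s => [//|t s IH] _; have [->|s0] := eqVneq s [::].
  by exists t; rewrite ?mem_head// => u; rewrite inE => /eqP->.
have [v vs vmin] := IH s0; have [tv|vt] := leqP (f t) (f v).
  exists t; rewrite ?mem_head// => u; rewrite inE => /predU1P[->//|/vmin].
  exact: leq_trans.
exists v; rewrite ?inE ?vs ?orbT// => u; rewrite inE => /predU1P[->|/vmin//].
exact: ltnW.
Qed.

Lemma filter_all_seq (T : eqType) (s : seq T) (I : Type) (F : set_system I) (P : T -> I -> Prop) :
  Filter F -> (forall t, t \in s -> F (P t)) -> F [set k | forall t, t \in s -> P t k].
Proof.
move=> FF; elim: s => [|t s IH] H; first by apply: filterS filterT => k _ t.
have /IH H1 : forall u, u \in s -> F (P u).
  by move=> u us; apply: H; rewrite inE us orbT.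
have H2 := H t (mem_head t s).
by apply: filterS2 H1 H2 => k h1 h2 u; rewrite inE => /predU1P[->|]; [|exact: h1].
Qed.

(** If no value is taken on a set of the ultrafilter, the complement of each level set belongs to
    it, and finitely many of these complements leave only values above a given bound. *)
Lemma ultra_nat_dichotomy (U : set_system nat) (d : nat -> nat) : UltraFilter U ->
  (exists b : nat, U [set k | d k = b]) \/ (forall b : nat, U [set k | (b < d k)%N]).
Proof.
move=> UU; have [|no] := pselect (exists b : nat, U [set k | d k = b]); first by left.
right=> b; have ne (c : nat) : U (~` [set k | d k = c]).
  have [Uc|//] := in_ultra_setVsetC [set k | d k = c] UU.
  by exfalso; apply: no; exists c.
elim: b => [|b IH].
  by apply: filterS (ne 0%N) => k /= /eqP; rewrite lt0n.
by apply: filterS2 IH (ne b.+1) => k /= h1 /eqP h2; rewrite ltn_neqAle eq_sym h2.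
Qed.

Lemma monomial_scale (u : 'rV[R]_n) (j : 'I_n -> nat) m :
  monomial m (\row_i (u 0 i * 2^-1 ^+ j i)) = monomial m u * 2^-1 ^+ wdot j m.
Proof.
rewrite /monomial /wdot -prodrXr -big_split; apply: eq_bigr => i _ /=.
by rewrite mxE exprMn -exprM.
Qed.

(** The coordinates may tend to 0 at unrelated rates, so no weight is given in advance. Each point
    is written as [u k] times powers of 1/2, with [u k] in a compact set. The gap between the dyadic
    exponent of a monomial and the smallest one is, along an ultrafilter, constant or unbounded.
    Monomials with constant gap survive in the limit, and the growth of the dyadic exponents between
    two indices is a weight that singles them out. *)
Lemma face_limit E (I : Type) (K : I -> Prop) (theta : I -> multiindex n -> R) :
  E != [::] ->
  (forall k : nat, exists x, (forall i, 0 < `|x 0 i| < 2^-1 ^+ k) /\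
    forall l, K l -> `|\sum_(m <- E) theta l m * monomial m x| <=
      k.+1%:R^-1 * newton_gauge E x) ->
  exists (a : 'I_n -> nat) (c : nat) (xi : 'rV[R]_n),
    [/\ forall i, (0 < a i)%N, forall i, xi 0 i != 0,
        forall m, m \in E -> (c <= wdot a m)%N,
        (exists2 m, m \in E & wdot a m = c) &
        forall l, K l ->
          \sum_(m <- E | wdot a m == c) theta l m * monomial m xi = 0].
Proof.
move=> E0 H; have [x Hx] := choice H.
have Hj k : exists j : 'I_n -> nat, forall i, (k <= j i)%N /\ 1 <= `|x k 0 i| * 2 ^+ j i <= 2.
  have H1 i : exists j : nat, (k <= j)%N /\ 1 <= `|x k 0 i| * 2 ^+ j <= 2.
    by have [/(_ i)/andP[x0 xk] _] := Hx k; exact: dyadic_scale.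
  by have [j Hj] := choice H1; exists j.
have {Hj} [j Hj] := choice Hj.
have Hmin (k : nat) := exists_argmin (wdot (j k)) E0.
have Hm (k : nat) : exists q : nat, (forall u, u \in E -> (q <= wdot (j k) u)%N) /\
    exists2 u, u \in E & wdot (j k) u = q.
  by have [t tE tm] := Hmin k; exists (wdot (j k) t); split => //; exists t.
have {Hm Hmin} [mn Hmn] := choice Hm.
pose u k : 'rV[R]_n := \row_i (x k 0 i * 2 ^+ j k i).
pose d m k := (wdot (j k) m - mn k)%N.
have dE m k : m \in E -> wdot (j k) m = (mn k + d m k)%N.
  by move=> mE; rewrite subnKC//; exact: (Hmn k).1.
have xE k : x k = \row_i (u k 0 i * 2^-1 ^+ j k i).
  apply/rowP => i; rewrite !mxE -mulrA -exprMn divff ?expr1n ?mulr1//.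
have ub k i : 1 <= `|u k 0 i| <= 2.
  by rewrite mxE normrM (@ger0_norm _ (2 ^+ _)) ?exprn_ge0//; have [_] := Hj k i.
(* One ultrafilter settles the behaviour of all monomials and the convergence of [u], in place of
   successive subsequences. *)
have [U [UU ooU]] := ultraFilterLemma eventually_filter.
have [v uv] : exists v : 'rV[R]_n, u @ U --> v.
  have cpt := @rV_compact R n (fun=> `[-2, 2]%classic) (fun=> @segment_compact R (-2) 2).
  have uc : (u @ U) [set w : 'rV[R]_n | forall i, `[-2, 2]%classic (w ord0 i)].
    have uc' (k : nat) : [set w : 'rV[R]_n | forall i, `[-2, 2]%classic (w ord0 i)] (u k).
      by move=> i /=; rewrite in_itv/= -ler_norml; have /andP[] := ub k i.
    apply: (@filterS _ U _ setT) filterT => k _; exact: uc'.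
  have [v [_ clv]] := cpt (u @ U) _ uc.
  exists v => B Bv; have [//|nB] := in_ultra_setVsetC (u @^-1` B) UU.
  by have [y [/= ny /ny]] := clv (~` B) B nB Bv.
have coord i : u k 0 i @[k --> U] --> v 0 i.
  exact: (@cvg_comp _ _ _ u (fun w : 'rV[R]_n => w 0 i) _ _ _ uv (@coord_continuous R 1 n 0 i v)).
have v1 i : 1 <= `|v 0 i|.
  have c1 : `|u k 0 i| @[k --> U] --> `|v 0 i| by apply: cvg_norm; exact: coord.
  apply: (@closed_cvg _ _ U _ (fun k => `|u k 0 i|) (fun y : R => 1 <= y) _ _ _ c1).
    exact: closed_ge.
  by apply: filterS filterT => k _; have /andP[] := ub k i.
have monv m : monomial m (u k) @[k --> U] --> monomial m v.
  exact: (@cvg_comp _ _ _ u (monomial m) _ _ _ uv (@continuous_monomial R n m v)).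
have Ab m : exists ob : option nat, if ob is Some b then U [set k | d m k = b]
    else forall b : nat, U [set k | (b < d m k)%N].
  by have [[b]|H'] := ultra_nat_dichotomy (d m) UU; [exists (Some b)|exists None].
have {Ab} [ob Hob] := choice Ab.
have UK : U [set k | forall m, m \in E -> if ob m is Some b then d m k = b else True].
  apply: filter_all_seq => m mE; have := Hob m; case: (ob m) => [b//|_].
  exact: filterS filterT.
have [k1 Hk1] := filter_ex UK.
have UK2 : U [set k | forall m, m \in E -> if ob m is Some b then True else (d m k1 < d m k)%N].
  apply: filter_all_seq => m mE; have := Hob m; case: (ob m) => [b _|h]; last exact: h.
  exact: filterS filterT.
have UK3 : U [set k | (\max_i j k1 i < k)%N].
  by apply: ooU; exists (\max_i j k1 i).+1.
have [k2 [[Hk2 Hk2'] Hk2'']] := filter_ex (filterI (filterI UK UK2) UK3).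
(* Constant gaps agree at [k1] and [k2], unbounded ones are larger at [k2]: the weight [a] takes one
   value on the surviving monomials and larger ones elsewhere. It is positive because [k2] exceeds
   all the exponents at [k1]. *)
pose a i := (j k2 i - j k1 i)%N.
have j12 i : (j k1 i < j k2 i)%N.
  apply: leq_trans (_ : (k2 <= _)%N); last by have [] := Hj k2 i.
  by apply: leq_ltn_trans Hk2''; exact: (@leq_bigmax_seq _ (index_enum 'I_n) xpredT (j k1)).
have aE m : (wdot a m + wdot (j k1) m = wdot (j k2) m)%N.
  rewrite /wdot -big_split; apply: eq_bigr => i _ /=.
  by rewrite -mulnDl subnK// ltnW.
have aE' m : m \in E -> (wdot a m + (mn k1 + d m k1) = mn k2 + d m k2)%N.
  by move=> mE; rewrite -!dE.
(* The smallest exponent is attained at every index, so the gaps cannot all be positive. *)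
have [m0 m0E [b0 ob0]] : exists2 m, m \in E & exists b : nat, ob m = Some b.
  apply: contrapT => no.
  have UP : U [set k | forall m, m \in E -> (0 < d m k)%N].
    apply: filter_all_seq => m mE; have := Hob m; case e : (ob m) => [b|] h; last exact: h.
    by exfalso; apply: no; exists m => //; exists b.
  have [k Hk] := filter_ex UP; have [_ [m mE mk]] := Hmn k.
  by have := Hk m mE; rewrite /d mk subnn.
have A0 : wdot a m0 = (mn k2 - mn k1)%N /\ (mn k1 <= mn k2)%N.
  have := aE' m0 m0E; have := Hk1 m0 m0E; have := Hk2 m0 m0E; rewrite ob0 => -> ->.
  by move=> h; split; lia.
have Asome m (b : nat) : m \in E -> ob m = Some b -> wdot a m = (mn k2 - mn k1)%N.
  move=> mE obm; have := aE' m mE; have := Hk1 m mE; have := Hk2 m mE; rewrite obm => -> ->.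
  by case: A0 => _; lia.
have Anone m : m \in E -> ob m = None -> (mn k2 - mn k1 < wdot a m)%N.
  move=> mE obm; have := aE' m mE; have := Hk2' m mE; rewrite obm.
  by case: A0 => _; lia.
exists a, (mn k2 - mn k1)%N, (\row_i (v 0 i * 2^-1 ^+ j k1 i)); split.
- by move=> i; rewrite subn_gt0.
- move=> i; rewrite mxE mulf_neq0 ?expf_neq0 ?invr_eq0 ?pnatr_eq0//.
  by rewrite -normr_gt0; apply: lt_le_trans (v1 i).
- by move=> m mE; case e : (ob m) => [b|]; [rewrite (Asome m b mE e)|rewrite ltnW// Anone].
- by exists m0 => //; case: A0.
move=> l Kl.
(* The form divided by its largest dyadic factor: it tends to 0 by hypothesis, and to the sum [L]
   over the surviving monomials. *)
pose f k := \sum_(m <- E) theta l m * (monomial m (u k) * 2^-1 ^+ d m k).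
pose L := \sum_(m <- E) theta l m * (monomial m v * (if ob m is Some b then 2^-1 ^+ b else 0)).
have fL : f k @[k --> U] --> L.
  apply: cvg_big; first exact: add_continuous.
  move=> m _; apply: cvgM; first exact: cvg_cst.
  apply: cvgM; first exact: monv.
  have := Hob m; case: (ob m) => [b Ub|Ub].
    by apply: cvg_near_cst; apply: filterS Ub => k /= ->.
  apply/cvgrPdist_le => eps eps0.
  have [N _ /(_ N (leqnn N))/= NE] := near_infty_natSinv_lt (PosNum eps0).
  apply: filterS (Ub N) => k /= Nd; rewrite sub0r normrN normrX.
  apply: le_trans (ltW NE); rewrite ger0_norm ?invr_ge0// exprVn lef_pV2 ?posrE ?exprn_gt0//.
  rewrite -natrX ler_nat; apply: leq_trans (ltn_expl N (ltnSn 1)) _.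
  by rewrite leq_exp2l// ltnW.
have f0 : f k @[k --> U] --> (0 : R).
  pose C := \sum_(m <- E) (2 : R) ^+ mdegree m.
  have C0 : 0 <= C by apply: sumr_ge0 => m _; rewrite exprn_ge0.
  have fle k : `|f k| <= C * k.+1%:R^-1.
    have xm m : m \in E -> monomial m (x k) = (monomial m (u k) * 2^-1 ^+ d m k) * 2^-1 ^+ mn k.
      by move=> mE; rewrite {1}xE monomial_scale dE// addnC exprD mulrA.
    have [_ /(_ l Kl)] := Hx k; rewrite /newton_gauge.
    rewrite (eq_big_seq (fun m => (theta l m * (monomial m (u k) * 2^-1 ^+ d m k)) * 2^-1 ^+ mn k)); last first.
      by move=> m mE; rewrite xm// mulrA.
    rewrite -mulr_suml normrM.
    rewrite [in leRHS](eq_big_seq (fun m => `|monomial m (u k) * 2^-1 ^+ d m k| * `|2^-1 ^+ mn k|)); last first.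
      by move=> m mE; rewrite xm// normrM.
    rewrite -mulr_suml mulrA ler_pM2r; last by rewrite normr_gt0 expf_neq0.
    move=> /le_trans; apply; rewrite mulrC ler_wpM2r// ler_sum// => m _.
    rewrite normrM -[leRHS]mulr1 ler_pM//.
      apply: norm_monomial_le; apply: norm_le_coord => // i.
      by have /andP[] := ub k i.
    by rewrite normrX ger0_norm ?invr_ge0// exprn_ile1// ?invr_ge0// invf_le1// ler1n.
  apply/cvgrPdist_le => eps eps0.
  have e0 : 0 < eps / (C + 1) by rewrite divr_gt0// ltr_wpDl.
  have [N _ NE] := near_infty_natSinv_lt (PosNum e0).
  have : U [set k | (N <= k)%N] by apply: ooU; exists N.
  apply: filterS => k /= Nk; rewrite sub0r normrN; apply: le_trans (fle k) _.
  have := ltW (NE k Nk); rewrite /= ler_pdivlMr ?ltr_wpDl// => h.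
  by apply: le_trans h; rewrite mulrC ler_wpM2l// lerDl.
have L0 : L = 0 by exact: (cvg_unique (@norm_hausdorff _ _) fL f0).
(* [xi] is the limit [v] rescaled by the dyadic exponents at [k1]; this absorbs the constant gaps
   into the values of the monomials at [xi]. *)
transitivity (2^-1 ^+ mn k1 * L); last by rewrite L0 mulr0.
rewrite /L mulr_sumr big_mkcond; apply: eq_big_seq => m mE /=.
case e : (ob m) => [b|]; last by rewrite gtn_eqF ?Anone// !mulr0.
rewrite (Asome m b mE e) eqxx monomial_scale dE//.
have := Hk1 m mE; rewrite e => ->; rewrite exprD.
by rewrite (mulrCA (monomial m v)) (mulrCA (theta l m)).
Qed.

End face_limit.

(** * Newton polyhedra and their exposed faces *)

Section newton_polyhedron.
Context {R : realType} {n : nat}.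
Implicit Types (x y : 'rV[R]_n) (a b m : multiindex n) (E : seq (multiindex n)).

Lemma convex_setP (A : set 'rV[R]_n) : convex_set A <->
  forall x y (t : R), 0 <= t -> t <= 1 -> A x -> A y -> A (t *: x + (1 - t) *: y).
Proof.
split=> [cA x y t t0 t1 Ax Ay|cA x y l].
  have tI : Itv.spec (@Itv.num_sem R) (Itv.Real `[0%Z, 1%Z]) t.
    by rewrite /= /Itv.num_sem /= num_real in_itv/= t0 t1.
  by have := cA x y (Itv.Def tI); rewrite !inE; apply.
by rewrite !inE => Ax Ay; apply: cA.
Qed.

Lemma convex_comb (A : set 'rV[R]_n) (I : Type) (r : seq I) (w : I -> R)
    (p : I -> 'rV[R]_n) : convex_set A -> (forall i, 0 <= w i) ->
  \sum_(i <- r) w i = 1 -> (forall i, A (p i)) -> A (\sum_(i <- r) w i *: p i).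
Proof.
move=> /convex_setP cA w0 w1 Ap.
suff H s : s = \sum_(i <- r) w i -> 0 < s -> A (s^-1 *: \sum_(i <- r) w i *: p i).
  by have := H 1 (esym w1) ltr01; rewrite invr1 scale1r.
elim: r s {w1} => [|i r IH] s sE s0; first by rewrite sE big_nil ltxx in s0.
rewrite big_cons scalerDr scalerA.
have S0 : 0 <= \sum_(j <- r) w j by exact: sumr_ge0.
move: S0; rewrite le_eqVlt => /predU1P[S0|S0].
  have W0 : \sum_(j <- r) w j *: p j = 0.
    elim: r S0 {IH sE} => [|j r IH] S0; first by rewrite big_nil.
    move: S0; rewrite !big_cons => /esym/eqP.
    by rewrite paddr_eq0 ?sumr_ge0// => /andP[/eqP-> /eqP/esym/IH->]; rewrite scale0r addr0.
  rewrite W0 scaler0 addr0 sE big_cons -S0 addr0 mulVf ?scale1r//.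
  by move: s0; rewrite sE big_cons -S0 addr0 => /gt_eqF->.
have -> : s^-1 *: \sum_(j <- r) w j *: p j =
    (1 - s^-1 * w i) *: ((\sum_(j <- r) w j)^-1 *: \sum_(j <- r) w j *: p j).
  rewrite scalerA; congr (_ *: _).
  have -> : 1 - s^-1 * w i = s^-1 * (\sum_(j <- r) w j).
    by rewrite -(mulVf (lt0r_neq0 s0)) -mulrBr {2}sE big_cons addrC addKr.
  by rewrite mulfK// gt_eqF.
apply: cA => //; [by rewrite mulr_ge0// invr_ge0 ltW| |exact: IH].
by rewrite mulrC ler_pdivrMr// mul1r sE big_cons lerDl ltW.
Qed.

Definition mdot (w : 'I_n -> R) (m : multiindex n) : R := \sum_i w i * (m i)%:R.

Variables (H : 'rV[R]_n -> R) (E : seq (multiindex n)).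
Hypothesis EP : minimal_basis (fun a => taylor_coef H a != 0) E.
Local Notation N := (newton_polyhedron H).

Lemma newton_polyhedron_min (A : set 'rV[R]_n) : convex_set A ->
  (forall m x, taylor_coef H m != 0 -> orthant m x -> A x) -> N `<=` A.
Proof.
move=> cA oA; apply: smallest_sub => //.
by move=> x [m /= tm mx]; exact: oA mx.
Qed.

Lemma convex_newton_polyhedron : convex_set N.
Proof.
apply/convex_setP => x y t t0 t1 Nx Ny A [cA oA].
by move/convex_setP : (cA); apply => //; [exact: Nx|exact: Ny].
Qed.

Lemma orthant_newton m x : taylor_coef H m != 0 -> orthant m x -> N x.
Proof. by move=> tm mx A [cA oA]; apply: oA; exists m. Qed.

Lemma newton_polyhedron_ge (w : 'I_n -> R) (c : R) : (forall i, 0 <= w i) ->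
  (forall m, m \in E -> c <= mdot w m) ->
  forall x, N x -> c <= \sum_i w i * x 0 i.
Proof.
move=> w0 cE; have [_ _ cov _] := EP; apply: newton_polyhedron_min => [|m x tm mx].
  apply/convex_setP => x y t t0 t1 /= cx cy.
  have -> : \sum_i w i * (t *: x + (1 - t) *: y) 0 i =
      t * (\sum_i w i * x 0 i) + (1 - t) * (\sum_i w i * y 0 i).
    by rewrite !mulr_sumr -big_split; apply: eq_bigr => i _ /=; rewrite !mxE; ring.
  have : t * c <= t * (\sum_i w i * x 0 i) by rewrite ler_wpM2l.
  have : (1 - t) * c <= (1 - t) * (\sum_i w i * y 0 i) by rewrite ler_wpM2l// subr_ge0.
  lra.
have [b bE /mleP bm] := cov _ tm; apply: le_trans (cE b bE) _.
apply: ler_sum => i _; rewrite ler_wpM2l//; apply: le_trans (mx i).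
by rewrite ler_nat.
Qed.

(** The points with such weights form a convex set that contains the generating orthants. Membership
    in the polyhedron becomes a statement on the finite list [E]. *)
Lemma newton_polyhedron_simplex x : N x ->
  exists w : multiindex n -> R, [/\ forall m, 0 <= w m, \sum_(m <- E) w m = 1 &
    forall i, \sum_(m <- E) w m * (m i)%:R <= x 0 i].
Proof.
have [uE _ cov _] := EP; move: x; apply: newton_polyhedron_min => [|m x tm mx].
  apply/convex_setP => x y t t0 t1 /= [w [w0 w1 wx]] [v [v0 v1 vy]].
  have t1' : 0 <= 1 - t by rewrite subr_ge0.
  exists (fun m => t * w m + (1 - t) * v m); split.
  - by move=> m; rewrite addr_ge0// mulr_ge0.
  - by rewrite big_split/= -!mulr_sumr w1 v1 !mulr1 addrC subrK.
  - move=> i; rewrite !mxE.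
    have -> : \sum_(m <- E) (t * w m + (1 - t) * v m) * (m i)%:R =
       t * (\sum_(m <- E) w m * (m i)%:R) + (1 - t) * (\sum_(m <- E) v m * (m i)%:R).
      by rewrite !mulr_sumr -big_split; apply: eq_bigr => m _ /=; ring.
    by rewrite lerD// ler_wpM2l.
have [b bE /mleP bm] := cov _ tm; exists (fun m => (m == b)%:R); split.
- by move=> k; rewrite ler0n.
- by rewrite (bigD1_seq b)//= eqxx big1 ?addr0// => k /negbTE->.
- move=> i; rewrite (bigD1_seq b)//= eqxx mul1r big1 ?addr0; last first.
    by move=> k /negbTE->; rewrite mul0r.
  by apply: le_trans (mx i); rewrite ler_nat.
Qed.

(** A point of the i-th axis dominates a convex combination of [E], so an exponent with positive
    weight in it has all its other entries zero. *)
Lemma newton_axes : meets_coordinate_axes N ->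
  forall i, exists k, [ffun j => if j == i then k else 0%N] \in E.
Proof.
move=> ax i; have [t /newton_polyhedron_simplex[w [w0 w1 wx]]] := ax i.
have [m mE wm] : exists2 m, m \in E & 0 < w m.
  apply: contrapT => no; move: w1; rewrite big1_seq; first by move/esym/eqP; rewrite oner_eq0.
  move=> m /= mE; apply/eqP; rewrite eq_le w0 andbT leNgt; apply/negP => wm.
  by apply: no; exists m.
exists (m i); rewrite (_ : finfun _ = m)//; apply/ffunP => j; rewrite ffunE.
case: eqP => [->//|/eqP ji].
have := wx j; rewrite !mxE eqxx/= (negbTE ji) mulr0 => wj.
have uE : uniq E by case: EP.
have : w m * (m j)%:R <= 0.
  apply: le_trans wj; rewrite (bigD1_seq m)//= lerDl sumr_ge0// => k _.
  by rewrite mulr_ge0.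
by rewrite pmulr_rle0// lern0 => /eqP.
Qed.

Section exposed_face.
Variables (a : 'I_n -> nat) (c : nat).
Hypotheses (a0 : forall i, (0 < a i)%N) (cE : forall m, m \in E -> (c <= wdot a m)%N)
  (cm : exists2 m, m \in E & wdot a m = c).

Let w i : R := (a i)%:R.
Let F : set 'rV[R]_n := [set x | N x /\ dotp (\row_i w i) x = c%:R].

Let mdotE m : mdot w m = (wdot a m)%:R.
Proof. by rewrite /mdot /wdot natr_sum; apply: eq_bigr => i _; rewrite natrM. Qed.

Let dotpE x : dotp (\row_i w i) x = \sum_i w i * x 0 i.
Proof. by apply: eq_bigr => i _; rewrite mxE. Qed.

Let N_ge x : N x -> c%:R <= dotp (\row_i w i) x.
Proof.
move=> Nx; rewrite dotpE; apply: newton_polyhedron_ge => // m mE.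
by rewrite mdotE ler_nat cE.
Qed.

Let dotp_mvec m : dotp (\row_i w i) (mvec m) = (wdot a m)%:R.
Proof. by rewrite dotpE -mdotE; apply: eq_bigr => i _; rewrite mxE. Qed.

(** As [a] is positive, an exponent properly above one of [E] has weight larger than [c]. *)
Lemma exposed_face_monomial m : taylor_coef H m != 0 -> F (mvec m) <-> m \in E /\ wdot a m = c.
Proof.
move=> tm; split=> [[_]|[mE mc]]; last first.
  by split; [apply: (orthant_newton tm) => i; rewrite mxE|rewrite dotp_mvec mc].
rewrite dotp_mvec => /eqP; rewrite eqr_nat => /eqP mc.
have [_ _ cov _] := EP; have [b bE bm] := cov m tm.
suff -> : m = b by split => //; apply/eqP; rewrite eqn_leq cE// -mc andbT leq_sum// => i _; rewrite leq_mul//; exact/mleP.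
apply/ffunP => i; apply/eqP; rewrite eqn_leq (mleP _ _ bm) andbT leqNgt; apply/negP => lt_bm.
have : (wdot a b < wdot a m)%N.
  rewrite /wdot (bigD1 i)//= [ltnRHS](bigD1 i)//= -addSn leq_add ?ltn_pmul2l//.
  by apply: leq_sum => k _; rewrite leq_mul//; exact/mleP.
by rewrite mc ltnNge cE.
Qed.

Lemma exposed_face_poly x : face_poly H F x =
  \sum_(m <- E | wdot a m == c) taylor_coef H m * monomial m x.
Proof.
have [uE Et _ _] := EP.
rewrite -big_filter [RHS]fsbig_seq ?filter_uniq// /face_poly.
apply/esym/fsbig_widen => m /=.
  by rewrite mem_filter => /andP[/eqP mc mE]; apply/exposed_face_monomial => //; exact: Et.
move=> [Fm mn]; have [->|tm] := eqVneq (taylor_coef H m) 0; first by rewrite mul0r.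
by exfalso; apply: mn; have [mE mc] := (exposed_face_monomial tm).1 Fm; rewrite /= mem_filter mE mc eqxx.
Qed.

(** The face is the convex hull of finitely many exponents, hence the continuous image of a closed
    part of a cube. *)
Lemma exposed_face_compact : compact_face N F.
Proof.
have [uE Et _ _] := EP; split.
  split; last by exists (\row_i w i), c%:R.
  by have [m mE mc] := cm; exists (mvec m); apply/exposed_face_monomial => //; exact: Et.
pose l := size E; pose Ei (j : 'I_l) := tnth (in_tuple E) j.
pose ind (j : 'I_l) : R := (wdot a (Ei j) == c)%:R.
pose cube := [set v : 'rV[R]_l | forall j, `[0, 1]%classic (v 0 j)].
pose D := cube `&` (lin_form ind) @^-1` [set 1].
pose f (v : 'rV[R]_l) : 'rV[R]_n := \sum_j v 0 j *: (ind j *: mvec (Ei j)).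
have cD : compact D.
  apply: compact_closedI.
    exact: (@rV_compact R l (fun=> `[0, 1]%classic) (fun=> @segment_compact R 0 1)).
  apply: closed_comp; last exact: closed1 || exact: closed_eq.
  by move=> v _; exact: continuous_lin_form.
have cf : continuous f.
  move=> v; have FF : Filter (nbhs (v : 'rV[R]_l)) by exact: nbhs_filter.
  apply: cvg_big; first exact: add_continuous.
  move=> j _; apply: cvgZ; last exact: cvg_cst.
  exact: coord_continuous.
suff -> : F = f @` D by apply: continuous_compact => //; exact: continuous_subspaceT.
have sumE (T : nmodType) (g : multiindex n -> T) : \sum_(m <- E) g m = \sum_(j < l) g (Ei j).
  by rewrite -[in LHS](in_tupleE E) big_tnth.
apply/seteqP; split => [x [Nx xc]|_ [v [vc v1] <-]].
  have [u [u0 u1 ux]] := newton_polyhedron_simplex Nx.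
  have S1 : \sum_(m <- E) u m * (wdot a m)%:R <= c%:R.
    rewrite -xc dotpE.
    have -> : \sum_(m <- E) u m * (wdot a m)%:R = \sum_i w i * (\sum_(m <- E) u m * (m i)%:R).
      under [RHS]eq_bigr do rewrite mulr_sumr.
      rewrite exchange_big; apply: eq_bigr => m _ /=.
      by rewrite -mdotE /mdot mulr_sumr; apply: eq_bigr => i _; rewrite mulrCA.
    by apply: ler_sum => i _; rewrite ler_wpM2l.
  have S2 : \sum_(m <- E) u m * ((wdot a m)%:R - c%:R) = 0.
    apply/eqP; rewrite eq_le; apply/andP; split.
      under eq_bigr do rewrite mulrBr.
      by rewrite sumrB -mulr_suml u1 mul1r subr_le0.
    rewrite big_seq; apply: sumr_ge0 => m mE.
    by rewrite mulr_ge0// subr_ge0 ler_nat cE.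
  have um m : m \in E -> wdot a m != c -> u m = 0.
    move=> mE mc; move: S2; rewrite (bigD1_seq m)//= => /eqP.
    rewrite paddr_eq0; last 2 first.
    - by rewrite mulr_ge0// subr_ge0 ler_nat cE.
    - rewrite big_seq_cond; apply: sumr_ge0 => k /andP[kE _].
      by rewrite mulr_ge0// subr_ge0 ler_nat cE.
    by rewrite mulf_eq0 subr_eq0 eqr_nat (negbTE mc) orbF => /andP[/eqP].
  (* A point of the polyhedron merely dominates a convex combination; on the face equality is
     forced, since a strict inequality in one coordinate would raise the weight. *)
  have xE : x = \sum_(m <- E) u m *: mvec m.
    apply/rowP => i; rewrite summxE.
    under eq_bigr do rewrite !mxE.
    apply/eqP; rewrite eq_sym eq_le ux/= leNgt; apply/negP => lt_i.
    suff : dotp (\row_i w i) (\sum_(m <- E) u m *: mvec m) < dotp (\row_i w i) x.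
      rewrite xc dotpE ltNge => /negP; apply.
      have -> : \sum_i0 w i0 * (\sum_(m <- E) u m *: mvec m) 0 i0 = \sum_(m <- E) u m * (wdot a m)%:R.
        under eq_bigr do rewrite summxE mulr_sumr.
        rewrite exchange_big; apply: eq_bigr => m _ /=.
        by rewrite -mdotE /mdot mulr_sumr; apply: eq_bigr => k _; rewrite !mxE mulrCA.
      have -> : c%:R = \sum_(m <- E) u m * c%:R by rewrite -mulr_suml u1 mul1r.
      rewrite [leLHS]big_seq [leRHS]big_seq; apply: ler_sum => m mE.
      by rewrite ler_wpM2l// ler_nat cE.
    rewrite !dotpE (bigD1 i)//= [ltRHS](bigD1 i)//= ltr_leD//.
      rewrite ltr_pM2l ?ltr0n// summxE; apply: le_lt_trans lt_i.
      by apply: ler_sum => m _; rewrite !mxE.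
    apply: ler_sum => k _; rewrite ler_wpM2l// summxE; apply: le_trans (ux k).
    by apply: ler_sum => m _; rewrite !mxE.
  have sup1 : \sum_(m <- E) (wdot a m == c)%:R * u m = 1.
    rewrite -[RHS]u1; apply: eq_big_seq => m mE.
    by case: eqVneq => [_|mc]; [rewrite mul1r|rewrite (um m mE mc) mulr0].
  have u_le1 m : m \in E -> u m <= 1.
    by move=> mE; rewrite -u1 (bigD1_seq m)//= lerDl sumr_ge0.
  exists (\row_j u (Ei j)); first split.
  - move=> j; rewrite /= mxE in_itv/= u0 u_le1//; exact: mem_tnth.
  - rewrite /preimage/= /lin_form -[RHS]sup1 sumE; apply: eq_bigr => j _.
    by rewrite mxE // mulrC.
  rewrite /f xE sumE; apply: eq_bigr => j _; rewrite mxE scalerA /ind.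
  by case: eqVneq => [_|mc]; [rewrite mulr1|rewrite (um _ (mem_tnth j (in_tuple E)) mc) mul0r].
have fE i : f v 0 i = \sum_j (v 0 j * ind j) * (Ei j i)%:R.
  by rewrite summxE; apply: eq_bigr => j _; rewrite !mxE mulrA.
have v1' : \sum_j v 0 j * ind j = 1.
  by move: v1; rewrite /preimage/= /lin_form => <-; apply: eq_bigr => j _; rewrite // mulrC.
split.
  have -> : f v = \sum_j (v 0 j * ind j) *: mvec (Ei j).
    by apply: eq_bigr => j _; rewrite scalerA.
  apply: (@convex_comb N _ _ (fun j => v 0 j * ind j) (fun j => mvec (Ei j))) => //.
  - exact: convex_newton_polyhedron.
  - by move=> j; rewrite mulr_ge0 ?ler0n//; have := vc j; rewrite /= in_itv/= => /andP[].
  - move=> j; apply: (orthant_newton (Et _ (mem_tnth j (in_tuple E)))) => i.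
    by rewrite mxE.
rewrite dotpE; under eq_bigr do rewrite fE mulr_sumr.
have -> : c%:R = \sum_j (v 0 j * ind j) * c%:R by rewrite -mulr_suml v1' mul1r.
rewrite exchange_big/=; apply: eq_bigr => j _.
rewrite /ind; case: eqVneq => [ec|_].
  rewrite mulr1 -ec -mdotE /mdot mulr_sumr; apply: eq_bigr => i _.
  by rewrite mulrCA.
by rewrite !mulr0 mul0r big1// => i _; rewrite mul0r mulr0.
Qed.

End exposed_face.

End newton_polyhedron.

(** * Lower bounds for directional derivatives *)

Section directions.
Context {R : realType} {n : nat}.
Implicit Types (x : 'rV[R]_n) (m : multiindex n) (E : seq (multiindex n)).

Lemma base_expansion_inj (D : nat) (l : nat) (b c : nat -> nat) :
  (forall i : nat, (b i < D)%N) -> (forall i : nat, (c i < D)%N) ->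
  (\sum_(i < l) b i * D ^ i = \sum_(i < l) c i * D ^ i)%N ->
  forall i : nat, (i < l)%N -> b i = c i.
Proof.
elim: l b c => [//|l IH] b c bD cD.
have D0 : (0 < D)%N by exact: leq_ltn_trans (bD 0%N).
have tail (e : nat -> nat) : (\sum_(i < l.+1) e i * D ^ i = e 0 + (\sum_(i < l) e i.+1 * D ^ i) * D)%N.
  rewrite big_ord_recl expn0 muln1 big_distrl/=; congr addn.
  by apply: eq_bigr => i _; rewrite /bump/= add1n expnSr mulnA.
rewrite !tail => eq_bc.
have b0 : b 0%N = c 0%N.
  by have := congr1 (modn^~ D) eq_bc; rewrite !(addnC (_ 0%N)) !modnMDl !modn_small.
move: eq_bc; rewrite b0 => /addnI/eqP; rewrite eqn_pmul2r// => /eqP eq_bc.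
by case=> [//|i]; rewrite ltnS; exact: (IH (fun i => b i.+1) (fun i => c i.+1)).
Qed.

Definition mbinom m (b : 'I_n -> nat) : nat := (\prod_i 'C(m i, b i))%N.

Lemma line_poly1_coef (D : nat) m (v : 'I_n -> nat) (p : nat) : (forall i, (m i < D)%N) ->
  (line_poly m (const_mx 1) (\row_i (v i)%:R : 'rV[R]_n))`_p =
  \sum_(f : {ffun 'I_n -> 'I_D} | (\sum_i f i == p)%N)
     (mbinom m (fun i => f i) * \prod_i v i ^ f i)%:R.
Proof.
move=> mD.
have -> : line_poly m (const_mx 1) (\row_i (v i)%:R : 'rV[R]_n) =
    \sum_(f : {ffun 'I_n -> 'I_D}) (mbinom m (fun i => f i) * \prod_i v i ^ f i)%:R *: 'X^(\sum_i f i).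
  have term i : ((\row_i (v i)%:R : 'rV[R]_n) 0 i *: 'X + ((const_mx 1 : 'rV[R]_n) 0 i)%:P) ^+ m i =
      \sum_(k < D) ('C(m i, k) * v i ^ k)%:R *: 'X^k :> {poly R}.
    rewrite !mxE addrC exprDn (big_ord_widen_cond D xpredT
      (fun k => (1%:P ^+ (m i - k) * ((v i)%:R *: 'X) ^+ k) *+ 'C(m i, k)))//.
    rewrite big_mkcond; apply: eq_bigr => k _.
    case: ltnP => [_|mk]; last by rewrite bin_small// mul0n scale0r.
    by rewrite expr1n mul1r exprZn natrM natrX -scaler_nat scalerA.
  rewrite /line_poly (eq_bigr _ (fun i _ => term i)) bigA_distr_bigA.
  apply: eq_bigr => f _; rewrite -(prodrXr _ _ _ _) /mbinom -big_split natr_prod.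
  by rewrite scaler_prod.
rewrite coef_sum [RHS]big_mkcond; apply: eq_bigr => f _.
rewrite coefZ coefXn eq_sym; case: eqP => _; by rewrite ?mulr1 ?mulr0.
Qed.

(** Kronecker's substitution: when [D] exceeds all exponents, distinct monomials become distinct
    powers of [s]. *)
Definition kronecker_dir (D : nat) (s : nat) (i : 'I_n) : nat := (s ^ (D ^ i))%N.

(** After the substitution the form is a polynomial in one variable of degree less than [S] with the
    [S] roots [1, ..., S]. A fixed finite set of directions thus detects every form of bounded
    degree. *)
Lemma kronecker_separation (D S : nat) (T : {ffun 'I_n -> 'I_D} -> R) (p : nat) :
  (forall f : {ffun 'I_n -> 'I_D}, (\sum_i f i * D ^ i < S)%N) ->
  (forall s : nat, (s < S)%N ->
    \sum_(f : {ffun 'I_n -> 'I_D} | (\sum_i f i == p)%N)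
       T f * (\prod_i kronecker_dir D s.+1 i ^ f i)%:R = 0) ->
  forall f : {ffun 'I_n -> 'I_D}, (\sum_i f i = p)%N -> T f = 0.
Proof.
move=> SP Q0 f fp.
pose kap (g : {ffun 'I_n -> 'I_D}) := (\sum_i g i * D ^ i)%N.
have kap_inj : injective kap.
  move=> g h gh; apply/ffunP => i; apply/val_inj => /=.
  have D0 : (0 < D)%N by exact: leq_ltn_trans (ltn_ord (g i)).
  pose ex (e : {ffun 'I_n -> 'I_D}) (k : nat) : nat := if insub k is Some j then e j else 0%N.
  have exE e (j : 'I_n) : ex e j = e j by rewrite /ex valK.
  have exD e (k : nat) : (ex e k < D)%N by rewrite /ex; case: insubP => // j _ _; exact: ltn_ord.
  have := @base_expansion_inj D n (ex g) (ex h) (exD g) (exD h) _ i (ltn_ord i).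
  rewrite !exE; apply; rewrite -[LHS]/(\sum_(i < n) _)%N.
  under eq_bigr do rewrite exE.
  by under [RHS]eq_bigr do rewrite exE.
pose Q : {poly R} := \sum_(g : {ffun 'I_n -> 'I_D} | (\sum_i g i == p)%N) T g *: 'X^(kap g).
have Qs : (size Q <= S)%N.
  apply: (leq_trans (size_sum _ _ _)); apply/bigmax_leqP => g _.
  by apply: (leq_trans (size_scale_leq _ _)); rewrite size_polyXn; exact: SP.
have Q0' : Q = 0.
  apply: (@roots_geq_poly_eq0 _ Q [seq s.+1%:R | s <- iota 0 S]).
  - apply/allP => y /mapP[s]; rewrite mem_iota add0n => sS ->.
    rewrite /root /Q horner_sum; apply/eqP; rewrite -[RHS](Q0 s sS).
    apply: eq_bigr => g _; rewrite hornerZ hornerXn; congr (_ * _).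
    rewrite natr_prod /kap -prodrXr; apply: eq_bigr => i _.
    by rewrite /kronecker_dir -expnM mulnC natrX.
  - rewrite map_inj_uniq ?iota_uniq// => s t /eqP.
    by rewrite eqr_nat => /eqP[].
  - by rewrite size_map size_iota.
have := congr1 (fun q : {poly R} => q`_(kap f)) Q0'.
rewrite coef0 coef_sum (bigD1 f)/=; last exact/eqP.
rewrite coefZ coefXn eqxx mulr1 big1 ?addr0// => g /andP[_ gf].
by rewrite coefZ coefXn (inj_eq kap_inj) eq_sym (negbTE gf) mulr0.
Qed.

(** Multiplication by the monomial of [b] expresses the derivative through the values of the
    monomials at [x], so that off the coordinate hyperplanes its vanishing is a linear relation
    between binomials. *)
Lemma mpartial_comb_binom (r : seq (multiindex n)) (t : multiindex n -> R) (b : multiindex n) x :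
  mpartial b (fun x => \sum_(m <- r) t m * monomial m x) x * monomial b x =
  (\prod_i (b i)`!)%N%:R * \sum_(m <- r) t m * monomial m x * (mbinom m b)%:R.
Proof.
rewrite mpartial_polynomial mulr_suml mulr_sumr; apply: eq_bigr => m _.
have -> : (\prod_j (m j) ^_ (b j))%N = (mbinom m b * \prod_i (b i)`!)%N.
  by rewrite -big_split; apply: eq_bigr => i _; rewrite /= bin_ffact.
have [mb|nmb] := boolP (mle b m).
  have -> : monomial m x = (\prod_j x 0 j ^+ (m j - b j)) * monomial b x.
    by rewrite /monomial -big_split; apply: eq_bigr => i _ /=; rewrite -exprD subnK//; exact/mleP.
  by rewrite natrM; ring.
suff -> : mbinom m b = 0%N by rewrite mul0n !(mul0r, mulr0).
have [i mbi] : exists i, (m i < b i)%N.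
  apply: contrapT => no; move/negP : nmb; apply; apply/mleP => i.
  by rewrite leqNgt; apply/negP => h; apply: no; exists i.
by rewrite /mbinom (bigD1 i)//= bin_small.
Qed.

Definition unit_index (j : 'I_n) : multiindex n := [ffun i => (i == j)%N : nat].

Lemma mbinom0 m : mbinom m [ffun => 0%N] = 1%N.
Proof. by rewrite /mbinom big1// => i _; rewrite ffunE bin0. Qed.

Lemma mbinom_unit m j : mbinom m (unit_index j) = m j.
Proof.
rewrite /mbinom (bigD1 j)//= ffunE eqxx bin1 big1 ?muln1// => i ij.
by rewrite ffunE (negbTE ij) bin0.
Qed.

Lemma mbinom_unit2 m j : mbinom m [ffun i => 2 * (i == j)]%N = 'C(m j, 2).
Proof.
rewrite /mbinom (bigD1 j)//= ffunE eqxx muln1 big1 ?muln1// => i ij.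
by rewrite ffunE (negbTE ij) muln0 bin0.
Qed.

Lemma mbinom_unitD m i j : i != j -> mbinom m [ffun k => (k == i) + (k == j)]%N = (m i * m j)%N.
Proof.
move=> ij; rewrite /mbinom (bigD1 i)//= (bigD1 j)/=; last by rewrite eq_sym.
rewrite !ffunE !eqxx (negbTE ij) eq_sym (negbTE ij) addn0 add0n !bin1.
rewrite big1 ?muln1// => k /andP[ki kj].
by rewrite ffunE (negbTE ki) (negbTE kj) bin0.
Qed.

Lemma mdegree_unit j : mdegree (unit_index j) = 1%N.
Proof.
rewrite /mdegree (bigD1 j)//= ffunE eqxx big1// => i ij.
by rewrite ffunE (negbTE ij).
Qed.

Lemma mdegree_unit2 j : mdegree ([ffun i => 2 * (i == j)]%N : multiindex n) = 2%N.
Proof.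
rewrite /mdegree (bigD1 j)//= ffunE eqxx big1// => i ij.
by rewrite ffunE (negbTE ij).
Qed.

Lemma mdegree_unitD i j : mdegree ([ffun k => (k == i) + (k == j)]%N : multiindex n) = 2%N.
Proof.
rewrite /mdegree; under eq_bigr do rewrite ffunE.
have one (l : 'I_n) : (\sum_(k < n) (k == l))%N = 1%N.
  by rewrite (bigD1 l)//= eqxx big1// => k /negbTE->.
by rewrite big_split/= !one.
Qed.

(* Euler's identity for the weight a: the second derivatives of a weighted
   homogeneous polynomial control its gradient, and the gradient its value. *)
Lemma euler_vanishing (r : seq (multiindex n)) (t : multiindex n -> R) (a : 'I_n -> nat) (c : nat) :
  (0 < c)%N -> (forall i, (0 < a i)%N) ->
  (forall m, m \in r -> wdot a m = c /\ (2 <= mdegree m)%N) ->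
  (forall b, mdegree b = 2%N -> \sum_(m <- r) t m * (mbinom m b)%:R = 0) ->
  forall b, (mdegree b < 2)%N -> \sum_(m <- r) t m * (mbinom m b)%:R = 0.
Proof.
move=> c0 a0 rP S2.
have S1 j : \sum_(m <- r) t m * (m j)%:R = 0.
  (* If [a j = c], a monomial of weight [c] and degree at least 2 cannot involve the j-th
     variable. *)
  have [caj|caj] := eqVneq c (a j).
    rewrite big1_seq// => m /= mr; have [am m2] := rP m mr.
    suff -> : m j = 0%N by rewrite mulr0.
    apply/eqP; rewrite -leqn0 leqNgt; apply/negP => mj.
    have : (a j * m j + \sum_(i | i != j) a i * m i = a j)%N.
      by rewrite -[RHS]caj -am /wdot [RHS](bigD1 j).
    have : (m j + \sum_(i | i != j) m i >= 2)%N by move: m2; rewrite /mdegree (bigD1 j).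
    have : (\sum_(i | i != j) m i <= \sum_(i | i != j) a i * m i)%N.
      by apply: leq_sum => i _; rewrite leq_pmull.
    have := a0 j; nia.
  (* Euler's identity for the j-th partial derivative, which is homogeneous of weight [c - a j]. *)
  suff : (c%:R - (a j)%:R) * (\sum_(m <- r) t m * (m j)%:R) = 0.
    by move/eqP; rewrite mulf_eq0 subr_eq0 eqr_nat (negbTE caj) => /eqP.
  transitivity (\sum_i (a i)%:R * (if i == j then 2 * \sum_(m <- r) t m * ('C(m j, 2))%:R
                   else \sum_(m <- r) t m * (m i * m j)%:R)).
    transitivity (\sum_(m <- r) t m * \sum_i (a i)%:R * (if i == j then 2 * ('C(m j, 2))%:R else (m i * m j)%:R)).
      rewrite mulr_sumr; apply: eq_big_seq => m mr; rewrite mulrCA; congr (_ * _).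
      rewrite -(rP m mr).1 /wdot natr_sum mulrBl mulr_suml.
      rewrite (bigD1 j)//= [RHS](bigD1 j)//= eqxx addrAC; congr (_ + _).
        rewrite -[2 * _](natrM R 2) -(mul_bin_diag (m j) 1) bin1.
        by case: (m j) => [|k]; rewrite ?(muln0, mulr0, mul0n, subr0)//= -[k.+1]addn1 !natrM natrD; ring.
      by apply: eq_bigr => i /negbTE->; rewrite !natrM mulrA.
    under eq_bigr do rewrite mulr_sumr.
    rewrite exchange_big/=; apply: eq_bigr => i _; case: eqP => _.
      by rewrite !mulr_sumr; apply: eq_bigr => m _; ring.
    by rewrite !mulr_sumr; apply: eq_bigr => m _; ring.
  rewrite big1// => i _; have [ij|ij] := eqVneq i j.
    have := S2 _ (mdegree_unit2 j); under eq_bigr do rewrite mbinom_unit2.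
    by move=> ->; rewrite !mulr0.
  have := S2 _ (mdegree_unitD i j); under eq_bigr do rewrite mbinom_unitD//.
  by move=> ->; rewrite mulr0.
move=> b; rewrite ltnS leq_eqVlt ltnS leqn0 => /orP[/eqP b1|/eqP b0].
  have [j bj] : exists j, b j != 0%N.
    apply: contrapT => no; move: b1; rewrite /mdegree big1// => i _.
    by apply/eqP/negPn/negP => h; apply: no; exists i.
  suff -> : b = unit_index j by rewrite -[RHS](S1 j); apply: eq_bigr => m _; rewrite mbinom_unit.
  move: b1; rewrite /mdegree (bigD1 j)//= => b1.
  apply/ffunP => i; rewrite ffunE; have [->|ij] := eqVneq i j.
    by move: bj b1; case: (b j) => // -[//|k]; rewrite !addSn.
  move: bj b1; rewrite (bigD1 i)//=.
  by case: (b j) => [//|k] _; case: (b i) => [//|l]; rewrite !addSn addnS.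
have -> : b = [ffun => 0%N] :> multiindex n.
  apply/ffunP => i; rewrite ffunE; move: b0; rewrite /mdegree (bigD1 i)//=.
  by move/eqP; rewrite addn_eq0 => /andP[/eqP].
suff : c%:R * (\sum_(m <- r) t m) = 0.
  move/eqP; rewrite mulf_eq0 pnatr_eq0 gtn_eqF//= => /eqP S0.
  by rewrite -[RHS]S0; apply: eq_bigr => m _; rewrite mbinom0 mulr1.
transitivity (\sum_i (a i)%:R * \sum_(m <- r) t m * (m i)%:R); last first.
  by rewrite big1// => i _; rewrite S1 mulr0.
under [RHS]eq_bigr do rewrite mulr_sumr.
rewrite exchange_big/= mulr_sumr; apply: eq_big_seq => m mr.
rewrite -(rP m mr).1 /wdot natr_sum mulr_suml; apply: eq_bigr => i _.
by rewrite natrM; ring.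
Qed.

Lemma monomial_neq0 m x : (forall i, x 0 i != 0) -> monomial m x != 0.
Proof. by move=> x0; apply/prodf_neq0 => i _; rewrite expf_neq0. Qed.

(* The coefficient of [s ^+ p] in the Newton part of H along the curve
   [s |-> (x_i * (1 + s * v_i))_i]. *)
Definition dirpart (H : 'rV[R]_n -> R) E (v : 'rV[R]_n) (p : nat) x : R :=
  \sum_(m <- E) taylor_coef H m * (line_poly m (const_mx 1) v)`_p * monomial m x.

(** By contradiction. If all radii and constants fail, [face_limit] gives a face and a point off the
    coordinate hyperplanes where the coefficients of orders 2 to [M] vanish along every direction of
    [G]. Kronecker separation kills all derivatives of these orders, Euler's identity those of
    orders 0 and 1, and the face polynomial has a zero of order above [M]. *)
Lemma direction_lower_bound (H : 'rV[R]_n -> R) E (M : nat) :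
  minimal_basis (fun a => taylor_coef H a != 0) E -> E != [::] ->
  (forall m, m \in E -> (2 <= mdegree m)%N) -> (2 <= M)%N ->
  (forall m : nat, face_zero_order H m -> (m <= M)%N) ->
  exists (G : seq 'rV[R]_n) (r c0 : R), [/\ 0 < r, 0 < c0 &
    forall x, (forall i, 0 < `|x 0 i| < r) -> exists (p : nat) v,
      [/\ (2 <= p <= M)%N, v \in G & c0 * newton_gauge E x <= `|dirpart H E v p x|]].
Proof.
move=> EP E0 E2 M2 HM; have [uE Et _ _] := EP.
(* [D] exceeds both the exponents in [E] and the orders up to [M]; [S] exceeds every exponent after
   the Kronecker substitution. *)
pose D := (M + \max_(m <- E) mdegree m).+1.
pose S := (\max_(f : {ffun 'I_n -> 'I_D}) \sum_i f i * D ^ i).+1%N.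
pose G := [seq (\row_i (kronecker_dir D s.+1 i)%:R : 'rV[R]_n) | s <- iota 0 S].
exists G; apply: contrapT => no.
pose K (l : nat * 'rV[R]_n) := (2 <= l.1 <= M)%N /\ l.2 \in G.
pose theta (l : nat * 'rV[R]_n) m := taylor_coef H m * (line_poly m (const_mx 1) l.2)`_l.1.
have [k|a [c [xi [a0 xi0 cE [m0 m0E m0c] T0]]]] := @face_limit R n E _ K theta E0.
  apply: contrapT => nok; apply: no; exists (2^-1 ^+ k), (k.+1%:R^-1); split => //.
  move=> x xr; apply: contrapT => nopv; apply: nok; exists x; split => // -[p v] [/= pM vG].
  by rewrite leNgt; apply/negP => h; apply: nopv; exists p, v; split => //; exact: ltW.
pose A := [seq m <- E | wdot a m == c].
pose t m := taylor_coef H m * monomial m xi.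
have AE m : m \in A -> m \in E /\ wdot a m = c by rewrite mem_filter => /andP[/eqP].
have mD m : m \in E -> (mdegree m < D)%N.
  move=> mE; rewrite ltnS; apply: leq_trans (leq_addl _ _).
  exact: (@leq_bigmax_seq _ E xpredT (@mdegree n)).
have mi m i : (m i <= mdegree m)%N by rewrite /mdegree (bigD1 i)//= leq_addr.
have S0 p (f : {ffun 'I_n -> 'I_D}) : (2 <= p <= M)%N -> (\sum_i f i = p)%N ->
    \sum_(m <- A) t m * (mbinom m (fun i => f i))%:R = 0.
  move=> pM; apply: (@kronecker_separation D S (fun f => \sum_(m <- A) t m * (mbinom m (fun i => f i))%:R)).
    move=> g; rewrite ltnS.
    exact: (@leq_bigmax _ (fun g : {ffun 'I_n -> 'I_D} => \sum_i g i * D ^ i)%N g).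
  move=> s sS; have vG : (\row_i (kronecker_dir D s.+1 i)%:R : 'rV[R]_n) \in G.
    by apply: map_f; rewrite mem_iota.
  have := T0 (p, _) (conj pM vG); rewrite -big_filter -/A /theta/= => T0'.
  rewrite -[RHS]T0' -[RHS]/(\sum_(m <- A) _).
  rewrite (eq_big_seq (fun m => \sum_(f : {ffun 'I_n -> 'I_D} | (\sum_i f i == p)%N)
     (t m * (mbinom m (fun i => f i))%:R) * (\prod_i kronecker_dir D s.+1 i ^ f i)%:R)); last first.
    move=> m mA; rewrite (@line_poly1_coef D); last first.
      by move=> i; apply: leq_ltn_trans (mi m i) _; apply: mD; exact: (AE m mA).1.
    rewrite mulrAC -/(t m) mulr_sumr; apply: eq_bigr => g _.
    by rewrite natrM mulrA.
  by rewrite exchange_big/=; apply: eq_bigr => g _; rewrite mulr_suml.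
have Sb b : (2 <= mdegree b <= M)%N -> \sum_(m <- A) t m * (mbinom m b)%:R = 0.
  move=> bM; have bD i : (b i < D)%N.
    by rewrite ltnS; apply: leq_trans (mi b i) _; apply: leq_trans (leq_addr _ _); case/andP: bM.
  have := S0 _ [ffun i => Ordinal (bD i)] bM; under eq_bigr do rewrite ffunE.
  move=> /(_ erefl) e; rewrite -[RHS]e; apply: eq_bigr => m _; congr (_ * _%:R).
  by apply: eq_bigr => i _; rewrite ffunE.
have c0 : (0 < c)%N.
  rewrite -m0c; apply: leq_trans (_ : (mdegree m0 <= _)%N); first by rewrite ltnW// E2.
  by apply: leq_sum => i _; rewrite leq_pmull.
have Sall b : (mdegree b <= M)%N -> \sum_(m <- A) t m * (mbinom m b)%:R = 0.
  move=> bM; have [b2|b2] := leqP 2 (mdegree b); first by apply: Sb; rewrite b2.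
  apply: (euler_vanishing c0 a0 _ _ b2).
    by move=> m /AE[mE mc]; split => //; exact: E2.
  by move=> b' b'2; apply: Sb; rewrite b'2 M2.
pose F := [set x | newton_polyhedron H x /\ dotp (\row_i (a i)%:R) x = c%:R].
have FE : face_poly H F = fun x => \sum_(m <- A) taylor_coef H m * monomial m x.
  apply/funext => x; rewrite big_filter.
  by apply: exposed_face_poly => //; exists m0.
have key b : (mpartial b (face_poly H F) xi == 0) = (\sum_(m <- A) t m * (mbinom m b)%:R == 0).
  have := mpartial_comb_binom A (taylor_coef H) b xi; rewrite -FE => /(congr1 (fun y => y == 0)).
  rewrite !mulf_eq0 => e; have : (monomial b xi == 0) = false.
    by apply/negbTE; exact: monomial_neq0.
  move: e => /[swap] ->; rewrite orbF => ->.
  suff -> : ((\prod_i (b i)`!)%N%:R == 0 :> R) = false by [].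
  by apply/negbTE; rewrite pnatr_eq0 -lt0n prodn_gt0// => i; exact: fact_gt0.
have Axne : A != [::].
  have : m0 \in A by rewrite mem_filter m0c eqxx.
  by case: (A).
(* For an exponent of largest degree on the face, the derivative of that same multi-index isolates
   its coefficient; hence the order of the zero is finite. *)
have [mm mmA mmax] : exists2 mm, mm \in A & forall m, m \in A -> (mdegree m <= mdegree mm)%N.
  have [mm mmA h] := exists_argmin (fun m => \max_(m' <- E) mdegree m' - mdegree m)%N Axne.
  exists mm => // m mA; have := h m mA.
  have le_max u : u \in A -> (mdegree u <= \max_(m' <- E) mdegree m')%N.
    by move=> /AE[uE' _]; exact: (@leq_bigmax_seq _ E xpredT (@mdegree n)).
  have := le_max m mA; have := le_max mm mmA; lia.
have exb : exists l : nat, `[<exists b, mdegree b = l /\ mpartial b (face_poly H F) xi != 0>].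
  exists (mdegree mm); apply/asboolP; exists mm; split => //.
  rewrite key (bigD1_seq mm) ?filter_uniq//= big1_seq ?addr0.
    rewrite mulf_neq0//.
      by rewrite mulf_neq0 ?Et ?(AE _ mmA).1// monomial_neq0.
    by rewrite pnatr_eq0 -lt0n prodn_gt0// => i; rewrite binn.
  move=> m /andP[mmm mA]; suff -> : mbinom m mm = 0%N by rewrite mulr0.
  have [i mi'] : exists i, (m i < mm i)%N.
    apply: contrapT => nolt; move/eqP : mmm; apply; apply/esym; apply: mle_degree_eq.
      by apply/mleP => i; rewrite leqNgt; apply/negP => h; apply: nolt; exists i.
    exact: mmax.
  by rewrite /mbinom (bigD1 i)//= bin_small.
case: (ex_minnP exb) => l /asboolP[b [bl bn0]] lmin.
have Ml : (M < l)%N.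
  rewrite ltnNge; apply/negP => lM; move/negP : bn0; apply.
  by rewrite key; apply/eqP; apply: Sall; rewrite bl.
have : face_zero_order H l.
  exists F, xi; split => //.
  - by apply: (exposed_face_compact EP a0 cE); exists m0.
  - have d0 : (mdegree ([ffun => 0%N] : multiindex n) <= M)%N.
      by rewrite /mdegree big1// => i _; rewrite ffunE.
    rewrite FE -[RHS](Sall _ d0).
    by apply: eq_bigr => m _; rewrite mbinom0 mulr1.
  split; first by exists b.
  move=> b' b'l; apply/eqP/negPn/negP => h; have : (l <= mdegree b')%N.
    by apply: lmin; apply/asboolP; exists b'.
  by rewrite leqNgt b'l.
by move=> /HM; rewrite leqNgt Ml.
Qed.

End directions.

(** * Oscillatory integrals over boxes *)

Section line_integrals.
Context {R : realType}.
Implicit Types (a b t : R) (f : R -> R).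
Local Notation lm := (@lebesgue_measure R).

Lemma continuous_antiderivative a b f : a <= b ->
  (forall t, t \in `[a, b] -> {for t, continuous f}) ->
  exists2 Phi, antiderivative a b Phi f & (\int[lm]_(t in `[a, b]) f t)%R = Phi b - Phi a.
Proof.
move=> ab cf.
have intf : lm.-integrable `[a, b] (EFin \o f).
  apply: (@continuous_compact_integrable R f `[a, b]%classic); first exact: segment_compact.
  by apply: continuous_in_subspaceT => x; rewrite inE; exact: cf.
exists (fun x => (\int[lm]_(t in `[a, x]) f t)%R); last first.
  by rewrite set_itv1 Rintegral_set1 subr0.
split; first exact: parameterized_integral_continuous.
move=> x; rewrite in_itv/= => /andP[ax xb].
have cx : {for x, continuous f} by apply: cf; rewrite in_itv/= !ltW.
have [dF <-] := @continuous_FTC1_closed R f a x b xb intf ax cx.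
by rewrite derive1E; exact: derivableP.
Qed.

Lemma oscillatory_integral (p : nat) : (1 < p)%N ->
  exists2 K : R, 0 < K & forall a b F (L : R) (A dA : R -> R) (M M' : R), a <= b -> 0 < L ->
    derivative_chain a b p F -> (forall t, t \in `[a, b] -> L <= `|F p t|) ->
    (forall t, t \in `[a, b] -> is_derive t 1 A (dA t)) ->
    (forall t, t \in `[a, b] -> `|A t| <= M) ->
    (forall t, t \in `[a, b] -> `|dA t| <= M') ->
    `|(\int[lm]_(t in `[a, b]) (cos (F 0%N t) * A t))%R| <=
      K * L `^ (- p%:R^-1) * (M + M' * (b - a)).
Proof.
move=> p1; have [K K0 HK] := @van_der_corput_norm R p p1; exists K => //.
move=> a b F L A dA M M' ab L0 cF LF dA' AM dAM.
have cF0 t : t \in `[a, b] -> {for t, continuous (fun t => cos (F 0%N t))}.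
  move=> tab; have [dF _] := cF 0%N t (leq0n _) tab.
  apply: (@continuous_comp _ _ _ (F 0%N) cos); last exact: continuous_cos.
  exact/differentiable_continuous/derivable1_diffP.
have cA t : t \in `[a, b] -> {for t, continuous A}.
  by move=> /dA'[dAt _]; exact/differentiable_continuous/derivable1_diffP.
have [Phi PhiP _] := continuous_antiderivative ab cF0.
have cFA t : t \in `[a, b] -> {for t, continuous (fun t => cos (F 0%N t) * A t)}.
  by move=> tab; apply: cvgM; [exact: cF0|exact: cA].
have [Psi PsiP ->] := continuous_antiderivative ab cFA.
apply: (amplitude_bound ab PhiP PsiP dA' AM dAM) => t; rewrite in_itv/= => /andP[at_ tb].
apply: (HK a t F L Phi) => //.
- by apply: (derivative_chainW _ _ _ cF).
- exact: (antiderivativeW _ _ PhiP).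
- by move=> s; rewrite in_itv/= => /andP[as_ st]; apply: LF; rewrite in_itv/= as_ (le_trans st).
Qed.

Lemma nonstationary_integral a b F (L B : R) (A dA : R -> R) (M M' : R) : a <= b -> 0 < L ->
    derivative_chain a b 1 F -> (forall t, t \in `[a, b] -> L <= `|F 1%N t|) ->
    (forall t, t \in `[a, b] -> `|F 2%N t| <= B) ->
    (forall t, t \in `[a, b] -> is_derive t 1 A (dA t)) ->
    (forall t, t \in `[a, b] -> `|A t| <= M) ->
    (forall t, t \in `[a, b] -> `|dA t| <= M') ->
    `|(\int[lm]_(t in `[a, b]) (cos (F 0%N t) * A t))%R| <=
      (2 / L + B / L ^+ 2 * (b - a)) * (M + M' * (b - a)).
Proof.
move=> ab L0 cF LF BF dA' AM dAM.
have cF0 t : t \in `[a, b] -> {for t, continuous (fun t => cos (F 0%N t))}.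
  move=> tab; have [dF _] := cF 0%N t (leq0n _) tab.
  apply: (@continuous_comp _ _ _ (F 0%N) cos); last exact: continuous_cos.
  exact/differentiable_continuous/derivable1_diffP.
have cA t : t \in `[a, b] -> {for t, continuous A}.
  by move=> /dA'[dAt _]; exact/differentiable_continuous/derivable1_diffP.
have [Phi PhiP _] := continuous_antiderivative ab cF0.
have cFA t : t \in `[a, b] -> {for t, continuous (fun t => cos (F 0%N t) * A t)}.
  by move=> tab; apply: cvgM; [exact: cF0|exact: cA].
have [Psi PsiP ->] := continuous_antiderivative ab cFA.
have B0 : 0 <= B by apply: le_trans (BF a _); rewrite // in_itv/= lexx.
apply: (amplitude_bound ab PhiP PsiP dA' AM dAM) => t; rewrite in_itv/= => /andP[at_ tb].
apply: (@le_trans _ _ (2 / L + (B / L ^+ 2 * t - B / L ^+ 2 * a))); last first.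
  by rewrite lerD2l -mulrBr ler_wpM2l ?divr_ge0 ?exprn_ge0 ?(ltW L0)// lerD2r.
apply: (@nonstationary_phase R a t F L Phi (fun t => B / L ^+ 2 * t) (fun=> B / L ^+ 2)) => //.
- by apply: (derivative_chainW _ _ _ cF).
- exact: (antiderivativeW _ _ PhiP).
- by move=> s; rewrite in_itv/= => /andP[as_ st]; apply: LF; rewrite in_itv/= as_ (le_trans st).
- apply: antiderivative_of_derive => s _.
  by apply: is_derive_eq; rewrite /GRing.scale/= mulr1.
- move=> s; rewrite in_itv/= => /andP[as_ st].
  have sab : s \in `[a, b] by rewrite in_itv/= !ltW//= (lt_le_trans st).
  rewrite ler_pM ?invr_ge0 ?sqr_ge0 ?BF//.
  have h := LF s sab; have F0 : 0 < F 1%N s ^+ 2.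
    by rewrite exprn_even_gt0//= -normr_gt0 (lt_le_trans L0).
  rewrite lef_pV2 ?posrE ?F0 ?(exprn_gt0 _ L0)//.
  by rewrite -[leRHS]real_normK ?num_real// lerXn2r ?nnegrE// ltW.
Qed.

(** A line meets a half-open box in an interval whose ends may or may not belong to it. Affine
    inequalities pass to the closed interval, and the integral does not see the ends. *)
Lemma interval_hull (J : set R) : is_interval J -> J `<=` `[0, 1] -> J !=set0 ->
  exists a b, [/\ a <= b, 0 <= a, b <= 1,
    forall al be ga : R, (forall t, J t -> al + be * t <= ga) ->
      forall t, t \in `[a, b] -> al + be * t <= ga &
    forall f, lm.-integrable `[a, b] (EFin \o f) ->
      (\int[lm]_(t in `[0%R, 1%R]) (f \_ J) t)%R = (\int[lm]_(t in `[a, b]) f t)%R].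
Proof.
move=> iJ J01 [t0 Jt0].
have lbJ : has_lbound J by exists 0 => t /J01/=; rewrite in_itv/= => /andP[].
have ubJ : has_ubound J by exists 1 => t /J01/=; rewrite in_itv/= => /andP[].
have sJ : has_sup J by split => //; exists t0.
have infJ t : J t -> inf J <= t by move=> Jt; exact: ge_inf.
have supJ t : J t -> t <= sup J by move=> Jt; exact: ub_le_sup.
exists (inf J), (sup J); split.
- exact: le_trans (infJ _ Jt0) (supJ _ Jt0).
- by apply: lb_le_inf; [exists t0|move=> t /J01/=; rewrite in_itv/= => /andP[]].
- by apply: ge_sup; [exists t0|move=> t /J01/=; rewrite in_itv/= => /andP[]].
- move=> al be ga H t; rewrite in_itv/= => /andP[it ts].
  have [be0|be0|be0] := ltgtP be 0.
  + apply: (@le_trans _ _ (al + be * inf J)).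
      by rewrite lerD2l ler_wnM2l// ltW.
    rewrite -lerBrDl -ler_ndivrMl//; apply: lb_le_inf; first by exists t0.
    by move=> s /H h; rewrite ler_ndivrMl// lerBrDl.
  + apply: (@le_trans _ _ (al + be * sup J)).
      by rewrite lerD2l ler_wpM2l// ltW.
    rewrite -lerBrDl -ler_pdivlMl//; apply: ge_sup; first by exists t0.
    by move=> s /H h; rewrite ler_pdivlMl// lerBrDl.
  + by have := H _ Jt0; rewrite be0 !mul0r.
- move=> f intf; rewrite -Rintegral_mkcondr.
  rewrite setIidr//.
  have JE : J = [set` Interval (BSide `[<J (inf J)>] (inf J)) (BSide (~~ `[<J (sup J)>]) (sup J))].
    by have := (is_intervalP J).1 iJ; rewrite /Rhull (asboolT lbJ) (asboolT ubJ).
  rewrite [in LHS]JE; set b1 := `[<_>]; set b2 := ~~ _.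
  have sub c d : lm.-integrable [set` Interval (BSide c (inf J)) (BSide d (sup J))] (EFin \o f).
    apply: integrableS intf => // t /=; rewrite !itv_boundlr/= => /andP[h1 h2].
    by apply/andP; split; [apply: le_trans h1|apply: (le_trans h2)]; rewrite bnd_simp; case: (c); case: (d).
  have -> : (\int[lm]_(t in [set` Interval (BSide b1 (inf J)) (BSide b2 (sup J))]) f t)%R =
      (\int[lm]_(t in [set` Interval (BLeft (inf J)) (BSide b2 (sup J))]) f t)%R.
    by case: (b1) (sub b1 b2) => // i; rewrite Rintegral_itv_obnd_cbnd.
  by case: (b2) (sub true b2) => // i; rewrite Rintegral_itv_bndo_bndc.
Qed.

End line_integrals.

(** * Bounds along lines give bounds on boxes *)

Section box_average.
Context {R : realType} {n : nat}.
Implicit Types (x : 'rV[R]_n) (f : 'rV[R]_n -> R) (l u : 'I_n -> R) (w : 'rV[R]_n).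
Local Notation lm := (@lebesgue_measure R).
Local Notation tup := (n.-tuple (measurableTypeR R)).
Local Notation mu := (@lebesgue_tuple R n).

Definition tuple_box l u : set tup := [set t | forall i, (tnth t i : R) \in `[l i, u i[].

Definition closed_box l u : set 'rV[R]_n := [set x | forall i, l i <= x 0 i <= u i].

Lemma measurable_tuple_box_co l u : measurable (tuple_box l u).
Proof. exact: (@measurable_tuple_box R n (fun i => `[l i, u i[)). Qed.

Lemma lebesgue_tuple_box_fin (a b : 'I_n -> R) : (forall i, a i <= b i) ->
  let Q := [set t : tup | forall i, (tnth t i : R) \in `[a i, b i]] in
  (mu Q < +oo)%E /\ fine (mu Q) <= \prod_i (b i - a i).
Proof.
move=> ab Q; have h : (mu Q <= (\prod_i (b i - a i))%:E)%E.
  apply: (@lebesgue_tuple_box_le R n (fun i => `[a i, b i])) => i.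
  by rewrite lebesgue_measure_itv/= lte_fin -EFinB; case: ifPn => //; rewrite lee_fin subr_ge0 ab.
have Qoo : (mu Q < +oo)%E by apply: le_lt_trans h _; rewrite ltry.
by split => //; rewrite -lee_fin fineK// ge0_fin_numE.
Qed.

(** The box is convex, so a segment in direction [w] meets it in an interval and the sharp cutoff
    does no harm. The average runs over points within [w] of the box, which lengthens each side by
    [2 * |w_i|]. *)
Lemma box_average f l u w (A0 K : R) : measurable_fun [set: tup] (f \o @row_of_tuple R n) ->
  (forall x, `|f x| <= A0) -> 0 <= K -> (forall i, l i <= u i) ->
  (forall x, closed_box l u x -> {for x, continuous f}) ->
  (forall x (a b : R), a <= b -> 0 <= a -> b <= 1 ->
    (forall t : R, t \in `[a, b] -> closed_box l u (x + t *: w)) ->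
    `|(\int[lm]_(t in `[a, b]) f (x + t *: w))%R| <= K) ->
  `|(\int[mu]_t (f (row_of_tuple t) * \1_(tuple_box l u) t))%R| <=
    K * \prod_i (u i - l i + 2 * `|w 0 i|).
Proof.
move=> mf fA K0 lu cf HK.
have A00 : 0 <= A0 by apply: le_trans (fA 0).
pose a i := l i - `|w 0 i|; pose b i := u i + `|w 0 i|.
have ab i : a i <= b i by rewrite /a /b lerD// ge0_cp.
have [Qoo Qle] := lebesgue_tuple_box_fin ab; set Q := (X in mu X) in Qoo Qle.
have -> : \prod_i (u i - l i + 2 * `|w 0 i|) = \prod_i (b i - a i).
  by apply: eq_bigr => i _; rewrite /a /b; ring.
apply: (@le_trans _ _ (K / 1 * fine (mu Q))); last by rewrite divr1 ler_wpM2l.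
have row_tshift (x : tup) (t : R) : row_of_tuple (tshift (fun i => t * w 0 i) x) = row_of_tuple x + t *: w :> 'rV[R]_n.
  by apply/rowP => i; rewrite !mxE tnth_tshift.
apply: (@translation_average R n _ (fun i => w 0 i) Q 1 K A0) => //.
- by apply: measurable_funM => //; exact: measurable_indic (measurable_tuple_box_co l u).
- move=> x; rewrite normrM indicE; case: (_ \in _); rewrite ?normr1 ?normr0 ?mulr1 ?mulr0//.
- exact: (@measurable_tuple_box R n (fun i => `[a i, b i])).
- move=> x t /andP[t0 t1]; rewrite mulf_eq0 negb_or indicE => /andP[_].
  case: (boolP (_ \in _)) => [|_]; last by rewrite eqxx.
  rewrite inE => bx _ i; have := bx i; rewrite /= tnth_tshift !in_itv/= => /andP[h1 h2].
  have : `|t * w 0 i| <= `|w 0 i| by rewrite normrM ger0_norm// ler_piMl.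
  by rewrite ler_norml /a /b => /andP[h3 h4]; apply/andP; split; lra.
move=> x _.
pose g t := f (row_of_tuple x + t *: w).
pose J := [set t : R | 0 <= t <= 1 /\ forall i, l i <= tnth x i + t * w 0 i < u i].
have -> : (\int[lm]_(t in `[0%R, 1%R])
     (f (row_of_tuple (tshift (fun i => t * w 0 i) x)) *
      \1_(tuple_box l u) (tshift (fun i => t * w 0 i) x)))%R = (\int[lm]_(t in `[0%R, 1%R]) (g \_ J) t)%R.
  apply: eq_Rintegral => t; rewrite inE/= in_itv/= => t01.
  rewrite row_tshift indicE patchE -/(g t).
  suff -> : (tshift (fun i => t * w 0 i) x \in tuple_box l u) = (t \in J).
    by case: (t \in J); rewrite ?mulr1 ?mulr0.
  apply/idP/idP; rewrite !inE.
    by move=> h; split => // i; have := h i; rewrite tnth_tshift in_itv.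
  by move=> [_ h] i; have := h i; rewrite tnth_tshift in_itv.
have [J0|/set0P J0] := eqVneq J set0.
  rewrite (_ : (\int[lm]_(t in `[0%R, 1%R]) (g \_ J) t)%R = 0) ?normr0//.
  by rewrite -Rintegral_mkcondr J0 setI0 /Rintegral integral_set0.
have iJ : is_interval J.
  move=> s t [s01 hs] [t01 ht] v /andP[sv vt]; split; first by move: s01 t01; lra.
  move=> i; have := hs i; have := ht i.
  have [w0|w0] := leP 0 (w 0 i).
    have : s * w 0 i <= v * w 0 i by rewrite ler_wpM2r.
    have : v * w 0 i <= t * w 0 i by rewrite ler_wpM2r.
    by move=> *; lra.
  have : v * w 0 i <= s * w 0 i by rewrite ler_wnM2r// ltW.
  have : t * w 0 i <= v * w 0 i by rewrite ler_wnM2r// ltW.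
  by move=> *; lra.
have J01 : J `<=` `[0, 1] by move=> t [t01 _]; rewrite /= in_itv.
have [c [d [cd c0 d1 aff intE]]] := interval_hull iJ J01 J0.
have clb t : t \in `[c, d] -> closed_box l u (row_of_tuple x + t *: w).
  move=> tcd i; rewrite !mxE; apply/andP; split.
    have := @aff (- tnth x i) (- w 0 i) (- l i) _ t tcd.
    rewrite mulNr -opprD lerN2 mulrC; apply => s [_ /(_ i)].
    by rewrite mulNr -opprD lerN2 mulrC => /andP[].
  have := @aff (tnth x i) (w 0 i) (u i) _ t tcd.
  by rewrite mulrC; apply => s [_ /(_ i)] /andP[_ /ltW]; rewrite mulrC.
rewrite intE; first exact: HK.
have cg t : t \in `[c, d] -> {for t, continuous g}.
  move=> /clb /cf cft; apply: (@continuous_comp _ _ _ (fun t : R => row_of_tuple x + t *: w) f) => //.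
  apply: cvgD; first exact: cvg_cst.
  by apply: cvgZ; [exact: cvg_id|exact: cvg_cst].
apply: (@continuous_compact_integrable R g `[c, d]%classic); first exact: segment_compact.
by apply: continuous_in_subspaceT => t; rewrite inE; exact: cg.
Qed.

End box_average.

(** * Directional derivatives on a whole box *)

Section box_derivative.
Context {R : realType} {n : nat}.
Implicit Types (x X w v : 'rV[R]_n) (m : multiindex n) (E : seq (multiindex n)).
Local Notation D s f := (foldr (@partial R n R) f s).

(** With [u] in the cube [[1, tau]^n] this parametrizes the box with corner [X], uniformly in its
    size and shape. *)
Definition mxscale X (u : 'rV[R]_n) : 'rV[R]_n := \row_i (X 0 i * u 0 i).

Lemma line_poly_scale m X (u : 'rV[R]_n) v p :
  (line_poly m (mxscale X u) (mxscale X v))`_p = monomial m X * (line_poly m u v)`_p.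
Proof.
rewrite -coefCM; congr (_`_p).
have term i : (mxscale X v 0 i *: 'X + (mxscale X u 0 i)%:P) ^+ m i =
    (X 0 i ^+ m i)%:P * (v 0 i *: 'X + (u 0 i)%:P) ^+ m i :> {poly R}.
  by rewrite !mxE rmorphXn/= -exprMn mulrDr -polyCM mul_polyC scalerA.
by rewrite /line_poly (eq_bigr _ (fun i _ => term i)) big_split /monomial rmorph_prod.
Qed.

Lemma continuous_line_poly_coef m v p : continuous (fun u : 'rV[R]_n => (line_poly m u v)`_p).
Proof.
have -> : (fun u : 'rV[R]_n => (line_poly m u v)`_p) =
    (fun u => (p`!%:R)^-1 * iter p (dirD v) (monomial m) u).
  apply/funext => u; rewrite deriv_iter_monomial_coef -[X in _ * X]mulr_natl mulKf//.
move=> u; have h : {for u, continuous (iter p (dirD v) (monomial m))}.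
  by have [] := @smooth_deriv_iter R n setT (monomial m) v p openT (@smooth_monomial R n m) [::] u I.
exact: (@cvgM R _ (nbhs (u : 'rV[R]_n)) (nbhs_filter u) (fun=> _) _ _ _ (cvg_cst _) h).
Qed.

Lemma newton_gauge_scale E X (u : 'rV[R]_n) (tau : R) : 1 <= tau -> (forall i, 0 <= (u : 'rV[R]_n) 0 i <= tau) ->
  newton_gauge E (mxscale X u) <= tau ^+ (\max_(m <- E) mdegree m) * newton_gauge E X.
Proof.
move=> tau1 u0; rewrite /newton_gauge mulr_sumr big_seq [leRHS]big_seq; apply: ler_sum => m mE.
have -> : monomial m (mxscale X u) = monomial m u * monomial m X.
  by rewrite /monomial -big_split; apply: eq_bigr => i _ /=; rewrite mxE exprMn mulrC.
rewrite normrM ler_wpM2r//; apply: (@le_trans _ _ (tau ^+ mdegree m)).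
  apply: norm_monomial_le; apply: norm_le_coord => [|i]; first exact: le_trans tau1.
  by have /andP[h1 h2] := u0 i; rewrite ger0_norm.
by rewrite ler_weXn2l//; exact: (@leq_bigmax_seq _ E xpredT (@mdegree n)).
Qed.

(** Order and direction are chosen at the corner and must serve the whole box. Moving [u] away from
    1 costs at most [c0 / 2] if [tau] is close to 1, and the remainder at most [c0 / 4] if [eps] is
    small; this leaves [c0 / 4]. *)
Lemma box_derivative_lower_bound (V : set 'rV[R]_n) (H : 'rV[R]_n -> R) E (M : nat)
    (G : seq 'rV[R]_n) (r c0 eps0 : R) :
  uniq E -> open V -> smooth_on V H -> (forall x, `|x| <= eps0 -> V x) -> remainder_estimate H E ->
  0 < r -> 0 < c0 -> 0 < eps0 ->
  (forall x, (forall i, 0 < `|x 0 i| < r) -> exists (p : nat) v,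
      [/\ (2 <= p <= M)%N, v \in G & c0 * newton_gauge E x <= `|dirpart H E v p x|]) ->
  exists tau eps c1 Wm : R, [/\ 1 < tau, 0 < eps <= eps0, 0 < c1, 0 <= Wm &
    forall X, (forall i, 0 < `|X 0 i|) -> (forall i, `|X 0 i| * tau <= eps) ->
    exists (p : nat) w, [/\ (2 <= p <= M)%N, forall i, `|w 0 i| <= Wm * `|X 0 i| &
      forall u : 'rV[R]_n, (forall i, 1 <= u 0 i <= tau) ->
        c1 * newton_gauge E X <= `|iter p (dirD w) H (mxscale X u)| ]].
Proof.
move=> uE oV sH epsV HR r0 c00 eps00 HG.
have [Cr [rr [Cr0 rr0 HCr]]] := HR M.
pose Wm := \sum_(v <- G) `|v|.
have Wm0 : 0 <= Wm by apply: sumr_ge0.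
have GW v : v \in G -> `|v| <= Wm.
  rewrite /Wm; elim: (G) => // v' s IH; rewrite inE big_cons => /predU1P[->|/IH h].
    by rewrite lerDl sumr_ge0.
  by apply: le_trans h _; rewrite lerDr.
pose T := \sum_(m <- E) `|taylor_coef H m|.
have T0 : 0 <= T by apply: sumr_ge0.
(* A change by [eta] in every line coefficient changes the weighted sum by at most [T * eta] times
   the gauge, below [c0 / 2]. *)
pose eta := c0 / (2 * (T + 1)).
have eta0 : 0 < eta by rewrite divr_gt0// mulr_gt0// ltr_wpDl.
pose one : 'rV[R]_n := const_mx 1.
(* Only finitely many functions of [u] are concerned, so one [tau] serves all boxes. *)
have near1 : \forall u \near one, forall l, l \in [seq (l, p) | l <- [seq (m, v) | m <- E, v <- G], p <- iota 0 M.+1] ->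
    `|(line_poly l.1.1 one l.1.2)`_l.2 - (line_poly l.1.1 u l.1.2)`_l.2| < eta.
  apply: filter_all_seq => -[[m v] p] _ /=.
  have := @continuous_line_poly_coef m v p one => /cvgrPdist_lt/(_ eta eta0); exact.
have /nbhs_ballP[d /= d0 Hd] := near1.
pose tau := 1 + Num.min 1 (d / 2).
have tau1 : 1 < tau by rewrite ltrDl lt_min ltr01 divr_gt0.
have tau2 : tau <= 2 by rewrite /tau -[leRHS]/(1 + 1) lerD2l ge_min lexx.
have taud : tau < 1 + d by rewrite ltrD2l gt_min orbC ltr_pdivrMr// ltr_pMr// ltr1n.
(* [K] collects the losses in the remainder: the number of words, the size of the direction relative
   to the corner, the constant of the estimate, and the growth of the gauge across a box with
   [tau <= 2]. *)
pose K := (n.+1%:R * (Wm + 1)) ^+ M * Cr * 2 ^+ (\max_(m <- E) mdegree m).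
have K0 : 0 < K.
  by rewrite !mulr_gt0 ?exprn_gt0// mulr_gt0// ltr_wpDl.
pose eps := Num.min (Num.min eps0 (rr / 2)) (Num.min (r / 2) (c0 / (4 * K))).
have eps_gt0 : 0 < eps by rewrite !lt_min eps00 !divr_gt0// mulr_gt0.
exists tau, eps, (c0 / 4), Wm; split => //.
- by rewrite eps_gt0 !ge_min lexx.
- by rewrite divr_gt0.
move=> X X0 Xe.
have Xr i : 0 < `|X 0 i| < r.
  rewrite X0/=; apply: (@le_lt_trans _ _ (`|X 0 i| * tau)); first by rewrite ler_peMr// ltW.
  apply: le_lt_trans (Xe i) _; apply: (@le_lt_trans _ _ (r / 2)).
    by rewrite !ge_min lexx !orbT.
  by rewrite ltr_pdivrMr// ltr_pMr// ltr1n.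
have [p [v [p2M vG HX]]] := HG X Xr; have [p2 pM] := andP p2M.
exists p, (mxscale X v); split => // [i|u u1].
  by rewrite mxE normrM mulrC ler_wpM2r//; apply: le_trans (coord_le_norm v i) (GW v vG).
set x := mxscale X u.
have xX i : `|X 0 i| <= `|x 0 i| <= `|X 0 i| * tau.
  have /andP[h1 h2] := u1 i; have ui : 0 <= u 0 i by apply: le_trans h1.
  by rewrite mxE normrM (ger0_norm ui) ler_peMr//= ler_wpM2l.
have xe : `|x| <= eps.
  by apply: norm_le_coord => [|i]; [exact: ltW|have /andP[_ h] := xX i; exact: le_trans h (Xe i)].
have Vx : V x by apply: epsV; apply: le_trans xe _; rewrite !ge_min lexx.
have xrr : `|x| < rr.
  apply: le_lt_trans xe _; apply: (@le_lt_trans _ _ (rr / 2)); first by rewrite !ge_min lexx !orbT.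
  by rewrite ltr_pdivrMr// ltr_pMr// ltr1n.
have gX0 : 0 <= newton_gauge E X := newton_gauge_ge0 E X.
have sP : smooth_on V (newton_part H E) by apply: smooth_subset (smooth_newton_part H E).
pose Rm y := H y - newton_part H E y.
have sR : smooth_on V Rm by exact: (@smooth_sub R n V H (newton_part H E) oV sH sP).
set w := mxscale X v.
have split_H : iter p (dirD w) H x = iter p (dirD w) (newton_part H E) x + iter p (dirD w) Rm x.
  pose FF (b : bool) := if b then newton_part H E else Rm.
  have sF b : smooth_on V (FF b) by case: b; [exact: sP|exact: sR].
  have := @deriv_iter_lin R n V bool [:: true; false] (fun=> 1) FF w p x oV sF Vx.
  rewrite !big_cons !big_nil/= !mul1r addr0 => <-; congr (iter p _ _ x).
  by apply/funext => y; rewrite !big_cons !big_nil/= !mul1r addr0 /Rm addrC subrK.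
have main : c0 / 2 * newton_gauge E X <= `|iter p (dirD w) (newton_part H E) x|.
  have -> : iter p (dirD w) (newton_part H E) x =
      (p`!)%:R * \sum_(m <- E) taylor_coef H m * (line_poly m u v)`_p * monomial m X.
    rewrite (@deriv_iter_lin R n setT _ E (taylor_coef H) (@monomial R n) w p x openT)//; last first.
      by move=> m; exact: smooth_monomial.
    rewrite mulr_sumr; apply: eq_bigr => m _.
    rewrite deriv_iter_monomial_coef line_poly_scale -mulr_natl; ring.
  apply: (@le_trans _ _ `|\sum_(m <- E) taylor_coef H m * (line_poly m u v)`_p * monomial m X|); last first.
    by rewrite normrM ler_peMl// normr_nat ler1n fact_gt0.
  have diff_le : `|dirpart H E v p X - \sum_(m <- E) taylor_coef H m * (line_poly m u v)`_p * monomial m X|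
      <= c0 / 2 * newton_gauge E X.
    rewrite /dirpart -sumrB; apply: (@le_trans _ _ (\sum_(m <- E) `|taylor_coef H m| * (eta * newton_gauge E X))).
      apply: le_trans (ler_norm_sum _ _ _) _; rewrite big_seq [leRHS]big_seq; apply: ler_sum => m mE.
      rewrite -mulrBl -mulrBr 2!normrM -mulrA ler_wpM2l// ler_pM//.
        apply: ltW; apply: (Hd u _ (m, v, p)); last first.
          have pI : p \in iota 0 M.+1 by rewrite mem_iota add0n ltnS pM.
          exact: (allpairs_f (fun l p => (l, p)) (allpairs_f (fun m v => (m, v)) mE vG) pI).
        rewrite -ball_normE /= -normrN opprB; apply: norm_lt_coord => // i.
        have /andP[h1 h2] := u1 i; rewrite !mxE ger0_norm ?subr_ge0// ltrBlDl.
        exact: le_lt_trans taud.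
      exact: monomial_le_gauge.
    rewrite -mulr_suml -/T mulrA ler_wpM2r// /eta mulrA ler_pdivrMr ?mulr_gt0 ?ltr_wpDl//.
    have -> : c0 / 2 * (2 * (T + 1)) = T * c0 + c0 by field.
    by rewrite lerDl ltW.
  have := ler_normD (dirpart H E v p X - \sum_(m <- E) taylor_coef H m * (line_poly m u v)`_p * monomial m X)
    (\sum_(m <- E) taylor_coef H m * (line_poly m u v)`_p * monomial m X).
  by rewrite subrK; move: HX diff_le; lra.
have gx : newton_gauge E x <= 2 ^+ (\max_(m <- E) mdegree m) * newton_gauge E X.
  apply: newton_gauge_scale; first by rewrite ler1n.
  by move=> i; have /andP[h1 h2] := u1 i; rewrite (le_trans ler01 h1) (le_trans h2 tau2).
have rem : `|iter p (dirD w) Rm x| <= c0 / 4 * newton_gauge E X.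
  apply: (@le_trans _ _ (n%:R ^+ p * ((Wm + 1) ^+ M * (Cr * `|x| * newton_gauge E x)))).
    apply: (@deriv_iter_bound R n V Rm w p x _ oV sR Vx) => s sp.
    have wx : `|\prod_(i <- s) w 0 i| <= (Wm + 1) ^+ M * `|\prod_(i <- s) x 0 i|.
      apply: (@le_trans _ _ ((Wm + 1) ^+ size s * `|\prod_(i <- s) x 0 i|)); last first.
        by rewrite ler_wpM2r// ler_weXn2l ?sp// lerDr.
      rewrite !normr_prod; elim: s {sp} => [|i s IH]; first by rewrite !big_nil expr0 mulr1.
      rewrite !big_cons/= exprS mulrACA; apply: ler_pM; rewrite ?normr_ge0 ?prodr_ge0//.
        rewrite mxE normrM mulrC; apply: (@le_trans _ _ ((Wm + 1) * `|X 0 i|)).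
          rewrite ler_wpM2r//; apply: le_trans (le_trans (coord_le_norm v i) (GW v vG)) _.
          by rewrite lerDl.
        by rewrite ler_wpM2l ?addr_ge0//; have /andP[] := xX i.
    rewrite normrM; apply: le_trans (ler_wpM2r (normr_ge0 _) wx) _.
    have := HCr x s xrr; rewrite sp => /(_ pM); rewrite normrM -/Rm.
    have W1 : 0 <= (Wm + 1) ^+ M by rewrite exprn_ge0// addr_ge0.
    move=> h; have := ler_wpM2l W1 h; rewrite [X in X <= _ -> _]mulrA; exact.
  have np : n%:R ^+ p <= n.+1%:R ^+ M :> R.
    apply: (@le_trans _ _ (n.+1%:R ^+ p)); first by rewrite lerXn2r ?nnegrE ?ler_nat.
    by rewrite ler_weXn2l// ler1n.
  apply: (@le_trans _ _ (K * eps * newton_gauge E X)); last first.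
    rewrite ler_wpM2r// mulrC -ler_pdivlMr//.
    have : eps <= c0 / (4 * K) by rewrite !ge_min lexx !orbT.
    by rewrite invfM mulrA.
  apply: (@le_trans _ _ (n.+1%:R ^+ M * ((Wm + 1) ^+ M * (Cr * eps * (2 ^+ (\max_(m <- E) mdegree m) * newton_gauge E X))))).
    apply: ler_pM => //; rewrite ?exprn_ge0// ?mulr_ge0 ?exprn_ge0 ?addr_ge0 ?newton_gauge_ge0 ?(ltW Cr0)//.
    rewrite ler_wpM2l ?exprn_ge0 ?addr_ge0// ler_pM ?mulr_ge0 ?newton_gauge_ge0 ?(ltW Cr0)//.
    by rewrite ler_wpM2l// ltW.
  by rewrite /K exprMn le_eqVlt; apply/orP; left; apply/eqP; ring.
rewrite split_H.
have := ler_normB (iter p (dirD w) (newton_part H E) x + iter p (dirD w) Rm x) (iter p (dirD w) Rm x).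
by rewrite addrK; move: main rem; lra.
Qed.

End box_derivative.

(** * Derivatives of the phase *)

Section phase.
Context {R : realType} {n : nat}.
Implicit Types (x X w : 'rV[R]_n) (H : 'rV[R]_n -> R) (V : set 'rV[R]_n).

Definition phase (th : R) (b : 'rV[R]_n) (L : R) H x : R :=
  th + \sum_i b 0 i * x 0 i + L * H x.

(** The phase is written as a linear combination of [H] and the monomials of degree at most 1, so
    that its smoothness and its iterated derivatives come from the lemmas on linear combinations. *)
Let comp H (j : option (option 'I_n)) : 'rV[R]_n -> R :=
  match j with
  | None => H
  | Some None => monomial [ffun => 0%N]
  | Some (Some i) => monomial (unit_index i)
  end.

Let coef (th : R) (b : 'rV[R]_n) (L : R) (j : option (option 'I_n)) : R :=
  match j with None => L | Some None => th | Some (Some i) => b 0 i end.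

Let indices : seq (option (option 'I_n)) :=
  [:: None, Some None & [seq Some (Some i) | i <- enum 'I_n]].

Let phaseE th b L H :
  phase th b L H = fun x => \sum_(j <- indices) coef th b L j * comp H j x.
Proof.
apply/funext => x; rewrite !big_cons big_map big_enum/= /phase addrC; congr (_ + _).
have -> : monomial [ffun => 0%N] x = 1.
  by rewrite /monomial big1// => i _; rewrite ffunE expr0.
rewrite mulr1; congr (_ + _); apply: eq_bigr => i _; congr (_ * _).
rewrite /monomial (bigD1 i)//= ffunE eqxx expr1 big1 ?mulr1// => k ki.
by rewrite ffunE (negbTE ki) expr0.
Qed.

Let smooth_comp V H j : open V -> smooth_on V H -> smooth_on V (comp H j).
Proof.
move=> oV sH; case: j => [[i|]|]; [| |exact: sH].
  exact: (@smooth_subset R n setT V _ (@subsetT _ V) (@smooth_monomial R n _)).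
exact: (@smooth_subset R n setT V _ (@subsetT _ V) (@smooth_monomial R n _)).
Qed.

Lemma smooth_phase V H th b L : open V -> smooth_on V H -> smooth_on V (phase th b L H).
Proof.
move=> oV sH; rewrite phaseE.
exact: (@smooth_lin R n V _ indices (coef th b L) (comp H) oV (fun j => smooth_comp j oV sH)).
Qed.

Lemma line_poly0 x w : line_poly [ffun => 0%N] x w = 1.
Proof. by rewrite /line_poly big1// => i _; rewrite ffunE expr0. Qed.

Lemma line_poly_unit i x w : line_poly (unit_index i) x w = w 0 i *: 'X + (x 0 i)%:P.
Proof.
rewrite /line_poly (bigD1 i)//= ffunE eqxx expr1 big1 ?mulr1// => k ki.
by rewrite ffunE (negbTE ki) expr0.
Qed.

Let deriv_comp V H w p th b L x : open V -> smooth_on V H -> V x ->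
  iter p (dirD w) (phase th b L H) x = L * iter p (dirD w) H x +
    (th * ((1 : {poly R})`_p *+ p`!) +
     \sum_i b 0 i * ((w 0 i *: 'X + (x 0 i)%:P)`_p *+ p`!)).
Proof.
move=> oV sH Vx; rewrite phaseE.
rewrite (@deriv_iter_lin R n V _ indices (coef th b L) (comp H) w p x oV (fun j => smooth_comp j oV sH) Vx).
rewrite 2!big_cons big_map big_enum/= deriv_iter_monomial_coef line_poly0.
congr (_ + (_ + _)); apply: eq_bigr => i _.
by rewrite deriv_iter_monomial_coef line_poly_unit.
Qed.

Lemma deriv_iter_phase V H th b L w p x : open V -> smooth_on V H -> V x -> (1 < p)%N ->
  iter p (dirD w) (phase th b L H) x = L * iter p (dirD w) H x.
Proof.
move=> oV sH Vx p1; rewrite (deriv_comp _ _ _ _ _ oV sH Vx).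
have p0 : (p == 0%N) = false by rewrite gtn_eqF// ltnW.
rewrite coef1 p0 mul0rn mulr0 add0r big1 ?addr0// => i _.
by rewrite coefD coefZ coefX coefC p0 gtn_eqF// mulr0 addr0 mul0rn mulr0.
Qed.

Lemma partial_phase V H th b L i x : open V -> smooth_on V H -> V x ->
  partial i (phase th b L H) x = b 0 i + L * partial i H x.
Proof.
move=> oV sH Vx; rewrite -[LHS]/(iter 1 (dirD (delta_mx 0 i)) _ x).
rewrite (deriv_comp _ _ _ _ _ oV sH Vx) addrC; congr (_ + _).
rewrite coef1 mul0rn mulr0 add0r (bigD1 i)//= big1 ?addr0.
  by rewrite coefD coefZ coefX coefC/= mxE !eqxx/= mulr1 addr0 fact0 || rewrite coefD coefZ coefX coefC/= mxE !eqxx/= mulr1 addr0 mulr1n mulr1.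
by move=> k ki; rewrite coefD coefZ coefC mxE (negbTE ki) andbF/= mul0r addr0 mul0rn mulr0.
Qed.

Lemma line_derivative_chain V f x w (a b : R) p : open V -> smooth_on V f ->
  (forall t, t \in `[a, b] -> V (x + t *: w)) ->
  derivative_chain a b p (fun q t => iter q (dirD w) f (x + t *: w)).
Proof.
move=> oV sf Vl q t _ tab; rewrite iterS; apply: is_derive_line.
have sq := @smooth_deriv_iter R n V f w q oV sf.
exact: (@smooth_derivable R n V (iter q (dirD w) f) (x + t *: w) w oV sq (Vl t tab)).
Qed.

End phase.

(** * The contribution of one box *)

Section piece.
Context {R : realType} {n : nat}.
Implicit Types (x X w : 'rV[R]_n) (H A f : 'rV[R]_n -> R) (V : set 'rV[R]_n).
Local Notation lm := (@lebesgue_measure R).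
Local Notation tup := (n.-tuple (measurableTypeR R)).
Local Notation mu := (@lebesgue_tuple R n).

Lemma powRN_min1 (a s : R) : 0 < a -> 0 <= s ->
  (1 <= a -> Num.min 1 (a `^ (- s)) = a `^ (- s)) /\ (a <= 1 -> Num.min 1 (a `^ (- s)) = 1).
Proof.
move=> a0 s0; rewrite powRN; have as0 : 0 < a `^ s by exact: powR_gt0.
split=> a1.
  apply/min_idPr; rewrite invf_le1//.
  by have := ge0_ler_powR s0 _ _ a1; rewrite powR1 !nnegrE ler01 ltW//; apply.
apply/min_idPl; rewrite invf_ge1//.
by have := ge0_ler_powR s0 _ _ a1; rewrite powR1 !nnegrE ler01 ltW//; apply.
Qed.

(** The box is spanned by [X] and [tau * X]; minimum and maximum take care of negative
    coordinates. *)
Definition corner_lo X (tau : R) i : R := Num.min (X 0 i) (X 0 i * tau).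
Definition corner_hi X (tau : R) i : R := Num.max (X 0 i) (X 0 i * tau).

Lemma corner_lo_hi X tau i : corner_lo X tau i <= corner_hi X tau i.
Proof. by rewrite /corner_lo /corner_hi ge_min le_max lexx. Qed.

Lemma corner_length X (tau : R) i : 1 <= tau ->
  corner_hi X tau i - corner_lo X tau i = (tau - 1) * `|X 0 i|.
Proof.
move=> t1; rewrite /corner_lo /corner_hi.
have [X0|X0] := leP 0 (X 0 i).
  have h : X 0 i <= X 0 i * tau by rewrite ler_peMr.
  by rewrite (min_idPl h) (max_idPr h) ger0_norm//; ring.
have h : X 0 i * tau <= X 0 i by rewrite ler_neMr// ltW.
by rewrite (min_idPr h) (max_idPl h) ltr0_norm//; ring.
Qed.

Lemma corner_closed_box X (tau : R) x : (forall i, X 0 i != 0) -> 1 <= tau ->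
  closed_box (corner_lo X tau) (corner_hi X tau) x ->
  exists2 u : 'rV[R]_n, x = mxscale X u & forall i, 1 <= u 0 i <= tau.
Proof.
move=> X0 t1 bx; exists (\row_i (x 0 i / X 0 i)).
  by apply/rowP => i; rewrite !mxE mulrC mulfVK.
move=> i; rewrite mxE; have := bx i; rewrite /corner_lo /corner_hi.
have [Xi|Xi] := ltP 0 (X 0 i).
  have h : X 0 i <= X 0 i * tau by rewrite ler_peMr// ltW.
  by rewrite (min_idPl h) (max_idPr h) ler_pdivlMr// ler_pdivrMr// mul1r mulrC (mulrC tau).
have {}Xi : X 0 i < 0 by rewrite lt_neqAle X0.
have h : X 0 i * tau <= X 0 i by rewrite ler_neMr// ltW.
by rewrite (min_idPr h) (max_idPl h) ler_ndivlMr// ler_ndivrMr// mul1r (mulrC tau) andbC.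
Qed.

Lemma derive_row_sum (f : 'rV[R]_n -> R) x w : differentiable f x ->
  'D_w f x = \sum_i w 0 i * partial i f x.
Proof.
move=> df; rewrite deriveE// {1}(row_sum_delta w) linear_sum.
by apply: eq_bigr => i _; rewrite linearZ /partial deriveE.
Qed.

Lemma line_amplitude V A x w (a b : R) (M1 W : R) : open V -> (forall x, V x -> differentiable A x) -> 0 <= W ->
  (forall t, t \in `[a, b] -> V (x + t *: w)) ->
  (forall t i, t \in `[a, b] -> `|partial i A (x + t *: w)| <= M1) ->
  (forall i, `|w 0 i| <= W) ->
  forall t, t \in `[a, b] ->
    is_derive t 1 (fun t => A (x + t *: w)) ('D_w A (x + t *: w)) /\
    `|'D_w A (x + t *: w)| <= n%:R * (W * M1).
Proof.
move=> oV sA W0 Vl AM wW t tab; split.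
  exact: (is_derive_line (diff_derivable (sA _ (Vl t tab)))).
rewrite (derive_row_sum w (sA _ (Vl t tab))).
apply: le_trans (ler_norm_sum _ _ _) _.
apply: (@le_trans _ _ (\sum_(i < n) W * M1)); last by rewrite sumr_const card_ord mulr_natl.
by apply: ler_sum => i _; rewrite normrM ler_pM// AM.
Qed.

(** The constant must depend neither on the phase nor on the box. If [|L| * Lam >= 1], the exponent
    [1 / p] can be weakened to [1 / M]; otherwise the trivial bound is obtained by averaging along
    [w = 0]. *)
Lemma piece_estimate (M : nat) (tau Wm eps M0 M1 : R) : 1 < tau -> 0 <= Wm ->
  0 < eps -> 0 <= M0 -> 0 <= M1 -> exists2 C : R, 0 <= C &
  forall V H A f th b L X w (p : nat) (Lam : R),
  open V -> smooth_on V H -> (forall x, V x -> differentiable A x) -> (forall x, `|x| <= eps -> V x) ->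
  (forall x, V x -> f x = cos (phase th b L H x) * A x) ->
  measurable_fun [set: tup] (f \o @row_of_tuple R n) -> (forall x, `|f x| <= M0) ->
  (forall x, `|x| <= eps -> `|A x| <= M0) ->
  (forall x i, `|x| <= eps -> `|partial i A x| <= M1) ->
  (forall i, X 0 i != 0) -> (forall i, `|X 0 i| * tau <= eps) -> (1 < p <= M)%N ->
  (forall i, `|w 0 i| <= Wm * `|X 0 i|) -> L != 0 -> 0 < Lam ->
  (forall u : 'rV[R]_n, (forall i, 1 <= u 0 i <= tau) -> Lam <= `|iter p (dirD w) H (mxscale X u)|) ->
  `|(\int[mu]_t (f (row_of_tuple t) * \1_(tuple_box (corner_lo X tau) (corner_hi X tau)) t))%R|
    <= C * \prod_i `|X 0 i| * Num.min 1 ((`|L| * Lam) `^ (- M%:R^-1)).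
Proof.
move=> tau1 Wm0 eps0 M00 M10.
have exK (p : nat) : exists K : R, 0 < K /\ ((1 < p)%N -> forall a b F (L : R) (A dA : R -> R) (M M' : R), a <= b -> 0 < L ->
    derivative_chain a b p F -> (forall t, t \in `[a, b] -> L <= `|F p t|) ->
    (forall t, t \in `[a, b] -> is_derive t 1 A (dA t)) ->
    (forall t, t \in `[a, b] -> `|A t| <= M) ->
    (forall t, t \in `[a, b] -> `|dA t| <= M') ->
    `|(\int[lm]_(t in `[a, b]) (cos (F 0%N t) * A t))%R| <=
      K * L `^ (- p%:R^-1) * (M + M' * (b - a))).
  have [p1|p1] := boolP (1 < p)%N; last by exists 1.
  by have [K K0 HK] := @oscillatory_integral R p p1; exists K.
have [Kf HKf] := choice exK.
(* The order [p] changes from box to box, so the constants of all orders up to [M] are added. *)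
pose Km := \sum_(p < M.+1) Kf p.
have KfM (p : nat) : (p <= M)%N -> Kf p <= Km.
  move=> pM; rewrite /Km (bigD1 (Ordinal (pM : (p < M.+1)%N)))//= lerDl sumr_ge0// => i _.
  by have [/ltW] := HKf i.
have Km0 : 0 <= Km by apply: sumr_ge0 => i _; have [/ltW] := HKf i.
pose M' := n%:R * (Wm * eps * M1).
have M'0 : 0 <= M' by rewrite !mulr_ge0// ltW.
pose K1 := Km * (M0 + M') + M0.
have K10 : 0 <= K1 by rewrite addr_ge0// mulr_ge0// addr_ge0.
exists (K1 * (tau - 1 + 2 * Wm) ^+ n).
  by rewrite mulr_ge0// exprn_ge0// addr_ge0 ?subr_ge0 ?mulr_ge0// ltW.
move=> V H A f th b L X w p Lam oV sH sA epsV fE mf fM AM dAM X0 Xe /andP[p1 pM] wX L0 Lam0 HLam.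
have tau1' : 1 <= tau by exact: ltW.
set y := `|L| * Lam; have y0 : 0 < y by rewrite mulr_gt0// normr_gt0.
have xe x : closed_box (corner_lo X tau) (corner_hi X tau) x -> `|x| <= eps.
  move=> /(corner_closed_box X0 tau1')[u -> u1]; apply: norm_le_coord => [|i]; first exact: ltW.
  have /andP[h1 h2] := u1 i; have ui : 0 <= u 0 i by apply: le_trans h1.
  by rewrite mxE normrM (ger0_norm ui); apply: le_trans (Xe i); rewrite ler_wpM2l.
have cf x : closed_box (corner_lo X tau) (corner_hi X tau) x -> {for x, continuous f}.
  move=> /xe/epsV Vx.
  have sph := smooth_phase th b L oV sH.
  have c1 : {for x, continuous (phase th b L H)} by have [] := sph [::] x Vx.
  have c2 : {for x, continuous A} by exact: differentiable_continuous (sA x Vx).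
  have c3 : {for x, continuous (fun x => cos (phase th b L H x) * A x)}.
    apply: (@cvgM R _ (nbhs (x : 'rV[R]_n)) (nbhs_filter x) (fun x => cos (phase th b L H x)) A) c2.
    exact: (@cvg_comp _ _ _ (phase th b L H) cos _ _ _ c1 (@continuous_cos R (phase th b L H x))).
  apply: near_eq_continuous c3; near=> z; apply/esym; apply: fE; near: z.
  exact: open_nbhs_nbhs.
have prodE (w' : 'rV[R]_n) : (forall i, `|w' 0 i| <= Wm * `|X 0 i|) ->
    \prod_i (corner_hi X tau i - corner_lo X tau i + 2 * `|w' 0 i|) <=
    (tau - 1 + 2 * Wm) ^+ n * \prod_i `|X 0 i|.
  move=> w'X; have -> : (tau - 1 + 2 * Wm) ^+ n = \prod_(i < n) (tau - 1 + 2 * Wm).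
    by rewrite prodr_const card_ord.
  rewrite -big_split/=; apply: ler_prod => i _; rewrite corner_length//; apply/andP; split.
    by rewrite addr_ge0 ?mulr_ge0// subr_ge0.
  by rewrite [leRHS]mulrDl lerD2l -mulrA ler_wpM2l.
have [min1 min2] := @powRN_min1 y M%:R^-1 y0 (ltac:(by rewrite invr_ge0)).
have P0 : 0 <= \prod_i `|X 0 i| by apply: prodr_ge0.
have fin (K : R) (w' : 'rV[R]_n) : 0 <= K -> K <= K1 * Num.min 1 (y `^ (- M%:R^-1)) -> (forall i, `|w' 0 i| <= Wm * `|X 0 i|) ->
  K * \prod_i (corner_hi X tau i - corner_lo X tau i + 2 * `|w' 0 i|) <=
  K1 * (tau - 1 + 2 * Wm) ^+ n * \prod_i `|X 0 i| * Num.min 1 (y `^ (- M%:R^-1)).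
  move=> K0 Kle /prodE Pw; apply: le_trans (ler_wpM2l K0 Pw) _.
  apply: (@le_trans _ _ (K1 * Num.min 1 (y `^ (- M%:R^-1)) * ((tau - 1 + 2 * Wm) ^+ n * \prod_i `|X 0 i|))).
    by rewrite ler_wpM2r// mulr_ge0// exprn_ge0// addr_ge0 ?subr_ge0 ?mulr_ge0.
  by rewrite le_eqVlt; apply/orP; left; apply/eqP; ring.
have [y1|y1] := leP 1 y; last first.
  have w0X i : `|(0 : 'rV[R]_n) 0 i| <= Wm * `|X 0 i| by rewrite mxE normr0 mulr_ge0.
  apply: le_trans (fin M0 0 M00 _ w0X); last first.
    by rewrite min2 ?(ltW y1)// mulr1 /K1 lerDr mulr_ge0// addr_ge0.
  apply: (@box_average R n f _ _ 0 M0 M0 mf fM M00 (corner_lo_hi X tau) cf) => x a b' ab a0 b1 cl.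
  have cl0 t : t \in `[a, b'] -> x + t *: (0 : 'rV[R]_n) = x by rewrite scaler0 addr0.
  rewrite (_ : (\int[lm]_(t in `[a, b']) f (x + t *: 0))%R = f x * (b' - a)).
    rewrite normrM -[leRHS]mulr1 ler_pM// ger0_norm ?subr_ge0//; lra.
  rewrite (@eq_Rintegral _ _ _ lm `[a, b']%classic (fun=> f x)).
    rewrite Rintegral_cst//= lebesgue_measure_itv/= lte_fin.
    by move: ab; rewrite le_eqVlt => /predU1P[->|->]; rewrite ?ltxx ?subrr.
  by move=> t _; rewrite scaler0 addr0.
pose K := Km * y `^ (- M%:R^-1) * (M0 + M').
have K0 : 0 <= K by rewrite !mulr_ge0 ?powR_ge0 ?addr_ge0.
apply: le_trans (fin K w K0 _ wX); last first.
  rewrite min1// /K mulrAC ler_wpM2r ?powR_ge0// /K1 lerDl//.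
apply: (@box_average R n f _ _ w M0 K mf fM K0 (corner_lo_hi X tau) cf) => x a b' ab a0 b1 cl.
have Vl t : t \in `[a, b'] -> V (x + t *: w) by move=> /cl/xe/epsV.
have sph := smooth_phase th b L oV sH.
pose F (q : nat) t := iter q (dirD w) (phase th b L H) (x + t *: w).
have chF : derivative_chain a b' p F by exact: line_derivative_chain oV sph Vl.
have Weps i : `|w 0 i| <= Wm * eps.
  apply: le_trans (wX i) _; rewrite ler_wpM2l//; apply: le_trans (Xe i).
  by rewrite ler_peMr.
have dA := line_amplitude oV sA (mulr_ge0 Wm0 (ltW eps0)) Vl (fun t i tab => dAM _ i (xe _ (cl t tab))) Weps.
have := (HKf p).2 p1 a b' F y (fun t => A (x + t *: w)) (fun t => 'D_w A (x + t *: w)) M0 M' ab y0 chF.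
have intE : (\int[lm]_(t in `[a, b']) f (x + t *: w))%R =
    (\int[lm]_(t in `[a, b']) (cos (F 0%N t) * A (x + t *: w)))%R.
  by apply: eq_Rintegral => t; rewrite inE => tab; rewrite fE//; exact: Vl.
rewrite intE => /(_ _ _ _ _)/le_trans; apply.
- move=> t tab; rewrite /F (deriv_iter_phase _ _ _ _ oV sH (Vl t tab) p1) normrM ler_wpM2l//.
  by have [u -> u1] := corner_closed_box X0 tau1' (cl t tab); exact: HLam.
- by move=> t /dA[].
- by move=> t /cl/xe/AM.
- by move=> t /dA[].
rewrite /K; apply: ler_pM.
- by rewrite mulr_ge0 ?powR_ge0//; have [/ltW] := HKf p.
- by rewrite addr_ge0// mulr_ge0// subr_ge0.
- apply: ler_pM; rewrite ?powR_ge0 ?KfM//; first by have [/ltW] := HKf p.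
  apply: ler_powR => //; rewrite lerN2 lef_pV2 ?posrE ?ltr0n ?ler_nat//; last exact: ltnW.
  exact: leq_trans (ltnW p1) pM.
- by rewrite lerD2l ler_piMr//; lra.
Unshelve. all: end_near.
Qed.

End piece.

(** * Decomposition of the cube into boxes *)

Section cube.
Context {R : realType} {n : nat}.
Implicit Types (x X w : 'rV[R]_n) (H A f : 'rV[R]_n -> R) (V : set 'rV[R]_n).
Local Notation tup := (n.-tuple (measurableTypeR R)).
Local Notation mu := (@lebesgue_tuple R n).

Lemma bounded_support_integral (g : tup -> R) (Q : set tup) (B : R) :
  measurable_fun [set: tup] g -> (forall t, `|g t| <= B) ->
  measurable Q -> (mu Q < +oo)%E -> (forall t, g t != 0 -> Q t) ->
  mu.-integrable setT (EFin \o g) /\ `|(\int[mu]_t g t)%R| <= B * fine (mu Q).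
Proof.
move=> mg gB mQ Qoo gQ.
have B0 : 0 <= B by apply: le_trans (gB [tuple of nseq n 0]).
have iQ : mu.-integrable setT (EFin \o (\1_Q : tup -> R)) by exact: integrable_indic_lty.
have iBQ : mu.-integrable setT (EFin \o (fun t => B * (\1_Q t : R))).
  by have := integrableZl measurableT B iQ; apply: eq_integrable.
have gle t : `|g t| <= B * \1_Q t.
  rewrite indicE; case: (boolP (t \in Q)) => [_|]; first by rewrite mulr1.
  by rewrite notin_setE => nQ; have [->|/gQ//] := eqVneq (g t) 0; rewrite normr0 mulr0.
have ig : mu.-integrable setT (EFin \o g).
  apply: le_integrable iBQ => //; first exact/measurable_EFinP.
  move=> t _; rewrite /= lee_fin [leRHS]ger0_norm//.
  by rewrite mulr_ge0// indicE ler0n.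
split => //; apply: le_trans (le_normr_Rintegral _ ig) _ => //.
apply: le_trans (le_Rintegral _ _ _ (fun t _ => gle t)) _ => //.
  exact: (integrable_norm ig).
by rewrite RintegralZl// ler_wpM2l// /Rintegral integral_indic// setIT lexx.
Qed.

Lemma norm_Rintegral_sum (I : Type) (r : seq I) (F : I -> tup -> R) :
  (forall i, mu.-integrable setT (EFin \o F i)) ->
  mu.-integrable setT (EFin \o (fun t => \sum_(i <- r) F i t)) /\
  `|(\int[mu]_t (\sum_(i <- r) F i t))%R| <= \sum_(i <- r) `|(\int[mu]_t F i t)%R|.
Proof.
move=> iF; elim: r => [|i r [IH1 IH2]].
  split; last first.
    rewrite big_nil (_ : (\int[mu]_t _)%R = 0) ?normr0// /Rintegral integral0_eq// => t _.
    by rewrite big_nil.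
  by under eq_fun do rewrite big_nil; exact: integrable0.
split.
  have := integrableD measurableT (iF i) IH1; apply: eq_integrable => // t _ /=.
  by rewrite big_cons EFinD.
rewrite big_cons; under eq_Rintegral do rewrite big_cons.
rewrite RintegralD//; apply: le_trans (ler_normD _ _) _.
by rewrite lerD2l.
Qed.

(** The corner closest to the origin, hence the exponent [(m i).+1]; [s] records the signs of the
    coordinates. *)
Definition scale_corner (eps th : R) (N : nat) (s : {ffun 'I_n -> bool})
    (m : {ffun 'I_n -> 'I_N}) : 'rV[R]_n :=
  \row_i ((-1) ^+ s i * (eps * th ^+ (m i).+1)).

(** For each sign the indicators telescope, leaving the indicator of the points of that sign between
    the scales [eps * th ^+ N] and [eps]. *)
Lemma scale_partition (eps th tau : R) (N : nat) (y : R) : 0 < eps -> 0 < th -> th < 1 ->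
  let ind (s : bool) (k : 'I_N) : R :=
    (if s then - (eps * th ^+ k) <= y < - (eps * th ^+ k.+1)
     else eps * th ^+ k.+1 <= y < eps * th ^+ k)%R%:R in
  let q := \sum_(k < N) \sum_(s : bool) ind s k in
  0 <= q <= 1 /\ (`|y| < eps -> q != 1 -> `|y| <= eps * th ^+ N).
Proof.
move=> eps0 th0 th1 ind q.
have a0 k : 0 < eps * th ^+ k by rewrite mulr_gt0// exprn_gt0.
have aS k : eps * th ^+ k.+1 <= eps * th ^+ k.
  by rewrite ler_pM2l// exprS ler_piMl ?exprn_ge0 ?(ltW th0) ?(ltW th1).
have aN : eps * th ^+ N <= eps by rewrite ler_piMr ?(ltW eps0)// exprn_ile1 ?(ltW th0) ?(ltW th1).
have indE (l u : R) : l <= u -> ((l <= y < u)%R%:R : R) = (l <= y)%R%:R - (u <= y)%R%:R.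
  by move=> lu; have [ly|ly] := leP l y; have [uy|uy] := leP u y => //=; rewrite ?subrr ?subr0//; lra.
have qE : q = (eps * th ^+ N <= y)%R%:R - (eps <= y)%R%:R + ((- eps <= y)%R%:R - (- (eps * th ^+ N) <= y)%R%:R).
  have -> : q = \sum_(k < N) (((eps * th ^+ k.+1 <= y)%R%:R - (eps * th ^+ k <= y)%R%:R) -
      ((- (eps * th ^+ k.+1) <= y)%R%:R - (- (eps * th ^+ k) <= y)%R%:R)).
    apply: eq_bigr => k _; rewrite big_bool /ind/= !indE ?lerN2//; ring.
  rewrite sumrB; congr (_ + _).
    rewrite -(big_mkord xpredT (fun k => (eps * th ^+ k.+1 <= y)%R%:R - (eps * th ^+ k <= y)%R%:R : R)).
    by rewrite (telescope_sumr (fun k => (eps * th ^+ k <= y)%R%:R : R))// expr0 mulr1.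
  rewrite -(big_mkord xpredT (fun k => (- (eps * th ^+ k.+1) <= y)%R%:R - (- (eps * th ^+ k) <= y)%R%:R : R)).
  by rewrite (telescope_sumr (fun k => (- (eps * th ^+ k) <= y)%R%:R : R))// expr0 mulr1 opprB.
rewrite qE; have aN0 := a0 N; move: (eps * th ^+ N) aN aN0 => b beps b0.
have [h1|h1] := leP b y; have [h2|h2] := leP eps y; have [h3|h3] := leP (- eps) y;
  have [h4|h4] := leP (- b) y; rewrite ?(ler_norml, ltr_norml);
  (split; [by rewrite /= ; lra | move=> /andP[? ?] /eqP/= ?; try (exfalso; lra); lra]).
Qed.

Lemma scale_cornerE (eps th tau : R) (N : nat) s (m : {ffun 'I_n -> 'I_N}) i :
  0 < eps -> 0 < th -> th < 1 -> th * tau = 1 ->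
  [/\ `|scale_corner eps th s m 0 i| = eps * th ^+ (m i).+1,
     `|scale_corner eps th s m 0 i| * tau = eps * th ^+ m i,
     corner_lo (scale_corner eps th s m) tau i = (if s i then - (eps * th ^+ m i) else eps * th ^+ (m i).+1) &
     corner_hi (scale_corner eps th s m) tau i = (if s i then - (eps * th ^+ (m i).+1) else eps * th ^+ m i)].
Proof.
move=> eps0 th0 th1 tht.
have a0 k : 0 < eps * th ^+ k by rewrite mulr_gt0// exprn_gt0.
have aS k : eps * th ^+ k.+1 <= eps * th ^+ k.
  by rewrite ler_pM2l// exprS ler_piMl ?exprn_ge0 ?(ltW th0) ?(ltW th1).
have at_ k : eps * th ^+ k.+1 * tau = eps * th ^+ k.
  by rewrite exprS -mulrA mulrAC tht mul1r.
have nE : `|scale_corner eps th s m 0 i| = eps * th ^+ (m i).+1.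
  by rewrite mxE normrM normrX normrN1 expr1n mul1r gtr0_norm.
split => //; first by rewrite nE.
  rewrite /corner_lo mxE; case: (s i); rewrite ?expr1 ?expr0 ?mulN1r ?mul1r ?mulNr at_.
    by apply/min_idPr; rewrite lerN2.
  by apply/min_idPl.
rewrite /corner_hi mxE; case: (s i); rewrite ?expr1 ?expr0 ?mulN1r ?mul1r ?mulNr at_.
  by apply/max_idPl; rewrite lerN2.
by apply/max_idPr.
Qed.

(** Finitely many boxes are used, which avoids infinite sums. Where [f] is nonzero, the part that
    they miss lies in [n] slabs of width proportional to [th ^+ N]. *)
Lemma cube_decomposition (eps th tau B : R) (N : nat) f : (0 < n)%N ->
  0 < eps -> 0 < th -> th < 1 -> th * tau = 1 ->
  measurable_fun [set: tup] (f \o @row_of_tuple R n) -> (forall x, `|f x| <= B) ->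
  (forall x, eps <= `|x| -> f x = 0) ->
  `|(\int[mu]_t f (row_of_tuple t))%R| <=
  \sum_(m : {ffun 'I_n -> 'I_N}) \sum_(s : {ffun 'I_n -> bool})
    `|(\int[mu]_t (f (row_of_tuple t) * \1_(tuple_box (corner_lo (scale_corner eps th s m) tau)
        (corner_hi (scale_corner eps th s m) tau)) t))%R|
  + B * n%:R * (2 * eps) ^+ n * th ^+ N.
Proof.
move=> n0 eps0 th0 th1 tht mf fB f0.
have B0 : 0 <= B by apply: le_trans (fB 0).
pose box s m := tuple_box (corner_lo (scale_corner eps th s m) tau) (corner_hi (@scale_corner eps th N s m) tau).
pose ind (y : R) (s : bool) (k : 'I_N) : R :=
    (if s then - (eps * th ^+ k) <= y < - (eps * th ^+ k.+1)
     else eps * th ^+ k.+1 <= y < eps * th ^+ k)%R%:R.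
pose q (y : R) := \sum_(k < N) \sum_(s : bool) ind y s k.
have q01 y : 0 <= q y <= 1 by have [] := @scale_partition eps th tau N y eps0 th0 th1.
have qN y : `|y| < eps -> q y != 1 -> `|y| <= eps * th ^+ N.
  by have [] := @scale_partition eps th tau N y eps0 th0 th1.
have indbox s m (t : tup) : (\1_(box s m) t : R) = \prod_i ind (tnth t i) (s i) (m i).
  have e i : ind (tnth t i) (s i) (m i) = ((tnth t i : R) \in `[corner_lo (scale_corner eps th s m) tau i,
      corner_hi (scale_corner eps th s m) tau i[)%:R.
    have [_ _ -> ->] := @scale_cornerE eps th tau N s m i eps0 th0 th1 tht.
    by rewrite /ind in_itv/=; case: (s i).
  rewrite (eq_bigr _ (fun i _ => e i)) indicE; case: (boolP (t \in _)) => [|].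
    by rewrite inE => bt; rewrite big1// => i _; rewrite bt.
  rewrite notin_setE => nb; have [i ni] : exists i, ~ ((tnth t i : R) \in `[corner_lo (scale_corner eps th s m) tau i,
      corner_hi (scale_corner eps th s m) tau i[).
    by apply: contrapT => no; apply: nb => i; apply: contrapT => h; apply: no; exists i.
  by rewrite (bigD1 i)//=; case: (_ \in _) ni => // _; rewrite mul0r.
have qprod (t : tup) : \prod_i q (tnth t i) =
    \sum_(m : {ffun 'I_n -> 'I_N}) \sum_(s : {ffun 'I_n -> bool}) (\1_(box s m) t : R).
  rewrite /q bigA_distr_bigA; apply: eq_bigr => m _.
  rewrite (bigA_distr_bigA (fun i s => ind (tnth t i) s (m i))); apply: eq_bigr => s _.
  by rewrite indbox.
have mbox s m : measurable (box s m) by exact: measurable_tuple_box_co.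
pose Q := [set t : tup | forall i, (tnth t i : R) \in `[- eps, eps]].
have mQ : measurable Q by exact: (@measurable_tuple_box R n (fun=> `[- eps, eps])).
have e2 : - eps <= eps by lra.
have [Qoo _] := @lebesgue_tuple_box_fin R n (fun=> - eps) (fun=> eps) (fun=> e2).
have fQ (t : tup) : f (row_of_tuple t) != 0 -> forall i, `|tnth t i : R| < eps.
  move=> ft i; have [h|h] := leP eps `|row_of_tuple t : 'rV[R]_n|; first by rewrite f0 ?eqxx in ft.
  by apply: le_lt_trans h; have := coord_le_norm (row_of_tuple t : 'rV[R]_n) i; rewrite mxE.
have fQ' (t : tup) : f (row_of_tuple t) != 0 -> Q t.
  by move=> /fQ h i; rewrite in_itv/= -ler_norml ltW.
have iF (j : {ffun 'I_n -> 'I_N} * {ffun 'I_n -> bool}) :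
    mu.-integrable setT (EFin \o (fun t => f (row_of_tuple t) * \1_(box j.2 j.1) t)).
  have [] := @bounded_support_integral (fun t => f (row_of_tuple t) * \1_(box j.2 j.1) t) Q B _ _ mQ Qoo _ => //.
  - by apply: measurable_funM => //; exact: measurable_indic.
  - move=> t; rewrite normrM indicE; case: (_ \in _); rewrite ?normr1 ?normr0 ?mulr1 ?mulr0//.
  - by move=> t; rewrite mulf_eq0 negb_or => /andP[/fQ'].
pose G (t : tup) := \sum_(j : {ffun 'I_n -> 'I_N} * {ffun 'I_n -> bool}) f (row_of_tuple t) * \1_(box j.2 j.1) t.
have [iG Gle] := @norm_Rintegral_sum _ (index_enum _) _ iF.
have GE (t : tup) : G t = f (row_of_tuple t) * \prod_i q (tnth t i).
  by rewrite qprod pair_big_dep/= mulr_sumr.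
pose D (i : 'I_n) := [set t : tup | forall j, (tnth t j : R) \in
   `[(if j == i then - (eps * th ^+ N) else - eps), (if j == i then eps * th ^+ N else eps)]].
have aN0 : 0 < eps * th ^+ N by rewrite mulr_gt0// exprn_gt0.
have mD i : measurable (D i).
  exact: (@measurable_tuple_box R n (fun j => `[(if j == i then - (eps * th ^+ N) else - eps), (if j == i then eps * th ^+ N else eps)])).
have Dle i : (mu (D i) < +oo)%E /\ fine (mu (D i)) <= (2 * eps) ^+ n * th ^+ N.
  have [|h1 h2] := @lebesgue_tuple_box_fin R n (fun j => if j == i then - (eps * th ^+ N) else - eps)
    (fun j => if j == i then eps * th ^+ N else eps).
    by move=> j; case: eqP => _; lra.
  split => //; apply: le_trans h2 _; rewrite (bigD1 i)//= eqxx.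
  rewrite (eq_bigr (fun=> 2 * eps)); last by move=> j /negbTE->; ring.
  have -> : (2 * eps) ^+ n = \prod_(j < n) (2 * eps) by rewrite prodr_const card_ord.
  by rewrite [in leRHS](bigD1 i)//= le_eqVlt; apply/orP; left; apply/eqP; ring.
pose rest (t : tup) := f (row_of_tuple t) * (1 - \prod_i q (tnth t i)).
have p01 (t : tup) : 0 <= \prod_i q (tnth t i) <= 1.
  apply/andP; split; first by apply: prodr_ge0 => i _; have /andP[] := q01 (tnth t i).
  apply: (@le_trans _ _ (\prod_(i < n) 1)); last by rewrite big1.
  by apply: ler_prod => i _; exact: q01.
have restB t : `|rest t| <= B.
  rewrite /rest normrM -[leRHS]mulr1 ler_pM// ger0_norm; have := p01 t; lra.
have restD t : rest t != 0 -> exists i, D i t.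
  rewrite /rest mulf_eq0 negb_or => /andP[ft p1].
  have [i qi] : exists i, q (tnth t i) != 1.
    apply: contrapT => no; move/negP : p1; apply; rewrite big1 ?subrr// => i _.
    by apply/eqP/negPn/negP => h; apply: no; exists i.
  exists i => j; have tj := fQ t ft j; rewrite in_itv/=; case: eqP => [->|_].
    by rewrite -ler_norml qN// fQ.
  by rewrite -ler_norml ltW.
have mrow i : measurable_fun [set: tup] (fun t : tup => tnth t i : R) by exact: measurable_tnth.
have mrest : measurable_fun [set: tup] rest.
  have -> : rest = (fun t => f (row_of_tuple t) - G t).
    by apply/funext => t; rewrite GE /rest mulrBr mulr1.
  by apply: measurable_funB => //; have /integrableP[/measurable_EFinP] := iG.
have [irest _] := @bounded_support_integral rest Q B mrest restB mQ Qoo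
  (fun t h => fQ' t (ltac:(by move: h; rewrite mulf_eq0 negb_or => /andP[]))).
have -> : (\int[mu]_t f (row_of_tuple t))%R = (\int[mu]_t (G t + rest t))%R.
  by apply: eq_Rintegral => t _; rewrite GE /rest; ring.
rewrite RintegralD//; apply: le_trans (ler_normD _ _) _; apply: lerD.
  by apply: le_trans Gle _; rewrite pair_big_dep.
apply: le_trans (le_normr_Rintegral measurableT irest) _.
have iD i : mu.-integrable setT (EFin \o (fun t => B * (\1_(D i) t : R))).
  have := integrableZl measurableT B (@integrable_indic_lty R _ _ mu (D i) (mD i) (Dle i).1).
  exact: eq_integrable.
have [isum sumle] := @norm_Rintegral_sum _ (index_enum 'I_n) (fun i t => B * (\1_(D i) t : R)) iD.
apply: (@le_trans _ _ (\int[mu]_t (\sum_(i < n) B * (\1_(D i) t : R)))%R).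
  apply: le_Rintegral => //; first exact: (integrable_norm irest).
  move=> t _; have [->|rt] := eqVneq (rest t) 0.
    by rewrite normr0 sumr_ge0// => i _; rewrite mulr_ge0// indicE ler0n.
  have [i Dit] := restD t rt; rewrite (bigD1 i)//=; apply: (@le_trans _ _ B); first exact: restB.
  rewrite indicE mem_set// mulr1 lerDl sumr_ge0// => j _; rewrite mulr_ge0// indicE ler0n//.
apply: le_trans (ler_norm _) _; apply: le_trans sumle _.
rewrite -mulrA -mulrA mulrCA.
apply: (@le_trans _ _ (\sum_(i < n) B * ((2 * eps) ^+ n * th ^+ N))); last first.
  by rewrite sumr_const card_ord -[leLHS]mulr_natl.
apply: ler_sum => i _; rewrite RintegralZl//; last exact: (@integrable_indic_lty R _ _ mu (D i) (mD i) (Dle i).1).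
rewrite normrM ger0_norm// ler_wpM2l// /Rintegral integral_indic// setIT ger0_norm ?fine_ge0//.
exact: (Dle i).2.
Qed.

Lemma cube_estimate (M : nat) (E : seq (multiindex n)) (tau eps Wm M0 M1 c1 : R) : (0 < n)%N -> E != [::] ->
  1 < tau -> 0 <= Wm -> 0 < eps -> 0 <= M0 -> 0 <= M1 -> 0 < c1 ->
  exists C c2 : R, [/\ 0 <= C, 0 < c2 & forall V H A f th b L,
  open V -> smooth_on V H -> (forall x, V x -> differentiable A x) -> (forall x, `|x| <= eps -> V x) ->
  (forall X, (forall i, 0 < `|X 0 i|) -> (forall i, `|X 0 i| * tau <= eps) ->
    exists (p : nat) w, [/\ (2 <= p <= M)%N, forall i, `|w 0 i| <= Wm * `|X 0 i| &
      forall u : 'rV[R]_n, (forall i, 1 <= u 0 i <= tau) ->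
        c1 * newton_gauge E X <= `|iter p (dirD w) H (mxscale X u)| ]) ->
  (forall x, V x -> f x = cos (phase th b L H x) * A x) ->
  measurable_fun [set: tup] (f \o @row_of_tuple R n) -> (forall x, `|f x| <= M0) ->
  (forall x, eps <= `|x| -> f x = 0) ->
  (forall x, `|x| <= eps -> `|A x| <= M0) ->
  (forall x i, `|x| <= eps -> `|partial i A x| <= M1) -> L != 0 ->
  forall N : nat, `|(\int[mu]_t f (row_of_tuple t))%R| <=
    C * (\sum_(m : {ffun 'I_n -> 'I_N}) tau^-1 ^+ (\sum_i m i) *
      Num.min 1 ((`|L| * c2 * \sum_(a <- E) tau^-1 ^+ wdot (fun i => m i) a) `^ (- M%:R^-1)) + tau^-1 ^+ N)].
Proof.
move=> n0 E0 tau1 Wm0 eps0 M00 M10 c10.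
have [C C0 HC] := @piece_estimate R n M tau Wm eps M0 M1 tau1 Wm0 eps0 M00 M10.
pose th := tau^-1.
have tau0 : 0 < tau by exact: lt_trans tau1.
have th0 : 0 < th by rewrite invr_gt0.
have th1 : th < 1 by rewrite invf_lt1.
have tht : th * tau = 1 by rewrite mulVf// gt_eqF.
(* At a corner each monomial carries a power of [eps * th]; capping the base at 1 lets the single
   power [e ^+ dm] bound all of them from below. *)
pose e := Num.min 1 (eps * th).
have e0 : 0 < e by rewrite lt_min ltr01 mulr_gt0.
pose dm := (\max_(a <- E) mdegree a)%N.
pose c2 := c1 * e ^+ dm.
have c20 : 0 < c2 by rewrite mulr_gt0// exprn_gt0.
(* The factor [2 ^+ n] counts the sign patterns, on which the bound for a box does not depend; the
   second summand is for the uncovered slabs. *)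
pose C1 := 2 ^+ n * (C * (eps * th) ^+ n) + M0 * n%:R * (2 * eps) ^+ n.
have C10 : 0 <= 2 ^+ n * (C * (eps * th) ^+ n).
  by rewrite !mulr_ge0 ?exprn_ge0// mulr_ge0// ltW.
have C20 : 0 <= M0 * n%:R * (2 * eps) ^+ n.
  by rewrite !mulr_ge0 ?exprn_ge0// mulr_ge0// ltW.
exists C1, c2; split; [by rewrite addr_ge0|by []|].
move=> V H A f ph b L oV sH sA epsV HX fE mf fM f0 AM dAM L0 N.
apply: le_trans (cube_decomposition N n0 eps0 th0 th1 tht mf fM f0) _.
rewrite mulrDr; apply: lerD; last first.
  by rewrite ler_wpM2r ?exprn_ge0 ?(ltW th0)// lerDr.
have term (m : {ffun 'I_n -> 'I_N}) (s : {ffun 'I_n -> bool}) :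
    `|(\int[mu]_t (f (row_of_tuple t) * \1_(tuple_box (corner_lo (scale_corner eps th s m) tau)
        (corner_hi (scale_corner eps th s m) tau)) t))%R| <=
    C * (eps * th) ^+ n * (th ^+ (\sum_i m i) *
      Num.min 1 ((`|L| * c2 * \sum_(a <- E) th ^+ wdot (fun i => m i) a) `^ (- M%:R^-1))).
  set X := scale_corner eps th s m.
  have XE i : `|X 0 i| = eps * th ^+ (m i).+1 by have [] := @scale_cornerE eps th tau N s m i eps0 th0 th1 tht.
  have Xt i : `|X 0 i| * tau = eps * th ^+ m i by have [] := @scale_cornerE eps th tau N s m i eps0 th0 th1 tht.
  have X0 i : 0 < `|X 0 i| by rewrite XE mulr_gt0// exprn_gt0.
  have Xe i : `|X 0 i| * tau <= eps.
    by rewrite Xt ler_piMr ?(ltW eps0)// exprn_ile1 ?(ltW th0) ?(ltW th1).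
  have gX : e ^+ dm * \sum_(a <- E) th ^+ wdot (fun i => m i) a <= newton_gauge E X.
    rewrite /newton_gauge mulr_sumr big_seq [leRHS]big_seq; apply: ler_sum => a aE.
    have -> : `|monomial a X| = (eps * th) ^+ mdegree a * th ^+ wdot (fun i => m i) a.
      rewrite normr_monomial /mdegree /wdot -!prodrXr -big_split; apply: eq_bigr => i _ /=.
      by rewrite XE exprS mulrA exprMn -exprM.
    rewrite ler_wpM2r ?exprn_ge0 ?(ltW th0)//; apply: (@le_trans _ _ (e ^+ mdegree a)).
      apply: ler_wiXn2l; [exact: ltW|by rewrite ge_min lexx|].
      exact: (@leq_bigmax_seq _ E xpredT (@mdegree n)).
    by rewrite lerXn2r ?nnegrE ?(ltW e0) ?mulr_ge0 ?(ltW eps0) ?(ltW th0)// ge_min lexx orbT.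
  have gsum0 : 0 < \sum_(a <- E) th ^+ wdot (fun i => m i) a.
    case: (E) E0 => // a r _; rewrite big_cons ltr_pwDl ?exprn_gt0// sumr_ge0// => a' _.
    by rewrite exprn_ge0// ltW.
  have gX0 : 0 < newton_gauge E X by apply: lt_le_trans gX; rewrite mulr_gt0// exprn_gt0.
  have [p [w [pM wX HL]]] := HX X X0 Xe.
  have X0' i : X 0 i != 0 by rewrite -normr_gt0.
  apply: le_trans (HC V H A f ph b L X w p (c1 * newton_gauge E X) oV sH sA epsV fE mf fM AM dAM X0' Xe pM wX L0 _ HL) _.
    by rewrite mulr_gt0.
  have -> : \prod_i `|X 0 i| = (eps * th) ^+ n * th ^+ (\sum_i m i).
    rewrite (eq_bigr (fun i => (eps * th) * th ^+ m i)); last by move=> i _; rewrite XE exprS mulrA.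
    by rewrite big_split/= prodr_const card_ord prodrXr.
  rewrite -!mulrA !ler_wpM2l ?exprn_ge0 ?mulr_ge0 ?(ltW eps0) ?(ltW th0)//.
  rewrite le_min !ge_min lexx/=; apply/orP; right.
  rewrite !powRN lef_pV2 ?posrE ?powR_gt0 ?mulr_gt0 ?normr_gt0 ?exprn_gt0//.
  apply: ge0_ler_powR; rewrite ?nnegrE ?invr_ge0 ?mulr_ge0 ?(ltW c10) ?(ltW gX0) ?(ltW gsum0) ?exprn_ge0 ?(ltW e0)//.
  by rewrite ler_wpM2l// ler_wpM2l// ltW.
apply: (@le_trans _ _ (\sum_(m : {ffun 'I_n -> 'I_N}) 2 ^+ n * (C * (eps * th) ^+ n * (th ^+ (\sum_i m i) *
      Num.min 1 ((`|L| * c2 * \sum_(a <- E) th ^+ wdot (fun i => m i) a) `^ (- M%:R^-1)))))).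
  apply: ler_sum => m _; apply: le_trans (ler_sum _ (fun s _ => term m s)) _.
  by rewrite sumr_const card_ffun card_bool card_ord -[leLHS]mulr_natl natrX.
rewrite -mulr_sumr -mulr_sumr mulrA ler_wpM2r//.
  apply: sumr_ge0 => m _; rewrite mulr_ge0 ?exprn_ge0 ?(ltW th0)//.
  by rewrite le_min ler01 powR_ge0.
by rewrite lerDl.
Qed.

End cube.

(** * Sums over the boxes *)

Section lattice_sums.
Context {R : realType}.

Lemma geometric_le (q : R) (N : nat) : 0 <= q -> q < 1 -> \sum_(i < N) q ^+ i <= (1 - q)^-1.
Proof.
move=> q0 q1; have q1' : 0 < 1 - q by rewrite subr_gt0.
elim: N => [|N IH]; first by rewrite big_ord0 invr_ge0 ltW.
rewrite big_ord_recl expr0; under eq_bigr do rewrite lift0 exprS.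
rewrite -mulr_sumr; apply: (@le_trans _ _ (1 + q * (1 - q)^-1)).
  by rewrite lerD2l ler_wpM2l.
by have := mulfV (lt0r_neq0 q1'); rewrite mulrBl mul1r; lra.
Qed.

Lemma two_sided_geometric_le (q : R) (N j : nat) : 0 <= q -> q < 1 ->
  \sum_(k < N) q ^+ `|k - j| <= 2 * (1 - q)^-1.
Proof.
move=> q0 q1; have q1' : 0 < 1 - q by rewrite subr_gt0.
suff H : \sum_(k < N) q ^+ `|k - j| <= (1 - q)^-1 + \sum_(i < j) q ^+ i.+1.
  apply: le_trans H _; rewrite mulr2n mulrDl !mul1r lerD2l.
  under eq_bigr do rewrite exprS.
  rewrite -mulr_sumr; apply: (@le_trans _ _ (1 * (1 - q)^-1)); last by rewrite mul1r.
  by rewrite ler_pM ?sumr_ge0 ?(ltW q1) ?geometric_le// => i _; rewrite exprn_ge0.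
elim: j N => [|j IH] N.
  rewrite big_ord0 addr0; under eq_bigr do rewrite distn0.
  exact: geometric_le.
case: N => [|N]; first by rewrite big_ord0 addr_ge0 ?invr_ge0 ?(ltW q1')// sumr_ge0// => i _; rewrite exprn_ge0.
have d0 : `|(@ord0 N : nat) - j.+1|%N = j.+1 by exact: (dist0n j.+1).
rewrite [leLHS]big_ord_recl [in leRHS]big_ord_recr d0 addrA [leLHS]addrC lerD2r.
rewrite (eq_bigr (fun k : 'I_N => q ^+ `|k - j|)); first exact: IH.
by move=> k _; rewrite lift0 -[k.+1]addn1 -[j.+1]addn1 distnDr.
Qed.

Lemma two_sided_exp_le (kap : R) : 0 < kap -> exists2 B : R, 1 <= B &
  forall (N : nat) (z : R), \sum_(k < N) expR (- (kap * `|k%:R - z|)) <= B.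
Proof.
move=> kap0; pose q := expR (- kap).
have q0 : 0 <= q by exact: expR_ge0.
have q1 : q < 1 by rewrite -expR0 ltr_expR; lra.
have q1' : 0 < 1 - q by rewrite subr_gt0.
exists (1 + expR kap * (2 * (1 - q)^-1)).
  by rewrite lerDl !mulr_ge0 ?expR_ge0 ?invr_ge0 ?(ltW q1').
move=> N z.
(* Replacing the real centre by an integer shortens distances by at most 1, which costs the factor
   [expR kap]. *)
have [j Hj] : exists j : nat, forall k : nat, `|k - j|%:R - 1 <= `|k%:R - z| :> R.
  have [z0|z0] := leP 0 z; last first.
    exists 0%N => k; rewrite distn0 ger0_norm; last by rewrite subr_ge0 (le_trans (ltW z0)).
    lra.
  exists (Num.trunc z) => k; have /andP[h1 h2] := Num.Theory.trunc_itv z0.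
  have -> : `|k - Num.trunc z|%:R = `|k%:R - (Num.trunc z)%:R| :> R.
    have [h|h] := leqP k (Num.trunc z).
      by rewrite distnEr// natrB// ler0_norm ?opprB// subr_le0 ler_nat.
    by rewrite distnEl ?(ltnW h)// natrB ?(ltnW h)// ger0_norm// subr_ge0 ler_nat ltnW.
  have : `|(Num.trunc z)%:R - z| <= 1.
    rewrite ler_norml; move: h2; rewrite -natr1; lra.
  have := ler_distD z k%:R (Num.trunc z)%:R; rewrite (distrC z); lra.
apply: (@le_trans _ _ (\sum_(k < N) expR kap * q ^+ `|k - j|)).
  apply: ler_sum => k _; rewrite /q -expRM_natl -expRD ler_expR.
  have := Hj k; rewrite -subr_ge0 => h; have := mulr_ge0 (ltW kap0) h; lra.
rewrite -mulr_sumr; apply: (@le_trans _ _ (expR kap * (2 * (1 - q)^-1))); last by lra.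
by rewrite ler_wpM2l ?expR_ge0// two_sided_geometric_le.
Qed.

(** About [|T| / d] terms are bounded by 1; the remaining ones decay geometrically. *)
Lemma ramp_exp_le (kap d : R) : 0 < kap -> 0 < d -> exists2 B : R, 0 <= B &
  forall (N : nat) (T : R), \sum_(k < N) expR (- (kap * Num.max 0 (d * k%:R - T))) <= B * (1 + `|T|).
Proof.
move=> kap0 d0; have [B B1 HB] := @two_sided_exp_le (kap * d) (mulr_gt0 kap0 d0).
have B0 : 0 <= B by apply: le_trans B1.
exists (1 + d^-1 + B); first by rewrite !addr_ge0 ?invr_ge0 ?(ltW d0).
move=> N T; pose j := (Num.trunc (`|T| / d)).+1.
have Td : 0 <= `|T| / d by rewrite divr_ge0// ltW.
have /andP[h1 h2] := Num.Theory.trunc_itv Td.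
apply: (@le_trans _ _ (\sum_(k < N) ((k < j)%N%:R + expR (- (kap * d * `|k%:R - j%:R|))))).
  apply: ler_sum => k _; have [kj|jk] := ltnP k j.
    apply: (@le_trans _ _ 1); last by rewrite lerDl expR_ge0.
    by rewrite -[leRHS]expR0 ler_expR oppr_le0 mulr_ge0 ?(ltW kap0)// le_max lexx.
  rewrite add0r ler_expR lerN2 -mulrA ler_wpM2l ?(ltW kap0)// le_max; apply/orP; right.
  rewrite ger0_norm ?subr_ge0 ?ler_nat// mulrBr lerB//.
  have : `|T| <= d * j%:R by rewrite mulrC -ler_pdivrMr// ltW.
  by apply: le_trans; exact: ler_norm.
rewrite big_split/=; apply: (@le_trans _ _ (j%:R + B)).
  apply: lerD; last exact: HB.
  rewrite -natr_sum ler_nat; suff -> : (\sum_(i < N) (i < j) = minn N j)%N by rewrite geq_minr.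
  elim: N => [|N IH]; first by rewrite big_ord0 min0n.
  by rewrite big_ord_recr/= IH; case: ltnP => h; lia.
have jle : j%:R <= 1 + d^-1 * `|T|.
  by rewrite /j -natr1; lra.
have T0 : 0 <= `|T| by [].
have dT : 0 <= d^-1 by rewrite invr_ge0 ltW.
have BT : 0 <= B * `|T| by rewrite mulr_ge0.
by move: jle; rewrite !mulrDl !mulrDr; lra.
Qed.

Lemma expR_prod (I : Type) (r : seq I) (F : I -> R) :
  expR (\sum_(i <- r) F i) = \prod_(i <- r) expR (F i).
Proof.
elim: r => [|i r IH]; first by rewrite !big_nil expR0.
by rewrite !big_cons expRD IH.
Qed.

(* r coordinates J of m are determined, up to a rapidly decaying error, by the r
   linear forms; the other n - r are only limited by d |m| <= T. *)
Lemma lattice_sum (n r : nat) (B : 'M[R]_(n, r)) (kap d : R) : row_full B -> 0 < kap -> 0 < d ->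
  exists2 C : R, 0 <= C & forall (N : nat) (T : R) (y : 'I_r -> R),
    \sum_(m : {ffun 'I_n -> 'I_N.+1})
      expR (- (kap * (\sum_j `|\sum_i (m i)%:R * B i j - y j| +
         Num.max 0 (d * (\sum_i m i)%:R - T)))) <= C * (1 + `|T|) ^+ (n - r).
Proof.
(* [f] selects [r] linearly independent rows of [B], whose indices form the set [J] below; [Cb]
   bounds the inverse of the selected square matrix. *)
move=> fB kap0 d0; pose f := fullrankfun fB; have f_inj : injective f by exact: fullrankfun_inj.
have uB : rowsub f B \in unitmx := fullrowsub_unit fB.
pose Bi := invmx (rowsub f B).
pose Cb : R := 1 + \sum_l \sum_j `|Bi j l|.
have Cb0 : 0 < Cb by rewrite ltr_pwDl// sumr_ge0// => l _; rewrite sumr_ge0.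
pose k1 := kap / Cb; have k10 : 0 < k1 by rewrite divr_gt0.
(* The single ramp in the total size is shared out among the coordinates, so that the exponential
   becomes a product. *)
pose k2 := kap / n.+1%:R; have k20 : 0 < k2 by rewrite divr_gt0.
have [B1 B11 HB1] := two_sided_exp_le k10.
have [B2 B20 HB2] := ramp_exp_le k20 d0.
have B10 : 0 <= B1 by apply: le_trans B11.
exists (B1 ^+ r * B2 ^+ (n - r)); first by rewrite mulr_ge0 ?exprn_ge0.
move=> N T y.
pose J : {set 'I_n} := [set f l | l in 'I_r]%SET.
have cJ : #|J| = r by rewrite card_imset// card_ord.
have cJ' : #|(~: J)%SET| = (n - r)%N by rewrite cardsCs finset.setCK cJ card_ord.
pose zero (m : {ffun 'I_n -> 'I_N.+1}) : {ffun 'I_n -> 'I_N.+1} := [ffun i => if i \in J then ord0 else m i].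
pose Z (m0 : {ffun 'I_n -> 'I_N.+1}) : 'rV[R]_r := \row_j (y j - \sum_(i | i \notin J) (m0 i)%:R * B i j).
(* With the coordinates outside [J] fixed, [zz] is the centre about which the linear forms
   concentrate the coordinates in [J]. *)
pose zz m0 (i : 'I_n) : R := \sum_(l | f l == i) (Z m0 *m Bi) 0 l.
have zzE m0 l : zz m0 (f l) = (Z m0 *m Bi) 0 l.
  by rewrite /zz (eq_bigl (pred1 l)) ?big_pred1_eq// => l'; rewrite /= (inj_eq f_inj).
pose h (m0 : {ffun 'I_n -> 'I_N.+1}) (i : 'I_n) (k : 'I_N.+1) : R :=
  if i \in J then expR (- (k1 * `|k%:R - zz m0 i|)) else expR (- (k2 * Num.max 0 (d * k%:R - T))).
have h0 m0 i k : 0 <= h m0 i k by rewrite /h; case: ifP; rewrite expR_ge0.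
have term (m : {ffun 'I_n -> 'I_N.+1}) :
    expR (- (kap * (\sum_j `|\sum_i (m i)%:R * B i j - y j| + Num.max 0 (d * (\sum_i m i)%:R - T))))
    <= \prod_i h (zero m) i (m i).
  pose v : 'rV[R]_r := \row_j (\sum_i (m i)%:R * B i j - y j).
  pose mJ : 'rV[R]_r := \row_l (m (f l))%:R.
  have Zm : Z (zero m) = \row_j (y j - \sum_(i | i \notin J) (m i)%:R * B i j).
    apply/rowP => j; rewrite !mxE; congr (_ - _); apply: eq_bigr => i iJ.
    by rewrite ffunE (negbTE iJ).
  have vE : v = mJ *m rowsub f B - Z (zero m).
    apply/rowP => j; rewrite Zm !mxE (bigID (mem J))/= big_imset/=; last by move=> a b _ _ /f_inj.
    under [in RHS]eq_bigr do rewrite !mxE.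
    set S1 := \sum_(i in _) _; set S2 := \sum_(i | _) _.
    have -> : S1 = \sum_l (m (f l))%:R * B (f l) j by apply: eq_bigl => l; rewrite inE.
    by ring.
  have vBi : v *m Bi = mJ - Z (zero m) *m Bi by rewrite vE mulmxBl -mulmxA mulmxV// mulmx1.
  have S1 : \sum_l `|(m (f l))%:R - zz (zero m) (f l)| <= Cb * \sum_j `|\sum_i (m i)%:R * B i j - y j|.
    rewrite mulrDl mul1r; apply: (@le_trans _ _ ((\sum_l \sum_j `|Bi j l|) * \sum_j `|\sum_i (m i)%:R * B i j - y j|)); last first.
      by rewrite lerDr sumr_ge0.
    rewrite mulr_suml; apply: ler_sum => l _; rewrite zzE.
    have -> : (m (f l))%:R - (Z (zero m) *m Bi) 0 l = (v *m Bi) 0 l by rewrite vBi !mxE.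
    rewrite mxE mulr_suml; apply: le_trans (ler_norm_sum _ _ _) _.
    apply: ler_sum => j _; rewrite normrM mulrC ler_wpM2l// mxE (bigD1 j)//= lerDl sumr_ge0//.
  have S2 : \sum_(i | i \notin J) Num.max 0 (d * (m i)%:R - T) <= n.+1%:R * Num.max 0 (d * (\sum_i m i)%:R - T).
    apply: (@le_trans _ _ (\sum_(i < n) Num.max 0 (d * (\sum_i m i)%:R - T))).
      rewrite [leRHS](bigID (mem J))/= -[leLHS]add0r lerD//.
        by rewrite sumr_ge0// => i _; rewrite le_max lexx.
      apply: ler_sum => i _; rewrite ge_max !le_max lexx/=; apply/orP; right.
      by rewrite lerD2r ler_wpM2l ?(ltW d0)// ler_nat (bigD1 i)//= leq_addr.
    rewrite sumr_const card_ord -[leLHS]mulr_natl ler_wpM2r ?ler_nat// le_max lexx//.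
  have -> : \prod_i h (zero m) i (m i) = expR (\sum_i (if i \in J then - (k1 * `|(m i)%:R - zz (zero m) i|)
      else - (k2 * Num.max 0 (d * (m i)%:R - T)))).
    by rewrite expR_prod; apply: eq_bigr => i _; rewrite /h; case: ifP.
  rewrite ler_expR [leRHS](bigID (mem J))/=.
  have -> : \sum_(i in J) (if i \in J then - (k1 * `|(m i)%:R - zz (zero m) i|)
      else - (k2 * Num.max 0 (d * (m i)%:R - T))) = - (k1 * \sum_l `|(m (f l))%:R - zz (zero m) (f l)|).
    rewrite (eq_bigr (fun i => - (k1 * `|(m i)%:R - zz (zero m) i|))); last by move=> i ->.
    rewrite sumrN -mulr_sumr big_imset/=; last by move=> a b _ _ /f_inj.
    by congr (- (_ * _)); apply: eq_bigl => l; rewrite inE.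
  have -> : \sum_(i | i \notin J) (if i \in J then - (k1 * `|(m i)%:R - zz (zero m) i|)
      else - (k2 * Num.max 0 (d * (m i)%:R - T))) = - (k2 * \sum_(i | i \notin J) Num.max 0 (d * (m i)%:R - T)).
    rewrite (eq_bigr (fun i => - (k2 * Num.max 0 (d * (m i)%:R - T)))); last by move=> i /negbTE->.
    by rewrite sumrN -mulr_sumr.
  have A1 := ler_wpM2l (ltW k10) S1; have A2 := ler_wpM2l (ltW k20) S2.
  rewrite mulrA /k1 mulfVK ?gt_eqF// in A1; rewrite mulrA /k2 mulfVK ?pnatr_eq0// in A2.
  by rewrite -opprD lerN2 mulrDr lerD.
pose ee (m0 : {ffun 'I_n -> 'I_N.+1}) (i : 'I_n) : R :=
  if i \in J then B1 else expR (- (k2 * Num.max 0 (d * (m0 i)%:R - T))).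
have inner (m0 : {ffun 'I_n -> 'I_N.+1}) : zero m0 == m0 ->
    \sum_(m | zero m == m0) \prod_i h (zero m) i (m i) <= \prod_i ee m0 i.
  move=> _; pose h' i (k : 'I_N.+1) : R := if i \in J then h m0 i k else (k == m0 i)%:R * h m0 i k.
  have h'0 i k : 0 <= h' i k by rewrite /h'; case: ifP => _ //; rewrite mulr_ge0.
  apply: (@le_trans _ _ (\sum_(m : {ffun 'I_n -> 'I_N.+1}) \prod_i h' i (m i))).
    rewrite big_mkcond; apply: ler_sum => m _; case: eqP => [mm0|_]; last exact: prodr_ge0.
    rewrite le_eqVlt; apply/orP; left; apply/eqP; apply: eq_bigr => i _.
    rewrite /h' mm0; case: ifPn => // iJ.
    have -> : m i = m0 i by rewrite -mm0 ffunE (negbTE iJ).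
    by rewrite eqxx mul1r.
  rewrite -(bigA_distr_bigA (fun i k => h' i k)); apply: ler_prod => i _; apply/andP; split.
    exact: sumr_ge0.
  rewrite /h' /ee; case: ifPn => iJ.
    by rewrite /h iJ; exact: HB1.
  rewrite (bigD1 (m0 i))//= eqxx mul1r big1 ?addr0; last by move=> k /negbTE->; rewrite mul0r.
  by rewrite /h (negbTE iJ).
apply: (@le_trans _ _ (\sum_(m : {ffun 'I_n -> 'I_N.+1}) \prod_i h (zero m) i (m i))).
  by apply: ler_sum => m _; exact: term.
(* The tuples are grouped by their coordinates outside [J]; each group is represented by its element
   that vanishes on [J]. *)
rewrite (partition_big zero (fun m0 => zero m0 == m0))/=; last first.
  by move=> m _; apply/eqP/ffunP => i; rewrite !ffunE; case: (i \in J).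
apply: (@le_trans _ _ (\sum_(m0 | zero m0 == m0) \prod_i ee m0 i)); first exact: ler_sum.
pose e' (i : 'I_n) (k : 'I_N.+1) : R :=
  if i \in J then (k == ord0)%:R * B1 else expR (- (k2 * Num.max 0 (d * k%:R - T))).
have e'0 i k : 0 <= e' i k by rewrite /e'; case: ifP => _; rewrite ?mulr_ge0 ?expR_ge0.
apply: (@le_trans _ _ (\sum_(m0 : {ffun 'I_n -> 'I_N.+1}) \prod_i e' i (m0 i))).
  rewrite big_mkcond; apply: ler_sum => m0 _; case: eqP => [m00|_]; last exact: prodr_ge0.
  rewrite le_eqVlt; apply/orP; left; apply/eqP; apply: eq_bigr => i _.
  rewrite /ee /e'; case: ifPn => // iJ.
  have -> : m0 i = ord0 by rewrite -m00 ffunE iJ.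
  by rewrite eqxx mul1r.
rewrite -(bigA_distr_bigA e').
apply: (@le_trans _ _ (\prod_i (if i \in J then B1 else B2 * (1 + `|T|)))).
  apply: ler_prod => i _; rewrite sumr_ge0//= /e'; case: ifP => _; last exact: HB2.
  by rewrite (bigD1 ord0)//= mul1r big1 ?addr0// => k /negbTE->; rewrite mul0r.
rewrite (bigID (mem J))/= (eq_bigr (fun=> B1)); last by move=> i ->.
rewrite [X in _ * X](eq_bigr (fun=> B2 * (1 + `|T|))); last by move=> i /negbTE->.
rewrite !prodr_const cJ.
have -> : #|[pred i | i \notin J]| = (n - r)%N by rewrite -cJ'; apply: eq_card => i; rewrite !inE.
by rewrite exprMn mulrA.
Qed.

End lattice_sums.

(** * Sums over the boxes in terms of the Newton polyhedron *)

Section newton_sums.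
Context {R : realType} {n : nat}.
Implicit Types (E : seq (multiindex n)) (H : 'rV[R]_n -> R).

(** In the application [s] is the total of [m], [T] the logarithm of the frequency in units of
    [- ln th], and [sig] the sum of the absolute values of the linear forms. The excess over [T / d]
    is the exponential decay that makes the sum over [m] converge; for [p < d] there is decay on
    both sides of [d * s = T]. *)
Lemma exponent_bound (p d ep : R) : 0 < p -> p <= d -> 0 < ep -> exists2 kap : R, 0 < kap &
  forall s T sig : R, 0 <= sig ->
    T / d + kap * (sig + Num.max 0 (d * s - T)) <= s + Num.max 0 ((ep * sig - (d * s - T)) / p) /\
    (p < d -> T / d + kap * (sig + `|d * s - T| + Num.max 0 (d * s - T)) <=
      s + Num.max 0 ((ep * sig - (d * s - T)) / p)).
Proof.
move=> p0 pd ep0; have d0 : 0 < d by exact: lt_le_trans pd.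
(* With [u = d * s - T], [k1] serves when [2 * u >= ep * sig] and [k2] when [u] is nonnegative but
   smaller. For negative [u], [ep / p] takes care of [sig] and [k3] of [|u|]; the value 1 of [k3] is
   a default when [p = d]. *)
pose k1 := (d * (2 / ep + 2))^-1.
pose k2 := (ep / (2 * p)) / (1 + ep).
pose k3 := if p < d then p^-1 - d^-1 else 1.
have k10 : 0 < k1 by rewrite invr_gt0 mulr_gt0// addr_gt0// divr_gt0.
have k20 : 0 < k2 by rewrite !divr_gt0// ?mulr_gt0// addr_gt0.
have k30 : 0 < k3 by rewrite /k3; case: ifP => // h; rewrite subr_gt0 ltf_pV2.
have k40 : 0 < ep / p by rewrite divr_gt0.
pose kap := Num.min (Num.min k1 k2) (Num.min k3 (ep / p)).
have kap0 : 0 < kap by rewrite !lt_min k10 k20 k30 k40.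
have kle1 : kap <= k1 by rewrite !ge_min lexx.
have kle2 : kap <= k2 by rewrite !ge_min lexx !orbT.
have kle3 : kap <= k3 by rewrite !ge_min lexx !orbT.
have kle4 : kap <= ep / p by rewrite !ge_min lexx !orbT.
exists kap => // s T sig sig0; set u := d * s - T.
have sE : s = T / d + u / d.
  by rewrite /u -mulrDl addrC subrK mulrAC mulfV ?gt_eqF// mul1r.
suff [S1 S2] : kap * (sig + Num.max 0 u) <= u / d + Num.max 0 ((ep * sig - u) / p) /\
    (p < d -> kap * (sig + `|u| + Num.max 0 u) <= u / d + Num.max 0 ((ep * sig - u) / p)).
  have K (x y : R) : x <= u / d + y -> T / d + x <= s + y by move: sE; lra.
  by split => [|/S2 h]; exact: K.
have [u0|u0] := leP 0 u.
  rewrite (ger0_norm u0).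
  suff S : kap * (sig + u + u) <= u / d + Num.max 0 ((ep * sig - u) / p).
    split => // ; apply: le_trans S; rewrite ler_wpM2l ?(ltW kap0)//; lra.
  have [h|h] := leP (ep * sig) (2 * u).
    apply: (@le_trans _ _ (u / d)); last by rewrite lerDl le_max lexx.
    apply: (@le_trans _ _ (k1 * (2 / ep + 2) * u)); last first.
      have c0 : 2 / ep + 2 != 0 by rewrite gt_eqF// addr_gt0// divr_gt0.
      by rewrite /k1 invfM mulfVK// mulrC.
    rewrite -mulrA; apply: ler_pM => //; [exact: ltW|lra|].
    have : sig <= 2 / ep * u by rewrite mulrAC ler_pdivlMr// mulrC.
    by rewrite mulrDl; lra.
  apply: (@le_trans _ _ ((ep * sig - u) / p)); last first.
    by rewrite -[leLHS]add0r lerD ?divr_ge0 ?(ltW d0)// le_max lexx orbT.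
  apply: (@le_trans _ _ (ep * sig / (2 * p))); last first.
    rewrite invfM mulrA ler_wpM2r ?invr_ge0 ?(ltW p0)//; lra.
  apply: (@le_trans _ _ (k2 * ((1 + ep) * sig))).
    by apply: ler_pM => //; [exact: ltW|lra|lra].
  have c0 : 1 + ep != 0 by rewrite gt_eqF// addr_gt0.
  by rewrite /k2 mulrA mulfVK// mulrAC.
rewrite (ltr0_norm u0) !addr0.
have epsig : 0 <= ep * sig by rewrite mulr_ge0// ltW.
have B : u / d + (ep * sig - u) / p <= u / d + Num.max 0 ((ep * sig - u) / p).
  by rewrite lerD2l le_max lexx orbT.
have kz : kap * sig <= ep / p * sig by rewrite ler_wpM2r.
have eE : u / d + (ep * sig - u) / p = ep / p * sig + (- u) * (p^-1 - d^-1) by ring.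
have u0' : 0 <= - u by rewrite oppr_ge0 ltW.
split.
  apply: le_trans B; rewrite eE; apply: le_trans kz _; rewrite lerDl mulr_ge0//.
  by rewrite subr_ge0 lef_pV2.
move=> ltpd; apply: le_trans B; rewrite eE mulrDr; apply: lerD => //.
by rewrite mulrC ler_wpM2l//; move: kle3; rewrite /k3 ltpd.
Qed.

(** A single exponent of weight at most [V] bounds the sum over [E] from below by [th] to the power
    [V]. In the exponent to base [th], the minimum with 1 becomes a maximum with 0. *)
Lemma newton_term (th : R) E (M : nat) (Lam V s e : R) (m : 'I_n -> nat) : 0 < th -> th < 1 ->
  (0 < M)%N -> 0 < Lam ->
  (exists2 a, a \in E & (wdot m a)%:R <= V) -> 
  e <= s + Num.max 0 ((ln Lam / - ln th - V) / M%:R) ->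
  expR (ln th * s) * Num.min 1 ((Lam * \sum_(a <- E) th ^+ wdot m a) `^ (- M%:R^-1)) <=
    expR (ln th * e).
Proof.
move=> th0 th1 M0 Lam0 [a aE aV] es.
have lth : ln th < 0 by rewrite ln_lt0// th0.
have M0' : 0 < M%:R :> R by rewrite ltr0n.
have G : expR (ln th * V) <= \sum_(a <- E) th ^+ wdot m a.
  apply: (@le_trans _ _ (th ^+ wdot m a)).
    rewrite -[th ^+ _]lnK ?posrE ?exprn_gt0// ler_expR lnXn// -[leRHS]mulr_natr.
    by rewrite ler_nM2l.
  elim: (E) aE => // b r IH; rewrite inE big_cons => /predU1P[->|/IH h].
    by rewrite lerDl sumr_ge0// => c _; rewrite exprn_ge0// ltW.
  by apply: le_trans h _; rewrite lerDr exprn_ge0// ltW.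
have G0 : 0 < \sum_(a <- E) th ^+ wdot m a by apply: lt_le_trans G; rewrite expR_gt0.
apply: (@le_trans _ _ (expR (ln th * s) * expR (ln th * Num.max 0 ((ln Lam / - ln th - V) / M%:R)))); last first.
  by rewrite -expRD ler_expR -mulrDr ler_nM2l.
rewrite ler_wpM2l ?expR_ge0//.
have [h|h] := leP 0 ((ln Lam / - ln th - V) / M%:R); last by rewrite mulr0 expR0 ge_min lexx.
rewrite ge_min; apply/orP; right.
rewrite powRN -ler_pV2 ?inE ?unitfE ?invr_eq0 ?gt_eqF ?invr_gt0 ?powR_gt0 ?expR_gt0 ?mulr_gt0//.
rewrite invrK -expRN.
apply: (@le_trans _ _ ((Lam * expR (ln th * V)) `^ M%:R^-1)); last first.
  apply: ge0_ler_powR; rewrite ?nnegrE ?invr_ge0 ?mulr_ge0 ?expR_ge0 ?(ltW Lam0) ?(ltW G0)//.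
  by rewrite ler_wpM2l// ltW.
have -> : Lam * expR (ln th * V) = expR (ln Lam + ln th * V) by rewrite expRD lnK ?posrE.
rewrite -expRM ler_expR le_eqVlt; apply/orP; left; apply/eqP.
have nl : ln th != 0 by rewrite lt_eqF.
have nM : M%:R != 0 :> R by rewrite gt_eqF.
by field; rewrite ?nl ?nM.
Qed.

(** The number of forms and their centres stay abstract, because the sum is estimated with the [k]
    directions of the face and also with [k + 1] forms, the last one centred at [T]. *)
Lemma newton_sum_lattice (th : R) E (M r : nat) (d kap : R) (B : 'M[R]_(n, r)) (y : R -> 'I_r -> R)
    (V : ('I_n -> nat) -> R) : 0 < th -> th < 1 -> (0 < M)%N -> 0 < d -> 0 < kap -> row_full B ->
  (forall m : 'I_n -> nat, exists2 a, a \in E & (wdot m a)%:R <= V m) ->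
  (forall (m : 'I_n -> nat) T, T / d + kap * (\sum_j `|\sum_i (m i)%:R * B i j - y T j| +
      Num.max 0 (d * (\sum_i m i)%N%:R - T)) <= (\sum_i m i)%N%:R + Num.max 0 ((T - V m) / M%:R)) ->
  exists2 C : R, 0 <= C & forall (Lam : R) (N : nat), 0 < Lam ->
    \sum_(m : {ffun 'I_n -> 'I_N.+1}) th ^+ (\sum_i m i) *
      Num.min 1 ((Lam * \sum_(a <- E) th ^+ wdot (fun i => m i) a) `^ (- M%:R^-1)) <=
    C * (Lam `^ (- d^-1) * (1 + `|ln Lam|) ^+ (n - r)).
Proof.
move=> th0 th1 M0 d0 kap0 fB HV HT.
have lth : ln th < 0 by rewrite ln_lt0// th0.
pose l := - ln th; have l0 : 0 < l by rewrite oppr_gt0.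
have [C C0 HC] := lattice_sum fB (mulr_gt0 l0 kap0) d0.
exists (C * (1 + l^-1) ^+ (n - r)).
  by rewrite mulr_ge0// exprn_ge0// addr_ge0// invr_ge0 ltW.
move=> Lam N Lam0; pose T := ln Lam / l.
apply: (@le_trans _ _ (\sum_(m : {ffun 'I_n -> 'I_N.+1}) Lam `^ (- d^-1) *
   expR (- (l * kap * (\sum_j `|\sum_i (m i)%:R * B i j - y T j| +
         Num.max 0 (d * (\sum_i m i)%N%:R - T)))))).
  apply: ler_sum => m _.
  have -> : th ^+ (\sum_i m i)%N = expR (ln th * (\sum_i m i)%N%:R).
    by rewrite mulrC expRM_natl lnK ?posrE.
  apply: le_trans (newton_term th0 th1 M0 Lam0 (HV (fun i => m i)) (HT (fun i => m i) T)) _.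
  have -> : Lam `^ (- d^-1) = expR (ln th * (T / d)).
    rewrite /powR gt_eqF//; congr expR; rewrite /T /l; field.
    by rewrite (lt_eqF lth) (gt_eqF d0).
  rewrite -expRD ler_expR le_eqVlt; apply/orP; left; apply/eqP; rewrite /l; ring.
rewrite -mulr_sumr.
apply: (@le_trans _ _ (Lam `^ (- d^-1) * (C * (1 + `|T|) ^+ (n - r)))).
  by rewrite ler_wpM2l ?powR_ge0//; exact: (HC N T (y T)).
have -> : C * (1 + l^-1) ^+ (n - r) * (Lam `^ (- d^-1) * (1 + `|ln Lam|) ^+ (n - r)) =
    Lam `^ (- d^-1) * (C * ((1 + l^-1) * (1 + `|ln Lam|)) ^+ (n - r)) by rewrite exprMn; ring.
rewrite ler_wpM2l ?powR_ge0// ler_wpM2l// lerXn2r ?nnegrE ?mulr_ge0 ?addr_ge0 ?invr_ge0 ?(ltW l0)//.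
have -> : `|T| = l^-1 * `|ln Lam| by rewrite /T normrM (gtr0_norm (_ : 0 < l^-1)) ?invr_gt0// mulrC.
have : 0 <= `|ln Lam| by []. have : 0 <= l^-1 by rewrite invr_ge0 ltW.
by rewrite !(mulrDl, mulrDr) !mul1r !mulr1; lra.
Qed.

(** As [t < M], the volume factor [th ^+ |m|] beats the loss of [th] to the power [- t |m| / M], and
    the sum factors into geometric series. *)
Lemma newton_sum_subcritical (th : R) E (M : nat) (t : R) : 0 < th -> th < 1 -> (0 < M)%N -> t < M%:R ->
  (forall m : 'I_n -> nat, exists2 a, a \in E & (wdot m a)%:R <= t * (\sum_i m i)%N%:R) ->
  exists2 C : R, 0 <= C & forall (Lam : R) (N : nat), 0 < Lam ->
    \sum_(m : {ffun 'I_n -> 'I_N.+1}) th ^+ (\sum_i m i) *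
      Num.min 1 ((Lam * \sum_(a <- E) th ^+ wdot (fun i => m i) a) `^ (- M%:R^-1)) <=
    C * Lam `^ (- M%:R^-1).
Proof.
move=> th0 th1 M0 tM HV.
have M0' : 0 < M%:R :> R by rewrite ltr0n.
have lth : ln th < 0 by rewrite ln_lt0// th0.
pose q := expR (ln th * (1 - t / M%:R)).
have q0 : 0 <= q by exact: expR_ge0.
have q1 : q < 1 by rewrite -expR0 ltr_expR nmulr_rlt0// subr_gt0 ltr_pdivrMr// mul1r.
exists ((1 - q)^-1 ^+ n); first by rewrite exprn_ge0// invr_ge0 subr_ge0 ltW.
move=> Lam N Lam0.
apply: (@le_trans _ _ (\sum_(m : {ffun 'I_n -> 'I_N.+1}) Lam `^ (- M%:R^-1) * \prod_i q ^+ m i)).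
  apply: ler_sum => m _; set s : R := (\sum_i m i)%N%:R.
  have -> : th ^+ (\sum_i m i)%N = expR (ln th * s).
    by rewrite /s mulrC expRM_natl lnK ?posrE.
  apply: le_trans (@newton_term th E M Lam (t * s) s (s + (ln Lam / - ln th - t * s) / M%:R) (fun i => m i) th0 th1 M0 Lam0 (HV (fun i => m i)) _) _.
    by rewrite lerD2l le_max lexx orbT.
  rewrite prodrXr /q -expRM_natl /powR gt_eqF// -expRD ler_expR le_eqVlt -/s; apply/orP; left; apply/eqP.
  have nl : ln th != 0 by rewrite lt_eqF.
  have nM : M%:R != 0 :> R by rewrite gt_eqF.
  by field; rewrite ?nl ?nM.
rewrite -mulr_sumr mulrC ler_wpM2r ?powR_ge0//.
rewrite -(bigA_distr_bigA (fun (i : 'I_n) (k : 'I_N.+1) => q ^+ k)).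
rewrite prodr_const card_ord lerXn2r ?nnegrE ?invr_ge0 ?subr_ge0 ?(ltW q1)//.
  by rewrite sumr_ge0// => k _; rewrite exprn_ge0.
exact: geometric_le.
Qed.

Lemma exists_le_average (T : eqType) (E : seq T) (w h : T -> R) (c : R) : uniq E ->
  (forall a, 0 <= w a) -> \sum_(a <- E) w a = 1 -> \sum_(a <- E) w a * h a <= c ->
  exists2 a, a \in E & h a <= c.
Proof.
move=> uE w0 w1; rewrite leNgt => /negP le; apply: contrapT => no; apply: le.
have lt_c a : a \in E -> c < h a.
  by move=> aE; rewrite ltNge; apply/negP => hc; apply: no; exists a.
have [a aE wa] : exists2 a, a \in E & 0 < w a.
  apply: contrapT => no'; move: w1; rewrite big1_seq; first by move/esym/eqP; rewrite oner_eq0.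
  move=> a /= aE; apply/eqP; rewrite eq_le w0 andbT leNgt; apply/negP => wa.
  by apply: no'; exists a.
have {1}-> : c = \sum_(a <- E) w a * c by rewrite -mulr_suml w1 mul1r.
rewrite (bigD1_seq a)//= [ltRHS](bigD1_seq a)//= ltr_leD ?ltr_pM2l ?lt_c//.
rewrite big_seq_cond [leRHS]big_seq_cond; apply: ler_sum => b /andP[bE _].
by rewrite ler_wpM2l// ltW// lt_c.
Qed.

(** Since the diagonal point is interior to the face, the polyhedron contains [diag d + v] for all
    small [v] in the direction space of the face. Taking [v] opposite to the signs of the linear
    forms at [m] lowers the weight by [ep] times their total size. The second rank condition says
    that the diagonal is transversal to the face. *)
Lemma critical_directions H E (d : R) (k : nat) : (0 < n)%N ->
  minimal_basis (fun a => taylor_coef H a != 0) E ->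
  d = newton_distance H -> 0 < d -> critical_face_dim H k ->
  exists (B : 'M[R]_(n, k)) (ep : R), [/\ 0 < ep, row_full B, row_full (row_mx B (const_mx d : 'cV_n)) &
    forall m : 'I_n -> nat, exists2 a, a \in E &
      (wdot m a)%:R <= d * (\sum_i m i)%N%:R - ep * \sum_j `|\sum_i (m i)%:R * B i j|].
Proof.
move=> n0 EP dE d0 [F [[_ [a0 [c0 [_ FE]]]] [Fd nearF] [p [Mx [rk affE]]]]].
rewrite -dE in Fd nearF.
have FN x : F x -> newton_polyhedron H x by rewrite FE => -[].
subst k; set k := \rank Mx.
pose L := row_base Mx.
have affd : (diag d - p <= Mx)%MS.
  have : affine_hull F (diag d).
    exists 1%N, (fun=> 1), (fun=> diag d); split => //; first by rewrite big_ord1.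
    by rewrite big_ord1 scale1r.
  by rewrite affE.
have [del /= del0 Hdel] := (iffLR (nbhs_ballP _ _) nearF).
have NE v : (v <= Mx)%MS -> `|v| < del -> newton_polyhedron H (diag d + v).
  move=> vM vd; apply: FN; apply: (Hdel (diag d + v)).
    by rewrite -ball_normE /= opprD addNKr normrN.
  rewrite affE /= addrAC; exact: addmx_sub.
(* [ep] is so small that steps of size [ep] along all rows of [L], with any signs, stay within the
   radius [del]. *)
exists L^T, (del / (2 * (1 + \sum_j `|row j L|))).
set S := \sum_j _; have S0 : 0 <= S by rewrite sumr_ge0.
set ep := del / _; have ep0 : 0 < ep by rewrite divr_gt0// mulr_gt0// ltr_pwDl.
have epS : ep * S < del.
  rewrite /ep mulrAC ltr_pdivrMr ?mulr_gt0 ?ltr_pwDl// ltr_pM2l//; lra.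
have rL : \rank L = k by apply/eqP; exact: row_base_free.
split => //.
- by rewrite /row_full mxrank_tr rL.
- have -> : row_mx L^T (const_mx d : 'cV_n) = (col_mx L (const_mx d : 'rV_n))^T.
    by rewrite tr_col_mx trmx_const.
  suff ltL : (L < L + (const_mx d : 'rV_n))%MS.
    rewrite /row_full mxrank_tr eqn_leq rank_leq_row/=.
    have h := rank_ltmx ltL; rewrite rL addsmxE in h.
    by apply: leq_trans h; rewrite addn1.
  rewrite /ltmx addsmxSl/= addsmx_sub submx_refl/=.
  apply/negP => dL.
  (* Were the diagonal parallel to the face, a diagonal point below [d] would lie in the polyhedron,
     against the definition of the Newton distance. *)
  have dM : (diag d <= Mx)%MS by rewrite -(eq_row_base Mx).
  pose t := Num.min (2^-1 : R) (del / (2 * d)).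
  have t0 : 0 < t by rewrite lt_min invr_gt0 ltr0n divr_gt0// mulr_gt0.
  have td : `|(- t) *: diag d : 'rV[R]_n| < del.
    apply: norm_lt_coord => // i; rewrite !mxE mulNr normrN gtr0_norm ?mulr_gt0//.
    apply: (@le_lt_trans _ _ (del / (2 * d) * d)); first by rewrite ler_wpM2r ?(ltW d0)// ge_min lexx orbT.
    by rewrite invfM mulrA mulfVK ?gt_eqF// ltr_pdivrMr// ltr_pMr// ltr1n.
  have := NE _ (scalemx_sub (- t) dM) td.
  have -> : diag d + (- t) *: diag d = diag (d - t * d) :> 'rV[R]_n.
    by apply/rowP => i; rewrite !mxE mulNr.
  move=> Nt; have : newton_distance H <= d - t * d.
    apply: ge_inf => //; exists 0 => s /= Ns.
    have := @newton_polyhedron_ge R n H E EP (fun i => (i == Ordinal n0)%:R) 0 _ _ _ Ns.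
    rewrite (bigD1 (Ordinal n0))//= mul1r mxE big1 ?addr0; last first.
      by move=> i /negbTE->; rewrite mul0r.
    apply => [i|m _]; first by rewrite ler0n.
    by rewrite /mdot sumr_ge0// => i _; rewrite mulr_ge0 ?ler0n.
  by have := mulr_gt0 t0 d0; rewrite -dE; lra.
move=> m; pose lm (j : 'I_k) : R := \sum_i (m i)%:R * L^T i j.
pose v : 'rV[R]_n := - ep *: \sum_j Num.sg (lm j) *: row j L.
have vM : (v <= Mx)%MS.
  rewrite scalemx_sub// summx_sub// => j _; apply: scalemx_sub.
  by apply: submx_trans (row_sub j L) _; rewrite (eq_row_base Mx).
have vd : `|v| < del.
  rewrite normrZ normrN gtr0_norm//; apply: le_lt_trans epS; rewrite ler_wpM2l ?(ltW ep0)//.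
  apply: le_trans (ler_norm_sum _ _ _) _; apply: ler_sum => j _.
  rewrite normrZ ler_piMl// normr_sg; case: (lm j != 0) => //.
have [w [w0 w1 wx]] := newton_polyhedron_simplex EP (NE v vM vd).
have key : \sum_(a <- E) w a * (wdot m a)%:R <= d * (\sum_i m i)%N%:R - ep * \sum_j `|lm j|.
  have -> : \sum_(a <- E) w a * (wdot m a)%:R = \sum_i (m i)%:R * \sum_(a <- E) w a * (a i)%:R.
    under [RHS]eq_bigr do rewrite mulr_sumr.
    rewrite exchange_big; apply: eq_bigr => a _ /=.
    by rewrite /wdot natr_sum mulr_sumr; apply: eq_bigr => i _; rewrite natrM mulrCA.
  apply: (@le_trans _ _ (\sum_i (m i)%:R * (diag d + v) 0 i)).
    by apply: ler_sum => i _; rewrite ler_wpM2l.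
  rewrite le_eqVlt; apply/orP; left; apply/eqP.
  rewrite (eq_bigr (fun i => d * (m i)%:R + (m i)%:R * v 0 i)); last first.
    by move=> i _; rewrite !mxE; ring.
  rewrite big_split/= -mulr_sumr natr_sum; congr (_ + _).
  rewrite -mulNr mulr_sumr.
  rewrite (eq_bigr (fun i => \sum_j - ep * (Num.sg (lm j) * ((m i)%:R * L^T i j)))); last first.
    move=> i _; rewrite mxE summxE mulr_sumr mulr_sumr; apply: eq_bigr => j _; rewrite !mxE; ring.
  rewrite exchange_big; apply: eq_bigr => j _ /=.
  by rewrite -mulr_sumr -mulr_sumr -/(lm j) -normrEsg.
have [uE _ _ _] := EP.
by have [a aE wa] := exists_le_average uE w0 w1 key; exists a.
Qed.

Lemma newton_sum_critical (th : R) H E (M k : nat) (d : R) : (0 < n)%N -> 0 < th -> th < 1 ->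
  (0 < M)%N -> minimal_basis (fun a => taylor_coef H a != 0) E ->
  d = newton_distance H -> M%:R <= d -> critical_face_dim H k ->
  exists2 C : R, 0 <= C & forall (Lam : R) (N : nat), 0 < Lam ->
    \sum_(m : {ffun 'I_n -> 'I_N.+1}) th ^+ (\sum_i m i) *
      Num.min 1 ((Lam * \sum_(a <- E) th ^+ wdot (fun i => m i) a) `^ (- M%:R^-1)) <=
    C * (Lam `^ (- d^-1) * (1 + `|ln Lam|) ^+ (n - k)) /\
    (M%:R < d -> \sum_(m : {ffun 'I_n -> 'I_N.+1}) th ^+ (\sum_i m i) *
      Num.min 1 ((Lam * \sum_(a <- E) th ^+ wdot (fun i => m i) a) `^ (- M%:R^-1)) <=
    C * (Lam `^ (- d^-1) * (1 + `|ln Lam|) ^+ (n - k - 1))).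
Proof.
move=> n0 th0 th1 M0 EP dE Md hk.
have M0' : 0 < M%:R :> R by rewrite ltr0n.
have d0 : 0 < d by exact: lt_le_trans Md.
have [B [ep [ep0 fB fB1 HV]]] := critical_directions n0 EP dE d0 hk.
have [kap kap0 Hkap] := exponent_bound M0' Md ep0.
pose sig (m : 'I_n -> nat) := \sum_j `|\sum_i (m i)%:R * B i j|.
pose V (m : 'I_n -> nat) := d * (\sum_i m i)%N%:R - ep * sig m.
have sig0 m : 0 <= sig m by exact: sumr_ge0.
have eq_arg (m : 'I_n -> nat) T : T - V m = ep * sig m - (d * (\sum_i m i)%N%:R - T).
  by rewrite /V; ring.
have HT1 (m : 'I_n -> nat) T : T / d + kap * (\sum_(j < k) `|\sum_i (m i)%:R * B i j - 0| +
     Num.max 0 (d * (\sum_i m i)%N%:R - T)) <=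
     (\sum_i m i)%N%:R + Num.max 0 ((T - V m) / M%:R).
  rewrite eq_arg (eq_bigr (fun j => `|\sum_i (m i)%:R * B i j|)); last by move=> j _; rewrite subr0.
  exact: (Hkap _ _ _ (sig0 m)).1.
have [C1 C10 HC1] := @newton_sum_lattice th E M k d kap B (fun _ _ => 0) V th0 th1 M0 d0 kap0 fB HV HT1.
have [Md'|nMd] := boolP (M%:R < d); last first.
  by exists C1 => // Lam N Lam0; split => //; exact: HC1.
(* For [M < d] the decay is two-sided in [d |m| - T], which acts as one more linear form, centred at
   [T], and removes one more summation. *)
pose y2 (T : R) (j : 'I_(k + 1)) : R := match fintype.split j with inl _ => 0 | inr _ => T end.
pose B2 : 'M[R]_(n, k + 1) := row_mx B (const_mx d : 'cV_n).
have HT2 (m : 'I_n -> nat) T : T / d + kap * (\sum_(j < k + 1) `|\sum_i (m i)%:R * B2 i j - y2 T j| + Num.max 0 (d * (\sum_i m i)%N%:R - T)) <=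
     (\sum_i m i)%N%:R + Num.max 0 ((T - V m) / M%:R).
  rewrite eq_arg; have := (Hkap (\sum_i m i)%N%:R T (sig m) (sig0 m)).2 Md'.
  suff -> : \sum_(j < k + 1) `|\sum_i (m i)%:R * B2 i j - y2 T j| = sig m + `|d * (\sum_i m i)%N%:R - T| by [].
  rewrite big_split_ord/= big_ord1 /y2 /B2; congr (_ + _).
    apply: eq_bigr => j _; rewrite -[lshift 1 j]/(unsplit (inl j)) unsplitK subr0; congr `|_|.
    by apply: eq_bigr => i _; rewrite row_mxEl.
  rewrite -[rshift k ord0]/(unsplit (inr ord0)) unsplitK; congr (`|_ - _|).
  rewrite natr_sum mulr_sumr; apply: eq_bigr => i _.
  by rewrite row_mxEr mxE mulrC.
have [C2 C20 HC2] := @newton_sum_lattice th E M (k + 1) d kap B2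
  y2 V th0 th1 M0 d0 kap0 fB1 HV HT2.
exists (C1 + C2); first by rewrite addr_ge0.
move=> Lam N Lam0; have X0 (j : nat) : 0 <= Lam `^ (- d^-1) * (1 + `|ln Lam|) ^+ j.
  by rewrite mulr_ge0 ?powR_ge0// exprn_ge0// addr_ge0.
split => [|_].
  apply: le_trans (HC1 Lam N Lam0) _; rewrite mulrDl lerDl mulr_ge0//.
by apply: le_trans (HC2 Lam N Lam0) _; rewrite subnDA mulrDl lerDr mulr_ge0.
Qed.

End newton_sums.

(** * The Taylor remainder of the graph function *)

Section reduction.
Context {R : realType} {n : nat}.
Implicit Types (x z : 'rV[R]_n) (f g H : 'rV[R]_n -> R) (V : set 'rV[R]_n) (E : seq (multiindex n)).
Local Notation D s f := (foldr (@partial R n R) f s).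

Lemma iterated_shift f z (s : seq 'I_n) : D s (fun x => f (x + z)) = fun x => D s f (x + z).
Proof.
elim: s => [//|i s IH] /=; rewrite IH; apply/funext => x.
rewrite /partial /derive /=.
by under [in RHS]eq_fun do rewrite addrA.
Qed.

Lemma continuous_shift z : continuous (fun x : 'rV[R]_n => x + z).
Proof.
move=> x; exact: (@cvgD _ _ _ (nbhs (x : 'rV[R]_n)) (nbhs_filter x) id (fun=> z) x z cvg_id (cvg_cst z)).
Qed.

Lemma open_shift V z : open V -> open [set x | V (x + z)].
Proof.
move=> oV; apply: (@open_comp _ _ (fun x : 'rV[R]_n => x + z) V) => // x _.
exact: continuous_shift.
Qed.

Lemma smooth_shift V f z : smooth_on V f -> smooth_on [set x | V (x + z)] (fun x => f (x + z)).
Proof.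
move=> sf s x /= Vx; rewrite iterated_shift; have [c d] := sf s _ Vx; split.
  apply: (@cvg_comp _ _ _ (fun x : 'rV[R]_n => x + z) (D s f) _ _ _ (@continuous_shift z x) c).
move=> i; have := d i; rewrite /derivable /=.
by under eq_fun do rewrite addrA.
Qed.

(** The remainder is itself a phase with [L = 1], so the lemmas on phases give its smoothness and
    its first derivatives. *)
Lemma taylor_remainder2E g z : taylor_remainder2 g z =
  phase (- g z) (\row_i (- partial i g z)) 1 (fun x => g (x + z)).
Proof.
apply/funext => x; rewrite /taylor_remainder2 /phase.
have -> : \sum_i (\row_i (- partial i g z)) 0 i * x 0 i = - \sum_i partial i g z * x 0 i.
  by rewrite -sumrN; apply: eq_bigr => i _; rewrite mxE mulNr.
by ring.
Qed.

Lemma mdegree_lt2 (a : multiindex n) : (mdegree a < 2)%N ->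
  a = [ffun => 0%N] \/ exists j, a = unit_index j.
Proof.
rewrite ltnS leq_eqVlt ltnS leqn0 => /orP[/eqP b1|/eqP b0]; last first.
  left; apply/ffunP => i; rewrite ffunE; move: b0; rewrite /mdegree (bigD1 i)//=.
  by move/eqP; rewrite addn_eq0 => /andP[/eqP].
right; have [j bj] : exists j, a j != 0%N.
  apply: contrapT => no; move: b1; rewrite /mdegree big1// => i _.
  by apply/eqP/negPn/negP => h; apply: no; exists i.
exists j; move: b1; rewrite /mdegree (bigD1 j)//= => b1.
apply/ffunP => i; rewrite ffunE; have [->|ij] := eqVneq i j.
  by move: bj b1; case: (a j) => // -[//|k]; rewrite !addSn.
move: bj b1; rewrite (bigD1 i)//=.
by case: (a j) => [//|k] _; case: (a i) => [//|l]; rewrite !addSn addnS.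
Qed.

Lemma size_mseq (a : multiindex n) : size (mseq a) = mdegree a.
Proof.
rewrite size_flatten /shape -map_comp sumnE big_map big_enum; apply: eq_bigr => i _.
by rewrite /= size_nseq.
Qed.

Lemma mpartial_unit f j x : mpartial (unit_index j) f x = partial j f x.
Proof.
rewrite mpartialE -/(mseq _).
have : size (mseq (unit_index j)) = 1%N by rewrite size_mseq mdegree_unit.
have := count_mseq (unit_index j) j; rewrite ffunE eqxx.
case: (mseq _) => [//|i [|//]] /=; rewrite addn0.
by case: eqVneq => [->|].
Qed.

Lemma mpartial0 f x : mpartial [ffun => 0%N] f x = f x.
Proof.
rewrite mpartialE -/(mseq _).
have : size (mseq ([ffun => 0%N] : multiindex n)) = 0%N.
  by rewrite size_mseq /mdegree big1// => i _; rewrite ffunE.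
by case: (mseq _).
Qed.

Lemma monomial0 x : monomial [ffun => 0%N] x = 1.
Proof. by rewrite /monomial big1// => i _; rewrite ffunE expr0. Qed.

Lemma monomial_unit j x : monomial (unit_index j) x = x 0 j.
Proof.
rewrite /monomial (bigD1 j)//= ffunE eqxx expr1 big1 ?mulr1// => k ki.
by rewrite ffunE (negbTE ki) expr0.
Qed.

Lemma taylor_coef0 f : taylor_coef f [ffun => 0%N] = f 0.
Proof.
rewrite /taylor_coef mpartial0 /mfactorial big1 ?divr1// => i _.
by rewrite ffunE fact0.
Qed.

Lemma taylor_coef_unit f j : taylor_coef f (unit_index j) = partial j f 0.
Proof.
rewrite /taylor_coef mpartial_unit /mfactorial big1 ?divr1// => i _.
by rewrite ffunE; case: (i == j).
Qed.

Lemma sum_degseq2 (F : multiindex n -> R) :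
  \sum_(a <- @degseq n 2) F a = F [ffun => 0%N] + \sum_j F (unit_index j).
Proof.
have z2 (j : 'I_n) : unit_index j != [ffun => 0%N].
  by apply/eqP => /ffunP/(_ j); rewrite !ffunE eqxx.
rewrite (perm_big ([ffun => 0%N] :: [seq unit_index j | j <- enum 'I_n])); last first.
  apply: uniq_perm; first exact: degseq_uniq.
    rewrite /= map_inj_uniq ?enum_uniq ?andbT; last first.
      move=> i j /ffunP/(_ i); by rewrite !ffunE eqxx; case: eqVneq.
    by apply/mapP => -[j _ /esym/eqP]; rewrite (negbTE (z2 j)).
  move=> a; rewrite mem_degseq inE; apply/idP/orP.
    by move=> /mdegree_lt2[->|[j ->]]; [left|right; apply: map_f; rewrite mem_enum].
  move=> [/eqP->|/mapP[j _ ->]]; last by rewrite mdegree_unit.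
  by rewrite /mdegree big1// => i _; rewrite ffunE.
by rewrite big_cons big_map big_enum.
Qed.

Lemma taylor_remainder2_flat V g z : open V -> V z -> smooth_on V g ->
  forall a, (mdegree a < 2)%N -> taylor_coef (taylor_remainder2 g z) a = 0.
Proof.
move=> oV Vz sg a /mdegree_lt2[->|[j ->]].
  rewrite taylor_coef0 /taylor_remainder2 add0r subrr big1 ?subrr// => i _.
  by rewrite mxE mulr0.
rewrite taylor_coef_unit taylor_remainder2E.
have V0 : [set x | V (x + z)] 0 by rewrite /= add0r.
rewrite (partial_phase _ _ _ _ (@open_shift V z oV) (@smooth_shift V g z sg) V0) mxE mul1r.
by have := iterated_shift g z [:: j]; rewrite /= => ->; rewrite add0r addNr.
Qed.

Lemma analytic_power_series V g z : analytic_on V g -> V z ->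
  exists r c, 0 < r /\ power_series r c (fun x => g (x + z)).
Proof.
move=> /[apply] -[c [r [r0 H]]]; exists r, c; split => //; split.
  (* At the point with all coordinates [rho] a monomial equals [rho ^+ mdegree a], so summability
     there is absolute convergence on the polydisc. *)
  move=> rho rho0 rhor; pose h : 'rV[R]_n := const_mx rho.
  have hr : `|h| < r by apply: norm_lt_coord => // i; rewrite mxE ger0_norm.
  have mh a : monomial a h = rho ^+ mdegree a.
    by rewrite /monomial /mdegree -prodrXr; apply: eq_bigr => i _; rewrite mxE.
  have [] := H h hr; rewrite /summable.
  set S := (X in (X < _)%E) => Soo _.
  exists (fine S) => N; rewrite -lee_fin fineK; last first.
    by rewrite ge0_fin_numE// esum_ge0.
  apply: esum_ge; exists [set` @degseq n N]; first by split => //; exact: finite_seq.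
  rewrite -fsbig_seq ?degseq_uniq// -sumEFin; apply: lee_sum => a _.
  by rewrite abse_EFin lee_fin mh normrM (ger0_norm (exprn_ge0 _ rho0)).
move=> x xr; have [_] := H x xr; rewrite addrC.
by under eq_fun do rewrite fsbig_degseq.
Qed.

Lemma analytic_taylor_remainder2 V g z : analytic_on V g -> V z ->
  exists2 r, 0 < r & power_series r (taylor_coef (taylor_remainder2 g z)) (taylor_remainder2 g z).
Proof.
move=> ag Vz; have [r [c [r0 pc]]] := analytic_power_series ag Vz.
exists r => //; pose c' a := if (mdegree a < 2)%N then 0 else c a.
suff pc' : power_series r c' (taylor_remainder2 g z) by rewrite (power_series_coef r0 pc').
have cE := power_series_coef r0 pc; case: pc => cb cf; split.
  move=> rho rho0 rhor; have [K HK] := cb rho rho0 rhor; exists K => N.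
  apply: le_trans (HK N); apply: ler_sum => a _; rewrite ler_wpM2r ?exprn_ge0// /c'.
  by case: ifP => // _; rewrite normr0.
move=> x xr; have h := cf x xr.
have part2 : \sum_(a <- @degseq n 2) c a * monomial a x = g z + \sum_i partial i g z * x 0 i.
  rewrite sum_degseq2 monomial0 mulr1 -cE taylor_coef0 add0r; congr (_ + _).
  apply: eq_bigr => j _; rewrite monomial_unit taylor_coef_unit.
  by have := iterated_shift g z [:: j]; rewrite /= => ->; rewrite add0r.
have sumE N : (2 <= N)%N -> \sum_(a <- @degseq n N) c' a * monomial a x =
    \sum_(a <- @degseq n N) c a * monomial a x - \sum_(a <- @degseq n 2) c a * monomial a x.
  move=> N2; rewrite [X in _ - X](_ : _ = \sum_(a <- @degseq n N | (mdegree a < 2)%N) c a * monomial a x).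
    rewrite [X in X - _](bigID (fun a => (mdegree a < 2)%N))/= addrAC subrr add0r.
    rewrite [RHS]big_mkcond; apply: eq_bigr => a _; rewrite /c'; case: ifP => //= _.
    by rewrite mul0r.
  rewrite -[RHS]big_filter; apply: perm_big; apply: uniq_perm; [exact: degseq_uniq|exact: filter_uniq (degseq_uniq _)|].
  move=> a; rewrite mem_degseq [RHS]mem_filter mem_degseq; case: ltnP => //= a2.
  by rewrite (leq_trans a2 N2).
have -> : taylor_remainder2 g z x = g (x + z) - \sum_(a <- @degseq n 2) c a * monomial a x.
  by rewrite part2 /taylor_remainder2 opprD addrA.
have : (\sum_(a <- @degseq n N) c a * monomial a x - \sum_(a <- @degseq n 2) c a * monomial a x) @[N --> \oo] -->
    g (x + z) - \sum_(a <- @degseq n 2) c a * monomial a x.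
  by apply: cvgB => //; exact: cvg_cst.
apply: cvg_trans; apply: near_eq_cvg; exists 2%N => // N /= N2.
by rewrite sumE.
Qed.

(** The two regularity hypotheses differ only in the source of the remainder estimate: the summable
    series, or pure powers in [E] that dominate a flat error. *)
Lemma reduction V g z : (0 < n)%N -> open V -> V z -> smooth_on V g ->
  (analytic_on V g /\ newton_polyhedron (taylor_remainder2 g z) !=set0) \/
    meets_coordinate_axes (newton_polyhedron (taylor_remainder2 g z)) ->
  exists E, [/\ minimal_basis (fun a => taylor_coef (taylor_remainder2 g z) a != 0) E, E != [::],
    forall m, m \in E -> (2 <= mdegree m)%N &
    remainder_estimate (taylor_remainder2 g z) E].
Proof.
move=> n0 oV Vz sg hyp; set H := taylor_remainder2 g z.
have [E EP] := exists_minimal_basis (fun a => taylor_coef H a != 0).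
have V0 : [set x | V (x + z)] 0 by rewrite /= add0r.
have oVz := @open_shift V z oV.
have sH : smooth_on [set x | V (x + z)] H.
  by rewrite /H taylor_remainder2E; exact: smooth_phase oVz (@smooth_shift V g z sg).
exists E; split => //.
- case: hyp => [[_ [x Nx]]|ax].
    apply/eqP => E0; have [w [_ w1 _]] := newton_polyhedron_simplex EP Nx.
    by move: w1; rewrite E0 big_nil => /esym/eqP; rewrite oner_eq0.
  by have [m] := newton_axes EP ax (Ordinal n0); case: (E).
- move=> m mE; rewrite leqNgt; apply/negP => m2; have [_ Et _ _] := EP.
  by have := Et m mE; rewrite (taylor_remainder2_flat oV Vz sg m2) eqxx.
- case: hyp => [[ag _]|ax].
    have [r r0 pH] := analytic_taylor_remainder2 ag Vz.
    exact: (analytic_remainder r0 pH EP).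
  exact: (@smooth_remainder R n [set x | V (x + z)] H E oVz sH V0 EP (newton_axes EP ax)).
Qed.

End reduction.

(** * Surface integrals over a graph *)

Section transfer.
Import HBSimple HBNNSimple.
Context {R : realType} d1 d2 (T1 : measurableType d1) (T2 : measurableType d2).
Variables (mu : {measure set T1 -> \bar R}) (sg : {measure set T2 -> \bar R}).
Variables (psi : T1 -> T2) (D1 : set T1) (D2 : set T2) (rho : T1 -> R).
Hypotheses (mD1 : measurable D1) (mD2 : measurable D2) (mpsi : measurable_fun D1 psi)
  (mrho : measurable_fun D1 rho) (rho0 : forall x, D1 x -> 0 <= rho x)
  (D12 : forall x, D1 x -> D2 (psi x))
  (sgE : forall B, measurable B -> B `<=` D2 ->
     sg B = (\int[mu]_(x in D1 `&` psi @^-1` B) (rho x)%:E)%E).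

Let m1 B : measurable B -> measurable (D1 `&` psi @^-1` B).
Proof. by move=> mB; exact: mpsi. Qed.

(** On indicators this is the hypothesis [sgE]; linearity extends it to simple functions, and
    monotone convergence will do the rest. *)
Let transfer_nnsfun (h : {nnsfun T2 >-> R}) :
  (\int[sg]_(y in D2) (h y)%:E = \int[mu]_(x in D1) (h (psi x) * rho x)%:E)%E.
Proof.
have mh y : measurable (h @^-1` [set y]) by exact: measurable_funPTI.
have nonneg (y : R) (v : T2) : 0 <= y * \1_(h @^-1` [set y]) v.
  have [y0|y0] := leP 0 y; first by rewrite mulr_ge0// indicE ler0n.
  by rewrite preimage_nnfun0// indic0 mulr0.
have mterm y : measurable_fun D1 (fun x => (y * \1_(h @^-1` [set y]) (psi x) * rho x)%:E).
  apply/measurable_EFinP; apply: measurable_funM => //; apply: measurable_funM => //.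
  by apply: (measurable_comp measurableT) => //; exact: measurable_indic.
under eq_integral do rewrite fimfunE -fsumEFin//.
rewrite ge0_integral_fsum//; last 2 first.
- by move=> y; apply/measurable_EFinP/measurable_funM => //; exact: measurable_indic.
- by move=> y v _; rewrite lee_fin.
transitivity (\int[mu]_(x in D1) (\sum_(y \in range h) (y * \1_(h @^-1` [set y]) (psi x) * rho x)%:E))%E; last first.
  apply: eq_integral => x _; rewrite fsumEFin//; congr EFin.
  rewrite {1}fimfunE mulrC mulr_fsumr; apply: eq_fsbigr => y _.
  by rewrite mulrC.
rewrite ge0_integral_fsum//; last first.
  by move=> y x D1x; rewrite lee_fin mulr_ge0// rho0.
apply: eq_fsbigr => y _; rewrite integralZl_indic_nnsfun//.
have -> : (\int[sg]_(v in D2) (\1_(h @^-1` [set y]) v)%:E)%E = sg (h @^-1` [set y] `&` D2).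
  by rewrite (@integral_indic _ _ _ sg D2 mD2).
have -> : h @^-1` [set y] `&` D2 = D2 `&` h @^-1` [set y] by rewrite setIC.
rewrite sgE; [|exact: (measurableI _ _ mD2 (mh y))|by move=> v []].
have -> : D1 `&` psi @^-1` (D2 `&` h @^-1` [set y]) = D1 `&` psi @^-1` (h @^-1` [set y]).
  by apply/seteqP; split => x /= [D1x]; [move=> [_ hx]|move=> hx]; split => //; split => //; exact: D12.
have [y0|y0] := ltP y 0.
  rewrite preimage_nnfun0// preimage_set0 setI0 integral_set0 mule0.
  by rewrite integral0_eq// => x _; rewrite indic0 mulr0 mul0r.
have -> : (\int[mu]_(x in D1 `&` psi @^-1` (h @^-1` [set y])) (rho x)%:E =
    \int[mu]_(x in D1) (\1_(h @^-1` [set y]) (psi x) * rho x)%:E)%E.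
  rewrite integral_mkcondr; apply: eq_integral => x _; rewrite patchE indicE.
  have -> : (x \in psi @^-1` (h @^-1` [set y])) = (psi x \in h @^-1` [set y]).
    by apply/idP/idP; rewrite !inE.
  by case: (_ \in _); rewrite ?mul1r ?mul0r.
rewrite -ge0_integralZl//.
- by apply: eq_integral => x _; rewrite -EFinM mulrA.
- apply/measurable_EFinP; apply: measurable_funM => //.
  by apply: (measurable_comp measurableT) => //; exact: measurable_indic.
- by move=> x D1x; rewrite lee_fin mulr_ge0 ?rho0// indicE ler0n.
Qed.

Lemma integral_transfer (F : T2 -> R) : measurable_fun [set: T2] F -> (forall y, 0 <= F y) ->
  (\int[sg]_(y in D2) (F y)%:E = \int[mu]_(x in D1) (F (psi x) * rho x)%:E)%E.
Proof.
move=> mF F0; have mF' : measurable_fun [set: T2] (EFin \o F) by exact/measurable_EFinP.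
pose h := nnsfun_approx measurableT mF'.
have hF y : (h k y)%:E @[k --> \oo] --> (F y)%:E.
  by apply: (cvg_nnsfun_approx measurableT mF') => //= t _; rewrite lee_fin.
have ndh y k l : (k <= l)%N -> h k y <= h l y.
  by move=> kl; have /lefP := nd_nnsfun_approx measurableT mF' kl; exact.
have h0 k y : 0 <= h k y by exact: fun_ge0.
have c2 : (\int[sg]_(y in D2) (h k y)%:E)%E @[k --> \oo] --> (\int[sg]_(y in D2) (F y)%:E)%E.
  have -> : (\int[sg]_(y in D2) (F y)%:E = \int[sg]_(y in D2) limn (fun k => (h k y)%:E))%E.
    by apply: eq_integral => y _; apply/esym/cvg_lim => //; exact: hF.
  apply: cvg_monotone_convergence => //.
  - by move=> k; apply/measurable_EFinP; exact: measurable_funTS.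
  - by move=> k y _; rewrite lee_fin.
  - by move=> y _ k l kl; rewrite lee_fin ndh.
have c1 : (\int[mu]_(x in D1) (h k (psi x) * rho x)%:E)%E @[k --> \oo] -->
    (\int[mu]_(x in D1) (F (psi x) * rho x)%:E)%E.
  have -> : (\int[mu]_(x in D1) (F (psi x) * rho x)%:E = \int[mu]_(x in D1) limn (fun k => (h k (psi x) * rho x)%:E))%E.
    apply: eq_integral => x _; apply/esym/cvg_lim => //.
    apply: cvg_EFin; first exact: nearW.
    by apply: cvgM; [exact: (fine_cvg (hF (psi x)))|exact: cvg_cst].
  apply: cvg_monotone_convergence => //.
  - move=> k; apply/measurable_EFinP/measurable_funM => //.
    by apply: (measurable_comp measurableT).
  - by move=> k x D1x; rewrite lee_fin mulr_ge0// rho0.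
  - by move=> x D1x k l kl; rewrite lee_fin ler_wpM2r ?rho0// ndh.
apply: (cvg_unique _ c2); first exact: ereal_hausdorff.
suff e : (fun k => \int[sg]_(y in D2) (h k y)%:E)%E = (fun k => \int[mu]_(x in D1) (h k (psi x) * rho x)%:E)%E.
  by rewrite /= e.
by apply/funext => k; exact: transfer_nnsfun.
Qed.

(** Positive and negative parts are transferred separately as extended integrals and then
    recombined. *)
Lemma Rintegral_transfer (F : T2 -> R) : measurable_fun [set: T2] F ->
  (\int[sg]_(y in D2) F y)%R = (\int[mu]_(x in D1) (F (psi x) * rho x))%R.
Proof.
move=> mF; rewrite /Rintegral; congr fine.
have mmax (G : T2 -> R) : measurable_fun [set: T2] G -> measurable_fun [set: T2] (fun y => Num.max (G y) 0).
  by move=> mG; apply: measurable_maxr => //; exact: measurable_cst.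
have part (G : T2 -> R) (G' : T1 -> R) : measurable_fun [set: T2] G ->
    (forall x, D1 x -> G' x = G (psi x) * rho x) ->
    (\int[sg]_(y in D2) maxe (G y)%:E 0 = \int[mu]_(x in D1) maxe (G' x)%:E 0)%E.
  move=> mG G'E; transitivity (\int[sg]_(y in D2) (Num.max (G y) 0)%:E)%E.
    by apply: eq_integral => y _; rewrite EFin_max.
  rewrite integral_transfer; [|exact: mmax|by move=> y; rewrite le_max lexx orbT].
  apply: eq_integral => x; rewrite inE => D1x; rewrite -EFin_max G'E//; congr EFin.
  by rewrite maxr_pMl ?rho0// mul0r.
rewrite integralE [in RHS]integralE; congr (_ - _)%E.
  transitivity (\int[sg]_(y in D2) maxe (F y)%:E 0)%E.
    by apply: eq_integral => y _; rewrite funeposE.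
  rewrite (part F (fun x => F (psi x) * rho x))//.
  by apply: eq_integral => x _; rewrite funeposE.
transitivity (\int[sg]_(y in D2) maxe (- F y)%:E 0)%E.
  by apply: eq_integral => y _; rewrite funenegE EFinN.
rewrite (part (fun y => - F y) (fun x => - (F (psi x) * rho x))).
- by apply: eq_integral => x _; rewrite funenegE EFinN.
- exact: measurable_funN.
- by move=> x _; rewrite mulNr.
Qed.

End transfer.

(** * Smoothness of graph maps *)

Section graph.
Context {R : realType} {n : nat}.
Implicit Types (x w z : 'rV[R]_n) (h : 'rV[R]_n -> R) (V : set 'rV[R]_n).
Local Notation D s f := (foldr (@partial R n R) f s).
Local Notation DW s f := (foldr (@partial R n 'rV[R]_(n + 1)) f s).

(** A class of maps that contains the graph map and is closed under partial derivatives, which act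
    on [h] and leave [v] fixed. Smoothness of the graph map thus reduces to that of a scalar
    function. *)
Definition affine_graph (P : 'M[R]_(n, n + 1)) (c v : 'rV[R]_(n + 1)) h x : 'rV[R]_(n + 1) :=
  x *m P + c + h x *: v.

Lemma affine_graph_derive P c v h x w : derivable h x w ->
  (fun t => t^-1 *: ((affine_graph P c v h \o shift x) (t *: w) - affine_graph P c v h x)) @ 0^' -->
    w *m P + 'D_w h x *: v.
Proof.
move=> dh.
have H : (fun t : R => w *m P + (t^-1 *: ((h \o shift x) (t *: w) - h x)) *: v) @ 0^' -->
    w *m P + 'D_w h x *: v.
  apply: cvgD; first exact: cvg_cst.
  by apply: cvgZ; [exact: dh|exact: cvg_cst].
apply: cvg_trans H; apply: near_eq_cvg; near=> t.
have t0 : t != 0 by near: t; exact: nbhs_dnbhs_neq.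
rewrite /affine_graph /= mulmxDl -scalemxAl.
have -> : t *: (w *m P) + x *m P + c + h (t *: w + x) *: v - (x *m P + c + h x *: v) =
    t *: (w *m P) + (h (t *: w + x) - h x) *: v.
  by rewrite scalerBl; apply/rowP => i; rewrite !mxE; ring.
move: (w *m P) => a; move: (h (t *: w + x) - h x) => e.
by apply/rowP => i; rewrite !mxE /GRing.scale /=; field.
Unshelve. all: end_near.
Qed.

Lemma differentiable_sum_seq (I : Type) (r : seq I) (f : I -> 'rV[R]_n -> 'rV[R]_(n + 1)) x :
  (forall i, differentiable (f i) x) -> differentiable (fun x => \sum_(i <- r) f i x) x.
Proof.
move=> df; elim: r => [|i r IH].
  by under eq_fun do rewrite big_nil; exact: differentiable_cst.
by under eq_fun do rewrite big_cons; exact: differentiableD.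
Qed.

Lemma differentiable_affine_graph P c v h x : differentiable h x -> differentiable (affine_graph P c v h) x.
Proof.
move=> dh; have -> : affine_graph P c v h = fun x => \sum_i x 0 i *: row i P + c + h x *: v.
  apply/funext => y; rewrite /affine_graph; congr (_ + _ + _).
  by rewrite mulmx_sum_row.
apply: differentiableD; last exact: differentiableZl.
apply: differentiableD; last exact: differentiable_cst.
apply: differentiable_sum_seq => i; apply: differentiableZl.
exact: differentiable_coord.
Qed.

Lemma near_derive (f k : 'rV[R]_n -> 'rV[R]_(n + 1)) V x w l : open V -> V x ->
  (forall y, V y -> f y = k y) ->
  (fun t => t^-1 *: ((k \o shift x) (t *: w) - k x)) @ 0^' --> l ->
  derivable f x w /\ 'D_w f x = l.
Proof.
move=> oV Vx fk kl.
have fl : (fun t => t^-1 *: ((f \o shift x) (t *: w) - f x)) @ 0^' --> l.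
  apply: cvg_trans kl; apply: near_eq_cvg; near=> t.
  rewrite /= (fk x Vx) fk//; near: t; apply: nbhs_dnbhs.
  have ct : {for (0 : R), continuous (fun t : R => t *: w + x : 'rV[R]_n)}.
    by apply: cvgD; [apply: cvgZr_tmp; exact: cvg_id|exact: cvg_cst].
  have V0 : nbhs ((0 : R) *: w + x : 'rV[R]_n) V by rewrite scale0r add0r; exact: open_nbhs_nbhs.
  exact: (ct _ V0).
split; last by apply: (cvg_lim _ fl).
by apply/cvg_ex; exists l.
Unshelve. all: end_near.
Qed.

Lemma affine_graph_iterated V P c v h : open V -> smooth_on V h -> forall s : seq 'I_n,
  exists P' c', forall x, V x -> DW s (affine_graph P c v h) x = affine_graph P' c' v (D s h) x.
Proof.
move=> oV sh; elim=> [|i s [P' [c' IH]]]; first by exists P, c.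
exists 0, (delta_mx 0 i *m P') => x Vx /=.
have dh : derivable (D s h) x (delta_mx 0 i) by have [_] := sh s x Vx; exact.
rewrite {1}/partial; have [_ ->] := near_derive oV Vx IH (@affine_graph_derive P' c' v (D s h) x (delta_mx 0 i) dh).
by rewrite /affine_graph mulmx0 add0r.
Qed.

Lemma smooth_affine_graph V P c v h : open V -> smooth_on V h -> smooth_on V (affine_graph P c v h).
Proof.
move=> oV sh s x Vx; have [P' [c' E]] := affine_graph_iterated P c v oV sh s.
have [ch dh] := sh s x Vx; split; last first.
  move=> i; exact: (near_derive oV Vx E (@affine_graph_derive P' c' v (D s h) x (delta_mx 0 i) (dh i))).1.
have sD : smooth_on V (D s h) by exact: (@smooth_iterated R n V h s sh).
have : {for x, continuous (affine_graph P' c' v (D s h))}.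
  by apply: differentiable_continuous; apply: differentiable_affine_graph; have [] := smooth_differentiable oV sD Vx.
apply: near_eq_continuous; near=> y; apply/esym/E; near: y.
exact: open_nbhs_nbhs.
Unshelve. all: end_near.
Qed.

End graph.

(** * Parametrization and area density of a graph *)

Section param.
Context {R : realType}.
Local Notation D s f := (foldr (@partial R _ R) f s).

Lemma differentiable_mulmxr m k (P : 'M[R]_(m, k)) (x : 'rV[R]_m) :
  differentiable (fun x : 'rV[R]_m => x *m P) x.
Proof.
have -> : (fun x : 'rV[R]_m => x *m P) = fun x => \sum_i x 0 i *: row i P.
  by apply/funext => y; rewrite mulmx_sum_row.
elim: (index_enum _) => [|i r IH].
  by under eq_fun do rewrite big_nil; exact: differentiable_cst.
under eq_fun do rewrite big_cons; apply: differentiableD => //.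
by apply: differentiableZl; exact: differentiable_coord.
Qed.

Lemma continuous_mulmxr m k (P : 'M[R]_(m, k)) : continuous (fun x : 'rV[R]_m => x *m P).
Proof. by move=> x; apply: differentiable_continuous; exact: differentiable_mulmxr. Qed.

Lemma lsubmxEmul m k : (fun p : 'rV[R]_(m + k) => lsubmx p) = fun p => p *m col_mx 1%:M 0.
Proof.
apply/funext => p; by rewrite -[in RHS](hsubmxK p) mul_row_col mulmx1 mulmx0 addr0.
Qed.

Lemma rsubmxEmul m k : (fun p : 'rV[R]_(m + k) => rsubmx p) = fun p => p *m col_mx 0 1%:M.
Proof.
apply/funext => p; by rewrite -[in RHS](hsubmxK p) mul_row_col mulmx1 mulmx0 add0r.
Qed.

Lemma continuous_lsubmx m k : continuous (fun p : 'rV[R]_(m + k) => lsubmx p).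
Proof. by rewrite lsubmxEmul; exact: continuous_mulmxr. Qed.

Lemma continuous_last m : continuous (fun p : 'rV[R]_(m + 1) => rsubmx p 0 0).
Proof.
move=> p; apply: differentiable_continuous.
have -> : (fun p : 'rV[R]_(m + 1) => rsubmx p 0 0) = (fun q : 'rV[R]_1 => q 0 0) \o (fun p => rsubmx p) by [].
rewrite rsubmxEmul; apply: differentiable_comp; first exact: differentiable_mulmxr.
exact: differentiable_coord.
Qed.

(** Sylvester's determinant identity, read off from a product of triangular block matrices written
    in two ways. *)
Lemma det_rank_one n (c : 'cV[R]_n) : \det (1%:M + c *m c^T) = 1 + \sum_i c i 0 ^+ 2.
Proof.
have e : block_mx (1%:M + c *m c^T) c 0 1%:M *m block_mx 1%:M 0 (- c^T) 1%:M =
    block_mx 1%:M 0 (- c^T) 1%:M *m block_mx 1%:M c 0 (1%:M + c^T *m c).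
  rewrite !mulmx_block !mulmx1 !mul1mx !mulmx0 !mul0mx !addr0 !add0r mulmxN addrK.
  by rewrite mulNmx addrC addrK.
have := congr1 (fun A => \det A) e; rewrite !det_mulmx !det_ublock !det_lblock !det1 !mulr1 !mul1r => ->.
rewrite det_mx11 mxE mxE eqxx mulr1n; congr (_ + _).
by rewrite mxE; apply: eq_bigr => i _; rewrite mxE expr2.
Qed.

Context {n : nat}.
Variables (g : 'rV[R]_n -> R) (z : 'rV[R]_n) (V : set 'rV[R]_n).
Hypotheses (oV : open V) (sg : smooth_on V g).

Let G x := g (x + z).
Let psi x := graph_map g (x + z).
Let V0 := [set x | V (x + z)].
Let oV0 : open V0 := @open_shift R n V z oV.
Let sG : smooth_on V0 G := @smooth_shift R n V g z sg.

Lemma graph_map_shiftE :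
  psi = affine_graph (row_mx 1%:M 0) (row_mx z 0) (row_mx 0 1%:M) G.
Proof.
apply/funext => x; rewrite /psi /graph_map /affine_graph mul_mx_row mulmx1 mulmx0.
by rewrite add_row_mx scale_row_mx scaler0 scalemx1 add_row_mx !addr0 add0r.
Qed.

Lemma jacobian_graph_map x : V0 x ->
  'J psi x = row_mx 1%:M (\col_i partial i g (x + z)).
Proof.
move=> Vx; apply/row_matrixP => i; rewrite rowE -deriveEjacobian; last first.
  rewrite graph_map_shiftE; apply: differentiable_affine_graph.
  by have [] := smooth_differentiable oV0 sG Vx.
have dh : derivable G x (delta_mx 0 i) by have [_] := sG [::] Vx; exact.
have E y : V0 y -> psi y = affine_graph (row_mx 1%:M 0) (row_mx z 0) (row_mx 0 1%:M) G y.
  by rewrite graph_map_shiftE.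
have [_ ->] := near_derive oV0 Vx E
  (@affine_graph_derive R n (row_mx 1%:M 0) (row_mx z 0) (row_mx 0 1%:M) G x (delta_mx 0 i) dh).
rewrite mul_mx_row mulmx1 mulmx0 scale_row_mx scaler0 scalemx1 add_row_mx addr0 add0r.
rewrite rowE mul_mx_row mulmx1; congr row_mx.
have := iterated_shift g z [:: i]; move/(congr1 (@^~ x)) => /= e.
rewrite -rowE; apply/rowP => j; rewrite [j]ord1 !mxE mulr1n.
exact: e.
Qed.

Lemma area_density_graph x : V0 x ->
  area_density psi x = Num.sqrt (1 + \sum_i partial i g (x + z) ^+ 2).
Proof.
move=> Vx; rewrite /area_density jacobian_graph_map//; congr Num.sqrt.
rewrite tr_row_mx mul_row_col trmx1 mulmx1 det_rank_one; congr (_ + _).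
by apply: eq_bigr => i _; rewrite mxE.
Qed.

Lemma graph_local_parametrization S (W : set 'rV[R]_(n + 1)) O : open W ->
  S `&` W = graph_map g @` V -> open O -> O `<=` V0 -> local_parametrization S O psi.
Proof.
move=> oW SW oO OV; split => //.
- rewrite graph_map_shiftE; apply: smooth_affine_graph => //.
  by move=> s x Ox; exact: (sG s (OV _ Ox)).
- move=> u Ou; rewrite jacobian_graph_map; last exact: OV.
  apply/row_freeP; exists (col_mx 1%:M 0).
  by rewrite mul_row_col mulmx1 mulmx0 addr0.
- move=> u v _ _ /(congr1 lsubmx); rewrite /psi /graph_map !row_mxKl.
  exact: addIr.
move=> B oB BO; exists (W `&` [set p | B (lsubmx p - z)]).
  apply: openI => //.
  have c : continuous (fun p : 'rV[R]_(n + 1) => lsubmx p - z).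
    move=> p; apply: (@cvg_comp _ _ _ (fun p : 'rV[R]_(n + 1) => lsubmx p) (fun x => x - z)).
      exact: continuous_lsubmx.
    exact: continuous_shift.
  by apply: open_comp oB => p _; exact: c.
apply/seteqP; split => [p [x Bx <-]|p [Sp [Wp /= Bp]]].
  have : (graph_map g @` V) (psi x) by exists (x + z) => //; exact/OV/BO.
  by rewrite -SW => -[? ?]; split => //; split => //=; rewrite /psi /graph_map row_mxKl addrK.
have : (S `&` W) p by [].
rewrite SW => -[x Vx xp]; exists (lsubmx p - z) => //.
by rewrite -xp /psi /graph_map row_mxKl subrK.
Qed.

End param.

Section measurability.
Context {R : realType}.

Lemma open_preimage_within m (V : topologicalType) (f : 'rV[R]_m -> V) (B : set 'rV[R]_m) (O : set V) :
  open B -> open O -> (forall x, B x -> {for x, continuous f}) -> open (B `&` f @^-1` O).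
Proof.
move=> oB oO cf; rewrite openE => x [Bx Ox]; apply: filterI; first exact: open_nbhs_nbhs.
by apply: (cf x Bx); exact: open_nbhs_nbhs.
Qed.

Lemma open_measurable_borel m (B : set 'rV[R]_m) : open B -> measurable (B : set (borelRn R m)).
Proof. by move=> oB; exact: (@sub_sigma_algebra _ _ (@open 'rV[R]_m)). Qed.

Context {d : measure_display} {T : measurableType d} {m : nat}.
Variables (q : T -> borelRn R m) (mq : measurable_fun [set: T] q).

Let mpre (B : set 'rV[R]_m) : open B -> measurable (q @^-1` B).
Proof.
by move=> oB; rewrite -[X in measurable X]setTI; apply: mq => //; exact: open_measurable_borel.
Qed.

Lemma measurable_comp_within (f : 'rV[R]_m -> R) (B : set 'rV[R]_m) : open B ->
  (forall x, B x -> {for x, continuous f}) -> measurable_fun (q @^-1` B) (f \o q).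
Proof.
move=> oB cf; apply: (measurability (RGenOpens.G (R := R))); first exact: RGenOpens.measurableE.
move=> _ [_ [a [b ->]] <-].
have -> : q @^-1` B `&` (f \o q) @^-1` `]a, b[%classic = q @^-1` (B `&` f @^-1` `]a, b[%classic) by [].
by apply: mpre; apply: open_preimage_within => //; exact: itv_open.
Qed.

Lemma measurable_comp_within_row k (f : 'rV[R]_m -> 'rV[R]_k) (B : set 'rV[R]_m) : open B ->
  (forall x, B x -> {for x, continuous f}) ->
  measurable_fun (q @^-1` B) (f \o q : T -> borelRn R k).
Proof.
move=> oB cf; apply: (@measurability _ _ _ (borelRn R k) _ _ (@open 'rV[R]_k)) => //.
move=> _ [A oA <-].
have -> : q @^-1` B `&` (f \o q) @^-1` A = q @^-1` (B `&` f @^-1` A) by [].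
by apply: mpre; exact: open_preimage_within.
Qed.

End measurability.

Section surface.
Context {R : realType} {n : nat}.
Variables (S : set 'rV[R]_(n + 1)) (sigma : {measure set (borelRn R (n + 1)) -> \bar R})
  (hsigma : is_surface_measure S sigma) (g : 'rV[R]_n -> R) (z : 'rV[R]_n)
  (V : set 'rV[R]_n) (oV : open V) (sg : smooth_on V g)
  (W : set 'rV[R]_(n + 1)) (oW : open W) (SW : S `&` W = graph_map g @` V).

Let psi x := graph_map g (x + z).
Let rho x := Num.sqrt (1 + \sum_i partial i g (x + z) ^+ 2).
Local Notation tup := (n.-tuple (measurableTypeR R)).
Local Notation row := (@row_of_tuple R n).

Variables (O : set 'rV[R]_n) (oO : open O) (OV : forall x, O x -> V (x + z)).

Let D2 : set 'rV[R]_(n + 1) := psi @` O.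

Lemma continuous_graph_map_shift x : O x -> {for x, continuous psi}.
Proof.
move=> Ox; apply: differentiable_continuous; rewrite /psi graph_map_shiftE.
apply: differentiable_affine_graph.
by have [] := smooth_differentiable (@open_shift R n V z oV) (@smooth_shift R n V g z sg) (OV Ox).
Qed.

Lemma differentiable_density x : O x -> differentiable rho x.
Proof.
move=> Ox; pose s (x : 'rV[R]_n) := 1 + \sum_i partial i g (x + z) ^+ 2.
have ds : differentiable s x.
  apply: differentiableD; first exact: differentiable_cst.
  have di i : differentiable (fun x => partial i g (x + z) ^+ 2) x.
    have sp : smooth_on [set x | V (x + z)] (fun x => partial i g (x + z)).
      exact: (@smooth_shift R n V (partial i g) z (@smooth_partial R n V g i sg)).
    have [d _] := smooth_differentiable (@open_shift R n V z oV) sp (OV Ox).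
    rewrite (_ : (fun x => _) = (fun x => partial i g (x + z)) * (fun x => partial i g (x + z))); last first.
      by apply/funext => y; rewrite expr2.
    exact: differentiableM.
  elim: (index_enum _) => [|i r IH].
    by under eq_fun do rewrite big_nil; exact: differentiable_cst.
  by under eq_fun do rewrite big_cons; exact: differentiableD.
have s0 : 0 < s x by rewrite ltr_pwDl// sumr_ge0// => i _; exact: sqr_ge0.
have -> : rho = Num.sqrt \o s by [].
apply: differentiable_comp => //; apply/derivable1_diffP.
by have [] := is_derive1_sqrt s0.
Qed.

Lemma continuous_density x : O x -> {for x, continuous rho}.
Proof. by move=> Ox; exact/differentiable_continuous/differentiable_density. Qed.

(** The graph over [O] is the zero set of a continuous function in the open cylinder above [O],
    hence a difference of two open sets. *)
Lemma measurable_graph_piece : measurable (D2 : set (borelRn R (n + 1))).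
Proof.
pose B := [set p : 'rV[R]_(n + 1) | O (lsubmx p - z)].
have cl (p : 'rV[R]_(n + 1)) : {for p, continuous (fun p : 'rV[R]_(n + 1) => lsubmx p - z)}.
  apply: (@cvg_comp _ _ _ (fun p : 'rV[R]_(n + 1) => lsubmx p) (fun x => x - z)).
    exact: continuous_lsubmx.
  exact: continuous_shift.
have oB : open B by apply: open_comp oO => p _; exact: cl.
pose q (p : 'rV[R]_(n + 1)) := rsubmx p 0 0 - g (lsubmx p).
have cq p : B p -> {for p, continuous q}.
  move=> Bp; apply: (@cvgB R R^o _ (nbhs p) (nbhs_filter p) _ _ _ _ (@continuous_last R n p)).
  apply: (@cvg_comp _ _ _ (fun p : 'rV[R]_(n + 1) => lsubmx p) g _ _ _ (@continuous_lsubmx R n 1 p)).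
  by have := OV Bp; rewrite subrK => Vp; have [] := sg [::] Vp.
have -> : D2 = B `\` (B `&` q @^-1` [set x | x != 0]).
  apply/seteqP; split => [p [x Ox <-]|p [Bp nq]].
    rewrite /B /q /psi /graph_map; split; rewrite /= ?row_mxKl ?row_mxKr ?addrK//.
    by move=> [_]; rewrite !mxE eqxx subrr eqxx.
  exists (lsubmx p - z) => //; rewrite /psi /graph_map subrK.
  rewrite -[RHS]hsubmxK; congr row_mx; apply/rowP => j; rewrite [j]ord1 !mxE eqxx mulr1n.
  apply/eqP; rewrite eq_sym -subr_eq0; apply/negPn/negP => h; apply: nq; split => //.
  by rewrite /q /= mxE.
apply: measurableD; first exact: open_measurable_borel.
apply: open_measurable_borel; apply: open_preimage_within => //.
Qed.

(** [F] lives on the part of [W] above [O], where the surface is a single parametrized piece and the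
    measure has density [rho]. The integrand in coordinates is extended by zero, so that it is
    defined on the whole space. *)
Lemma surface_integral (F : 'rV[R]_(n + 1) -> R) : continuous F ->
  (forall p, F p != 0 -> W p /\ O (lsubmx p - z)) ->
  let f := (fun x => F (psi x) * rho x) \_ O in
  (\int[sigma]_(s in S) F s = \int[lebesgue_tuple n]_t f (row t))%R /\
  measurable_fun [set: tup] (f \o row).
Proof.
move=> cF F0 f.
have mrow := @measurable_row_of_tuple R n.
pose D1 : set tup := row @^-1` O.
have mD1 : measurable D1.
  by rewrite -[D1]setTI; apply: mrow => //; exact: open_measurable_borel.
have mF : measurable_fun [set: borelRn R (n + 1)] (F : borelRn R (n + 1) -> R).
  have := @measurable_comp_within R _ (borelRn R (n + 1)) (n + 1) id (@measurable_id _ _ _) F setT openT.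
  by apply=> x _; exact: cF.
have mrho : measurable_fun D1 (rho \o row).
  exact: (@measurable_comp_within R _ _ n row mrow rho O oO continuous_density).
have mpsi : measurable_fun D1 (psi \o row : tup -> borelRn R (n + 1)).
  exact: (@measurable_comp_within_row R _ _ n row mrow _ psi O oO continuous_graph_map_shift).
have mf : measurable_fun [set: tup] (f \o row).
  have -> : f \o row = (fun t => F (psi (row t)) * rho (row t)) \_ D1.
    apply/funext => t; rewrite /f /= !patchE; have -> : (row t \in O) = (t \in D1) by apply/idP/idP; rewrite !inE.
    by [].
  apply/(measurable_restrict _ mD1 measurableT); rewrite setTI.
  apply: measurable_funM => //.
  exact: (measurable_comp (F := setT) measurableT _ mF mpsi).
split => //.
have D2S : D2 `<=` S.
  by move=> p [x Ox <-]; have [//] : (S `&` W) (psi x); rewrite SW; exists (x + z) => //; exact: OV.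
transitivity (\int[sigma]_(s in D2) F s)%R.
  rewrite Rintegral_mkcond [RHS]Rintegral_mkcond; congr Rintegral; apply/funext => p; rewrite !patchE.
  case: (boolP (p \in D2)) => [|pD].
    by rewrite inE => /D2S pS; rewrite mem_set.
  case: (boolP (p \in S)) => //; rewrite inE => pS; apply/eqP/negPn/negP => /F0[Wp Op].
  move/negP: pD; apply; rewrite inE.
  have : (S `&` W) p by [].
  by rewrite SW => -[x Vx xp]; exists (lsubmx p - z) => //; rewrite -xp /psi /graph_map row_mxKl subrK.
have LP : local_parametrization S O psi.
  by apply: (@graph_local_parametrization R n g z V oV sg S W O oW SW oO) => x; exact: OV.
have sgE (B : set (borelRn R (n + 1))) : measurable B -> B `<=` D2 ->
    sigma B = (\int[lebesgue_tuple n]_(x in D1 `&` (psi \o row) @^-1` B) ((rho \o row) x)%:E)%E.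
  move=> mB BD; rewrite (hsigma.2 _ _ LP B mB BD).
  have mD : measurable (O `&` psi @^-1` B : set (borelRn R n)).
    have := @measurable_comp_within_row R _ (borelRn R n) n id (@measurable_id _ _ _) _ psi O oO continuous_graph_map_shift.
    by apply => //; exact: open_measurable_borel.
  transitivity (\int[lebesgueRn (n := n)]_(u in O `&` psi @^-1` B) (rho u)%:E)%E.
    by apply: eq_integral => u; rewrite inE => -[Ou _]; rewrite (@area_density_graph R n g z V oV sg)//; exact: OV.
  rewrite /lebesgueRn (ge0_integral_pushforward mrow)//.
  - apply/measurable_EFinP.
    have mr : measurable_fun (O : set (borelRn R n)) (rho : borelRn R n -> R).
      exact: (@measurable_comp_within R _ (borelRn R n) n id (@measurable_id _ _ _) rho O oO continuous_density).
    by apply: measurable_funS mr => //; exact: open_measurable_borel.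
  - by move=> u _; rewrite lee_fin sqrtr_ge0.
rewrite (@Rintegral_transfer R _ _ _ _ (lebesgue_tuple n) sigma (psi \o row) D1 D2 (rho \o row)
  mD1 measurable_graph_piece mpsi mrho (fun t _ => sqrtr_ge0 _) _ sgE F mF); last first.
  by move=> t Ot; exists (row t).
rewrite Rintegral_mkcond; congr Rintegral; apply/funext => t; rewrite /f /= !patchE.
Qed.

End surface.

(** * Bounds for the amplitude *)

Section amplitude.
Context {R : realType} {n : nat}.

Lemma bounded_on_ball (h : 'rV[R]_n -> R) (e : R) :
  (forall x, `|x| <= e -> {for x, continuous h}) ->
  exists2 B : R, 0 <= B & forall x, `|x| <= e -> `|h x| <= B.
Proof.
move=> ch; have [e0|e0] := ltP e 0.
  by exists 0 => // x xe; have := le_lt_trans (le_trans (normr_ge0 x) xe) e0; rewrite ltxx.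
pose K := [set x : 'rV[R]_n | forall i, `[- e, e]%classic (x 0 i)].
have KE x : K x <-> `|x| <= e.
  split=> [Kx|xe i].
    by apply: norm_le_coord => // i; have := Kx i; rewrite /= in_itv/= -ler_norml.
  by rewrite /= in_itv/= -ler_norml; apply: le_trans xe; exact: coord_le_norm.
have cK : compact K by apply: (@rV_compact R n (fun=> `[- e, e]%classic)) => _; exact: segment_compact.
have cw : {within K, continuous h}.
  by apply: continuous_in_subspaceT => x; rewrite inE => /KE; exact: ch.
have /compact_bounded [B [_ HB]] := continuous_compact cw cK.
exists (`|B| + 1); first by rewrite addr_ge0.
move=> x /KE xK; apply: (HB (`|B| + 1)); last by exists x.
by rewrite (le_lt_trans (ler_norm _))// ltrDl.
Qed.

Lemma bounded_family_on_ball (I : finType) (h : I -> 'rV[R]_n -> R) (e : R) :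
  (forall j x, `|x| <= e -> {for x, continuous (h j)}) ->
  exists2 B : R, 0 <= B & forall j x, `|x| <= e -> `|h j x| <= B.
Proof.
move=> ch; have : forall j, exists B : R, 0 <= B /\ forall x, `|x| <= e -> `|h j x| <= B.
  by move=> j; have [B B0 HB] := @bounded_on_ball (h j) e (ch j); exists B.
move=> /choice[B HB]; exists (\sum_j B j).
  by apply: sumr_ge0 => j _; have [] := HB j.
move=> j x xe; apply: le_trans ((HB j).2 x xe) _.
by rewrite (bigD1 j)//= lerDl sumr_ge0// => l _; have [] := HB l.
Qed.

Variables (g : 'rV[R]_n -> R) (z : 'rV[R]_n) (V : set 'rV[R]_n) (oV : open V) (sg : smooth_on V g).
Variables (phi : 'rV[R]_(n + 1) -> R) (sphi : smooth_on [set: 'rV[R]_(n + 1)] phi).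

Let psi x := graph_map g (x + z).
Let rho x := Num.sqrt (1 + \sum_i partial i g (x + z) ^+ 2).

Let V0 := [set x | V (x + z)].
Let oV0 : open V0 := @open_shift R n V z oV.

Let Gd j (x : 'rV[R]_n) := partial j g (x + z).
Let sGd j : smooth_on V0 (Gd j).
Proof. exact: (@smooth_shift R n V (partial j g) z (@smooth_partial R n V g j sg)). Qed.

Let dphi p : differentiable phi p.
Proof. by have [] := smooth_differentiable openT sphi (I : [set: _] p). Qed.

Let dpsi x : V0 x -> differentiable psi x.
Proof.
move=> Vx; rewrite /psi graph_map_shiftE; apply: differentiable_affine_graph.
by have [] := smooth_differentiable oV0 (@smooth_shift R n V g z sg) Vx.
Qed.

Lemma partial_comp_graph i x : V0 x ->
  partial i (phi \o psi) x = \sum_j row i ('J psi x) 0 j * partial j phi (psi x).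
Proof.
move=> Vx; rewrite /partial deriveE; last exact: differentiable_comp (dpsi Vx) (dphi _).
rewrite (diff_comp (dpsi Vx) (dphi _)) /= -(deriveE _ (dpsi Vx)) -(deriveE _ (dphi _)).
rewrite (derive_row_sum _ (dphi _)) (deriveEjacobian _ (dpsi Vx)).
by apply: eq_bigr => j _; rewrite rowE.
Qed.

(** Differentiating [rho * rho] yields [rho] times the derivative of [rho] without the formula for a
    square root; then [rho >= 1] is used. *)
Lemma partial_density_bound i x : V0 x ->
  `|partial i rho x| <= \sum_j `|Gd j x| * `|partial i (Gd j) x|.
Proof.
move=> Vx; pose s (x : 'rV[R]_n) := 1 + \sum_j Gd j x ^+ 2.
have ds r : is_derive x (delta_mx 0 i) (fun x => \sum_(j <- r) Gd j x ^+ 2)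
    (\sum_(j <- r) (2 * (Gd j x * partial i (Gd j) x))).
  elim: r => [|j r IH].
    by under eq_fun do rewrite big_nil; rewrite big_nil; exact: is_derive_cst.
  under eq_fun do rewrite big_cons; rewrite big_cons; apply: is_deriveD.
  have dj : is_derive x (delta_mx 0 i) (Gd j) (partial i (Gd j) x).
    by split => //; have [_] := sGd j [::] Vx; exact.
  rewrite (_ : (fun x => _) = Gd j * Gd j); last by apply/funext => y; rewrite expr2.
  apply: is_derive_eq; rewrite /GRing.scale/=; ring.
have s0 y : 0 <= s y by rewrite addr_ge0// sumr_ge0// => j _; exact: sqr_ge0.
have rho1 : 1 <= rho x.
  by rewrite -[leLHS]sqrtr1 ler_wsqrtr// lerDl sumr_ge0// => j _; exact: sqr_ge0.
have drho : derivable rho x (delta_mx 0 i).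
  apply: diff_derivable.
  exact: (@differentiable_density R n g z V oV sg V0 (fun x h => h) x Vx).
have e : 2 * (rho x * partial i rho x) = 2 * \sum_j (Gd j x * partial i (Gd j) x).
  have h1 : is_derive x (delta_mx 0 i) (rho * rho) (2 * (rho x * partial i rho x)).
    have dr : is_derive x (delta_mx 0 i) rho (partial i rho x) by split.
    apply: is_derive_eq; rewrite /GRing.scale/=; ring.
  have h2 : is_derive x (delta_mx 0 i) (rho * rho) (0 + \sum_(j <- index_enum 'I_n) (2 * (Gd j x * partial i (Gd j) x))).
    have -> : rho * rho = s.
      by apply/funext => y; rewrite /= -[RHS](sqr_sqrtr (s0 y)) expr2.
    by apply: is_deriveD.
  by rewrite mulr_sumr -[RHS]add0r -(@derive_val _ _ _ _ _ _ _ h1) (@derive_val _ _ _ _ _ _ _ h2).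
have {}e : rho x * partial i rho x = \sum_j (Gd j x * partial i (Gd j) x) by lra.
apply: (@le_trans _ _ (rho x * `|partial i rho x|)).
  by rewrite ler_peMl.
rewrite -[X in X * _](@ger0_norm _ (rho x)) ?sqrtr_ge0// -normrM e.
by apply: le_trans (ler_norm_sum _ _ _) _; apply: ler_sum => j _; rewrite normrM.
Qed.

(** Bounds of order at most 1 suffice, because the amplitude enters only through one integration by
    parts on each line. *)
Lemma amplitude_bounds (e : R) : (forall x, `|x| <= e -> V0 x) ->
  (forall x, V0 x -> differentiable (fun x => phi (psi x) * rho x) x) /\
  exists M0 M1 : R, [/\ 0 <= M0, 0 <= M1,
    forall x, `|x| <= e -> `|phi (psi x) * rho x| <= M0 &
    forall x i, `|x| <= e -> `|partial i (fun x => phi (psi x) * rho x) x| <= M1].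
Proof.
move=> eV.
have drho x : V0 x -> differentiable rho x.
  by move=> Vx; exact: (@differentiable_density R n g z V oV sg V0 (fun x h => h) x Vx).
have dA x : V0 x -> differentiable (fun x => phi (psi x) * rho x) x.
  move=> Vx; have -> : (fun x => phi (psi x) * rho x) = (phi \o psi) * rho by [].
  by apply: differentiableM; [apply: differentiable_comp; [exact: dpsi|exact: dphi]|exact: drho].
have cpsi x : V0 x -> {for x, continuous psi}.
  by move=> Vx; exact: differentiable_continuous (dpsi Vx).
split => //.
have [B0 B00 HB0] := @bounded_on_ball _ e (fun x xe => differentiable_continuous (dA x (eV x xe))).
have [Br Br0 HBr] := @bounded_on_ball _ e (fun x xe => differentiable_continuous (drho x (eV x xe))).
have [Bp Bp0 HBp] : exists2 B : R, 0 <= B & forall x, `|x| <= e -> `|phi (psi x)| <= B.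
  apply: bounded_on_ball => x xe.
  by apply: differentiable_continuous; apply: differentiable_comp; [exact: dpsi (eV x xe)|exact: dphi].
have [B1 B10 HB1] : exists2 B : R, 0 <= B & forall j x, `|x| <= e -> `|Gd j x| <= B.
  by apply: bounded_family_on_ball => j x xe; have [] := sGd j [::] (eV x xe).
have [B2 B20 HB2] : exists2 B : R, 0 <= B & forall (ij : 'I_n * 'I_n) x, `|x| <= e ->
    `|partial ij.1 (Gd ij.2) x| <= B.
  by apply: bounded_family_on_ball => -[i j] x xe; have [] := sGd j [:: i] (eV x xe).
have [B3 B30 HB3] : exists2 B : R, 0 <= B & forall j x, `|x| <= e -> `|partial j phi (psi x)| <= B.
  apply: bounded_family_on_ball => j x xe.
  apply: (@cvg_comp _ _ _ psi (partial j phi) _ _ _ (cpsi x (eV x xe))).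
  by have [] := sphi [:: j] (I : [set: _] (psi x)).
exists B0, (Bp * (\sum_(j < n) B1 * B2) + Br * (\sum_(j < n + 1) (1 + B1) * B3)); split => //.
  by rewrite addr_ge0 ?mulr_ge0 ?sumr_ge0// => j _; rewrite mulr_ge0// addr_ge0.
move=> x i xe; have Vx := eV x xe.
have dc : differentiable (phi \o psi) x by apply: differentiable_comp; [exact: dpsi|exact: dphi].
have -> : partial i (fun x => phi (psi x) * rho x) x =
    phi (psi x) * partial i rho x + rho x * partial i (phi \o psi) x.
  have d1 : is_derive x (delta_mx 0 i) (phi \o psi) (partial i (phi \o psi) x).
    by split => //; exact: diff_derivable.
  have d2 : is_derive x (delta_mx 0 i) rho (partial i rho x).
    by split => //; apply: diff_derivable; exact: drho.
  have d := is_deriveM d1 d2.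
  by rewrite {1}/partial (_ : (fun x => _) = (phi \o psi) * rho)// (@derive_val _ _ _ _ _ _ _ d).
apply: le_trans (ler_normD _ _) _; rewrite !normrM; apply: lerD; apply: ler_pM => //.
- exact: HBp.
- apply: le_trans (partial_density_bound i Vx) _; apply: ler_sum => j _; apply: ler_pM => //.
    exact: HB1.
  exact: (HB2 (i, j)).
- exact: HBr.
rewrite (partial_comp_graph i Vx); apply: le_trans (ler_norm_sum _ _ _) _.
apply: ler_sum => j _; rewrite normrM; apply: ler_pM => //; last exact: HB3.
rewrite (jacobian_graph_map oV sg Vx) mxE mxE; case: (fintype.split j) => k; rewrite !mxE.
  by case: eqP => _; rewrite ?mulr1n ?mulr0n ?normr1 ?normr0; lra.
by have := HB1 i x xe; rewrite /Gd => h; lra.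
Qed.

End amplitude.

(** * Decay of the Fourier transform *)

Section nonstationary.
Context {R : realType} {n : nat}.
Local Notation tup := (n.-tuple (measurableTypeR R)).
Local Notation mu := (@lebesgue_tuple R n).
Local Notation lm := (@lebesgue_measure R).
Local Notation dirD w f := ('D_w f : 'rV[R]_n -> R).

(** One integration by parts on every line parallel to the i-th axis, with the whole cube as a
    single box. A second derivative of size at most [B * K] keeps the error [|F''| / F'^2] of order
    [1 / K]. *)
Lemma nonstationary_cube (eps M0 M1 B : R) : 0 < eps -> 0 <= M0 -> 0 <= M1 -> 0 <= B ->
  exists2 C : R, 0 <= C & forall V H A f th b L K i,
  open V -> smooth_on V H -> (forall x, V x -> differentiable A x) -> (forall x, `|x| <= eps -> V x) ->
  (forall x, V x -> f x = cos (phase th b L H x) * A x) ->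
  measurable_fun [set: tup] (f \o @row_of_tuple R n) -> (forall x, `|f x| <= M0) ->
  (forall x, eps <= `|x| -> f x = 0) ->
  (forall x, `|x| <= eps -> `|A x| <= M0) ->
  (forall x i, `|x| <= eps -> `|partial i A x| <= M1) ->
  0 < K -> (forall x, `|x| <= eps -> K <= `|partial i (phase th b L H) x|) ->
  (forall x, `|x| <= eps -> `|partial i (partial i (phase th b L H)) x| <= B * K) ->
  `|(\int[mu]_t f (row_of_tuple t))%R| <= C / K.
Proof.
move=> eps0 M00 M10 B0; exists ((2 + B) * (M0 + n%:R * M1) * (2 * eps + 2) ^+ n).
  by rewrite !mulr_ge0 ?addr_ge0 ?exprn_ge0 ?addr_ge0 ?mulr_ge0 ?(ltW eps0).
move=> V H A f th b L K i oV sH sA epsV fE mf fM f0 AM dAM K0 Kle BK.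
pose l (_ : 'I_n) : R := - eps; pose u (_ : 'I_n) : R := eps.
have sph := smooth_phase th b L oV sH.
have xe x : closed_box l u x -> `|x| <= eps.
  move=> bx; apply: norm_le_coord => [|j]; first exact: ltW.
  by have := bx j; rewrite -ler_norml.
have cf x : closed_box l u x -> {for x, continuous f}.
  move=> /xe/epsV Vx.
  have c1 : {for x, continuous (phase th b L H)} by have [] := sph [::] x Vx.
  have c2 : {for x, continuous A} by exact: differentiable_continuous (sA x Vx).
  have c3 : {for x, continuous (fun x => cos (phase th b L H x) * A x)}.
    apply: (@cvgM R _ (nbhs (x : 'rV[R]_n)) (nbhs_filter x) (fun x => cos (phase th b L H x)) A) c2.
    exact: (@cvg_comp _ _ _ (phase th b L H) cos _ _ _ c1 (@continuous_cos R (phase th b L H x))).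
  apply: near_eq_continuous c3; near=> z; apply/esym; apply: fE; near: z.
  exact: open_nbhs_nbhs.
have -> : (\int[mu]_t f (row_of_tuple t))%R = (\int[mu]_t (f (row_of_tuple t) * \1_(tuple_box l u) t))%R.
  congr Rintegral; apply/funext => t; rewrite indicE.
  have [|tb] := boolP (t \in tuple_box l u); first by rewrite mulr1.
  rewrite mulr0; apply: f0; rewrite leNgt; apply/negP => te; move/negP: tb; apply; rewrite inE => j /=.
  have : `|tnth t j : R| < eps.
    by apply: le_lt_trans te; have := coord_le_norm (row_of_tuple t : 'rV[R]_n) j; rewrite mxE.
  by rewrite ltr_norml in_itv/= => /andP[/ltW -> ->].
pose w : 'rV[R]_n := delta_mx 0 i.
have w1 j : `|w 0 j| <= 1 by rewrite mxE eqxx /=; case: eqP => _; rewrite ?normr1 ?normr0.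
pose K' := (2 + B) * (M0 + n%:R * M1) / K.
have K'0 : 0 <= K' by rewrite /K' !mulr_ge0 ?addr_ge0 ?mulr_ge0 ?invr_ge0// ltW.
have lu j : l j <= u j by rewrite /l /u; lra.
apply: (@le_trans _ _ (K' * \prod_j (u j - l j + 2 * `|w 0 j|))); last first.
  rewrite /K' -[leRHS]mulrA -[leRHS]mulrCA.
  rewrite [leRHS](_ : _ = (2 + B) * (M0 + n%:R * M1) / K * (2 * eps + 2) ^+ n); last by ring.
  apply: ler_wpM2l => //.
  have -> : (2 * eps + 2) ^+ n = \prod_(j < n) (2 * eps + 2) by rewrite prodr_const card_ord.
  apply: ler_prod => j _; have := w1 j; have := normr_ge0 (w 0 j); rewrite /u /l => h1 h2.
  by apply/andP; split; lra.
apply: (@box_average R n f l u w M0 K' mf fM K'0 lu cf) => x a b' ab a0 b1 cl.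
have Vl t : t \in `[a, b'] -> V (x + t *: w) by move=> /cl/xe/epsV.
pose F (q : nat) t := iter q (fun h => 'D_w h) (phase th b L H) (x + t *: w).
have chF : derivative_chain a b' 1 F by exact: line_derivative_chain oV sph Vl.
have dA := line_amplitude oV sA (ler01 : 0 <= (1 : R)) Vl (fun t i tab => dAM _ i (xe _ (cl t tab))) w1.
have intE : (\int[lm]_(t in `[a, b']) f (x + t *: w))%R =
    (\int[lm]_(t in `[a, b']) (cos (F 0%N t) * A (x + t *: w)))%R.
  by apply: eq_Rintegral => t; rewrite inE => tab; rewrite fE//; exact: Vl.
rewrite intE.
have h1 t : t \in `[a, b'] -> K <= `|F 1%N t| by move=> /cl/xe/Kle.
have h2 t : t \in `[a, b'] -> `|F 2%N t| <= B * K by move=> /cl/xe/BK.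
have h3 t : t \in `[a, b'] -> is_derive t 1 (fun t => A (x + t *: w)) ('D_w A (x + t *: w)) by move=> /dA[].
have h4 t : t \in `[a, b'] -> `|A (x + t *: w)| <= M0 by move=> /cl/xe/AM.
have h5 t : t \in `[a, b'] -> `|'D_w A (x + t *: w)| <= n%:R * (1 * M1) by move=> /dA[].
apply: le_trans (@nonstationary_integral R a b' F K (B * K) _ _ M0 _ ab K0 chF h1 h2 h3 h4 h5) _.
have -> : B * K / K ^+ 2 = B / K by field; rewrite gt_eqF.
rewrite /K' mul1r [leRHS]mulrAC; apply: ler_pM.
- by rewrite addr_ge0 ?mulr_ge0 ?invr_ge0 ?(ltW K0)//; lra.
- by rewrite addr_ge0 ?mulr_ge0//; lra.
- have : B / K * (b' - a) <= B / K by rewrite ler_piMr ?mulr_ge0 ?invr_ge0 ?(ltW K0)//; lra.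
  by rewrite mulrDl; lra.
- have : n%:R * M1 * (b' - a) <= n%:R * M1 by rewrite ler_piMr ?mulr_ge0//; lra.
  lra.
Unshelve. all: end_near.
Qed.

End nonstationary.

(** * From the graph to the surface *)

Section decay.
Context {R : realType}.

Lemma cos_sub_pihalf (x : R) : cos (x - pi / 2) = sin x.
Proof. by rewrite cosB cos_pihalf sin_pihalf mulr0 mulr1 add0r. Qed.

(** If all coordinates were smaller than the norm divided by [m], the sum of their squares would
    fall short of the squared norm. *)
Lemma enorm_le_coord m (v : 'rV[R]_m) : (0 < m)%N -> exists j, enorm v <= m%:R * `|v 0 j|.
Proof.
case: m v => // m v _.
apply: contrapT => h; have {}h j : m.+1%:R * `|v 0 j| < enorm v.
  by rewrite ltNge; apply/negP => hj; apply: h; exists j.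
have m0 : 0 < m.+1%:R :> R by rewrite ltr0n.
have N0 : 0 <= enorm v by exact: sqrtr_ge0.
have Nsq : enorm v ^+ 2 = \sum_j v 0 j ^+ 2.
  rewrite sqr_sqrtr; first by apply: eq_bigr => j _; rewrite expr2.
  by apply: sumr_ge0 => j _; rewrite -expr2 sqr_ge0.
have : m.+1%:R * enorm v ^+ 2 < m.+1%:R * enorm v ^+ 2.
  rewrite {1}Nsq mulr_sumr.
  have -> : m.+1%:R * enorm v ^+ 2 = \sum_(j < m.+1) enorm v ^+ 2.
    by rewrite sumr_const card_ord mulr_natl.
  rewrite ltNge; apply/negP => le.
  have : forall j, m.+1%:R * v 0 j ^+ 2 < enorm v ^+ 2.
    move=> j; apply: (@le_lt_trans _ _ ((m.+1%:R * `|v 0 j|) ^+ 2)).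
      by rewrite exprMn real_normK ?num_real// ler_wpM2r ?sqr_ge0// expr2 ler_peMr ?ler1n// ltW.
    by rewrite ltrXn2r// ?nnegrE// mulr_ge0// ltW.
  move=> lt; have : \sum_(j < m.+1) (m.+1%:R * v 0 j ^+ 2) < \sum_(j < m.+1) enorm v ^+ 2.
    rewrite !big_ord_recl; apply: ltr_leD; first exact: lt.
    by apply: ler_sum => j _; exact: ltW.
  by rewrite ltNge le.
by rewrite ltxx.
Qed.

Lemma expn_small (th e : R) : 0 < th -> th < 1 -> 0 < e -> exists N, th ^+ N.+1 <= e.
Proof.
move=> th0 th1 e0; have c : th ^+ N @[N --> \oo] --> (0 : R) by apply: cvg_expr; rewrite ger0_norm// ltW.
have /(@cvgr_dist_lt _ _ _ _ _ _ _ c)[N _ /(_ N.+1 (leqnSn N))] := e0.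
rewrite /= distrC subr0 ger0_norm ?exprn_ge0 ?ltW//.
by move=> /ltW ?; exists N.
Qed.

Context {n : nat}.
Local Notation tup := (n.-tuple (measurableTypeR R)).
Local Notation mu := (@lebesgue_tuple R n).
Variables (S : set 'rV[R]_(n + 1)) (sigma : {measure set (borelRn R (n + 1)) -> \bar R})
  (hsigma : is_surface_measure S sigma) (g : 'rV[R]_n -> R) (z : 'rV[R]_n)
  (V : set 'rV[R]_n) (oV : open V) (sg : smooth_on V g)
  (W : set 'rV[R]_(n + 1)) (oW : open W) (SW : S `&` W = graph_map g @` V).

Let psi x := graph_map g (x + z).
Let rho x := Num.sqrt (1 + \sum_i partial i g (x + z) ^+ 2).
Let V0 := [set x | V (x + z)].
Let oV0 : open V0 := @open_shift R n V z oV.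
Let H := taylor_remainder2 g z.

Lemma smooth_taylor_remainder2 : smooth_on V0 H.
Proof.
by rewrite /H taylor_remainder2E; apply: smooth_phase => //; exact: smooth_shift.
Qed.

(** The shift [th0] lets one cosine integral treat the real and the imaginary part. The gradient of
    [g] at [z] goes into the linear coefficients, so that [H] alone carries the higher orders. *)
Lemma graph_phase (lam : 'rV[R]_(n + 1)) (th0 : R) x :
  let l := lam 0 (rshift n 0) in
  th0 - dotp lam (psi x) =
    phase (th0 - \sum_i lam 0 (lshift 1 i) * z 0 i - l * g z)
      (\row_i (- (lam 0 (lshift 1 i) + l * partial i g z))) (- l) H x.
Proof.
move=> l; rewrite /dotp big_split_ord big_ord1 /= /psi /graph_map row_mxEr mxE eqxx mulr1n.
under eq_bigr do rewrite row_mxEl mxE mulrDr.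
rewrite big_split /= /phase /H /taylor_remainder2.
have -> : \sum_i (\row_i (- (lam 0 (lshift 1 i) + l * partial i g z))) 0 i * x 0 i =
   - (\sum_i lam 0 (lshift 1 i) * x 0 i + l * \sum_i partial i g z * x 0 i).
  rewrite mulr_sumr -big_split /= -sumrN; apply: eq_bigr => i _; rewrite mxE; ring.
rewrite -/l; ring.
Qed.

Lemma continuous_wave (phi : 'rV[R]_(n + 1) -> R) (lam : 'rV[R]_(n + 1)) (th0 : R) :
  smooth_on [set: 'rV[R]_(n + 1)] phi -> continuous (fun p => cos (th0 - dotp lam p) * phi p).
Proof.
move=> sphi p.
have c1 : {for p, continuous (fun p => th0 - dotp lam p)}.
  have -> : (fun p => th0 - dotp lam p) = fun p => th0 - lin_form (lam 0) p.
    by apply/funext => q; congr (_ - _); apply: eq_bigr => i _; rewrite mulrC.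
  apply: (@cvgB R R^o _ (nbhs p) (nbhs_filter p) (fun=> th0) _ _ _ (@cvg_cst _ _ _ _ _)).
  exact: continuous_lin_form.
have c2 : {for p, continuous phi} by have [] := sphi [::] p I.
apply: (@cvgM R _ (nbhs p) (nbhs_filter p) (fun x => cos (th0 - dotp lam x)) phi) c2.
exact: (@cvg_comp _ _ _ (fun p => th0 - dotp lam p) cos _ _ _ c1 (@continuous_cos R _)).
Qed.

Lemma newton_sum_antitone (th : R) E (M N : nat) (a b : R) : 0 < th -> 0 < a -> a <= b -> E != [::] ->
  \sum_(m : {ffun 'I_n -> 'I_N}) th ^+ (\sum_i m i) *
    Num.min 1 ((b * \sum_(a <- E) th ^+ wdot (fun i => m i) a) `^ (- M%:R^-1)) <=
  \sum_(m : {ffun 'I_n -> 'I_N}) th ^+ (\sum_i m i) *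
    Num.min 1 ((a * \sum_(a <- E) th ^+ wdot (fun i => m i) a) `^ (- M%:R^-1)).
Proof.
move=> th0 a0 ab E0; apply: ler_sum => m _; apply: ler_wpM2l; first by rewrite exprn_ge0// ltW.
set s := \sum_(a <- E) _.
have s0 : 0 < s.
  rewrite {}/s; case: E E0 => // e E' _; rewrite big_cons ltr_pwDl ?exprn_gt0// sumr_ge0// => c _.
  by rewrite exprn_ge0// ltW.
have as0 : 0 < a * s by rewrite mulr_gt0.
have le : (b * s) `^ (- M%:R^-1) <= (a * s) `^ (- M%:R^-1).
  have bs0 : 0 < b * s by rewrite mulr_gt0// (lt_le_trans a0).
  rewrite !powRN lef_pV2 ?posrE ?powR_gt0//.
  have le : a * s <= b * s by rewrite ler_wpM2r// ltW.
  apply: ge0_ler_powR => //; rewrite ?invr_ge0// nnegrE; first exact: ltW.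
  exact: le_trans (ltW as0) le.
by rewrite le_min ge_min lexx /= ge_min le orbT.
Qed.

Variables (M : nat) (E : seq (multiindex n)) (tau eps c1 Wm : R) (n0 : (0 < n)%N) (E0 : E != [::])
  (tau1 : 1 < tau) (Wm0 : 0 <= Wm) (eps0 : 0 < eps) (c10 : 0 < c1)
  (epsV : forall x, `|x| <= eps -> V (x + z)).
Hypothesis Hbox : forall X : 'rV[R]_n, (forall i, 0 < `|X 0 i|) -> (forall i, `|X 0 i| * tau <= eps) ->
    exists (p : nat) (w : 'rV[R]_n), [/\ (2 <= p <= M)%N, forall i, `|w 0 i| <= Wm * `|X 0 i| &
      forall u : 'rV[R]_n, (forall i, 1 <= u 0 i <= tau) ->
        c1 * newton_gauge E X <= `|iter p (fun h => 'D_w h : 'rV[R]_n -> R) H (mxscale X u)|].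
Variables (phi : 'rV[R]_(n + 1) -> R) (sphi : smooth_on [set: 'rV[R]_(n + 1)] phi).
Hypothesis supp : forall p, phi p != 0 -> W p /\ `|lsubmx p - z| < eps.

Let A x := phi (psi x) * rho x.

(** [Bd] is any common bound of the inverse frequency and of all truncated sums over boxes, so one
    statement serves every range of the Newton distance. *)
Lemma real_decay : exists C c2 : R, [/\ 0 <= C, 0 < c2 & forall th0 lam Bd,
  0 < enorm lam -> (enorm lam)^-1 <= Bd ->
  (forall N, \sum_(m : {ffun 'I_n -> 'I_N.+1}) tau^-1 ^+ (\sum_i m i) *
      Num.min 1 ((c2 * enorm lam * \sum_(a <- E) tau^-1 ^+ wdot (fun i => m i) a) `^ (- M%:R^-1)) <= Bd) ->
  `|(\int[sigma]_(s in S) (cos (th0 - dotp lam s) * phi s))%R| <= C * Bd].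
Proof.
have [dA [M0 [M1 [M00 M10 AM dAM]]]] := @amplitude_bounds R n g z V oV sg phi sphi eps epsV.
have sH := smooth_taylor_remainder2.
have [B1 B10 HB1] : exists2 B : R, 0 <= B & forall i x, `|x| <= eps -> `|partial i H x| <= B.
  by apply: bounded_family_on_ball => i x /epsV Vx; have [] := sH [:: i] x Vx.
have [B2 B20 HB2] : exists2 B : R, 0 <= B & forall i x, `|x| <= eps -> `|partial i (partial i H) x| <= B.
  by apply: bounded_family_on_ball => i x /epsV Vx; have [] := sH [:: i; i] x Vx.
pose Bz := \sum_i `|partial i g z|.
have Bz0 : 0 <= Bz by apply: sumr_ge0.
have HBz i : `|partial i g z| <= Bz by rewrite /Bz (bigD1 i)//= lerDl sumr_ge0.
have [C [c2 [C0 c20 HC]]] := @cube_estimate R n M E tau eps Wm M0 M1 c1 n0 E0 tau1 Wm0 eps0 M00 M10 c10.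
have [C' C'0 HC'] := @nonstationary_cube R n eps M0 M1 B2 eps0 M00 M10 B20.
pose d : R := (n + 1)%:R.
have d1 : 1 <= d by rewrite /d ler1n addn1.
(* If [|L|] is below [kap] times the frequency, then [|L|] times the derivatives of [g] and [H] is
   at most half of the lower bound for the largest coordinate of [lam]. The summand 1 excludes the
   last coordinate as the largest one. *)
pose kap := (2 * d * (1 + Bz + B1))^-1.
have kap0 : 0 < kap by rewrite invr_gt0 !mulr_gt0//; lra.
exists (2 * C + 2 * d * C'), (kap * c2); split; first by rewrite addr_ge0 ?mulr_ge0//; lra.
  by rewrite mulr_gt0.
move=> th0 lam Bd N0 NBd sumBd.
have wsupp p : cos (th0 - dotp lam p) * phi p != 0 -> W p /\ V0 (lsubmx p - z).
  by rewrite mulf_eq0 negb_or => /andP[_ /supp[Wp pe]]; split => //; apply: epsV; exact: ltW.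
have [fI mf] := @surface_integral R n S sigma hsigma g z V oV sg W oW SW V0 oV0 (fun x h => h)
  (fun p => cos (th0 - dotp lam p) * phi p) (@continuous_wave phi lam th0 sphi)
  wsupp.
pose th := th0 - \sum_i lam 0 (lshift 1 i) * z 0 i - lam 0 (rshift n 0) * g z.
pose b := \row_i (- (lam 0 (lshift 1 i) + lam 0 (rshift n 0) * partial i g z)).
pose L := - lam 0 (rshift n 0).
pose f := (fun x => cos (th0 - dotp lam (psi x)) * phi (psi x) * rho x) \_ V0.
rewrite fI -/f.
have fE x : V0 x -> f x = cos (phase th b L H x) * A x.
  by move=> Vx; rewrite /f patchE mem_set// graph_phase mulrA.
have f0 x : eps <= `|x| -> f x = 0.
  move=> ex; rewrite /f patchE; case: ifPn => //; rewrite inE => Vx.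
  have [->|/supp[_]] := eqVneq (phi (psi x)) 0; first by rewrite mulr0 mul0r.
  by rewrite /psi /graph_map row_mxKl addrK ltNge ex.
have fM x : `|f x| <= M0.
  have [/f0 ->|xe] := leP eps `|x|; first by rewrite normr0.
  rewrite fE; last exact/epsV/ltW.
  rewrite normrM -[leRHS]mul1r ler_pM//; first by rewrite ler_norml cos_geN1 cos_le1.
  exact/AM/ltW.
have Bd0 : 0 < Bd by apply: lt_le_trans NBd; rewrite invr_gt0.
have [st|nst] := leP (kap * enorm lam) `|L|.
  have L0 : L != 0 by rewrite -normr_gt0; apply: lt_le_trans st; rewrite mulr_gt0.
  have t0 : 0 < tau^-1 by rewrite invr_gt0 (lt_trans ltr01 tau1).
  have t1 : tau^-1 < 1 by rewrite invf_lt1// (lt_trans ltr01 tau1).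
  (* The truncation level is chosen after the frequency, so that the uncovered part of the cube is
     below [Bd]. *)
  have [N HN] := expn_small t0 t1 Bd0.
  apply: le_trans (HC V0 H A f th b L oV0 sH dA epsV Hbox fE mf fM f0 AM dAM L0 N.+1) _.
  apply: (@le_trans _ _ (C * (Bd + Bd))).
    apply: ler_wpM2l => //; apply: lerD => //; apply: le_trans (sumBd N).
    apply: newton_sum_antitone => //; first by rewrite !mulr_gt0.
    by rewrite mulrAC ler_wpM2r// ltW.
  rewrite mulrDl; have : 0 <= 2 * d * C' * Bd by rewrite !mulr_ge0//; lra.
  lra.
have N1 : 0 < enorm lam / (2 * d) by rewrite divr_gt0//; lra.
have kapd : kap * (1 + Bz + B1) = (2 * d)^-1 by rewrite /kap; field; rewrite !gt_eqF//; lra.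
have kapN : kap * enorm lam * (1 + Bz + B1) = enorm lam / (2 * d) by rewrite mulrAC kapd mulrC.
have LN : `|L| * (1 + Bz + B1) <= enorm lam / (2 * d).
  by rewrite -kapN ler_wpM2r ?(ltW nst)//; lra.
have LN1 : `|L| <= enorm lam / (2 * d).
  by apply: le_trans LN; rewrite ler_peMr//; lra.
have d2 : enorm lam / (2 * d) + enorm lam / (2 * d) = enorm lam / d by field; rewrite gt_eqF//; lra.
have [j] := @enorm_le_coord _ lam (ltac:(by rewrite addn1)).
rewrite -ler_pdivrMl; last by lra.
rewrite mulrC -/d => lamj.
case: (fintype.splitP j) => [i ij|i ij]; last first.
  have jE : j = rshift n 0 by apply: ord_inj => /=; rewrite ij; case: i {ij} => -[].
  have : `|L| = `|lam 0 j| by rewrite /L normrN jE.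
  by move=> LE; lra.
have jE : j = lshift 1 i by apply: ord_inj => /=; rewrite ij.
have Kle x : `|x| <= eps -> enorm lam / (2 * d) <= `|partial i (phase th b L H) x|.
  move=> xe; rewrite (partial_phase _ _ _ _ oV0 sH (epsV xe)) mxE.
  have -> : - (lam 0 (lshift 1 i) + lam 0 (rshift n 0) * partial i g z) + L * partial i H x =
    - (lam 0 j - L * (partial i g z + partial i H x)) by rewrite jE /L; ring.
  rewrite normrN; apply: le_trans (lerB_dist _ _).
  have : `|L * (partial i g z + partial i H x)| <= `|L| * (1 + Bz + B1).
    rewrite normrM ler_wpM2l//; apply: le_trans (ler_normD _ _) _.
    by have := HBz i; have := HB1 i x xe; lra.
  by lra.
have Ble x : `|x| <= eps -> `|partial i (partial i (phase th b L H)) x| <= B2 * (enorm lam / (2 * d)).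
  move=> xe; have -> : partial i (partial i (phase th b L H)) x = L * partial i (partial i H) x.
    exact: (@deriv_iter_phase R n V0 H th b L (delta_mx 0 i) 2 x oV0 sH (epsV xe) isT).
  by rewrite normrM mulrC ler_pM// HB2.
apply: le_trans (HC' V0 H A f th b L _ i oV0 sH dA epsV fE mf fM f0 AM dAM N1 Kle Ble) _.
rewrite invf_div mulrCA mulrA -mulrA [leRHS]mulrDl.
have h : C' * (2 * d * (enorm lam)^-1) <= C' * (2 * d * Bd).
  by rewrite !ler_wpM2l//; lra.
have : 0 <= 2 * C * Bd by rewrite !mulr_ge0// ltW.
lra.
Qed.

Lemma surface_decay : exists C c2 : R, [/\ 0 <= C, 0 < c2 & forall lam Bd,
  0 < enorm lam -> (enorm lam)^-1 <= Bd ->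
  (forall N, \sum_(m : {ffun 'I_n -> 'I_N.+1}) tau^-1 ^+ (\sum_i m i) *
      Num.min 1 ((c2 * enorm lam * \sum_(a <- E) tau^-1 ^+ wdot (fun i => m i) a) `^ (- M%:R^-1)) <= Bd) ->
  `|surface_FT S sigma phi lam| <= (C * Bd)%:C%C].
Proof.
have [C [c2 [C0 c20 HC]]] := real_decay.
exists (2 * C), c2; split => //; first by rewrite mulr_ge0.
move=> lam Bd N0 NB sB; rewrite normc_def lecR.
have re : complex.Re (surface_FT S sigma phi lam) = (\int[sigma]_(s in S) (cos (0 - dotp lam s) * phi s))%R.
  rewrite /surface_FT /cintegral /=; congr Rintegral; apply/funext => s.
  by rewrite /= mulr0 subr0 sub0r.
(* A sine is a cosine shifted by a quarter period, so the real and imaginary parts are two instances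
   of [real_decay]. *)
have im : complex.Im (surface_FT S sigma phi lam) =
    (\int[sigma]_(s in S) (cos (- (pi / 2) - dotp lam s) * phi s))%R.
  rewrite /surface_FT /cintegral /=; congr Rintegral; apply/funext => s.
  by rewrite /= mulr0 add0r -cos_sub_pihalf addrC.
have := HC 0 lam Bd N0 NB sB; have := HC (- (pi / 2)) lam Bd N0 NB sB.
rewrite -re -im; move: (complex.Re _) (complex.Im _) => a b hb ha.
have Bd0 : 0 <= Bd by apply: le_trans NB; rewrite invr_ge0 ltW.
have CB0 : 0 <= C * Bd by rewrite mulr_ge0.
rewrite -mulrA -[leRHS]ger0_norm ?mulr_ge0// -sqrtr_sqr ler_wsqrtr//.
rewrite -(real_normK (num_real a)) -(real_normK (num_real b)).
have : `|a| ^+ 2 <= (C * Bd) ^+ 2 by rewrite ler_sqr ?nnegrE.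
have : `|b| ^+ 2 <= (C * Bd) ^+ 2 by rewrite ler_sqr ?nnegrE.
have : (2 * (C * Bd)) ^+ 2 = 4 * (C * Bd) ^+ 2 by ring.
by have := sqr_ge0 (C * Bd); lra.
Qed.

End decay.

(** * The ranges of the Newton distance *)

Section assembly.
Context {R : realType}.

(** For [N > 2] the logarithm is at least [ln 2], so additive constants and the rescaling by [c2]
    are absorbed into a multiple of [ln N]. *)
Lemma powR_ln_bound (d c2 C1 : R) (p : nat) : 1 <= d -> 0 < c2 -> 0 <= C1 ->
  exists2 K : R, 0 <= K & forall N : R, 2 < N ->
    N^-1 <= K * (N `^ (- d^-1) * ln N ^+ p) /\
    C1 * ((c2 * N) `^ (- d^-1) * (1 + `|ln (c2 * N)|) ^+ p) <= K * (N `^ (- d^-1) * ln N ^+ p).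
Proof.
move=> d1 c20 C10; have d0 : 0 < d by lra.
have l2 : 0 < ln 2 :> R by rewrite ln_gt0// ltr1n.
pose q := (1 + `|ln c2|) / ln 2 + 1.
have q0 : 0 <= q by rewrite addr_ge0// divr_ge0 ?addr_ge0// ltW.
exists ((ln 2 ^+ p)^-1 + C1 * (c2 `^ (- d^-1) * q ^+ p)).
  by rewrite addr_ge0 ?invr_ge0 ?exprn_ge0 ?mulr_ge0 ?powR_ge0 ?exprn_ge0// ltW.
move=> N N2; have N0 : 0 < N by lra.
have lN : ln 2 <= ln N by rewrite ler_ln ?posrE//; lra.
have lN0 : 0 <= ln N by lra.
have h1 : 0 <= N `^ (- d^-1) * ln N ^+ p by rewrite mulr_ge0 ?powR_ge0 ?exprn_ge0.
have h2 : 0 <= C1 * (c2 `^ (- d^-1) * q ^+ p) by rewrite !mulr_ge0 ?powR_ge0 ?exprn_ge0.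
have h3 : 0 <= (ln 2 ^+ p)^-1 :> R by rewrite invr_ge0 exprn_ge0// ltW.
split.
  apply: (@le_trans _ _ ((ln 2 ^+ p)^-1 * (N `^ (- d^-1) * ln N ^+ p))); last first.
    by rewrite ler_wpM2r// lerDl.
  rewrite mulrCA -[leLHS]mulr1; apply: ler_pM => //; first by rewrite invr_ge0 ltW.
    rewrite -powR_inv1 ?(ltW N0)//; apply: ler_powR; first lra.
    by rewrite lerN2 invf_le1.
  by rewrite mulrC ler_pdivlMr ?exprn_gt0// mul1r lerXn2r ?nnegrE// ltW.
apply: (@le_trans _ _ (C1 * (c2 `^ (- d^-1) * q ^+ p) * (N `^ (- d^-1) * ln N ^+ p))); last first.
  by rewrite ler_wpM2r// lerDr.
rewrite -mulrA; apply: ler_wpM2l => //; rewrite powRM ?(ltW c20) ?(ltW N0)//.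
rewrite mulrACA; apply: ler_wpM2l; first by rewrite mulr_ge0 ?powR_ge0.
rewrite -exprMn; apply: lerXn2r; rewrite ?nnegrE ?addr_ge0 ?mulr_ge0//.
rewrite lnM ?posrE// mulrDl mul1r.
have : (1 + `|ln c2|) <= (1 + `|ln c2|) / ln 2 * ln N.
  rewrite -mulrA ler_peMr ?addr_ge0// mulrC ler_pdivlMr//; lra.
have := ler_normD (ln c2) (ln N); rewrite (ger0_norm lN0); lra.
Qed.

Context {n : nat}.
Variables (n0 : (0 < n)%N) (S : set 'rV[R]_(n + 1)) (sigma : {measure set (borelRn R (n + 1)) -> \bar R})
  (hsigma : is_surface_measure S sigma) (g : 'rV[R]_n -> R) (z : 'rV[R]_n)
  (V : set 'rV[R]_n) (oV : open V) (Vz : V z) (sg : smooth_on V g)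
  (W : set 'rV[R]_(n + 1)) (oW : open W) (Wy : W (graph_map g z)) (SW : S `&` W = graph_map g @` V).
Let H := taylor_remainder2 g z.
Hypothesis hyp : (analytic_on V g /\ newton_polyhedron H !=set0) \/
         meets_coordinate_axes (newton_polyhedron H).

(** The order of the quantifiers is the point: the neighbourhood, [E] and [th] are fixed before
    [phi], and only the two constants depend on [phi]. *)
Lemma decay_neighborhood (M : nat) : (2 <= M)%N ->
  (forall m : nat, face_zero_order H m -> (m <= M)%N) ->
  exists (U : set 'rV[R]_(n + 1)) E (th : R), [/\ nbhs (graph_map g z) U,
    minimal_basis (fun a => taylor_coef H a != 0) E, E != [::], 0 < th < 1 &
    forall phi, smooth_on [set: 'rV[R]_(n + 1)] phi -> closed_support phi `<=` U ->
    exists C c2 : R, [/\ 0 <= C, 0 < c2 & forall lam Bd,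
      0 < enorm lam -> (enorm lam)^-1 <= Bd ->
      (forall N, \sum_(m : {ffun 'I_n -> 'I_N.+1}) th ^+ (\sum_i m i) *
        Num.min 1 ((c2 * enorm lam * \sum_(a <- E) th ^+ wdot (fun i => m i) a) `^ (- M%:R^-1)) <= Bd) ->
      `|surface_FT S sigma phi lam| <= (C * Bd)%:C%C]].
Proof.
move=> M2 HM; have [E [EP E0 E2 RE]] := @reduction R n V g z n0 oV Vz sg hyp.
have [Gs [r [c0 [r0 c00 dirB]]]] := @direction_lower_bound R n H E M EP E0 E2 M2 HM.
pose V0 := [set x | V (x + z)].
have oV0 : open V0 := @open_shift R n V z oV.
have [eps0 eps00 epsV0] : exists2 e : R, 0 < e & forall x, `|x| <= e -> V0 x.
  have : nbhs (0 : 'rV[R]_n) V0 by apply: open_nbhs_nbhs; split => //; rewrite /V0 /= add0r.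
  move=> /nbhs_ballP[e /= e0 eV]; exists (e / 2); first by rewrite divr_gt0.
  move=> x xe; apply: eV; rewrite -ball_normE /= sub0r normrN; apply: le_lt_trans xe _.
  by rewrite ltr_pdivrMr//; lra.
have [uE _ _ _] := EP.
have sH : smooth_on V0 H by exact: smooth_taylor_remainder2.
have [tau [eps [c1 [Wm [tau1 /andP[e0 ee0] c10 Wm0 Hbox]]]]] :=
  @box_derivative_lower_bound R n V0 H E M Gs r c0 eps0 uE oV0 sH epsV0 RE r0 c00 eps00 dirB.
exists (W `&` [set p | `|lsubmx p - z| < eps]), E, tau^-1; split => //.
- apply: filterI; first exact: open_nbhs_nbhs.
  have c : {for graph_map g z, continuous (fun p : 'rV[R]_(n + 1) => lsubmx p - z)}.
    apply: (@cvg_comp _ _ _ (fun p : 'rV[R]_(n + 1) => lsubmx p) (fun x => x - z)).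
      exact: continuous_lsubmx.
    exact: continuous_shift.
  have : nbhs (lsubmx (graph_map g z) - z) [set x : 'rV[R]_n | `|x| < eps].
    rewrite /graph_map row_mxKl subrr; apply/nbhs_ballP; exists eps => //= x.
    by rewrite -ball_normE /= sub0r normrN.
  exact: c.
- by rewrite invr_gt0 (lt_trans ltr01 tau1)/= invf_lt1// (lt_trans ltr01 tau1).
move=> phi sphi sup.
have supp p : phi p != 0 -> W p /\ `|lsubmx p - z| < eps.
  by move=> pp; apply: sup; exact: subset_closure.
have epsV x : `|x| <= eps -> V (x + z) by move=> xe; apply: epsV0; exact: le_trans ee0.
exact: (@surface_decay R n S sigma hsigma g z V oV sg W oW SW M E tau eps c1 Wm n0 E0 tau1 Wm0 e0 c10 epsV Hbox phi sphi supp).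
Qed.

Lemma decays_like_bound (T : 'rV[R]_(n + 1) -> R[i]) (C K : R) (b : R -> R) :
  0 <= C -> 0 <= K -> (forall lam, 2 < enorm lam -> `|T lam| <= (C * (K * b (enorm lam)))%:C%C) ->
  decays_like T b.
Proof.
by move=> C0 K0 HT; exists (C * K) => lam /HT; rewrite mulrA.
Qed.

(** Applied with [M = 2] when the distance is below 2, and with [M] the maximal order of a zero when
    that order exceeds both 2 and the distance. *)
Lemma subcritical_decay (M : nat) : (2 <= M)%N ->
  (forall m : nat, face_zero_order H m -> (m <= M)%N) -> newton_distance H < M%:R ->
  exists U, nbhs (graph_map g z) U /\ forall phi, smooth_on [set: 'rV[R]_(n + 1)] phi ->
    closed_support phi `<=` U -> decays_like (surface_FT S sigma phi) (fun t => t `^ (- (1 / M%:R))).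
Proof.
move=> M2 HM dM; have M0 : (0 < M)%N by apply: leq_trans M2.
have [U [E [th [yU EP E0 /andP[th0 th1] HU]]]] := decay_neighborhood M2 HM.
exists U; split => // phi sphi sup; have [C [c2 [C0 c20 HC]]] := HU phi sphi sup.
(* The distance is an infimum; a diagonal point of the polyhedron strictly below [M] is enough and
   avoids asking whether it is attained. *)
have [t Nt tM] : exists2 t, newton_polyhedron H (diag t) & t < M%:R.
  have [|t Nt tM] := @inf_lt R [set t | newton_polyhedron H (diag t)] M%:R _ dM; last by exists t.
  have [e eE] : exists e, e \in E by case: (E) E0 => // e E' _; exists e; rewrite mem_head.
  have [_ Et _ _] := EP.
  exists (\sum_i (e i)%:R) => /=; apply: (orthant_newton (Et e eE)) => i; rewrite mxE.
  by rewrite (bigD1 i)//= lerDl sumr_ge0.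
have [w [w0 w1 wx]] := newton_polyhedron_simplex EP Nt.
have [uE _ _ _] := EP.
have sub (m : 'I_n -> nat) : exists2 a, a \in E & (wdot m a)%:R <= t * (\sum_i m i)%N%:R.
  apply: (exists_le_average uE w0 w1).
  have -> : \sum_(a <- E) w a * (wdot m a)%:R = \sum_i (m i)%:R * \sum_(a <- E) w a * (a i)%:R.
    under [RHS]eq_bigr do rewrite mulr_sumr.
    rewrite exchange_big; apply: eq_bigr => a _ /=.
    by rewrite /wdot natr_sum mulr_sumr; apply: eq_bigr => i _; rewrite natrM mulrCA.
  rewrite natr_sum mulr_sumr; apply: ler_sum => i _; rewrite [leRHS]mulrC ler_wpM2l//.
  by have := wx i; rewrite mxE.
have [C1 C10 HC1] := newton_sum_subcritical th0 th1 M0 tM sub.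
have M1 : 1 <= M%:R :> R by rewrite ler1n.
have [K K0 HK] := powR_ln_bound 0 M1 c20 C10.
apply: (decays_like_bound C0 K0) => lam lam2.
have lam0 : 0 < enorm lam by lra.
have [h1 h2] := HK _ lam2; rewrite !expr0 !mulr1 in h1 h2; rewrite div1r.
apply: HC => // N; apply: le_trans h2; apply: HC1; exact: mulr_gt0.
Qed.

(** Orders of zeros are integers, so the truncation of the distance still bounds them. If the
    distance is not an integer, the truncation is strictly smaller and one logarithm is saved. *)
Lemma critical_decay (k : nat) : critical_face_dim H k -> 2 <= newton_distance H ->
  (forall m : nat, face_zero_order H m -> m%:R <= newton_distance H) ->
  exists U, nbhs (graph_map g z) U /\ forall phi, smooth_on [set: 'rV[R]_(n + 1)] phi ->
    closed_support phi `<=` U ->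
    decays_like (surface_FT S sigma phi)
        (fun t => t `^ (- (1 / newton_distance H)) * ln t ^+ (n - k)) /\
      (newton_distance H \isn't a Num.int ->
       decays_like (surface_FT S sigma phi)
        (fun t => t `^ (- (1 / newton_distance H)) * ln t ^+ (n - k - 1))).
Proof.
set d := newton_distance H => hk d2 Hd; pose M := Num.trunc d.
have d0 : 0 <= d by lra.
have M2 : (2 <= M)%N by rewrite /M truncn_ge_nat.
have HM m : face_zero_order H m -> (m <= M)%N by move=> /Hd; rewrite /M truncn_ge_nat.
have M0 : (0 < M)%N by apply: leq_trans M2.
have Md : M%:R <= d by rewrite /M truncn_le.
have [U [E [th [yU EP E0 /andP[th0 th1] HU]]]] := decay_neighborhood M2 HM.
exists U; split => // phi sphi sup; have [C [c2 [C0 c20 HC]]] := HU phi sphi sup.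
have [C1 C10 HC1] := newton_sum_critical n0 th0 th1 M0 EP (erefl d) Md hk.
have d1 : 1 <= d by lra.
have target p : (forall (Lam : R) N, 0 < Lam -> \sum_(m : {ffun 'I_n -> 'I_N.+1}) th ^+ (\sum_i m i) *
      Num.min 1 ((Lam * \sum_(a <- E) th ^+ wdot (fun i => m i) a) `^ (- M%:R^-1)) <=
    C1 * (Lam `^ (- d^-1) * (1 + `|ln Lam|) ^+ p)) ->
    decays_like (surface_FT S sigma phi) (fun t => t `^ (- (1 / d)) * ln t ^+ p).
  move=> Hp; have [K K0 HK] := powR_ln_bound p d1 c20 C10.
  apply: (decays_like_bound C0 K0) => lam lam2.
  have lam0 : 0 < enorm lam by lra.
  have [h1 h2] := HK _ lam2; rewrite div1r.
  apply: HC => // N; apply: le_trans h2; apply: Hp; exact: mulr_gt0.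
split; first by apply: target => Lam N Lam0; exact: (HC1 Lam N Lam0).1.
move=> dI; apply: target => Lam N Lam0; apply: (HC1 Lam N Lam0).2.
rewrite lt_neqAle Md andbT; apply/negP => /eqP dM; move/negP: dI; apply.
by rewrite -dM; exact: natr_int.
Qed.

End assembly.

Unset Implicit Arguments.

Theorem theorem1p5 (R : realType) (n : nat) (hn : (2 <= n)%N)
  (S : set 'rV[R]_(n + 1)) (hS : smooth_hypersurface S)
  (sigma : {measure set (borelRn R (n + 1)) -> \bar R})
  (hsigma : is_surface_measure S sigma)
  (g : 'rV[R]_n -> R) (z : 'rV[R]_n) (y : 'rV[R]_(n + 1))
  (hy : y = graph_map g z) (hSy : S y)
  (V : set 'rV[R]_n) (hV : open V) (hVz : V z) (hg : smooth_on V g)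
  (W : set 'rV[R]_(n + 1)) (hW : open W) (hWy : W y)
  (hgraph : S `&` W = graph_map g @` V) (H : 'rV[R]_n -> R)
  (hH : H = taylor_remainder2 g z)
  (hyp : (analytic_on V g /\ newton_polyhedron H !=set0) \/
         meets_coordinate_axes (newton_polyhedron H))
  (k : nat) (hk : critical_face_dim H k) :
  exists U : set 'rV[R]_(n + 1), nbhs y U /\
  forall phi : 'rV[R]_(n + 1) -> R,
    smooth_on [set: 'rV[R]_(n + 1)] phi ->
    compact (closed_support phi) -> closed_support phi `<=` U ->
    [/\
      newton_distance H < 2 ->
      (forall m : nat, face_zero_order H m -> (m <= 2)%N) ->
      decays_like (surface_FT S sigma phi) (fun t => t `^ (- (1 / 2))),

      2 <= newton_distance H ->
      (forall m : nat, face_zero_order H m -> m%:R <= newton_distance H) ->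
      decays_like (surface_FT S sigma phi)
        (fun t => t `^ (- (1 / newton_distance H)) * ln t ^+ (n - k)) /\
      (newton_distance H \isn't a Num.int ->
       decays_like (surface_FT S sigma phi)
        (fun t => t `^ (- (1 / newton_distance H)) * ln t ^+ (n - k - 1)))
    & forall m : nat,
      face_zero_order H m ->
      (forall m' : nat, face_zero_order H m' -> (m' <= m)%N) ->
      Num.max (newton_distance H) 2 < m%:R ->
      decays_like (surface_FT S sigma phi) (fun t => t `^ (- (1 / m%:R)))].
Proof.
have n0 : (0 < n)%N by apply: leq_trans hn.
subst y H; set d := newton_distance _.
(* One neighbourhood has to serve all three parts. Their hypotheses concern [H] only and exclude one
   another, so it is chosen by cases. *)
have [[dlt2 m2]|caseA] := pselect (d < 2 /\ forall m : nat, face_zero_order (taylor_remainder2 g z) m -> (m <= 2)%N).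
  have [U [yU HU]] := @subcritical_decay R n n0 S sigma hsigma g z V hV hVz hg W hW hWy hgraph hyp 2 isT m2 dlt2.
  exists U; split => // phi sphi _ sup; split; first by move=> _ _; exact: HU.
    by move=> d2; move: dlt2; rewrite ltNge d2.
  by move=> m fm _; rewrite gt_max ltr_nat ltnNge m2// andbF.
have [[d2 md]|caseB] := pselect (2 <= d /\ forall m : nat, face_zero_order (taylor_remainder2 g z) m -> m%:R <= d).
  have [U [yU HU]] := @critical_decay R n n0 S sigma hsigma g z V hV hVz hg W hW hWy hgraph hyp k hk d2 md.
  exists U; split => // phi sphi _ sup; split; first by rewrite ltNge d2.
    by move=> _ _; exact: HU.
  by move=> m fm _; rewrite gt_max ltNge md.
have [[m [fm mm dm]]|caseC] := pselect (exists m, [/\ face_zero_order (taylor_remainder2 g z) m,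
    forall m' : nat, face_zero_order (taylor_remainder2 g z) m' -> (m' <= m)%N & Num.max d 2 < m%:R]).
  have [dm' m2] : d < m%:R /\ (2 < m)%N by move: dm; rewrite gt_max ltr_nat => /andP[].
  have [U [yU HU]] := @subcritical_decay R n n0 S sigma hsigma g z V hV hVz hg W hW hWy hgraph hyp m (ltnW m2) mm dm'.
  exists U; split => // phi sphi _ sup; split.
  - by move=> dlt h; case: caseA.
  - by move=> dle h; case: caseB.
  - move=> m' fm' mm' _; have -> : m' = m by apply/eqP; rewrite eqn_leq mm ?mm'.
    exact: HU.
(* No part applies, and any neighbourhood will do. *)
exists setT; split; first exact: filterT.
move=> phi _ _ _; split; [by move=> dlt h; case: caseA|by move=> dle h; case: caseB|].
by move=> m fm mm dm; case: caseC; exists m.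
Qed.
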